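(* There exists $C>0$, independent of $h$, such that for every $E\in\mathcal T_h$ $$\eta_E^2\le C\sum_{E'\in\omega_E}\left(\|\mathbf w-\mathbf w_h\|_{1,E'}^2+\|\mathbf w-\boldsymbol\Pi_0^{E'}\mathbf w_h\|_{0,E'}^2+|\mathbf w-\boldsymbol\Pi_\varepsilon^{E'}\mathbf w_h|_{1,E'}^2+h_E^2\|\lambda\mathbf w-\lambda_h\mathbf w_h\|_{0,E'}^2\right),$$ where $\omega_E:=\{E'\in\mathcal T_h:\ E'\text{ and }E\text{ share an edge}\}$ (in particular $E\in\omega_E$).
   Context: Continuous problem. $\Omega\subset\mathbb R^2$ is a bounded connected Lipschitz domain whose boundary is the disjoint union $\partial\Omega=\Gamma_D\cup\Gamma_N$, with $\Gamma_D$ of positive length. $\boldsymbol{\mathcal V}:=[H^1_{\Gamma_D}(\Omega)]^2$ is the space of fields in $[H^1(\Omega)]^2$ with zero trace on $\Gamma_D$. $\|\cdot\|_{s,\omega}$, $|\cdot|_{s,\omega}$ are the usual Sobolev norms and seminorms on $\omega$. $\boldsymbol\varepsilon(\mathbf v)=\frac12(\nabla\mathbf v+(\nabla\mathbf v)^t)$; $\mathcal C\boldsymbol\tau:=2\mu_S\boldsymbol\tau+\lambda_S\operatorname{tr}(\boldsymbol\tau)\boldsymbol I$ with constant Lamé coefficients $\lambda_S,\mu_S$ such that $\mathcal C$ is positive definite on symmetric tensors; $\varrho>0$ is a constant. For a set $\omega$, $a^\omega(\mathbf u,\mathbf v)=\int_\omega\mathcal C\boldsymbol\varepsilon(\mathbf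 u):\boldsymbol\varepsilon(\mathbf v)$, $b^\omega(\mathbf u,\mathbf v)=\int_\omega\varrho\,\mathbf u\cdot\mathbf v$, and $a=a^\Omega$, $b=b^\Omega$. Virtual element discretization. $\{\mathcal T_h\}_h$ is a sequence of decompositions of $\Omega$ into simple polygons $E$ of diameter $h_E$, with $h=\max_E h_E$, and there is $C_{\mathcal T}>0$ such that for every $h$ and $E\in\mathcal T_h$: (A1) the ratio between the shortest edge of $E$ and $h_E$ is larger than $C_{\mathcal T}$; (A2) $E$ is star-shaped with respect to every point of a ball of radius $C_{\mathcal T}h_E$. Fix an integer $k\ge1$; $\mathbb P_j(S)$ denotes polynomials of degree $\le j$ on $S$ ($\mathbb P_{-1}=\{0\}$). Let $\boldsymbol{\mathcal W}_h^E$ be the set of $\mathbf v\in[H^1(E)]^2$ with $\Delta\mathbf v\in[\mathbb P_k(E)]^2$ and $\mathbf v|_{\partial E}$ continuous and in $[\mathbb P_k(\ell)]^2$ on each edge $\ell$. The projector $\boldsymbol\Pi_\varepsilon^E:\boldsymbol{\mathcal W}_h^E\to[\mathbb P_k(E)]^2$ is defined by $a^E(\mathbf p,\boldsymbol\Pi_\varepsilon^E\mathbf v)=a^E(\mathbf p,\mathbf v)$ for all $\mathbf p\in[\mathbb P_k(E)]^2$ and $\langle\langle\mathbf p,\boldsymbol\Pi_\varepsilon^E\mathbf v\rangle\rangle=\langle\langle\mathbf p,\mathbf v\rangle\rangle$ for all $\mathbf p\in\ker a^E(\cdot,\cdot)$ (rigid motions), where $\langle\langle\mathbf r,\mathbf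 s\rangle\rangle$ is the average of $\mathbf r\cdot\mathbf s$ over the vertices of $E$. The local space $\boldsymbol{\mathcal V}_h^E$ is the set of $\mathbf v\in\boldsymbol{\mathcal W}_h^E$ with $\int_E\mathbf p\cdot\boldsymbol\Pi_\varepsilon^E\mathbf v=\int_E\mathbf p\cdot\mathbf v$ for every $\mathbf p\in[\mathbb P_k(E)]^2$ that is $L^2(E)$-orthogonal to $[\mathbb P_{k-2}(E)]^2$. $\boldsymbol\Pi_0^E$ is the $[L^2(E)]^2$-orthogonal projector onto $[\mathbb P_k(E)]^2$. The global space is $\boldsymbol{\mathcal V}_h=\{\mathbf v\in\boldsymbol{\mathcal V}:\mathbf v|_E\in\boldsymbol{\mathcal V}_h^E\ \forall E\in\mathcal T_h\}$. $S_\varepsilon^E,S_0^E$ are symmetric positive definite bilinear forms on $\boldsymbol{\mathcal V}_h^E$ with $c_0a^E(\mathbf v,\mathbf v)\le S_\varepsilon^E(\mathbf v,\mathbf v)\le c_1a^E(\mathbf v,\mathbf v)$ for $\mathbf v\in\boldsymbol{\mathcal V}_h^E$ with $\boldsymbol\Pi_\varepsilon^E\mathbf v=\mathbf 0$, and $\tilde c_0b^E(\mathbf v,\mathbf v)\le S_0^E(\mathbf v,\mathbf v)\le\tilde c_1b^E(\mathbf v,\mathbf v)$ for all $\mathbf v\in\boldsymbol{\mathcal V}_h^E$, with positive constants depending only on $C_{\mathcal T}$. Put $a_h^E(\mathbf u,\mathbf v)=a^E(\boldsymbol\Pi_\varepsilon^E\mathbf u,\boldsymbol\Pi_\varepsilon^E\mathbf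 v)+S_\varepsilon^E(\mathbf u-\boldsymbol\Pi_\varepsilon^E\mathbf u,\mathbf v-\boldsymbol\Pi_\varepsilon^E\mathbf v)$, $b_h^E(\mathbf u,\mathbf v)=b^E(\boldsymbol\Pi_0^E\mathbf u,\boldsymbol\Pi_0^E\mathbf v)+S_0^E(\mathbf u-\boldsymbol\Pi_0^E\mathbf u,\mathbf v-\boldsymbol\Pi_0^E\mathbf v)$, $a_h=\sum_Ea_h^E$, $b_h=\sum_Eb_h^E$. Eigenpairs. $(\lambda,\mathbf w)\in\mathbb R\times\boldsymbol{\mathcal V}$ satisfies $a(\mathbf w,\mathbf v)=\lambda b(\mathbf w,\mathbf v)$ for all $\mathbf v\in\boldsymbol{\mathcal V}$, with $\lambda$ a simple eigenvalue and $\|\mathbf w\|_{0,\Omega}=1$. For each mesh, $(\lambda_h,\mathbf w_h)\in\mathbb R\times\boldsymbol{\mathcal V}_h$ satisfies $a_h(\mathbf w_h,\mathbf v_h)=\lambda_hb_h(\mathbf w_h,\mathbf v_h)$ for all $\mathbf v_h\in\boldsymbol{\mathcal V}_h$, $\|\mathbf w_h\|_{0,\Omega}=1$, and $\lambda_h\to\lambda$, $\|\mathbf w-\mathbf w_h\|_{1,\Omega}\to0$ as $h\to0$. Estimator. $\mathcal S_E$ is the set of edges of $E$; the set of all edges is split as $\mathcal S_\Omega\cup\mathcal S_{\Gamma_D}\cup\mathcal S_{\Gamma_N}$ (interior edges, edges in $\Gamma_D$, edges in $\Gamma_N$). For $\ell\in\mathcal S_\Omega$ shared by $E^+,E^-$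 with outer unit normals $\boldsymbol n_{E^\pm}$, $[\![\mathcal C\boldsymbol\varepsilon(\mathbf v)\boldsymbol n]\!]_\ell=\mathcal C\boldsymbol\varepsilon(\mathbf v|_{E^+})\boldsymbol n_{E^+}+\mathcal C\boldsymbol\varepsilon(\mathbf v|_{E^-})\boldsymbol n_{E^-}$. Define $J_\ell=\frac12[\![\mathcal C\boldsymbol\varepsilon(\boldsymbol\Pi_\varepsilon^E\mathbf w_h)\boldsymbol n]\!]_\ell$ for $\ell\in\mathcal S_\Omega$ (the elementwise projection being used on each side), $J_\ell=-\mathcal C\boldsymbol\varepsilon(\boldsymbol\Pi_\varepsilon^E\mathbf w_h)\boldsymbol n$ for $\ell\in\mathcal S_{\Gamma_N}$, $J_\ell=\mathbf 0$ for $\ell\in\mathcal S_{\Gamma_D}$. Set $\theta_E^2=b_h^E(\mathbf w_h-\boldsymbol\Pi_0^E\mathbf w_h,\mathbf w_h-\boldsymbol\Pi_0^E\mathbf w_h)+a_h^E(\mathbf w_h-\boldsymbol\Pi_\varepsilon^E\mathbf w_h,\mathbf w_h-\boldsymbol\Pi_\varepsilon^E\mathbf w_h)$, $R_E^2=h_E^2\|\lambda_h\varrho\boldsymbol\Pi_0^E\mathbf w_h+\mathbf{div}(\mathcal C\boldsymbol\varepsilon(\boldsymbol\Pi_\varepsilon^E\mathbf w_h))\|_{0,E}^2$, and $\eta_E^2=\theta_E^2+R_E^2+\sum_{\ell\in\mathcal S_E}h_E\|J_\ell\|_{0,\ell}^2$. *)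

(* Defs.v *)
From HB Require Import structures.
From mathcomp Require Import all_boot all_order all_algebra.
From mathcomp Require Import all_classical all_reals all_analysis.
Import Order.TTheory GRing.Theory Num.Theory.
Import numFieldNormedType.Exports.

Set Implicit Arguments.
Unset Strict Implicit.
Unset Printing Implicit Defensive.

Local Open Scope classical_set_scope.
Local Open Scope ring_scope.

(* Points of the plane are pairs, so that the product Lebesgue measure applies;
   the norm of the library on R * R is the max norm, hence the explicit
   Euclidean distance. Fields are functions on the whole plane, of which only
   the values on the relevant domain matter, up to null sets. Vector fields take
   values in 'cV[R]_2, tensors are 2 x 2 matrices, and (grad v) i j is the
   derivative of v_i along e_j. *)
Notation plane R := (R * R)%type.
Notation vfield R := (R * R -> 'cV[R]_2).

Section Plane.
Context {R : realType}.
Implicit Types (x y p q : plane R) (D A : set (plane R)).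

Definition area : set (plane R) -> \bar R :=
  (@lebesgue_measure R \x @lebesgue_measure R)%E.

Definition axis_dir (j : 'I_2) : plane R := if j == ord0 then (1, 0) else (0, 1).

Definition eucl x y : R :=
  Num.sqrt ((x.1 - y.1) ^+ 2 + (x.2 - y.2) ^+ 2).

Definition eball x (r : R) : set (plane R) := [set y | eucl x y < r].

Definition ediam A : \bar R :=
  ereal_sup (0%E |` [set (eucl z.1 z.2)%:E | z in A `*` A]).

Definition lerp p q (t : R) : plane R := (1 - t) *: p + t *: q.

Definition seg p q : set (plane R) := [set lerp p q t | t in `[0, 1]].

Definition open_seg p q : set (plane R) := [set lerp p q t | t in `]0, 1[].

Definition bd D : set (plane R) := closure D `\` D°.

Definition seg_int (l : plane R * plane R) (F : plane R -> R) : R :=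
  eucl l.1 l.2 * \int[lebesgue_measure]_(t in `[0, 1]) F (lerp l.1 l.2 t).

(* One-dimensional Hausdorff measure, normalised so that it is the length on
   segments. *)
Definition hausdorff1_delta (delta : R) A : \bar R :=
  ereal_inf [set (\sum_(i <oo) ediam (U i))%E | U in
    [set U : (set (plane R))^nat |
      A `<=` \bigcup_i U i /\ forall i, (ediam (U i) <= delta%:E)%E]].

Definition hausdorff1 A : \bar R :=
  ereal_sup [set hausdorff1_delta delta A | delta in [set d | 0 < d]].

(* Integral of F >= 0 on A with respect to arc length, by the layer-cake
   formula; this equals the Lebesgue integral when A and F are Borel. *)
Definition arc_int A (F : plane R -> R) : \bar R :=
  (\int[lebesgue_measure]_(t in `]0%R, +oo[)
     hausdorff1 (A `&` [set x | (t < F x)%R]))%E.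

Definition lipschitz_domain D : Prop :=
  forall x, bd D x -> exists r c s (g : R -> R),
    [/\ 0 < r, c ^+ 2 + s ^+ 2 = 1, [lipschitz g t | t in setT] &
      forall y, eball x r y ->
        (D y <-> g (c * y.1 + s * y.2) < c * y.2 - s * y.1)].

End Plane.

Section Sobolev.
Context {R : realType}.
Implicit Types (x : plane R) (D E : set (plane R)) (u v p : vfield R).

Definition partial (j : 'I_2) (f : plane R -> R) x : R := 'D_(axis_dir j) f x.

Definition C1 (f : plane R -> R) : Prop :=
  forall j, (forall x, derivable f x (axis_dir j)) /\ continuous (partial j f).

Definition C1c D (phi : plane R -> R) : Prop :=
  C1 phi /\ exists2 K, compact K & K `<=` D /\ forall x, ~ K x -> phi x = 0.

Definition C1_field u : Prop := forall i, C1 (fun x => u x i ord0).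

Definition jac u x : 'M[R]_2 :=
  \matrix_(i, j) partial j (fun y => u y i ord0) x.

Definition divt (T : plane R -> 'M[R]_2) x : 'cV[R]_2 :=
  \col_i \sum_j partial j (fun y => T y i j) x.

Definition frob m n (A B : 'M[R]_(m, n)) : R := \sum_i \sum_j A i j * B i j.

Definition L2 m n D (f : plane R -> 'M[R]_(m, n)) : Prop := forall i j,
  measurable_fun D (fun x => f x i j) /\
  area.-integrable D (fun x => ((f x i j) ^+ 2)%:E).

(* Weak derivatives, tested against C^1 functions with compact support in D;
   smooth test functions give the same notion. *)
Definition is_wjac D u (G : plane R -> 'M[R]_2) : Prop :=
  L2 D G /\ forall i j phi, C1c D phi ->
    \int[area]_(x in D) (u x i ord0 * partial j phi x) =
    - \int[area]_(x in D) (G x i j * phi x).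

Definition H1 D u : Prop := L2 D u /\ exists G, is_wjac D u G.

Definition wjac D u : plane R -> 'M[R]_2 := xget (fun=> 0) [set G | is_wjac D u G].

Definition is_wlaplacian D u (f : vfield R) : Prop :=
  forall i phi, C1c D phi ->
    \int[area]_(x in D) (\sum_j wjac D u x i j * partial j phi x) =
    - \int[area]_(x in D) (f x i ord0 * phi x).

Definition ip0 D u v : R := \int[area]_(x in D) frob (u x) (v x).
Definition norm0sq D u : R := ip0 D u u.
Definition semi1sq D u : R :=
  \int[area]_(x in D) frob (wjac D u x) (wjac D u x).
Definition norm1sq D u : R := norm0sq D u + semi1sq D u.

(* g is the trace of u, in the sense of the extension by density of the
   restriction to the boundary: some C^1 fields converge to u in H^1(D) while
   their restrictions converge to g in L^2. The functional bint is the integral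
   over the part of the boundary under consideration. *)
Definition is_trace D (bint : (plane R -> R) -> \bar R) u g : Prop :=
  H1 D u /\ exists phi : (vfield R)^nat,
    [/\ forall m, C1_field (phi m),
        norm1sq D (phi m - u) @[m --> \oo] --> 0 &
        bint (fun x => frob (phi m x - g x) (phi m x - g x)) @[m --> \oo]
          --> 0%E].

Definition H1_zero D (Gamma : set (plane R)) : set (vfield R) :=
  [set u | is_trace D (arc_int Gamma) u (fun=> 0)].

End Sobolev.

Section Elasticity.
Context {R : realType}.
Variables mu lam rho : R.
Implicit Types (D : set (plane R)) (u v : vfield R) (A : 'M[R]_2).

Definition sym A : 'M[R]_2 := 2^-1 *: (A + A^T).

Definition stiff A : 'M[R]_2 := (2 * mu) *: A + (lam * \tr A)%:M.

Definition stiff_posdef : Prop :=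
  forall A, A^T = A -> A != 0 -> 0 < frob (stiff A) A.

Definition aform D u v : R :=
  \int[area]_(x in D) frob (stiff (sym (wjac D u x))) (sym (wjac D v x)).

Definition bform D u v : R := \int[area]_(x in D) (rho * frob (u x) (v x)).

Definition stress u x : 'M[R]_2 := stiff (sym (jac u x)).

End Elasticity.

(* A polygon is given by the cyclic list of its vertices (angles equal to pi are
   allowed) together with the open region that they enclose. *)
Record polygon (R : realType) := Polygon {
  verts : seq (plane R);
  region :> set (plane R) }.

Section Polygon.
Context {R : realType}.
Implicit Types (E : polygon R) (l : plane R * plane R).

Definition vert E (i : nat) : plane R := nth 0 (verts E) (i %% size (verts E)).

Definition edges E : seq (plane R * plane R) :=
  zip (verts E) (rot 1 (verts E)).

(* Edges are unoriented. *)
Definition has_edge E l : bool :=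
  (l \in edges E) || ((l.2, l.1) \in edges E).

Definition share_edge E1 E2 : bool := has (has_edge E1) (edges E2).

(* An open bounded connected set whose boundary is a Jordan curve is the
   interior of that curve. *)
Definition simple_polygon E : Prop :=
  let n := size (verts E) in
  [/\ (3 <= n)%N /\ uniq (verts E),
      forall i j x, (i < j < n)%N ->
        seg (vert E i) (vert E i.+1) x -> seg (vert E j) (vert E j.+1) x ->
        (j = i.+1 /\ x = vert E j) \/ (i = 0%N /\ j = n.-1 /\ x = vert E 0),
      region E !=set0 /\ open (region E),
      bounded_set (region E) /\ connected (region E) &
      bd E = [set x | exists2 l, l \in edges E & seg l.1 l.2 x]].

Definition diam E : R := fine (ediam (region E)).

Definition bd_int E (F : plane R -> R) : R := \sum_(l <- edges E) seg_int l F.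

Definition outer_normal E l : 'cV[R]_2 :=
  let shift (n : 'cV[R]_2) (t : R) : plane R :=
    lerp l.1 l.2 2^-1 + t *: (n ord0 ord0, n ord_max ord0) in
  xget 0 [set n : 'cV[R]_2 |
    [/\ frob n n = 1,
        n ord0 ord0 * (l.2.1 - l.1.1) + n ord_max ord0 * (l.2.2 - l.1.2) = 0 &
        \forall t \near 0^'+,
          ~ closure E (shift n t) /\ region E (shift n (- t))]].

(* The edges are not too short, and the region is star-shaped with respect to
   every point of a ball, both relative to the diameter. *)
Definition shape_regular (CT : R) E : Prop :=
  (forall l, l \in edges E -> CT * diam E < eucl l.1 l.2) /\
  exists x0, eball x0 (CT * diam E) `<=` region E /\
    forall y x, eball x0 (CT * diam E) y -> region E x ->
      seg y x `<=` region E.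

End Polygon.

Section Mesh.
Context {R : realType} (N : nat).
Implicit Types (T : 'I_N -> polygon R) (l : plane R * plane R).

Definition is_mesh (Omega GammaD GammaN : set (plane R)) T : Prop :=
  [/\ forall i, simple_polygon (T i) /\ region (T i) `<=` Omega,
      forall i j, i != j -> region (T i) `&` region (T j) = set0,
      closure Omega = \bigcup_i closure (region (T i)) &
      forall i l, l \in edges (T i) ->
        [\/ open_seg l.1 l.2 `<=` Omega /\ (exists2 j, j != i & has_edge (T j) l),
            open_seg l.1 l.2 `<=` GammaD |
            open_seg l.1 l.2 `<=` GammaN]].

Definition mesh_size T : R := \big[Num.max/0]_i diam (T i).

End Mesh.

Section VirtualElements.
Context {R : realType}.
Variables (mu lam rho : R) (k : nat).
Implicit Types (E : polygon R) (u v p q g wh : vfield R).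

(* Polynomials of degree < m in each component; thus [P_j]^2 is vpoly j.+1, and
   vpoly k.-1 is [P_{k-2}]^2 with the convention P_{-1} = {0} for k = 1. *)
Definition poly2 (m : nat) : set (plane R -> R) :=
  [set f | exists c : nat -> nat -> R, forall x,
    f x = \sum_(i < m) \sum_(j < m | (i + j < m)%N)
            c i j * x.1 ^+ i * x.2 ^+ j].

Definition vpoly (m : nat) : set (vfield R) :=
  [set p | forall i, poly2 m (fun x => p x i ord0)].

(* Continuous trace; unique on the boundary of E, hence vertex values of fields
   in space_W below are values of ctrace. *)
Definition is_ctrace E v g : Prop :=
  {within bd E, continuous g} /\ is_trace E (fun F => (bd_int E F)%:E) v g.

Definition ctrace E v : vfield R := xget (fun=> 0) [set g | is_ctrace E v g].

Definition space_W E : set (vfield R) :=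
  [set v | [/\ H1 E v,
    exists2 p, vpoly k.+1 p & is_wlaplacian E v p &
    exists2 g, is_ctrace E v g & forall l, l \in edges E ->
      exists2 p, vpoly k.+1 p & forall x, seg l.1 l.2 x -> g x = p x]].

Definition vert_avg E u v : R :=
  (\sum_(x <- verts E) frob (u x) (v x)) / (size (verts E))%:R.

(* The kernel of a^E, realised in [P_k]^2. *)
Definition ker_a E : set (vfield R) :=
  [set p | vpoly k.+1 p /\ forall v, H1 E v -> aform mu lam E p v = 0].

Definition is_Pi_eps E v p : Prop :=
  [/\ vpoly k.+1 p,
      forall q, vpoly k.+1 q -> aform mu lam E q p = aform mu lam E q v &
      forall q, ker_a E q -> vert_avg E q p = vert_avg E q (ctrace E v)].

Definition Pi_eps E v : vfield R := xget (fun=> 0) [set p | is_Pi_eps E v p].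

Definition is_Pi_0 E v p : Prop :=
  vpoly k.+1 p /\ forall q, vpoly k.+1 q -> ip0 E q p = ip0 E q v.

Definition Pi_0 E v : vfield R := xget (fun=> 0) [set p | is_Pi_0 E v p].

Definition space_V E : set (vfield R) :=
  [set v | space_W E v /\ forall p, vpoly k.+1 p ->
    (forall q, vpoly k.-1 q -> ip0 E p q = 0) ->
    ip0 E p (Pi_eps E v) = ip0 E p v].

(* Symmetric positive definite bilinear form on a space of fields on D, seen
   up to equality almost everywhere. *)
Definition spd_form (D : set (plane R)) (V : set (vfield R))
    (S : vfield R -> vfield R -> R) : Prop :=
  [/\ forall c u v w, V u -> V v -> V w -> S (c *: u + v) w = c * S u w + S v w,
      forall u v, V u -> V v -> S u v = S v u,
      forall v, V v -> 0 <= S v v &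
      forall v, V v -> ~ {ae area, forall x, D x -> v x = 0} -> 0 < S v v].

Variables Seps S0 : vfield R -> vfield R -> R.

Definition aform_hE E u v : R :=
  aform mu lam E (Pi_eps E u) (Pi_eps E v) + Seps (u - Pi_eps E u) (v - Pi_eps E v).

Definition bform_hE E u v : R :=
  bform rho E (Pi_0 E u) (Pi_0 E v) + S0 (u - Pi_0 E u) (v - Pi_0 E v).

Definition theta2 E wh : R :=
  bform_hE E (wh - Pi_0 E wh) (wh - Pi_0 E wh) +
  aform_hE E (wh - Pi_eps E wh) (wh - Pi_eps E wh).

Definition res2 E (lamh : R) wh : R :=
  diam E ^+ 2 * norm0sq E (fun x =>
    (lamh * rho) *: Pi_0 E wh x + divt (stress mu lam (Pi_eps E wh)) x).

End VirtualElements.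

Section Global.
Context {R : realType}.
Variables (Omega GammaD GammaN : set (plane R)) (mu lam rho : R) (k N : nat).
Variable T : 'I_N -> polygon R.
Variables Seps S0 : 'I_N -> vfield R -> vfield R -> R.
Implicit Types (u v wh : vfield R) (l : plane R * plane R).

Definition space_Vh : set (vfield R) :=
  [set v | H1_zero Omega GammaD v /\ forall i, space_V mu lam k (T i) v].

Definition aform_h u v : R := \sum_i aform_hE mu lam k (Seps i) (T i) u v.

Definition bform_h u v : R := \sum_i bform_hE rho k (S0 i) (T i) u v.

(* An interior edge belongs to exactly two elements of a mesh and a boundary
   edge to exactly one, so that the sum is the jump of the normal stress in the
   first case and the one-sided normal stress in the second. *)
Definition residual_J wh l x : 'cV[R]_2 :=
  let sigma := \sum_(i | has_edge (T i) l)
    stress mu lam (Pi_eps mu lam k (T i) wh) x *m outer_normal (T i) l in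
  if `[< open_seg l.1 l.2 `<=` Omega >] then 2^-1 *: sigma
  else if `[< open_seg l.1 l.2 `<=` GammaN >] then - sigma
  else 0.

Definition eta2 (i : 'I_N) (lamh : R) wh : R :=
  theta2 mu lam rho k (Seps i) (S0 i) (T i) wh + res2 mu lam rho k (T i) lamh wh +
  \sum_(l <- edges (T i))
    diam (T i) * seg_int l (fun x => frob (residual_J wh l x) (residual_J wh l x)).

End Global.

(* Main.v *)
Require Import Defs.
From mathcomp Require Import all_boot all_order all_algebra.
From mathcomp Require Import all_classical all_reals all_analysis.
From mathcomp Require Import measurable_realfun.
From mathcomp Require Import ring lra.
Import Order.TTheory GRing.Theory Num.Theory.
Import numFieldNormedType.Exports.
Set Implicit Arguments.
Unset Strict Implicit.
Unset Printing Implicit Defensive.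

Local Open Scope classical_set_scope.
Local Open Scope ring_scope.

(** The estimator is bounded by the error with the bubble function technique:
    the residuals are polynomials, and they can be tested with themselves after
    multiplication by a cut-off function.

    On an element, the difference of the weak equation of w and of the equation
    of the piecewise polynomial stresses says that the element residual r
    satisfies int r . v = int d . v + int S : grad v for all C^1 fields v with
    compact support in the element, where d is lambda_h rho Pi_0 wh - lambda
    rho w and S is the stress of w - Pi_eps wh ([element_equation]). Testing
    with r times a bump on a box inside the ball of star centres, and using that
    this box controls a polynomial and its gradient on the whole element
    ([poly2_int_bound]), gives h |r| <= C (h |d| + |S|) ([element_residual]).

    On an edge, the jump of the normal stresses is a polynomial. It is extended
    constantly across the edge and cut off near the middle of the edge; Green's
    formula in the adjacent elements turns the weak equation into the integral
    of its square over the edge ([green_edge], [edge_residual]). The support of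
    the cut-off function must be comparable to the edge, meet no other elements,
    and avoid the Dirichlet boundary. Star-shapedness with respect to a ball
    provides such a box on the inner side of the edge ([half_box_in]); between
    two elements this suffices ([interior_cutoff]), and beyond a Neumann edge
    the Lipschitz condition leaves a strip without points of the domain
    ([empty_strip], [boundary_cutoff]).

    The stabilisation terms only involve wh - Pi_0 wh and wh - Pi_eps wh. These
    fields belong to the local space and are annihilated by the corresponding
    projection, so that the upper bounds of the stabilisations apply
    ([theta_bound]). That the projections commute with the subtraction of
    polynomials depends on the unique solvability of their defining equations
    ([Pi_eps_exists], [Pi_eps_unique]) and on the uniqueness of the vertex
    values of continuous traces ([ctrace_vert]).

    Finally d is expressed by w - Pi_0 wh, w - wh and lambda w - lambda_h wh
    ([data_bound]). The constants are uniform because the diameters of elements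
    with a common edge are comparable ([share_edge_diam]), elements have a
    bounded number of edges ([edges_bound]), and the mesh sizes and the discrete
    eigenvalues converge. *)

(** * Boxes and Borel sets of the plane *)

Section Box.
Context {R : realType}.
Implicit Types (x y : plane R) (r : R) (U D : set (plane R)).

Definition box x r : set (plane R) :=
  [set y | `|y.1 - x.1| < r /\ `|y.2 - x.2| < r].

Lemma nbhs_box x U : nbhs x U <-> exists2 r : R, 0 < r & box x r `<=` U.
Proof.
split=> [/nbhs_ballP|] [r /= r0 sub]; [|apply/nbhs_ballP]; exists r => //.
- move=> y [y1 y2]; apply: sub; split; rewrite /ball/= distrC//.
- move=> y [y1 y2]; apply: sub; split; rewrite distrC//.
Qed.

Lemma box_center x r : 0 < r -> box x r x.
Proof. by move=> r0; split; rewrite subrr normr0. Qed.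

Lemma open_box x r : open (box x r).
Proof.
rewrite openE => y [y1 y2]; apply/nbhs_box.
exists (Num.min (r - `|y.1 - x.1|) (r - `|y.2 - x.2|)).
  by rewrite lt_min !subr_gt0 y1 y2.
move=> z [z1 z2]; move: z1 z2; rewrite !lt_min => /andP[z1 _] /andP[_ z2].
split.
- have := ler_normD (z.1 - y.1) (y.1 - x.1); rewrite addrA subrK => /le_lt_trans.
  by apply; rewrite -ltrBrDr.
- have := ler_normD (z.2 - y.2) (y.2 - x.2); rewrite addrA subrK => /le_lt_trans.
  by apply; rewrite -ltrBrDr.
Qed.

Lemma open_boxP U : open U <-> forall x, U x -> exists2 r : R, 0 < r & box x r `<=` U.
Proof.
rewrite openE; split=> oU x /oU; first by move/nbhs_box.
by move=> h; apply/nbhs_box.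
Qed.

Lemma box_setX x r :
  box x r = `]x.1 - r, x.1 + r[%classic `*` `]x.2 - r, x.2 + r[%classic.
Proof.
apply/seteqP; split => y /=.
  by move=> [y1 y2]; rewrite !in_itv/= -!ltr_distl.
by move=> []; rewrite !in_itv/= -!ltr_distl => y1 y2; split.
Qed.

Lemma measurable_box x r : measurable (box x r).
Proof. by rewrite box_setX; apply: measurableX; exact: measurable_itv. Qed.

Lemma area_box x r : 0 <= r -> area (box x r) = ((2 * r) ^+ 2)%:E.
Proof.
move=> r0; rewrite box_setX.
have e : forall a : R, lebesgue_measure `]a - r, a + r[%classic = (2 * r)%:E.
  move=> a; rewrite lebesgue_measure_itv/= lte_fin; case: ifPn.
    by move=> _; rewrite -EFinD; congr EFin; ring.
  rewrite ltrBlDr -addrA ltrDl -mulr2n -leNgt => h; congr EFin.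
  have -> : r = 0; last by rewrite mulr0.
  by apply/le_anti; rewrite r0 andbT -(pmulrn_lle0 _ (ltn0Sn 1)).
rewrite /area product_measure1E; last 2 first.
- exact: measurable_itv.
- exact: measurable_itv.
by rewrite [X in (X * _)%E]e [X in (_ * X)%E]e -EFinM expr2.
Qed.

(** Boxes with rational centres and radii form a countable base of the
    topology. *)
Lemma open_measurable2 U : open U -> measurable U.
Proof.
move=> /open_boxP oU.
pose B (q : rat * rat * rat) := box (ratr q.1.1 : R, ratr q.1.2 : R) (ratr q.2).
pose F (n : nat) := if unpickle n is Some q then
  (if `[< B q `<=` U >] then B q else set0) else set0.
suff -> : U = \bigcup_n F n.
  apply: bigcup_measurable => n _; rewrite /F; case: unpickle => [q|//].
  by case: ifP => // _; exact: measurable_box.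
apply/seteqP; split => x; last first.
  by move=> [n _]; rewrite /F; case: unpickle => [q|//]; case: ifPn => // /asboolP; apply.
move=> /oU [r r0 sub].
have rat_near (a e : R) : 0 < e -> exists q : rat, `|ratr q - a| < e.
  move=> e0; have [q] := rat_in_itvoo (ltr_pwDr e0 (lexx a)).
  rewrite in_itv/= => /andP[q1 q2]; exists q.
  by rewrite ger0_norm ?subr_ge0 ?(ltW q1)// ltrBlDl.
have r4 : 0 < r / 4 by rewrite divr_gt0.
have [a ha] := rat_near x.1 _ r4; have [b hb] := rat_near x.2 _ r4.
have [c hc] := rat_near (r / 2) _ r4.
have c1 : r / 4 < ratr c.
  move: hc; rewrite ltr_distl => /andP[h _]; apply: le_lt_trans h.
  by rewrite le_eqVlt; apply/orP; left; apply/eqP; field.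
have c2 : ratr c < 3 * (r / 4).
  move: hc; rewrite ltr_distl => /andP[_ h]; apply: lt_le_trans h _.
  by rewrite le_eqVlt; apply/orP; left; apply/eqP; field.
have FE q : F (pickle q) = if `[< B q `<=` U >] then B q else set0 by rewrite /F pickleK.
exists (pickle (a, b, c)); first by [].
rewrite FE.
have Bx : B (a, b, c) x.
  by split; rewrite distrC (lt_trans _ c1).
case: ifPn => // /asboolP []; move=> y [/= y1 y2]; apply: sub; split.
- have := ler_normD (y.1 - ratr a) (ratr a - x.1); rewrite addrA subrK => /le_lt_trans; apply.
  by have := lt_trans y1 c2; lra.
- have := ler_normD (y.2 - ratr b) (ratr b - x.2); rewrite addrA subrK => /le_lt_trans; apply.
  by have := lt_trans y2 c2; lra.
Qed.

Lemma continuous_measurable2 D (f : plane R -> R) :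
  measurable D -> continuous f -> measurable_fun D f.
Proof.
move=> mD /continuousP cf; apply: (measurability _ (RGenOpens.measurableE R)).
move=> _ [_ [a [b ->] <-]]; apply: measurableI => //; apply: open_measurable2.
exact/cf/interval_open.
Qed.

End Box.

(** * Integrals over plane sets *)

Section Integral.
Context {R : realType}.
Implicit Types (D Z A B : set (plane R)) (f g h : plane R -> R) (c : R).
Local Notation P2 := (measurableTypeR R * measurableTypeR R)%type.

(** The plane has two structures of measurable space with the same
    measurable sets, its own one and the product P2. Fubini's theorem and
    induction over Dynkin systems apply to P2, so integrability is expressed
    there. *)
Definition itg D f := integrable (area : set P2 -> \bar R) D (EFin \o f : P2 -> \bar R).

(** The identity transports the area between the two measurable structures
    of the plane. *)
Lemma ge0_integral_area D (h : plane R -> \bar R) : measurable D ->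
  measurable_fun D h -> (forall x, 0 <= h x)%E ->
  integral (area : set (plane R) -> \bar R) D h =
  integral (area : set P2 -> \bar R) D (h : P2 -> \bar R).
Proof.
move=> mD mh h0; pose id1 := (fun x : P2 => x : plane R).
have mid : measurable_fun setT id1 by move=> _ Y mY; rewrite setTI; exact: mY.
have := @ge0_integral_pushforward _ _ P2 ((R * R)%type : measurableType _) R
  id1 mid (area : measure P2 R) D h mD mh; apply.
by move=> y _; exact: h0.
Qed.

Lemma itgE D f : measurable D -> area.-integrable D (EFin \o f) <-> itg D f.
Proof.
move=> mD; split => /integrableP[mf i1]; apply/integrableP; split => //.
- by move: i1; rewrite ge0_integral_area//; apply: measurableT_comp.
- by rewrite ge0_integral_area//; apply: measurableT_comp.
Qed.

Lemma itg_mf D f : itg D f -> measurable_fun D f.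
Proof. by move=> /measurable_int/measurable_EFinP. Qed.

Lemma itg_le D f g : measurable D -> measurable_fun D f ->
  (forall x, D x -> `|f x| <= g x) -> itg D g -> itg D f.
Proof.
move=> mD mf fg gi.
apply: (@le_integrable _ P2 R area D mD _ (EFin \o g : P2 -> \bar R) _ _ gi).
  exact/measurable_EFinP.
by move=> x Dx /=; rewrite lee_fin (le_trans (fg x Dx))// ler_norm.
Qed.

Lemma eq_itg D f g : measurable D -> (forall x, D x -> f x = g x) -> itg D f -> itg D g.
Proof.
move=> mD fg; apply: (@eq_integrable _ P2 R area D mD) => x /set_mem Dx /=.
by rewrite fg.
Qed.

Lemma itg0 D : measurable D -> itg D (fun=> 0).
Proof. by move=> mD; exact: integrable0. Qed.

Lemma itgD D f g : measurable D -> itg D f -> itg D g -> itg D (fun x => f x + g x).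
Proof. by move=> mD fi gi; exact: (@integrableD _ P2 R area D mD _ _ fi gi). Qed.

Lemma itgZ D c f : measurable D -> itg D f -> itg D (fun x => c * f x).
Proof. by move=> mD fi; exact: (@integrableZl _ P2 R area D mD c _ fi). Qed.

Lemma itgN D f : measurable D -> itg D f -> itg D (fun x => - f x).
Proof.
move=> mD fi; apply: eq_itg mD _ (itgZ (-1) mD fi) => x _; by rewrite mulN1r.
Qed.

Lemma itgB D f g : measurable D -> itg D f -> itg D g -> itg D (fun x => f x - g x).
Proof. by move=> mD fi gi; apply: itgD => //; apply: itgN. Qed.

Lemma itg_sum D (I : Type) (s : seq I) (F : I -> plane R -> R) : measurable D ->
  (forall i, itg D (F i)) -> itg D (fun x => \sum_(i <- s) F i x).
Proof.
move=> mD Fi; elim: s => [|i s IH].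
  by apply: eq_itg mD _ (itg0 mD) => x _; rewrite big_nil.
apply: eq_itg mD _ (itgD mD (Fi i) IH) => x _; by rewrite big_cons.
Qed.

Lemma itgS D A f : measurable D -> measurable A -> A `<=` D -> itg D f -> itg A f.
Proof. by move=> mD mA AD; exact: (@integrableS _ P2 R area _ _ _ mD mA AD). Qed.

Lemma itg_bounded D f c : measurable D -> (area D < +oo)%E -> measurable_fun D f ->
  (forall x, D x -> `|f x| <= c) -> itg D f.
Proof.
move=> mD fD mf bf; apply: (@measurable_bounded_integrable _ P2 R area f D mD) => //.
exists c; split; first exact: num_real.
by move=> M cM x Dx; apply: (le_trans (bf x Dx)); rewrite ltW.
Qed.

Local Notation I D f := (\int[@area R]_(x in D) f x).

Lemma I_eq D f g : (forall x, D x -> f x = g x) -> I D f = I D g.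
Proof. by move=> fg; apply: eq_Rintegral => x /set_mem; exact: fg. Qed.

Lemma I_D D f g : measurable D -> itg D f -> itg D g ->
  I D (fun x => f x + g x) = I D f + I D g.
Proof. by move=> mD fi gi; rewrite RintegralD. Qed.

Lemma I_B D f g : measurable D -> itg D f -> itg D g ->
  I D (fun x => f x - g x) = I D f - I D g.
Proof. by move=> mD fi gi; rewrite RintegralB. Qed.

Lemma I_Z D c f : measurable D -> itg D f -> I D (fun x => c * f x) = c * I D f.
Proof. by move=> mD fi; rewrite RintegralZl. Qed.

Lemma I_N D f : measurable D -> itg D f -> I D (fun x => - f x) = - I D f.
Proof.
move=> mD fi; rewrite -[RHS]mulN1r -I_Z//; apply: I_eq => x _; by rewrite mulN1r.
Qed.

Lemma I_0 D : I D (fun=> 0) = 0.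
Proof. by rewrite /Rintegral integral0. Qed.

Lemma I_sum D (J : Type) (s : seq J) (F : J -> plane R -> R) : measurable D ->
  (forall i, itg D (F i)) ->
  I D (fun x => \sum_(i <- s) F i x) = \sum_(i <- s) I D (F i).
Proof.
move=> mD Fi; elim: s => [|i s IH].
  by rewrite big_nil -[RHS](I_0 D); apply: I_eq => x _; rewrite big_nil.
rewrite big_cons -IH -I_D//; last exact: itg_sum.
by apply: I_eq => x _; rewrite big_cons.
Qed.

Lemma I_le D f g : measurable D -> itg D f -> itg D g ->
  (forall x, D x -> f x <= g x) -> I D f <= I D g.
Proof. by move=> mD fi gi fg; exact: le_Rintegral. Qed.

Lemma I_ge0 D f : (forall x, D x -> 0 <= f x) -> 0 <= I D f.
Proof. by move=> f0; exact: Rintegral_ge0. Qed.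

Lemma I_cst D c : measurable D -> I D (fun=> c) = c * fine (area D).
Proof. by move=> mD; rewrite Rintegral_cst. Qed.

Lemma I_sub D A f : measurable D -> measurable A -> A `<=` D -> itg D f ->
  (forall x, D x -> 0 <= f x) -> I A f <= I D f.
Proof.
move=> mD mA AD fi f0; rewrite /Rintegral fine_le//.
- exact: integrable_fin_num (itgS mD mA AD fi).
- exact: integrable_fin_num.
- apply: (@ge0_subset_integral _ P2 R area) => //.
  by apply/measurable_EFinP; exact: itg_mf.
Qed.

(** The null set is explicit, so that equal fields can be combined pointwise
    without any measurability of the fields. *)
Definition aeq m n D (F G : plane R -> 'M[R]_(m, n)) :=
  exists Z, [/\ measurable Z, area Z = 0%E & forall x, D x -> ~ Z x -> F x = G x].

Lemma I_null D Z f : measurable D -> measurable Z -> area Z = 0%E -> itg D f ->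
  I D f = I (D `\` Z) f.
Proof.
move=> mD mZ Z0 fi; rewrite /Rintegral; congr fine.
by rewrite (@negligible_integral _ P2 R area D Z).
Qed.

Lemma I_aeq D Z f g : measurable D -> measurable Z -> area Z = 0%E ->
  itg D f -> itg D g -> (forall x, D x -> ~ Z x -> f x = g x) -> I D f = I D g.
Proof.
move=> mD mZ Z0 fi gi fg; rewrite (I_null mD mZ Z0 fi) (I_null mD mZ Z0 gi).
by apply: I_eq => x [Dx nZ]; exact: fg.
Qed.

Lemma I_setU A B f : measurable A -> measurable B -> A `&` B = set0 ->
  itg (A `|` B) f -> I (A `|` B) f = I A f + I B f.
Proof.
move=> mA mB AB fi; rewrite Rintegral_setU//; apply/eqP/seteqP; split => x//=.
by move=> /= xAB; rewrite -[False]/(set0 x) -AB.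
Qed.

Lemma itg_mkcond D f : measurable D -> itg D f <-> itg setT (f \_ D).
Proof.
move=> mD; rewrite /itg (@integrable_mkcond _ P2 R area D)//.
by rewrite -restrict_EFin.
Qed.

Lemma I_mkcond D f : I D f = I setT (f \_ D).
Proof. exact: Rintegral_mkcond. Qed.

Lemma I_supp D A f : (forall x, D x -> ~ A x -> f x = 0) -> A `<=` D -> I D f = I A f.
Proof.
move=> f0 AD; rewrite I_mkcond (I_mkcond A); apply: I_eq => x _.
rewrite !patchE; case: ifPn => Dx; case: ifPn => Ax //.
- by apply: f0; [exact: set_mem|move=> /mem_set; apply/negP].
- by move/negP: Dx => []; apply/mem_set/AD/set_mem.
Qed.

Lemma itg_supp D A f : measurable D -> measurable A -> A `<=` D ->
  (forall x, D x -> ~ A x -> f x = 0) -> itg A f -> itg D f.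
Proof.
move=> mD mA AD f0 /(itg_mkcond _ mA) h; apply/(itg_mkcond _ mD).
apply: (eq_itg (@measurableT _ (R * R)%type) _ h) => x _; rewrite !patchE; case: ifPn => Ax; case: ifPn => Dx //.
- by move/negP: Dx => []; apply/mem_set/AD/set_mem.
- by rewrite f0//; [exact: set_mem|move=> /mem_set; apply/negP].
Qed.

Lemma aeq_sym m n D (F G : plane R -> 'M[R]_(m, n)) : aeq D F G -> aeq D G F.
Proof. by move=> [Z [mZ Z0 FG]]; exists Z; split=> // x Dx nZ; rewrite FG. Qed.

Lemma area0U Z A : measurable Z -> measurable A -> area Z = 0%E -> area A = 0%E ->
  area (Z `|` A) = 0%E.
Proof.
move=> mZ mA Z0 A0; apply/eqP; rewrite eq_le; apply/andP; split; last exact: measure_ge0.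
have h : (area (Z `|` A) <= area Z + area A)%E := @measureU2 _ P2 R area _ _ mZ mA.
by rewrite Z0 A0 adde0 in h.
Qed.

Lemma aeq_op m n p q D (F G : plane R -> 'M[R]_(m, n)) (F' G' : plane R -> 'M[R]_(p, q))
   r s (op : 'M[R]_(m, n) -> 'M[R]_(p, q) -> 'M[R]_(r, s)) :
  aeq D F G -> aeq D F' G' -> aeq D (fun x => op (F x) (F' x)) (fun x => op (G x) (G' x)).
Proof.
move=> [Z [mZ Z0 FG]] [Z' [mZ' Z'0 FG']]; exists (Z `|` Z'); split.
- exact: measurableU.
- exact: area0U.
- by move=> x Dx /not_orP[nZ nZ']; rewrite FG// FG'.
Qed.

Lemma aeq_refl m n D (F : plane R -> 'M[R]_(m, n)) : aeq D F F.
Proof. by exists set0; split => //; exact: measure0. Qed.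

Lemma I_aeq_frob m n D (F G F' G' : plane R -> 'M[R]_(m, n)) : measurable D ->
  itg D (fun x => frob (F x) (F' x)) -> itg D (fun x => frob (G x) (G' x)) ->
  aeq D F G -> aeq D F' G' ->
  I D (fun x => frob (F x) (F' x)) = I D (fun x => frob (G x) (G' x)).
Proof.
move=> mD fi gi [Z [mZ Z0 FG]] [Z' [mZ' Z'0 FG']].
apply: (@I_aeq D (Z `|` Z')) => //.
- exact: measurableU.
- exact: area0U.
- by move=> x Dx /not_orP[nZ nZ']; rewrite FG// FG'.
Qed.

End Integral.

Section Bounded.
Context {R : realType}.
Implicit Types (D : set (plane R)) (f : plane R -> R).

Lemma bounded_sub_box D : bounded_set D -> exists2 M : R, 0 < M & D `<=` box (0, 0) M.
Proof.
move=> [M0 [_ hM]]; pose M := Num.max M0 0 + 1.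
have M0M : M0 < M by rewrite /M ltr_pwDr// le_max lexx.
exists (M + 1).
  by rewrite /M -addrA ltr_wpDl// ?le_max ?lexx ?orbT.
move=> x Dx; have /= := hM M M0M x Dx; rewrite prod_normE ge_max => /andP[h1 h2].
by split; rewrite /= subr0; [apply: (le_lt_trans h1)|apply: (le_lt_trans h2)]; rewrite ltrDl.
Qed.

Lemma box_bounded x (r : R) : bounded_set (box x r).
Proof.
exists (`|x.1| + `|x.2| + r); split; first exact: num_real.
move=> M hM y /= [y1 y2]; rewrite prod_normE ge_max.
have t1 := ler_normD (y.1 - x.1) x.1; have t2 := ler_normD (y.2 - x.2) x.2.
rewrite subrK in t1; rewrite subrK in t2.
have := normr_ge0 x.1; have := normr_ge0 x.2.
by move=> ? ?; apply/andP; split; lra.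
Qed.

Lemma area_fin D : measurable D -> bounded_set D -> (area D < +oo)%E.
Proof.
move=> mD /bounded_sub_box[M M0 DM].
have h : (area D <= area (box (0%R, 0%R) M))%E.
  by apply: (@le_measure _ _ _ (@lebesgue_measure R \x @lebesgue_measure R)%E) => //;
    rewrite inE//; exact: measurable_box.
by apply: (le_lt_trans h); rewrite area_box ?ltry// ltW.
Qed.

Lemma continuous_bounded f (K : set (plane R)) : continuous f -> bounded_set K ->
  exists c, forall x, K x -> `|f x| <= c.
Proof.
move=> cf /bounded_sub_box[M M0 KM].
pose C := `[- M, M]%classic `*` `[- M, M]%classic : set (plane R).
have cC : compact C by apply: compact_setX; exact: segment_compact.
have : compact (f @` C).
  by apply: continuous_compact => //; exact: continuous_subspaceT.
move=> /compact_bounded[c [_ hc]]; exists (c + 1) => x /KM[x1 x2].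
apply: (hc (c + 1)); first by rewrite ltrDl.
exists x => //; split; rewrite /= in_itv/=.
- by move: x1; rewrite subr0 ltr_norml => /andP[/ltW-> /ltW->].
- by move: x2; rewrite subr0 ltr_norml => /andP[/ltW-> /ltW->].
Qed.

Lemma itg_continuous D f : measurable D -> bounded_set D -> continuous f -> itg D f.
Proof.
move=> mD bD cf; have [c hc] := continuous_bounded cf bD.
apply: (itg_bounded mD (area_fin mD bD) (continuous_measurable2 mD cf) hc).
Qed.

(** Together with [I_le_box], this converts pointwise bounds into integral
    bounds with the right power of a diameter. *)
Lemma I_ge_box D f x (r c : R) : measurable D -> itg D f -> 0 <= r ->
  (forall y, D y -> 0 <= f y) -> box x r `<=` D -> (forall y, box x r y -> c <= f y) ->
  c * (2 * r) ^+ 2 <= \int[area]_(y in D) f y.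
Proof.
move=> mD fi r0 f0 BD fc.
have mB := @measurable_box R x r.
apply: le_trans (I_sub mD mB BD fi f0).
have -> : c * (2 * r) ^+ 2 = \int[area]_(y in box x r) c.
  by rewrite I_cst// area_box.
apply: I_le => //; last exact: itgS fi.
by apply: itg_continuous => //; [exact: box_bounded|move=> z; exact: cvg_cst].
Qed.

Lemma I_le_box D f x (r c : R) : measurable D -> itg D f -> 0 <= r -> 0 <= c ->
  D `<=` box x r -> (forall y, D y -> f y <= c) ->
  \int[area]_(y in D) f y <= c * (2 * r) ^+ 2.
Proof.
move=> mD fi r0 c0 DB fc; have mB := @measurable_box R x r.
have bB := @box_bounded x r.
have ci (A : set (plane R)) : measurable A -> bounded_set A -> itg A (fun=> c).
  by move=> mA bA; apply: itg_continuous => // z; exact: cvg_cst.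
have bD : bounded_set D.
  by move: bB => [M [MR hM]]; exists M; split => // N /hM h z /DB; exact: h.
apply: le_trans (I_le mD fi (ci D mD bD) fc) _.
apply: le_trans (I_sub mB mD DB (ci _ mB bB) (fun _ _ => c0)) _.
by rewrite I_cst// area_box.
Qed.

End Bounded.

(** * Functions of class C^1 with explicit gradients *)

Section Calculus.
Context {R : realType}.
Implicit Types (x y : plane R).
Local Notation grad := ('I_2 -> plane R -> R).

Lemma is_derive_line (V : normedModType R) (f : V -> R) (x v : V) (t d : R) :
  is_derive (t *: v + x) v f d <-> is_derive t 1 (fun s : R => f (s *: v + x)) d.
Proof.
have e : (fun h : R => h^-1 *: (f (h *: v + (t *: v + x)) - f (t *: v + x))) =
  (fun h : R => h^-1 *: ((fun s : R => f (s *: v + x)) (h *: 1 + t) - f (t *: v + x))).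
  by apply/funext => h; rewrite addrA -scalerDl /GRing.scale/= mulr1.
split=> -[dx Dx].
- have dt : derivable (fun s : R => f (s *: v + x)) t 1 by move: dx; rewrite /derivable e.
  by apply: DeriveDef => //; rewrite -Dx /derive e.
- have dt : derivable f (t *: v + x) v by rewrite /derivable e.
  by apply: DeriveDef => //; rewrite -Dx /derive e.
Qed.

(** A quadratic remainder is easily checked for the piecewise quadratic
    functions from which cut-off functions are built. *)
Lemma is_derive_quad (k : R -> R) (y d C : R) :
  (forall h, `|k (h + y) - k y - d * h| <= C * h ^+ 2) -> is_derive y 1 k d.
Proof.
move=> kC.
have : h^-1 *: (k (h *: 1 + y) - k y) @[h --> 0^'] --> d.
  apply/cvgrPdist_le => e e0; near=> h.
  have h0 : h != 0 by near: h; exact: nbhs_dnbhs_neq.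
  have hC : `|h| * `|C| <= e.
    have : `|h| <= e / (`|C| + 1).
      near: h; apply: dnbhs0_le; by rewrite divr_gt0// ltr_wpDl.
    have C1 : 0 < `|C| + 1 by rewrite ltr_wpDl.
    rewrite ler_pdivlMr// => H; apply: le_trans H.
    by rewrite ler_wpM2l// lerDl.
  rewrite /GRing.scale/= mulr1 distrC.
  have -> : h^-1 * (k (h + y) - k y) - d = h^-1 * (k (h + y) - k y - d * h).
    by rewrite !mulrBr; congr (_ - _); rewrite mulrCA mulVf// mulr1.
  rewrite normrM normfV.
  apply: le_trans (ler_wpM2l _ (kC h)) _; first by rewrite invr_ge0.
  apply: le_trans hC; rewrite ler_pdivrMl ?normr_gt0//.
  rewrite -[X in _ <= X]/(`|h| * (`|h| * `|C|)) mulrA -expr2 mulrC.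
  by rewrite real_normK ?num_real// ler_wpM2l ?sqr_ge0// ler_norm.
move=> H; have dk : derivable k y 1 by apply/cvg_ex; exists d.
by apply: DeriveDef => //; exact: cvg_lim.
Unshelve. all: by end_near. Qed.

(** The square makes the positive part continuously differentiable. *)
Definition pos2 (y : R) := (Num.max 0 y) ^+ 2.

Lemma is_derive_pos2 (y : R) : is_derive y 1 pos2 (2 * Num.max 0 y).
Proof.
apply: (@is_derive_quad _ _ _ 1) => h; rewrite mul1r /pos2.
by case: (leP 0 (h + y)); case: (leP 0 y) => a b; rewrite ler_norml; apply/andP; split; nra.
Qed.

Lemma MVT_bound (k k' : R -> R) (a b M : R) :
  (forall t : R, is_derive t 1 k (k' t)) ->
  (forall t, (a <= t <= b) || (b <= t <= a) -> `|k' t| <= M) ->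
  `|k a - k b| <= M * `|a - b|.
Proof.
move=> dk kM; wlog ab : a b kM / a < b.
  move=> H; case: (ltgtP a b) => [ab|ba|->]; first exact: H.
    by rewrite distrC (distrC a); apply: H => // t; rewrite orbC; exact: kM.
  by rewrite !subrr !normr0 mulr0.
have [|c cab e] := @MVT R k k' a b ab (fun t _ => dk t).
  apply: continuous_subspaceT => t; apply: differentiable_continuous.
  by apply/derivable1_diffP; have [] := dk t.
rewrite distrC e normrM (distrC a) ler_wpM2r//; apply: kM.
by move: cab; rewrite in_itv/= => /andP[/ltW-> /ltW->].
Qed.

Definition hasd f (g : grad) :=
  forall j x, is_derive x (axis_dir j) f (g j x).

(** Gradients are given as explicit functions, so that those of sums,
    products and compositions are composed like the functions themselves. *)
Definition C1d f (g : grad) := hasd f g /\ forall j, continuous (g j).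

Lemma partialE f g j : hasd f g -> partial j f = g j.
Proof. by move=> fg; apply/funext => x; have [] := fg j x. Qed.

Lemma C1P f : C1 f <-> exists g, C1d f g.
Proof.
split=> [cf|[g [fg cg]] j].
  exists (fun j => partial j f); split => [j x|j]; last by have [_] := cf j.
  by have [df _] := cf j; exact/derivableP.
split; first by move=> x; have [] := fg j x.
by rewrite (partialE j fg).
Qed.

Lemma hasd_slice1 f g : hasd f g -> forall b t : R,
  is_derive t 1 (fun s => f (s, b)) (g ord0 (t, b)).
Proof.
move=> fg b t; have /= := fg ord0 (t, b).
have e s : (s, b) = s *: axis_dir ord0 + (0, b) :> plane R.
  by rewrite /axis_dir eqxx; apply: injective_projections; rewrite /= /GRing.scale/= ?mulr1 ?mulr0 ?addr0 ?add0r.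
rewrite {1}e => /is_derive_line; congr (is_derive _ _ _ _).
by apply/funext => s; rewrite e.
Qed.

Lemma hasd_slice2 f g : hasd f g -> forall a t : R,
  is_derive t 1 (fun s => f (a, s)) (g ord_max (a, t)).
Proof.
move=> fg a t; have /= := fg ord_max (a, t).
have e s : (a, s) = s *: axis_dir ord_max + (a, 0) :> plane R.
  by rewrite /axis_dir; apply: injective_projections; rewrite /= /GRing.scale/= ?mulr1 ?mulr0 ?addr0 ?add0r.
rewrite {1}e => /is_derive_line; congr (is_derive _ _ _ _).
by apply/funext => s; rewrite e.
Qed.

(** The mean value inequality on the two sides of a path that is parallel to
    the axes. *)
Lemma hasd_lip f g x (r M : R) : hasd f g ->
  (forall j y, box x r y -> `|g j y| <= M) ->
  forall y z, box x r y -> box x r z -> `|f y - f z| <= M * (`|y.1 - z.1| + `|y.2 - z.2|).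
Proof.
move=> fg gM [y1 y2] [z1 z2] [/= by1 by2] [/= bz1 bz2].
have -> : f (y1, y2) - f (z1, z2) = (f (y1, y2) - f (z1, y2)) + (f (z1, y2) - f (z1, z2)).
  by rewrite addrA subrK.
rewrite mulrDr; apply: le_trans (ler_normD _ _) (lerD _ _).
- apply: (MVT_bound (fun t => hasd_slice1 fg y2 t)) => t tt; apply: gM; split => //=.
  move: by1 bz1; rewrite !ltr_norml => /andP[? ?] /andP[? ?].
  by case/orP: tt => /andP[? ?]; apply/andP; split; lra.
- apply: (MVT_bound (fun t => hasd_slice2 fg z1 t)) => t tt; apply: gM; split => //=.
  move: by2 bz2; rewrite !ltr_norml => /andP[? ?] /andP[? ?].
  by case/orP: tt => /andP[? ?]; apply/andP; split; lra.
Qed.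

(** Continuous partial derivatives are bounded near each point, which makes
    the function locally Lipschitz by [hasd_lip]. *)
Lemma C1d_continuous f g : C1d f g -> continuous f.
Proof.
move=> [fg cg] x.
have [c0 h0] := continuous_bounded (cg ord0) (@box_bounded _ x 1).
have [c1 h1] := continuous_bounded (cg ord_max) (@box_bounded _ x 1).
pose M := Num.max (Num.max c0 c1) 1.
have M0 : 0 < M by rewrite lt_max ltr01 orbT.
have gM j y : box x 1 y -> `|g j y| <= M.
  move=> xy; have [->|->] : j = ord0 \/ j = ord_max.
    by case: j => [[|[|//]] ?]; [left|right]; exact: val_inj.
  - by rewrite !le_max h0.
  - by rewrite !le_max h1// orbT.
have L := hasd_lip fg gM.
apply/cvgrPdist_lt => e e0.
apply/nbhs_box; exists (Num.min 1 (e / (2 * M))).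
  by rewrite lt_min ltr01/= divr_gt0// mulr_gt0.
move=> y [/=]; rewrite !lt_min => /andP[a1 a2] /andP[b1 b2].
apply: le_lt_trans (L x y _ _) _; [exact: box_center|by []|].
rewrite (distrC x.1) (distrC x.2).
have -> : e = M * (e / (2 * M) + e / (2 * M)) by field; rewrite gt_eqF.
by rewrite ltr_pM2l// ltrD.
Qed.

Lemma C1d_cst c : C1d (fun=> c) (fun _ _ => 0).
Proof. by split => [j x|j x]; [exact: is_derive_cst|exact: cvg_cst]. Qed.

Lemma is_derive_lin (l : plane R -> R) x v : (forall (h : R) x v, l (h *: v + x) = h * l v + l x) ->
  is_derive x v l (l v).
Proof.
move=> ll; have -> : x = 0 *: v + x by rewrite scale0r add0r.
apply/is_derive_line; have -> : (fun s : R => l (s *: v + x)) = (fun s : R => l v * s + l x).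
  by apply/funext => s; rewrite ll mulrC.
by apply: (@is_derive_quad _ _ _ 0) => h; rewrite mul0r mulrDr opprD addrACA subrr addr0 addrK subrr normr0.
Qed.

Lemma C1d_fst : C1d (fun x => x.1) (fun j _ => (j == ord0)%:R).
Proof.
split => [j x|j x]; last exact: cvg_cst.
have := @is_derive_lin (fun x => x.1) x (axis_dir j).
have -> : (axis_dir j : plane R).1 = (j == ord0)%:R by rewrite /axis_dir; case: eqP.
by apply.
Qed.

Lemma C1d_snd : C1d (fun x => x.2) (fun j _ => (j != ord0)%:R).
Proof.
split => [j x|j x]; last exact: cvg_cst.
have := @is_derive_lin (fun x => x.2) x (axis_dir j).
have -> : (axis_dir j : plane R).2 = (j != ord0)%:R by rewrite /axis_dir; case: eqP.
by apply.
Qed.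

Lemma C1dD (f g : plane R -> R) f' g' : C1d f f' -> C1d g g' ->
  C1d (fun x => f x + g x) (fun j x => f' j x + g' j x).
Proof.
move=> [df cf] [dg cg]; split => [j x|j x]; last exact: cvgD (cf j x) (cg j x).
exact: is_deriveD (df j x) (dg j x).
Qed.

Lemma C1dM (f g : plane R -> R) f' g' : C1d f f' -> C1d g g' ->
  C1d (fun x => f x * g x) (fun j x => f x * g' j x + g x * f' j x).
Proof.
move=> Cf Cg; have cf := C1d_continuous Cf; have cg := C1d_continuous Cg.
case: Cf Cg => [df cf'] [dg cg']; split => [j x|j x].
  exact: is_deriveM (df j x) (dg j x).
by apply: cvgD; apply: cvgM; [exact: cf|exact: cg'|exact: cg|exact: cf'].
Qed.

Lemma C1d_ext (f g : plane R -> R) f' g' : C1d f f' -> (forall x, f x = g x) ->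
  (forall j x, f' j x = g' j x) -> C1d g g'.
Proof.
move=> Cf fg fg'; have <- : f = g by exact/funext.
by have <- : f' = g' by apply/funext => j; exact/funext.
Qed.

Lemma C1dZ c f f' : C1d f f' -> C1d (fun x => c * f x) (fun j x => c * f' j x).
Proof.
move=> Cf; apply: (C1d_ext (C1dM (C1d_cst c) Cf)) => //.
by move=> j x; rewrite mulr0 addr0.
Qed.

Lemma C1dN f f' : C1d f f' -> C1d (fun x => - f x) (fun j x => - f' j x).
Proof.
by move=> Cf; apply: (C1d_ext (C1dZ (-1) Cf)) => [x|j x]; rewrite mulN1r.
Qed.

Lemma C1dB (f g : plane R -> R) f' g' : C1d f f' -> C1d g g' ->
  C1d (fun x => f x - g x) (fun j x => f' j x - g' j x).
Proof. by move=> Cf Cg; exact: C1dD Cf (C1dN Cg). Qed.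

Lemma C1d_sum (I : Type) (s : seq I) F F' : (forall i : I, C1d (F i) (F' i)) ->
  C1d (fun x => \sum_(i <- s) F i x) (fun j x => \sum_(i <- s) F' i j x).
Proof.
move=> CF; elim: s => [|i s IH].
  by apply: (C1d_ext (C1d_cst 0)) => [x|j x]; rewrite big_nil.
by apply: (C1d_ext (C1dD (CF i) IH)) => [x|j x]; rewrite big_cons.
Qed.

Lemma C1d_comp (h h' : R -> R) f f' : (forall t : R, is_derive t 1 h (h' t)) -> continuous h' ->
  C1d f f' -> C1d (fun x => h (f x)) (fun j x => h' (f x) * f' j x).
Proof.
move=> dh ch Cf; have cf := C1d_continuous Cf; case: Cf => df cf'.
split=> [j x|j x].
  have -> : x = 0 *: axis_dir j + x by rewrite scale0r add0r.
  apply/is_derive_line; apply: (@is_derive1_comp _ h (fun s : R => f (s *: axis_dir j + x))).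
  exact: (proj1 (is_derive_line f x (axis_dir j) 0 _) (df j (0 *: axis_dir j + x))).
apply: cvgM; last exact: cf'.
by apply: (@continuous_comp _ _ _ f h'); [exact: cf|exact: ch].
Qed.

Lemma continuous_max0 : continuous (fun y : R => 2 * Num.max 0 y).
Proof.
by move=> y; apply: cvgM; [exact: cvg_cst|apply: (@continuous_max R R (fun=> 0) id); [exact: cvg_cst|exact: cvg_id]].
Qed.

Lemma C1d_pos2 f f' : C1d f f' ->
  C1d (fun x => pos2 (f x)) (fun j x => (2 * Num.max 0 (f x)) * f' j x).
Proof. by move=> Cf; exact: C1d_comp is_derive_pos2 continuous_max0 Cf. Qed.

Lemma C1dX f f' n : C1d f f' ->
  C1d (fun x => f x ^+ n) (fun j x => n%:R * f x ^+ n.-1 * f' j x).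
Proof.
move=> Cf; elim: n => [|n IH].
  by apply: (C1d_ext (C1d_cst 1)) => [x|j x]; rewrite ?expr0// !mul0r.
apply: (C1d_ext (C1dM Cf IH)) => [x|j x]; first by rewrite exprS.
case: n {IH} => [|n] /=; first by rewrite !mul0r mulr0 add0r !expr0 !mul1r.
by rewrite [in RHS]mulrSr !exprS; ring.
Qed.

End Calculus.

(** * Bump functions *)

Section Bump.
Context {R : realType}.
Implicit Types (x y : plane R) (r : R).

Definition b01 (u : R) := pos2 (1 - u ^+ 2).

Definition db01 (u : R) := 2 * Num.max 0 (1 - u ^+ 2) * (- (2 * u)).

Lemma b01_ge0 u : 0 <= b01 u. Proof. exact: sqr_ge0. Qed.

Lemma b01_le1 u : b01 u <= 1.
Proof.
by rewrite /b01 /pos2; have := sqr_ge0 u; case: (leP 0 (1 - u ^+ 2)) => a b; nra.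
Qed.

Lemma b01_out u : 1 <= `|u| -> b01 u = 0.
Proof.
move=> u1; rewrite /b01 /pos2 max_l ?expr0n//.
by rewrite subr_le0 -[u ^+ 2]real_normK ?num_real//; nra.
Qed.

Lemma db01_out u : 1 <= `|u| -> db01 u = 0.
Proof.
move=> u1; rewrite /db01 max_l ?mulr0 ?mul0r//.
by rewrite subr_le0 -[u ^+ 2]real_normK ?num_real//; nra.
Qed.

Lemma b01_gt0 u : `|u| < 1 -> 0 < b01 u.
Proof.
move=> u1; have h : 0 < 1 - u ^+ 2.
  by rewrite -[u ^+ 2]real_normK ?num_real//; have := normr_ge0 u; nra.
by rewrite /b01 /pos2 max_r ?exprn_gt0// ltW.
Qed.

Lemma b01_half u : `|u| <= 1/2 -> 1/2 <= b01 u.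
Proof.
move=> u1; have h : 3/4 <= 1 - u ^+ 2.
  by rewrite -[u ^+ 2]real_normK ?num_real//; have := normr_ge0 u; nra.
by rewrite /b01 /pos2 max_r; nra.
Qed.

Lemma db01_le u : `|db01 u| <= 4.
Proof.
rewrite /db01; case: (leP 0 (1 - u ^+ 2)) => h; last by rewrite mulr0 mul0r normr0.
have a := sqr_ge0 u; have u1 : -1 <= u <= 1 by apply/andP; split; nra.
case/andP: u1 => u1 u2.
have p1 : 0 <= (1 - u ^+ 2) * (1 - u) by rewrite mulr_ge0// subr_ge0.
have p2 : 0 <= (1 - u ^+ 2) * (1 + u) by rewrite mulr_ge0//; lra.
by rewrite ler_norml; apply/andP; split; lra.
Qed.

Lemma C1d_b01 f f' : C1d f f' -> C1d (fun x => b01 (f x)) (fun j x => db01 (f x) * f' j x).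
Proof.
move=> Cf; have C1 := C1d_pos2 (C1dB (C1d_cst 1) (C1dX 2 Cf)).
apply: (C1d_ext C1) => // j x; rewrite /db01/= expr1 sub0r; ring.
Qed.

(** A product of bumps in one variable, to which all bounds reduce. *)
Definition bump x r y := b01 (r^-1 * (y.1 - x.1)) * b01 (r^-1 * (y.2 - x.2)).

Definition dbump x r (j : 'I_2) y :=
  if j == ord0 then r^-1 * db01 (r^-1 * (y.1 - x.1)) * b01 (r^-1 * (y.2 - x.2))
  else r^-1 * b01 (r^-1 * (y.1 - x.1)) * db01 (r^-1 * (y.2 - x.2)).

Lemma C1d_bump x r : C1d (bump x r) (dbump x r).
Proof.
have C1 := C1d_b01 (C1dZ r^-1 (C1dB (@C1d_fst R) (C1d_cst x.1))).
have C2 := C1d_b01 (C1dZ r^-1 (C1dB (@C1d_snd R) (C1d_cst x.2))).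
apply: (C1d_ext (C1dM C1 C2)) => // j y; rewrite /dbump; case: eqP => _ /=; ring.
Qed.

Lemma bump_ge0 x r y : 0 <= bump x r y.
Proof. by rewrite mulr_ge0 ?b01_ge0. Qed.

Lemma bump_le1 x r y : bump x r y <= 1.
Proof. by rewrite mulr_ile1 ?b01_ge0 ?b01_le1. Qed.

Lemma box_scale x r y : 0 < r ->
  box x r y <-> `|r^-1 * (y.1 - x.1)| < 1 /\ `|r^-1 * (y.2 - x.2)| < 1.
Proof.
move=> r0; have e a : (`|r^-1 * a| < 1) = (`|a| < r).
  by rewrite normrM gtr0_norm ?invr_gt0// ltr_pdivrMl// mulr1.
by rewrite !e.
Qed.

Lemma bump_out x r y : 0 < r -> ~ box x r y -> bump x r y = 0.
Proof.
move=> r0; rewrite box_scale// => /not_andP[] /negP; rewrite -leNgt => h.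
  by rewrite /bump b01_out// mul0r.
by rewrite /bump [X in _ * X]b01_out// mulr0.
Qed.

Lemma dbump_out x r j y : 0 < r -> ~ box x r y -> dbump x r j y = 0.
Proof.
move=> r0; rewrite box_scale// /dbump => /not_andP[] /negP; rewrite -leNgt => h.
  by case: eqP => _; rewrite ?(db01_out h) ?(b01_out h) ?mulr0 ?mul0r.
by case: eqP => _; rewrite ?(db01_out h) ?(b01_out h) ?mulr0 ?mul0r.
Qed.

Lemma bump_gt0 x r y : 0 < r -> box x r y -> 0 < bump x r y.
Proof. by move=> r0; rewrite box_scale// => -[a b]; rewrite mulr_gt0// b01_gt0. Qed.

Lemma bump_half x r y : 0 < r -> box x (r / 2) y -> 1/4 <= bump x r y.
Proof.
move=> r0 [a b].
have e t : `|t| < r / 2 -> 1/2 <= b01 (r^-1 * t).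
  move=> h; apply: b01_half; rewrite normrM gtr0_norm ?invr_gt0// ler_pdivrMl//.
  by rewrite ltW// mul1r.
by have := e _ a; have := e _ b; rewrite /bump; nra.
Qed.

Lemma dbump_le x r j y : 0 < r -> `|dbump x r j y| <= 4 * r^-1.
Proof.
move=> r0; have ri : 0 < r^-1 by rewrite invr_gt0.
have h u v : `|r^-1 * db01 u * b01 v| <= 4 * r^-1.
  rewrite normrM (ger0_norm (b01_ge0 v)) normrM (gtr0_norm ri).
  have := b01_le1 v; have := b01_ge0 v; have := db01_le u; have := normr_ge0 (db01 u).
  move=> a b c d; rewrite -mulrA mulrC; rewrite ler_wpM2r ?(ltW ri)//; nra.
rewrite /dbump; case: eqP => _; first exact: h.
by rewrite mulrAC; exact: h.
Qed.

Lemma closed_plane (K : set (plane R)) : compact K -> closed K.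
Proof. by apply: compact_closed; exact: norm_hausdorff. Qed.

(** The margin between r and r' leaves room for a compact box inside D. *)
Lemma C1c_box (D : set (plane R)) phi g x r r' : C1d phi g -> r < r' ->
  (forall y, ~ box x r y -> phi y = 0) -> box x r' `<=` D -> C1c D phi.
Proof.
move=> Cp rr p0 BD; split; first by apply/C1P; exists g.
exists (`[x.1 - r, x.1 + r]%classic `*` `[x.2 - r, x.2 + r]%classic).
  by apply: compact_setX; exact: segment_compact.
split=> [y /= [] | y nK].
  rewrite !in_itv/= -!ler_distl => a b; apply: BD; split; [exact: le_lt_trans a _|exact: le_lt_trans b _].
apply: p0 => -[a b]; apply: nK; split; rewrite /= in_itv/= -ler_distl; exact: ltW.
Qed.

Lemma partial_out (phi : plane R -> R) (K : set (plane R)) j x : closed K ->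
  (forall y, ~ K y -> phi y = 0) -> ~ K x -> partial j phi x = 0.
Proof.
move=> cK p0 nK; rewrite /partial.
have nx : \forall y \near x, phi y = 0.
  have oK : open (~` K) by exact: closed_openC.
  have : nbhs x (~` K) by exact: open_nbhs_nbhs.
  by apply: filterS => y; exact: p0.
rewrite (near_eq_derive _ (g := fun=> 0))//; first exact: derive_cst.
Qed.

End Bump.

(** * The divergence theorem in a half-plane *)

Section OneDim.
Context {R : realType}.
Local Notation leb := (@lebesgue_measure R).

Lemma int1_supp (f : R -> R) (A : set R) : measurable A ->
  (forall t, ~ A t -> f t = 0) ->
  (\int[leb]_t (f t)%:E = \int[leb]_(t in A) (f t)%:E)%E.
Proof.
move=> mA f0; rewrite [RHS]integral_mkcond; apply: eq_integral => t _.
rewrite patchE; case: ifPn => // nA; rewrite f0// => At.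
by move/negP: nA; apply; exact/mem_set.
Qed.

Lemma ftc_segment (k k' : R -> R) (a b : R) : a < b -> (forall t : R, is_derive t 1 k (k' t)) ->
  continuous k' -> (\int[leb]_(t in `[a, b]) (k' t)%:E = (k b - k a)%:E)%E.
Proof.
move=> ab dk ck.
have kc : continuous k.
  move=> t; apply: differentiable_continuous.
  by apply/derivable1_diffP; have [] := dk t.
rewrite (@continuous_FTC2 _ k' k)//.
- exact: continuous_subspaceT.
- split.
  + by move=> t _; have [] := dk t.
  + by apply: cvg_at_right_filter; exact: kc.
  + by apply: cvg_at_left_filter; exact: kc.
- by move=> t _; rewrite derive1E; have [] := dk t.
Qed.

(** The fundamental theorem of calculus on a half-line. The condition is
    affine, rather than a bound on t, so that the statement applies to all
    slices of a half-plane, including those that the half-plane contains or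
    misses. *)
Lemma int_halfline (k k' : R -> R) (M al be : R) :
  (forall t : R, is_derive t 1 k (k' t)) -> continuous k' ->
  (forall t, M <= `|t| -> k t = 0) -> (forall t, M <= `|t| -> k' t = 0) ->
  (\int[leb]_t (if 0 < al * t + be then k' t else 0)%:E =
   (if al == 0 then 0 else - Num.sg al * k (- be / al))%:E)%E.
Proof.
move=> dk ck kM k'M; have [->|al0] := eqVneq al 0.
  have h : (\int[leb]_t (k' t)%:E = 0)%E.
    pose N := `|M| + 1; have N0 : 0 < N by rewrite ltr_wpDl.
    have MN : M <= N by rewrite (le_trans (ler_norm _))// lerDl.
    rewrite (@int1_supp _ `[- N, N]%classic)//.
      rewrite (ftc_segment _ dk ck); last by lra.
      by rewrite !kM ?subrr// ?normrN gtr0_norm.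
    move=> t /negP; rewrite in_itv/= -ler_norml -ltNge => Nt.
    by apply: k'M; apply: le_trans MN (ltW Nt).
  case: (ltP 0 be) => hb.
    by rewrite -[RHS]h; apply: eq_integral => t _; rewrite mul0r add0r hb.
  by apply: integral0_eq => t _; rewrite mul0r add0r ltNge hb.
pose tau := - be / al.
have tauE t : al * t + be = al * (t - tau) by rewrite /tau; field.
pose N := `|M| + `|tau| + 1.
have N1 : `|tau| < N by rewrite /N ltr_pwDr// lerDr.
have N2 : M <= N by rewrite /N (le_trans (ler_norm _))// -addrA lerDl addr_ge0.
have N0 : 0 < N := le_lt_trans (normr_ge0 _) N1.
have NN : `|N| = N by rewrite gtr0_norm.
have k'N t : N <= `|t| -> k' t = 0 by move=> h; apply: k'M; exact: le_trans h.
move: N1; rewrite ltr_norml => /andP[T1 T2].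
have mk' (A : set R) : measurable A -> measurable_fun A (fun t => (k' t)%:E).
  move=> mA; apply/measurable_EFinP; apply: (measurable_funS measurableT) => //.
  exact: continuous_measurable_fun.
move: al0; case: (ltgtP al 0) => // sal _.
- rewrite (_ : Num.sg al = -1) ?ltr0_sg// opprK mul1r -/tau.
  rewrite (@int1_supp _ `[- N, tau[%classic)//; last first.
    move=> t /negP; rewrite in_itv/= => nt; case: ifPn => //.
    rewrite tauE nmulr_rgt0// subr_lt0 => h; apply: k'N.
    move: nt; rewrite h andbT -ltNge => h2.
    by rewrite ler_normr lerNr (ltW h2) orbT.
  rewrite (_ : (\int[leb]_(t in `[(- N)%R, tau[) _ = \int[leb]_(t in `[(- N)%R, tau[) (k' t)%:E)%E).
    rewrite integral_itv_bndo_bndc; last exact: mk'.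
    by rewrite (ftc_segment _ dk ck)// (kM (- N)) ?subr0// normrN NN.
  apply: eq_integral => t; rewrite inE/= in_itv/= => /andP[_ h].
  by rewrite tauE nmulr_rgt0// subr_lt0 h.
- rewrite (_ : Num.sg al = 1) ?gtr0_sg// mulN1r -/tau.
  rewrite (@int1_supp _ `]tau, N]%classic)//; last first.
    move=> t /negP; rewrite in_itv/= => nt; case: ifPn => //.
    rewrite tauE pmulr_rgt0// subr_gt0 => h; apply: k'N.
    move: nt; rewrite h /= -ltNge => h2.
    by rewrite ler_normr (ltW h2).
  rewrite (_ : (\int[leb]_(t in `]tau, N]) _ = \int[leb]_(t in `]tau, N]) (k' t)%:E)%E).
    rewrite integral_itv_obnd_cbnd; last exact: mk'.
    by rewrite (ftc_segment _ dk ck)// (kM N) ?sub0r// NN.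
  apply: eq_integral => t; rewrite inE/= in_itv/= => /andP[h _].
  by rewrite tauE pmulr_rgt0// subr_gt0 h.
Qed.

(** The integrand vanishes outside the segment, so the change of variables
    also reduces the line to the segment. *)
Lemma int_affine (G : R -> R) (p d : R) : d != 0 -> continuous G ->
  (forall t, ~ (0 <= t <= 1) -> G (p + t * d) = 0) ->
  \int[leb]_y G y = `|d| * \int[leb]_(t in `[0, 1]) G (p + t * d).
Proof.
move=> d0 cG G0.
pose A := fun t : R => p + t * d.
have dA (t : R) : is_derive t 1 A d.
  apply: (@is_derive_quad _ _ _ _ 0) => h; rewrite /A mul0r.
  by rewrite (_ : _ - _ - _ = 0) ?normr0//; ring.
have A'E : A^`()%classic = fun=> d.
  by apply/funext => t; rewrite derive1E; have [] := dA t.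
have cA : continuous A.
  move=> t; apply: differentiable_continuous.
  by apply/derivable1_diffP; have [] := dA t.
have Aoo : derivable_oo_LRcontinuous A 0 1.
  split; first by move=> t _; have [] := dA t.
  + by apply: cvg_at_right_filter; exact: cA.
  + by apply: cvg_at_left_filter; exact: cA.
have A0 : A 0 = p by rewrite /A mul0r addr0.
have A1 : A 1 = p + d by rewrite /A mul1r.
have cGA : continuous (fun t => G (A t)).
  by move=> t; apply: (@continuous_comp _ _ _ A G); [exact: cA|exact: cG].
have iGA : leb.-integrable `[0, 1] (EFin \o (fun t => G (A t))).
  by apply: continuous_compact_integrable; [exact: segment_compact|exact: continuous_subspaceT].
have inv y : y = A ((y - p) / d) by rewrite /A; field.
rewrite -RintegralZl// /Rintegral; congr fine.
move: d0; case: (ltgtP d 0) => // sd _.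
- rewrite (@int1_supp _ `[A 1, A 0]%classic)//; last first.
    move=> y /negP; rewrite in_itv/= A0 A1 => ny; rewrite (inv y) G0// => /andP[h1 h2].
    move/negP: ny; apply; move: h1 h2; rewrite ler_ndivlMr// mul0r subr_le0.
    by rewrite ler_ndivrMr// mul1r => ? ?; apply/andP; split; lra.
  rewrite (@integration_by_substitution_decreasing _ A G 0 1)//.
  + apply: eq_integral => t _; rewrite A'E ltr0_norm//=; congr EFin.
    by rewrite -[LHS]/(G (A t) * - d) mulrC.
  + by move=> s t _ _ st; rewrite /A ltrD2l ltr_nM2r.
  + by rewrite A'E => t _; exact: cvg_cst.
  + by rewrite A'E; apply: is_cvg_cst.
  + by rewrite A'E; apply: is_cvg_cst.
  + exact: continuous_subspaceT.
- rewrite (@int1_supp _ `[A 0, A 1]%classic)//; last first.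
    move=> y /negP; rewrite in_itv/= A0 A1 => ny; rewrite (inv y) G0// => /andP[h1 h2].
    move/negP: ny; apply; move: h1 h2; rewrite ler_pdivlMr// mul0r subr_ge0.
    by rewrite ler_pdivrMr// mul1r => ? ?; apply/andP; split; lra.
  rewrite (@integration_by_substitution_increasing _ A G 0 1)//.
  + apply: eq_integral => t _; rewrite A'E gtr0_norm//=; congr EFin.
    by rewrite -[LHS]/(G (A t) * d) mulrC.
  + by move=> s t _ _ st; rewrite /A ltrD2l ltr_pM2r.
  + by rewrite A'E => t _; exact: cvg_cst.
  + by rewrite A'E; apply: is_cvg_cst.
  + by rewrite A'E; apply: is_cvg_cst.
  + exact: continuous_subspaceT.
Qed.

End OneDim.

Section Fubini2.
Context {R : realType}.
Local Notation leb := (@lebesgue_measure R).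
Local Notation P2 := (measurableTypeR R * measurableTypeR R)%type.

Lemma fubini1 (phi : plane R -> R) (psi : R -> R) : itg setT phi ->
  (forall y, \int[leb]_x (phi (x, y))%:E = (psi y)%:E)%E ->
  \int[area]_x phi x = \int[leb]_y psi y.
Proof.
move=> iphi h; rewrite /Rintegral; congr fine.
rewrite -[LHS]/(\int[leb \x leb]_z ((EFin \o phi : P2 -> \bar R) z))%E.
rewrite -integral21_prod_meas1//.
by apply: eq_integral => y _; rewrite -h.
Qed.

Lemma fubini2 (phi : plane R -> R) (psi : R -> R) : itg setT phi ->
  (forall x, \int[leb]_y (phi (x, y))%:E = (psi x)%:E)%E ->
  \int[area]_x phi x = \int[leb]_x psi x.
Proof.
move=> iphi h; rewrite /Rintegral; congr fine.
rewrite -[LHS]/(\int[leb \x leb]_z ((EFin \o phi : P2 -> \bar R) z))%E.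
rewrite -integral12_prod_meas1//.
by apply: eq_integral => y _; rewrite -h.
Qed.

End Fubini2.

Section HalfPlane.
Context {R : realType}.
Implicit Types (a P d x : plane R).
Local Notation leb := (@lebesgue_measure R).

Definition pcoord (j : 'I_2) x : R := if j == ord0 then x.1 else x.2.

Lemma continuous_pair (f g : R -> R) : continuous f -> continuous g ->
  continuous (fun t => (f t, g t) : plane R).
Proof.
move=> cf cg t A /nbhs_box[r r0 BA].
have /cvgrPdistC_lt/(_ _ r0) f1 := cf t; have /cvgrPdistC_lt/(_ _ r0) g1 := cg t.
by apply: filterS2 f1 g1 => u fu gu; apply: BA.
Qed.

Lemma cbox_closed x (r : R) :
  closed (`[x.1 - r, x.1 + r]%classic `*` `[x.2 - r, x.2 + r]%classic).
Proof. by apply: closed_plane; apply: compact_setX; exact: segment_compact. Qed.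

Lemma C1d_out (F : plane R -> R) F' (M : R) : C1d F F' -> (forall x, ~ box (0, 0) M x -> F x = 0) ->
  forall j x, ~ box (0, 0) (M + 1) x -> F' j x = 0.
Proof.
move=> [dF _] F0 j x nx; rewrite -(partialE j dF).
apply: (@partial_out _ F _ j x (@cbox_closed (0, 0) M)).
  move=> y ny; apply: F0 => -[/= y1 y2]; apply: ny.
  by split; rewrite /= in_itv/= -ler_distl; exact: ltW.
move=> [/=]; rewrite !in_itv/= -!ler_distl => x1 x2; apply: nx.
by split; rewrite /= ltr_pwDr.
Qed.

Lemma open_halfplane a (c : R) : open [set x | c < a.1 * x.1 + a.2 * x.2].
Proof.
have cl : continuous (fun x : plane R => a.1 * x.1 + a.2 * x.2).
  exact: C1d_continuous (C1dD (C1dZ a.1 (@C1d_fst R)) (C1dZ a.2 (@C1d_snd R))).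
rewrite (_ : [set x | _] = (fun x : plane R => a.1 * x.1 + a.2 * x.2) @^-1` `]c, +oo[%classic).
  by apply: open_comp; [move=> x _; exact: cl|exact: interval_open].
by apply/seteqP; split => x /=; rewrite in_itv/= andbT.
Qed.

Lemma itg_halfplane (F : plane R -> R) (M : R) (H : set (plane R)) : measurable H ->
  continuous F -> (forall x, ~ box (0, 0) M x -> F x = 0) -> itg H F.
Proof.
move=> mH cF F0; have mB := measurable_box ((0, 0) : plane R) M.
apply: (@itg_supp _ H (H `&` box (0, 0) M)) => //.
- exact: measurableI.
- by move=> x Hx nx; apply: F0 => Bx; apply: nx.
- apply: itgS (itg_continuous mB (@box_bounded _ _ _) cF) => //; exact: measurableI.
Qed.

(** Fubini's theorem in the direction e_j, and the fundamental theorem of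
    calculus on each line parallel to e_j. *)
Lemma halfplane_slice (F : plane R -> R) F' (M : R) a (c : R) j : C1d F F' ->
  (forall x, ~ box (0, 0) M x -> F x = 0) ->
  \int[area]_(x in [set x | c < a.1 * x.1 + a.2 * x.2]) F' j x =
  if j == ord0 then
    (if a.1 == 0 then 0 else
     \int[leb]_y (- Num.sg a.1 * F ((c - a.2 * y) / a.1, y)))
  else
    (if a.2 == 0 then 0 else
     \int[leb]_y (- Num.sg a.2 * F (y, (c - a.1 * y) / a.2))).
Proof.
move=> CF F0; have F'0 := C1d_out CF F0.
set H := [set x | _]; have mH : measurable H by apply: open_measurable2; exact: open_halfplane.
have [dF cF'] := CF.
have iF' : itg H (F' j) by apply: (itg_halfplane mH (cF' j)) => x; exact: F'0.
rewrite I_mkcond; move: iF'; rewrite itg_mkcond// => iF'.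
have HE x : (F' j \_ H) x = if 0 < a.1 * x.1 + a.2 * x.2 - c then F' j x else 0.
  rewrite patchE; case: ifPn => [/set_mem|nx]; rewrite /H/=.
    by rewrite subr_gt0 => ->.
  by rewrite subr_gt0 ifN//; apply: contra nx => h; exact/mem_set.
have off1 y t : M + 1 <= `|t| -> F' j (t, y) = 0.
  by move=> h; apply: F'0 => -[/= b _]; move: b; rewrite subr0 ltNge h.
have off2 y t : M + 1 <= `|t| -> F' j (y, t) = 0.
  by move=> h; apply: F'0 => -[/= _ b]; move: b; rewrite subr0 ltNge h.
have ofF1 y t : M + 1 <= `|t| -> F (t, y) = 0.
  by move=> h; apply: F0 => -[/= b _]; move: b; rewrite subr0 ltNge (le_trans _ h)// lerDl.
have ofF2 y t : M + 1 <= `|t| -> F (y, t) = 0.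
  by move=> h; apply: F0 => -[/= _ b]; move: b; rewrite subr0 ltNge (le_trans _ h)// lerDl.
have cpair1 y : continuous (fun t : R => (t, y) : plane R).
  by apply: continuous_pair => t; [exact: cvg_id|exact: cvg_cst].
have cpair2 y : continuous (fun t : R => (y, t) : plane R).
  by apply: continuous_pair => t; [exact: cvg_cst|exact: cvg_id].
have cs1 y : continuous (fun t : R => F' j (t, y)).
  by move=> t; apply: (@continuous_comp _ _ _ (fun t : R => (t, y))); [exact: cpair1|exact: cF'].
have cs2 y : continuous (fun t : R => F' j (y, t)).
  by move=> t; apply: (@continuous_comp _ _ _ (fun t : R => (y, t))); [exact: cpair2|exact: cF'].
have [?|?] : j = ord0 \/ j = ord_max; try subst j.
    by case: (j) => [[|[|//]] ?]; [left|right]; exact: val_inj.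
- rewrite eqxx (fubini1 (psi := fun y => if a.1 == 0 then 0 else
     - Num.sg a.1 * F ((c - a.2 * y) / a.1, y)) iF'); last first.
    move=> y; transitivity (\int[leb]_t
      (if (0 < a.1 * t + (a.2 * y - c))%R then F' ord0 (t, y) else 0%R)%:E)%E.
      by apply: eq_integral => t _; rewrite HE/= addrA.
    rewrite (int_halfline _ _ (hasd_slice1 dF y) (cs1 y) (ofF1 y) (off1 y)).
    by case: ifP => // _; rewrite opprB.
  by case: ifP => // _; rewrite /Rintegral integral0.
- rewrite (_ : (ord_max == ord0 :> 'I_2) = false)//.
  rewrite (fubini2 (psi := fun y => if a.2 == 0 then 0 else
     - Num.sg a.2 * F (y, (c - a.1 * y) / a.2)) iF'); last first.
    move=> y; transitivity (\int[leb]_t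
      (if (0 < a.2 * t + (a.1 * y - c))%R then F' ord_max (y, t) else 0%R)%:E)%E.
      by apply: eq_integral => t _; rewrite HE/= (addrC (a.1 * y)) addrA.
    rewrite (int_halfline _ _ (hasd_slice2 dF y) (cs2 y) (ofF2 y) (off2 y)).
    by case: ifP => // _; rewrite opprB.
  by case: ifP => // _; rewrite /Rintegral integral0.
Qed.

Lemma int_plane0 (F : plane R -> R) F' (M : R) j : C1d F F' ->
  (forall x, ~ box (0, 0) M x -> F x = 0) -> \int[area]_x F' j x = 0.
Proof.
move=> CF F0; have := halfplane_slice (0, 0) (-1) j CF F0.
rewrite /= eqxx; rewrite if_same => <-.
by congr Rintegral; apply/seteqP; split => x //= _; rewrite !mul0r addr0 ltrN10.
Qed.

(** By [halfplane_slice] the left-hand side is an integral over one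
    coordinate of the boundary line, which [int_affine] parametrises by t.
    The vector a is the inner normal of the half-plane, as long as d. *)
Lemma divergence_halfplane (F : plane R -> R) F' (M s : R) P d j : C1d F F' ->
  (forall x, ~ box (0, 0) M x -> F x = 0) -> s ^+ 2 = 1 ->
  (forall t, ~ (0 <= t <= 1) -> F (P + t *: d) = 0) ->
  let a : plane R := (- s * d.2, s * d.1) in
  \int[area]_(x in [set x | 0 < a.1 * (x.1 - P.1) + a.2 * (x.2 - P.2)]) F' j x =
  - pcoord j a * \int[leb]_(t in `[0, 1]) F (P + t *: d).
Proof.
move=> CF F0 s1 Fl a.
have cF := C1d_continuous CF.
have s0 : s != 0 by apply: contra_eq_neq s1 => ->; rewrite expr0n/= eq_sym oner_eq0.
have -> : [set x | 0 < a.1 * (x.1 - P.1) + a.2 * (x.2 - P.2)] =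
  [set x | a.1 * P.1 + a.2 * P.2 < a.1 * x.1 + a.2 * x.2].
  apply/seteqP; split => x /= h.
    by rewrite -subr_gt0; move: h; congr (_ < _); ring.
  by move: h; rewrite -subr_gt0; congr (_ < _); ring.
have cline : continuous (fun t : R => F (P + t *: d)).
  move=> t; apply: (@continuous_comp _ _ _ (fun t : R => P + t *: d) F); last exact: cF.
  by apply: cvgD; [exact: cvg_cst|apply: cvgZr_tmp; exact: cvg_id].
rewrite (halfplane_slice a _ j CF F0) /pcoord.
have sgM (s' e : R) : s' ^+ 2 = 1 -> Num.sg (s' * e) * `|e| = s' * e.
  move=> s'1; have [->|e0] := eqVneq e 0; first by rewrite mulr0 sgr0 mul0r.
  have {2}-> : s' = Num.sg s' * `|s'| by rewrite -numEsg.
  have -> : `|s'| = 1 by apply/eqP; rewrite -(@eqrXn2 _ 2)// ?expr1n// real_normK ?num_real// s'1.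
  by rewrite mulr1 sgrM -mulrA -numEsg.
have iline c : \int[leb]_(t in `[0, 1]) (c * F (P + t *: d)) =
    c * \int[leb]_(t in `[0, 1]) F (P + t *: d).
  rewrite RintegralZl//.
  by apply: continuous_compact_integrable; [exact: segment_compact|exact: continuous_subspaceT].
case: ifP => [_|_].
- have [a0|a0] := eqVneq a.1 0; first by rewrite a0 oppr0 mul0r.
  have d0 : d.2 != 0 by apply: contra_neq a0 => /= ->; rewrite mulr0.
  pose G y := - Num.sg a.1 * F ((a.1 * P.1 + a.2 * P.2 - a.2 * y) / a.1, y).
  have GE t : G (P.2 + t * d.2) = - Num.sg a.1 * F (P + t *: d).
    rewrite /G; congr (_ * F _); apply: injective_projections => //=.
    by rewrite /GRing.scale/=; field; rewrite s0 d0.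
  have cG : continuous G.
    move=> y; apply: cvgM; first exact: cvg_cst.
    apply: (@continuous_comp _ _ _ (fun y => (_, y) : plane R) F); last exact: cF.
    apply: continuous_pair => t; last exact: cvg_id.
    apply: cvgM; last exact: cvg_cst.
    by apply: cvgB; [exact: cvg_cst|apply: cvgM; [exact: cvg_cst|exact: cvg_id]].
  rewrite -[LHS]/(\int[leb]_y G y) (@int_affine _ G P.2 d.2 d0 cG); last first.
    by move=> t nt; rewrite GE Fl// mulr0.
  have -> : \int[leb]_(t in `[0, 1]) G (P.2 + t * d.2) =
      \int[leb]_(t in `[0, 1]) (- Num.sg a.1 * F (P + t *: d)).
    by apply: eq_Rintegral => t _; exact: GE.
  rewrite iline mulrA; congr (_ * _).
  rewrite mulrC mulNr; congr (- _); rewrite /a/= sgM// sqrrN//.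
- have [a0|a0] := eqVneq a.2 0; first by rewrite a0 oppr0 mul0r.
  have d0 : d.1 != 0 by apply: contra_neq a0 => /= ->; rewrite mulr0.
  pose G y := - Num.sg a.2 * F (y, (a.1 * P.1 + a.2 * P.2 - a.1 * y) / a.2).
  have GE t : G (P.1 + t * d.1) = - Num.sg a.2 * F (P + t *: d).
    rewrite /G; congr (_ * F _); apply: injective_projections => //=.
    by rewrite /GRing.scale/=; field; rewrite s0 d0.
  have cG : continuous G.
    move=> y; apply: cvgM; first exact: cvg_cst.
    apply: (@continuous_comp _ _ _ (fun y => (y, _) : plane R) F); last exact: cF.
    apply: continuous_pair => t; first exact: cvg_id.
    apply: cvgM; last exact: cvg_cst.
    by apply: cvgB; [exact: cvg_cst|apply: cvgM; [exact: cvg_cst|exact: cvg_id]].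
  rewrite -[LHS]/(\int[leb]_y G y) (@int_affine _ G P.1 d.1 d0 cG); last first.
    by move=> t nt; rewrite GE Fl// mulr0.
  have -> : \int[leb]_(t in `[0, 1]) G (P.1 + t * d.1) =
      \int[leb]_(t in `[0, 1]) (- Num.sg a.2 * F (P + t *: d)).
    by apply: eq_Rintegral => t _; exact: GE.
  rewrite iline mulrA; congr (_ * _).
  by rewrite mulrC mulNr; congr (- _); rewrite /a/= sgM.
Qed.

Lemma area_line a (c : R) : a != 0 -> area [set x | a.1 * x.1 + a.2 * x.2 = c] = 0%E.
Proof.
move=> a0; have [a2|a2] := eqVneq a.2 0.
  have a1 : a.1 != 0 by apply: contra_neq a0 => a1; apply: injective_projections.
  have -> : [set x | a.1 * x.1 + a.2 * x.2 = c] = [set c / a.1] `*` setT.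
    apply/seteqP; split => x /=; rewrite a2 mul0r addr0.
      by move=> <-; split => //; rewrite mulrC mulKf.
    by move=> [-> _]; rewrite mulrC divfK.
  rewrite /area product_measure1E//.
  by rewrite [X in (X * _)%E](_ : _ = 0%E) ?mul0e//; exact: lebesgue_measure_set1.
rewrite /area /product_measure1; apply: integral0_eq => x _ /=.
rewrite (_ : xsection _ x = [set (c - a.1 * x) / a.2]); first exact: lebesgue_measure_set1.
apply/seteqP; split => y; rewrite /xsection/= inE/=.
  by move=> <-; rewrite addrC addKr mulrC mulKf.
by move=> ->; field.
Qed.

Lemma measurable_line a (c : R) : measurable [set x : plane R | a.1 * x.1 + a.2 * x.2 = c].
Proof.
rewrite (_ : [set x | _] = ~` ([set x | c < a.1 * x.1 + a.2 * x.2] `|`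
    [set x | - c < - a.1 * x.1 + - a.2 * x.2])).
  apply: measurableC; apply: measurableU; apply: open_measurable2; first exact: open_halfplane.
  exact: (@open_halfplane (- a.1, - a.2)).
apply/seteqP; split => x /=.
  by move=> <- [|]; rewrite ?ltxx// !mulNr -opprD ltxx.
rewrite !mulNr -opprD ltrN2 => /not_orP[] /negP; rewrite -leNgt => h1 /negP; rewrite -leNgt => h2.
by apply/le_anti; rewrite h1 h2.
Qed.

End HalfPlane.

(** * The fundamental lemma of the calculus of variations *)

Section Fundamental.
Context {R : realType}.
Implicit Types (x : plane R) (D A B : set (plane R)).
Local Notation P2 := (measurableTypeR R * measurableTypeR R)%type.

Definition l2 D (f : plane R -> R) := measurable_fun D f /\ itg D (fun x => f x ^+ 2).

Lemma itg_l2 D A f : measurable D -> measurable A -> bounded_set A -> A `<=` D ->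
  l2 D f -> itg A f.
Proof.
move=> mD mA bA AD [mf f2].
have i1 : itg A (fun=> 1 : R) by apply: itg_continuous => // z; exact: cvg_cst.
apply: (itg_le mA _ _ (itgD mA i1 (itgS mD mA AD f2))).
  exact: measurable_funS mf.
move=> x _; rewrite -[f x ^+ 2]real_normK ?num_real//.
by have := normr_ge0 (f x); nra.
Qed.

Lemma integral_eq0 D (f : plane R -> R) : measurable D -> itg D f ->
  \int[area]_(x in D) f x = 0 ->
  integral (area : set P2 -> \bar R) D (EFin \o f : P2 -> \bar R) = 0%E.
Proof.
move=> mD fi; rewrite /Rintegral => h.
by rewrite -[LHS](fineK (@integrable_fin_num _ P2 R area D mD _ fi)) [X in X%:E = _]h.
Qed.

Definition rect (a b c d : R) : set (plane R) := `]a, b[%classic `*` `]c, d[%classic.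

Definition rects : set (set (plane R)) := [set A | exists a b c d, A = rect a b c d].

Lemma rectI a b c d a' b' c' d' : rect a b c d `&` rect a' b' c' d' =
  rect (Num.max a a') (Num.min b b') (Num.max c c') (Num.min d d').
Proof.
apply/seteqP; split => x; rewrite /rect/= !in_itv/= ?gt_max ?lt_min.
  by move=> [[/andP[-> ->] /andP[-> ->]] [/andP[-> ->] /andP[-> ->]]].
by move=> [/andP[/andP[-> ->] /andP[-> ->]] /andP[/andP[-> ->] /andP[-> ->]]].
Qed.

Lemma setI_closed_rects : setI_closed rects.
Proof.
by move=> A B [a [b [c [d ->]]]] [a' [b' [c' [d' ->]]]]; rewrite rectI; do 4 eexists.
Qed.

Lemma box_rect x (r : R) : box x r = rect (x.1 - r) (x.1 + r) (x.2 - r) (x.2 + r).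
Proof. exact: box_setX. Qed.

Lemma nat_above (t : R) : exists n, `|t| < n%:R.
Proof. by exists (Num.truncn `|t|).+1; rewrite truncnS_gt. Qed.

(** The preimage of an interval by a coordinate is a countable union of
    rectangles. *)
Lemma measurable_rects : @measurable _ P2 = <<s rects >>.
Proof.
apply/seteqP; split; last first.
  apply: smallest_sub; first exact: sigma_algebra_measurable.
  by move=> A [a [b [c [d ->]]]]; apply: measurableX; exact: measurable_itv.
pose T' := g_sigma_algebraType rects.
have mr (a b c d : R) : measurable (rect a b c d : set T').
  by apply: sub_sigma_algebra; do 4 eexists.
have m1 : measurable_fun setT (fst : T' -> R).
  apply: (measurability _ (RGenOpens.measurableE R)).
  move=> _ [_ [a [b ->] <-]]; rewrite setTI.
  rewrite (_ : _ @^-1` _ = \bigcup_n rect a b (- n%:R) n%:R).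
    by apply: bigcup_measurable => n _; exact: mr.
  apply/seteqP; split => x /=; last by move=> [n _ []].
  have [n] := nat_above x.2; rewrite ltr_norml => h1 h2.
  by exists n => //; split; rewrite //= in_itv.
have m2 : measurable_fun setT (snd : T' -> R).
  apply: (measurability _ (RGenOpens.measurableE R)).
  move=> _ [_ [a [b ->] <-]]; rewrite setTI.
  rewrite (_ : _ @^-1` _ = \bigcup_n rect (- n%:R) n%:R a b).
    by apply: bigcup_measurable => n _; exact: mr.
  apply/seteqP; split => x /=; last by move=> [n _ []].
  have [n] := nat_above x.1; rewrite ltr_norml => h1 h2.
  by exists n => //; split; rewrite //= in_itv.
rewrite measurable_prod_measurableType; apply: smallest_sub; first exact: smallest_sigma_algebra.
move=> _ [A mA] [B mB] <-.
have h1 := m1 measurableT A mA; have h2 := m2 measurableT B mB.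
rewrite setTI in h1; rewrite setTI in h2.
exact: measurableI h1 h2.
Qed.

(** If psi is a bump that is positive exactly on the rectangle, the test
    functions 1 - (1 - psi)^n increase to its indicator, and dominated
    convergence applies. *)
Lemma int_rect0 D G x (r r' a b c d : R) : open D -> l2 D G -> r < r' -> box x r' `<=` D ->
  (forall phi, C1c D phi -> \int[area]_(x in D) (G x * phi x) = 0) ->
  rect a b c d `<=` box x r -> \int[area]_(x in rect a b c d) G x = 0.
Proof.
move=> oD lG rr BD G0 AB.
have mD := open_measurable2 oD.
have [ab|ba] := ltP a b; last first.
  rewrite (_ : rect _ _ _ _ = set0) ?Rintegral_set0//.
  by apply/seteqP; split => z // [/=]; rewrite in_itv/= => /andP[h1 h2]; have := lt_trans h1 h2; rewrite ltNge ba.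
have [cd|dc] := ltP c d; last first.
  rewrite (_ : rect _ _ _ _ = set0) ?Rintegral_set0//.
  by apply/seteqP; split => z // [/= _]; rewrite in_itv/= => /andP[h1 h2]; have := lt_trans h1 h2; rewrite ltNge dc.
set A := rect a b c d in AB *.
have mA : measurable A by apply: measurableX; exact: measurable_itv.
have AD : A `<=` D by move=> z /AB [z1 z2]; apply: BD; split; exact: lt_trans rr.
have bA : bounded_set A.
  have [M [MR hM]] := @box_bounded _ x r; exists M; split => // N /hM h z /AB; exact: h.
have iG := itg_l2 mD mA bA AD lG.
pose u1 (z : plane R) := ((b - a) / 2)^-1 * (z.1 - (a + b) / 2).
pose u2 (z : plane R) := ((d - c) / 2)^-1 * (z.2 - (c + d) / 2).
pose psi z := b01 (u1 z) * b01 (u2 z).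
have inA z : A z <-> `|u1 z| < 1 /\ `|u2 z| < 1.
  have e (s t q : R) : s < t -> (`|((t - s) / 2)^-1 * (q - (s + t) / 2)| < 1) = (s < q < t).
    move=> st; have st2 : 0 < (t - s) / 2 by rewrite divr_gt0 ?subr_gt0.
    rewrite normrM gtr0_norm ?invr_gt0// ltr_pdivrMl// mulr1 ltr_distl.
    by congr andb; congr (_ < _); field.
  by rewrite /u1 /u2 (e a b)// (e c d)// /A /rect/= !in_itv/=.
have psi01 z : 0 <= psi z <= 1.
  by rewrite mulr_ge0 ?b01_ge0// mulr_ile1 ?b01_ge0 ?b01_le1.
have psiA z : A z -> 0 < psi z by move=> /inA[h1 h2]; rewrite mulr_gt0// b01_gt0.
have psiN z : ~ A z -> psi z = 0.
  rewrite inA => /not_andP[] /negP; rewrite -leNgt => h.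
    by rewrite /psi b01_out// mul0r.
  by rewrite /psi (b01_out h) mulr0.
have Cpsi : exists g, C1d psi g.
  eexists; apply: C1dM; apply: C1d_b01; apply: C1dZ; apply: C1dB.
  - exact: C1d_fst. - exact: C1d_cst. - exact: C1d_snd. - exact: C1d_cst.
have [g Cg] := Cpsi.
pose phi n z := 1 - (1 - psi z) ^+ n.
have Cphi n := C1dB (C1d_cst 1) (C1dX n (C1dB (C1d_cst 1) Cg)).
have phiN n z : ~ A z -> phi n.+1 z = 0.
  by move=> nA; rewrite /phi psiN// subr0 expr1n subrr.
have phic n : C1c D (phi n.+1).
  by apply: (C1c_box (Cphi n.+1) rr _ BD) => z nB; apply: phiN => /AB.
have int0 n : \int[area]_(z in A) (G z * phi n.+1 z) = 0.
  rewrite -(G0 _ (phic n)); apply/esym/I_supp => // z _ nA.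
  by rewrite phiN// mulr0.
have phi1 n z : `|phi n z| <= 1.
  have /andP[p0 p1] := psi01 z.
  have q0 : 0 <= (1 - psi z) ^+ n by rewrite exprn_ge0// subr_ge0.
  have q1 : (1 - psi z) ^+ n <= 1 by rewrite exprn_ile1// ?subr_ge0// gerBl.
  by rewrite /phi ger0_norm ?subr_ge0// gerBl.
have mphi n : measurable_fun A (fun z => G z * phi n.+1 z).
  apply: measurable_funM; first exact: itg_mf iG.
  by apply: continuous_measurable2 => //; exact: C1d_continuous (Cphi n.+1).
have iphi n : itg A (fun z => G z * phi n.+1 z).
  apply: (itg_le mA (mphi n) (g := fun z => `|G z|)).
    by move=> z _; rewrite normrM ler_piMr.
  exact: (@integrable_norm _ P2 R area A G iG).
have [| |_ _ H] := @dominated_convergence _ P2 R area A mA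
  (fun n z => (G z * phi n.+1 z)%:E) (fun z => (G z)%:E) (fun z => `|G z|%:E)
  (fun n => proj2 (measurable_EFinP _ _) (mphi n)) (measurable_int _ iG) _
  (@integrable_norm _ P2 R area A G iG) _.
- apply: aeW => z Az; apply: cvg_EFin; first exact: nearW.
  rewrite -[X in _ --> X]mulr1; apply: cvgM; first exact: cvg_cst.
  rewrite -[X in _ --> X](subr0 1); apply: cvgB; first exact: cvg_cst.
  have /andP[p0 p1] := psi01 z; have pz := psiA z Az.
  have h : (1 - psi z) ^+ n @[n --> \oo] --> 0.
    by apply: cvg_expr; rewrite ger0_norm ?subr_ge0// gtrBl.
  by move: h; rewrite -(cvg_shiftS (fun n => (1 - psi z) ^+ n)).
- by apply: aeW => z n _; rewrite abse_EFin lee_fin normrM ler_piMr.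
have z0 : (fun n => integral (area : set P2 -> \bar R) A (fun z : P2 => (G z * phi n.+1 z)%:E)) = fun=> 0%E.
  apply/funext => n; exact: integral_eq0 (iphi n) (int0 n).
suff h : integral (area : set P2 -> \bar R) A (fun z : P2 => (G z)%:E) = 0%E.
  by rewrite /Rintegral [X in fine X]h.
move: H; rewrite [mk_sequence _]z0 => H.
by apply/esym; apply: (cvg_unique _ _ H) => //; exact: cvg_cst.
Qed.

(** Near a point of D, the sets on which G integrates to zero form a Dynkin
    system containing the rectangles ([int_rect0]), so G vanishes almost
    everywhere there. Countably many rational boxes cover D. *)
Lemma fundamental D G : open D -> l2 D G ->
  (forall phi, C1c D phi -> \int[area]_(x in D) (G x * phi x) = 0) ->
  exists Z, [/\ measurable Z, area Z = 0%E & forall x, D x -> ~ Z x -> G x = 0].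
Proof.
move=> oD lG G0; have mD := open_measurable2 oD.
have loc x (r r' : R) : 0 < r -> r < r' -> box x r' `<=` D ->
    (area : set P2 -> \bar R).-negligible ([set z | box x r z /\ G z <> 0] : set P2).
  move=> r0 rr BD; set B := box x r.
  have mB : measurable B := measurable_box x r.
  have bB : bounded_set B := @box_bounded _ x r.
  have BD' : B `<=` D by move=> z [z1 z2]; apply: BD; split; exact: lt_trans rr.
  have iG := itg_l2 mD mB bB BD' lG.
  have R0 a b c d : rect a b c d `<=` B -> \int[area]_(z in rect a b c d) G z = 0.
    exact: int_rect0 oD lG rr BD G0.
  have BE : B = rect (x.1 - r) (x.1 + r) (x.2 - r) (x.2 + r) := box_rect x r.
  have all0 (S : set P2) : measurable S -> \int[area]_(z in S `&` B) G z = 0.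
    have mSB (S' : set P2) : measurable S' -> measurable (S' `&` B) by move=> mS'; exact: measurableI.
    have iS (S' : set P2) : measurable S' -> itg (S' `&` B) G.
      by move=> mS'; apply: itgS iG => //; exact: mSB.
    rewrite measurable_rects.
    apply: (@dynkin_induction _ P2 rects (fun S => \int[area]_(z in S `&` B) G z = 0)).
    - exact: measurable_rects.
    - exact: setI_closed_rects.
    - by rewrite setTI BE R0// -BE.
    - move=> _ [a [b [c [d ->]]]]; rewrite BE rectI; apply: R0.
      by rewrite -rectI -BE; exact: subIsetr.
    - move=> S' mS' S0.
      have := @I_setU R (S' `&` B) (~` S' `&` B) G (mSB _ mS') (mSB _ (measurableC mS')).
      rewrite -setIUl setUv setTI S0 add0r => <- //.
      + by rewrite BE R0// -BE.
      + by rewrite setIACA setICr set0I.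
    - move=> F mF tF F0.
      rewrite setI_bigcupl /Rintegral (@integral_bigcup _ P2 R area).
      + rewrite eseries0// => n _ _.
        exact: (integral_eq0 (mSB _ (mF n)) (iS _ (mF n)) (F0 n)).
      + by apply/trivIsetP => i j _ _ ij; rewrite setIACA (proj1 trivIsetP tF _ _ I I ij) set0I.
      + by move=> n; exact: mSB.
      + by rewrite -setI_bigcupl; apply: iS; exact: bigcup_measurable.
  have H := @integral_ae_eq _ P2 R area B mB (cst 0%E) (EFin \o G) iG (measurable_cst _).
  have : ae_eq area B (EFin \o G) (cst 0%E : P2 -> \bar R).
    apply: H => S SB mS; rewrite integral0.
    apply: (integral_eq0 mS (itgS mB mS SB iG)).
    by have := all0 S mS; rewrite setIidl.
  rewrite /ae_eq/=; apply: negligibleS => z [Bz Gz] /= /(_ Bz)[] h.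
  by apply: Gz; exact: h.
pose B (q : rat * rat * rat) := box (ratr q.1.1 : R, ratr q.1.2 : R) (ratr q.2).
pose ok (q : rat * rat * rat) := (0 < q.2) /\
  box (ratr q.1.1 : R, ratr q.1.2 : R) (2 * ratr q.2) `<=` D.
pose F (n : nat) : set P2 := if unpickle n is Some q then
  (if `[< ok q >] then [set z | B q z /\ G z <> 0] else set0) else set0.
have FE q : F (pickle q) = if `[< ok q >] then [set z | B q z /\ G z <> 0] else set0.
  by rewrite /F pickleK.
have : (area : set P2 -> \bar R).-negligible (\bigcup_n F n).
  apply: (@negligible_bigcup _ P2 R area F) => n; rewrite /F; case: unpickle => [q|]; last exact: negligible_set0.
  case: ifPn => [/asboolP[q0 qD]|_]; last exact: negligible_set0.
  apply: (loc _ _ _ _ _ qD); first by rewrite ltr0q.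
  by rewrite ltr_pMl ?ltr1n// ltr0q.
move=> [Z [mZ Z0 FZ]]; exists Z; split => // x Dx nZ.
apply: contrapT => Gx; apply: nZ; apply: FZ.
have [r r0 rD] := (open_boxP D).1 oD x Dx.
have r8 : 0 < r / 8 by rewrite divr_gt0.
have rat_near (a e : R) : 0 < e -> exists q : rat, `|ratr q - a| < e.
  move=> e0; have [q] := rat_in_itvoo (ltr_pwDr e0 (lexx a)).
  rewrite in_itv/= => /andP[q1 q2]; exists q.
  by rewrite ger0_norm ?subr_ge0 ?(ltW q1)// ltrBlDl.
have [a ha] := rat_near x.1 _ r8; have [b hb] := rat_near x.2 _ r8.
have [c hc] := rat_near (r / 4) _ r8.
have /andP[c1 c2] : r / 8 < ratr c < 3 * (r / 8).
  by move: hc; rewrite ltr_distl => /andP[h1 h2]; apply/andP; split; lra.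
exists (pickle (a, b, c)); first by [].
have okq : ok (a, b, c).
  split; first by rewrite -(ltr0q R); exact: lt_trans c1.
  move=> z [/= z1 z2]; apply: rD; split.
    by have := ler_normD (z.1 - ratr a) (ratr a - x.1); rewrite addrA subrK; lra.
  by have := ler_normD (z.2 - ratr b) (ratr b - x.2); rewrite addrA subrK; lra.
rewrite FE ifT; last exact/asboolP.
by split => //; split; rewrite distrC /=; apply: lt_trans c1.
Qed.

End Fundamental.

(** * Square-integrable fields and weak gradients *)

Section L2Algebra.
Context {R : realType}.
Implicit Types (D : set (plane R)) (f g : plane R -> R).
Local Notation P2 := (measurableTypeR R * measurableTypeR R)%type.

Lemma itg_l2M D f g : measurable D -> l2 D f -> l2 D g -> itg D (fun x => f x * g x).
Proof.
move=> mD [mf f2] [mg g2]; apply: (itg_le mD _ _ (itgD mD f2 g2)).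
  exact: measurable_funM.
move=> x _; rewrite normrM -[f x ^+ 2]real_normK ?num_real// -[g x ^+ 2]real_normK ?num_real//.
by have := sqr_ge0 (`|f x| - `|g x|); have := sqr_ge0 (`|f x| + `|g x|); nra.
Qed.

Lemma l2D D f g : measurable D -> l2 D f -> l2 D g -> l2 D (fun x => f x + g x).
Proof.
move=> mD lf lg; have fg := itg_l2M mD lf lg; case: lf lg => [mf f2] [mg g2]; split.
  exact: measurable_funD.
apply: (eq_itg mD _ (itgD mD (itgD mD f2 g2) (itgZ 2 mD fg))) => x _; ring.
Qed.

Lemma l2Z D (c : R) f : measurable D -> l2 D f -> l2 D (fun x => c * f x).
Proof.
move=> mD [mf f2]; split; first exact: measurable_funM.
apply: (eq_itg mD _ (itgZ (c ^+ 2) mD f2)) => x _; ring.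
Qed.

Lemma eq_l2 D f g : measurable D -> (forall x, D x -> f x = g x) -> l2 D f -> l2 D g.
Proof.
move=> mD fg [mf f2]; split.
  by apply: (eq_measurable_fun f) mf => x /set_mem; exact: fg.
by apply: (eq_itg mD _ f2) => x Dx; rewrite fg.
Qed.

Lemma l2N D f : measurable D -> l2 D f -> l2 D (fun x => - f x).
Proof. by move=> mD lf; apply: (eq_l2 mD _ (l2Z (-1) mD lf)) => x _; rewrite mulN1r. Qed.

Lemma l2B D f g : measurable D -> l2 D f -> l2 D g -> l2 D (fun x => f x - g x).
Proof. by move=> mD lf lg; apply: l2D => //; exact: l2N. Qed.

Lemma l2_cont D f : measurable D -> bounded_set D -> continuous f -> l2 D f.
Proof.
move=> mD bD cf; split; first exact: continuous_measurable2.
by apply: itg_continuous => // x; apply: cvgM; exact: cf.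
Qed.

Lemma l2_0 D : measurable D -> l2 D (fun=> 0 : R).
Proof.
by move=> mD; split => //; apply: (eq_itg mD _ (itg0 mD)) => x _; rewrite expr0n.
Qed.

Lemma l2S D (A : set (plane R)) f : measurable D -> measurable A -> A `<=` D -> l2 D f -> l2 A f.
Proof.
move=> mD mA AD [mf f2]; split; first exact: measurable_funS mf.
exact: itgS f2.
Qed.

Lemma L2P m n D (F : plane R -> 'M[R]_(m, n)) : measurable D ->
  L2 D F <-> forall i j, l2 D (fun x => F x i j).
Proof.
by move=> mD; split => h i j; have [mf f2] := h i j; split => //;
  move: f2; rewrite (itgE (fun x => F x i j ^+ 2) mD).
Qed.

Lemma L2D m n D (F G : plane R -> 'M[R]_(m, n)) : measurable D -> L2 D F -> L2 D G ->
  L2 D (fun x => F x + G x).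
Proof.
move=> mD /(L2P _ mD) lF /(L2P _ mD) lG; apply/(L2P _ mD) => i j.
by apply: (eq_l2 mD _ (l2D mD (lF i j) (lG i j))) => x _; rewrite mxE.
Qed.

Lemma L2Z m n D c (F : plane R -> 'M[R]_(m, n)) : measurable D -> L2 D F ->
  L2 D (fun x => c *: F x).
Proof.
move=> mD /(L2P _ mD) lF; apply/(L2P _ mD) => i j.
by apply: (eq_l2 mD _ (l2Z c mD (lF i j))) => x _; rewrite mxE.
Qed.

Lemma L2B m n D (F G : plane R -> 'M[R]_(m, n)) : measurable D -> L2 D F -> L2 D G ->
  L2 D (fun x => F x - G x).
Proof.
move=> mD lF lG; have := L2D mD lF (L2Z (-1) mD lG).
by under eq_fun do rewrite scaleN1r.
Qed.

Lemma L2S m n D (A : set (plane R)) (F : plane R -> 'M[R]_(m, n)) : measurable D ->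
  measurable A -> A `<=` D -> L2 D F -> L2 A F.
Proof. by move=> mD mA AD /(L2P _ mD) lF; apply/(L2P _ mA) => i j; exact: l2S (lF i j). Qed.

Lemma L2_cont m n D (F : plane R -> 'M[R]_(m, n)) : measurable D -> bounded_set D ->
  (forall i j, continuous (fun x => F x i j)) -> L2 D F.
Proof. by move=> mD bD cF; apply/(L2P _ mD) => i j; exact: l2_cont. Qed.

Lemma itg_frob m n D (F G : plane R -> 'M[R]_(m, n)) : measurable D ->
  L2 D F -> L2 D G -> itg D (fun x => frob (F x) (G x)).
Proof.
move=> mD /(L2P _ mD) lF /(L2P _ mD) lG.
by apply: itg_sum => // i; apply: itg_sum => // j; exact: itg_l2M.
Qed.

Lemma frobC m n (A B : 'M[R]_(m, n)) : frob A B = frob B A.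
Proof. by apply: eq_bigr => i _; apply: eq_bigr => j _; rewrite mulrC. Qed.

Lemma frobDl m n (A B C : 'M[R]_(m, n)) : frob (A + B) C = frob A C + frob B C.
Proof.
rewrite /frob -big_split; apply: eq_bigr => i _; rewrite -big_split.
by apply: eq_bigr => j _; rewrite mxE mulrDl.
Qed.

Lemma frobZl m n (c : R) (A C : 'M[R]_(m, n)) : frob (c *: A) C = c * frob A C.
Proof.
rewrite /frob mulr_sumr; apply: eq_bigr => i _; rewrite mulr_sumr.
by apply: eq_bigr => j _; rewrite mxE mulrA.
Qed.

Lemma frobDr m n (A B C : 'M[R]_(m, n)) : frob C (A + B) = frob C A + frob C B.
Proof. by rewrite frobC frobDl !(frobC C). Qed.

Lemma frobZr m n (c : R) (A C : 'M[R]_(m, n)) : frob C (c *: A) = c * frob C A.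
Proof. by rewrite frobC frobZl frobC. Qed.

Lemma frobNl m n (A C : 'M[R]_(m, n)) : frob (- A) C = - frob A C.
Proof. by rewrite -scaleN1r frobZl mulN1r. Qed.

Lemma frobNr m n (A C : 'M[R]_(m, n)) : frob C (- A) = - frob C A.
Proof. by rewrite -scaleN1r frobZr mulN1r. Qed.

Lemma frobBl m n (A B C : 'M[R]_(m, n)) : frob (A - B) C = frob A C - frob B C.
Proof. by rewrite frobDl frobNl. Qed.

Lemma frobBr m n (A B C : 'M[R]_(m, n)) : frob C (A - B) = frob C A - frob C B.
Proof. by rewrite frobDr frobNr. Qed.

Lemma frob_ge0 m n (A : 'M[R]_(m, n)) : 0 <= frob A A.
Proof. by apply: sumr_ge0 => i _; apply: sumr_ge0 => j _; rewrite -expr2 sqr_ge0. Qed.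

Lemma frob_eq0 m n (A : 'M[R]_(m, n)) : frob A A = 0 -> A = 0.
Proof.
move=> /eqP; rewrite psumr_eq0 => [/allP h|i _]; last first.
  by apply: sumr_ge0 => j _; rewrite -expr2 sqr_ge0.
apply/matrixP => i j; rewrite mxE; have := h i (mem_index_enum _).
rewrite /= psumr_eq0 => [/allP h'|j' _]; last by rewrite -expr2 sqr_ge0.
by have := h' j (mem_index_enum _); rewrite /= -expr2 sqrf_eq0 => /eqP.
Qed.

Lemma frob_young m n (t : R) (A B : 'M[R]_(m, n)) : 0 < t ->
  2 * frob A B <= t * frob A A + t^-1 * frob B B.
Proof.
move=> t0; have := frob_ge0 (t *: A - B).
rewrite !(frobBl, frobBr, frobZl, frobZr) (frobC B A) => h.
rewrite -subr_ge0 -(pmulr_rge0 _ t0); apply: le_trans h _.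
by rewrite le_eqVlt; apply/orP; left; apply/eqP; field; rewrite gt_eqF.
Qed.

Lemma frob_sqD m n (A B : 'M[R]_(m, n)) :
  frob (A + B) (A + B) <= 2 * frob A A + 2 * frob B B.
Proof.
have := frob_ge0 (A - B); rewrite !(frobBl, frobBr, frobDl, frobDr) (frobC B A); lra.
Qed.

Lemma frob_sqC m n (A B : 'M[R]_(m, n)) : frob (A - B) (A - B) = frob (B - A) (B - A).
Proof. by rewrite -opprB frobNl frobNr opprK. Qed.

End L2Algebra.

Section Weak.
Context {R : realType}.
Implicit Types (D E : set (plane R)) (u v : vfield R) (G H : plane R -> 'M[R]_2).

(** Test functions and their partial derivatives are of this kind. *)
Definition ccs D (phi : plane R -> R) :=
  continuous phi /\ exists2 K, compact K & K `<=` D /\ forall x, ~ K x -> phi x = 0.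

Lemma C1c_ccs D phi : C1c D phi -> ccs D phi.
Proof. by move=> [/C1P[g Cg] hK]; split => //; exact: C1d_continuous Cg. Qed.

Lemma C1c_partial D phi j : C1c D phi -> ccs D (partial j phi).
Proof.
move=> [C1 [K cK [KD K0]]]; split; first by have [_] := C1 j.
exists K => //; split => // x nK.
exact: (partial_out _ (closed_plane cK) K0 nK).
Qed.

Lemma compact_meas (K : set (plane R)) : compact K -> measurable K.
Proof.
move=> /closed_plane/closed_openC/open_measurable2 h.
by rewrite -[K]setCK; exact: measurableC.
Qed.

Lemma itg_ccs D f phi : measurable D -> l2 D f -> ccs D phi -> itg D (fun x => f x * phi x).
Proof.
move=> mD lf [cphi [K cK [KD K0]]].
have mK := compact_meas cK; have bK := compact_bounded cK.
apply: (itg_supp mD mK KD) => [x _ nK|]; first by rewrite K0 ?mulr0.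
apply: itg_l2M => //; first exact: l2S lf.
exact: l2_cont.
Qed.

Lemma ccs_box D phi : ccs D phi -> exists M, forall x, ~ box (0, 0) M x -> phi x = 0.
Proof.
move=> [_ [K /compact_bounded/bounded_sub_box[M _ KM] [_ K0]]].
by exists M => x nB; apply: K0 => /KM.
Qed.

Lemma aeq_entries m n D (F G : plane R -> 'M[R]_(m, n)) :
  (forall i j, exists Z, [/\ measurable Z, area Z = 0%E &
     forall x, D x -> ~ Z x -> F x i j = G x i j]) -> aeq D F G.
Proof.
move=> h; have /choice[Z hZ] : forall p : 'I_m * 'I_n, exists Z, [/\ measurable Z, area Z = 0%E &
     forall x, D x -> ~ Z x -> F x p.1 p.2 = G x p.1 p.2] by move=> [i j]; exact: h.
exists (\big[setU/set0]_(p : 'I_m * 'I_n) Z p).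
have [m0 a0] : measurable (\big[setU/set0]_(p : 'I_m * 'I_n) Z p) /\
    area (\big[setU/set0]_(p : 'I_m * 'I_n) Z p) = 0%E.
  elim/big_ind: _ => [|A B [mA A0] [mB B0]|p _].
  - by split => //; exact: measure0.
  - by split; [exact: measurableU|exact: area0U].
  - by have [] := hZ p.
split => // x Dx nZ; apply/matrixP => i j.
have [_ _] := hZ (i, j); apply => // Zx; apply: nZ.
by rewrite (bigD1 (i, j))//=; left.
Qed.

(** Apply [fundamental] to the entries of the difference. *)
Lemma wjac_unique D u G H : open D -> is_wjac D u G -> is_wjac D u H -> aeq D G H.
Proof.
move=> oD [lG hG] [lH hH]; have mD := open_measurable2 oD.
move/(L2P _ mD) : lG => lG; move/(L2P _ mD) : lH => lH.
apply: aeq_entries => i j.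
have [|Z [mZ Z0 hZ]] := fundamental oD (l2B mD (lG i j) (lH i j)); last first.
  by exists Z; split => // x Dx nZ; apply/eqP; rewrite -subr_eq0; apply/eqP; exact: hZ.
move=> phi Cphi; have cphi := C1c_ccs Cphi.
rewrite (_ : (fun x => _) = (fun x => G x i j * phi x - H x i j * phi x)); last first.
  by apply/funext => x; rewrite mulrBl.
rewrite I_B//; [|exact: itg_ccs|exact: itg_ccs].
have := hG i j phi Cphi; rewrite (hH i j phi Cphi) => /oppr_inj ->.
by rewrite subrr.
Qed.

Lemma wjacP D u : H1 D u -> is_wjac D u (wjac D u).
Proof. by move=> [_ h]; exact: xgetPex h. Qed.

Lemma wjac_aeq D u G : open D -> is_wjac D u G -> aeq D (wjac D u) G.
Proof.
move=> oD h; apply: (wjac_unique oD (u := u)) => //.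
by apply: xgetPex; exists G.
Qed.

Lemma is_wjacD D u v G H : open D -> L2 D u -> L2 D v -> is_wjac D u G -> is_wjac D v H ->
  is_wjac D (fun x => u x + v x) (fun x => G x + H x).
Proof.
move=> oD lu lv [lG hG] [lH hH]; have mD := open_measurable2 oD.
split => [|i j phi Cphi]; first exact: L2D.
move/(L2P _ mD) : lG => lG; move/(L2P _ mD) : lH => lH.
move/(L2P _ mD) : lu => lu; move/(L2P _ mD) : lv => lv.
have c0 := C1c_ccs Cphi; have c1 := C1c_partial j Cphi.
rewrite (I_eq (g := fun x => u x i ord0 * partial j phi x + v x i ord0 * partial j phi x)); last first.
  by move=> x _; rewrite mxE mulrDl.
rewrite [in RHS](I_eq (g := fun x => G x i j * phi x + H x i j * phi x)); last first.
  by move=> x _; rewrite mxE mulrDl.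
rewrite !I_D//; try exact: itg_ccs.
by rewrite hG// hH// opprD.
Qed.

Lemma is_wjacZ D c u G : open D -> L2 D u -> is_wjac D u G ->
  is_wjac D (fun x => c *: u x) (fun x => c *: G x).
Proof.
move=> oD lu [lG hG]; have mD := open_measurable2 oD.
split => [|i j phi Cphi]; first exact: L2Z.
move/(L2P _ mD) : lG => lG; move/(L2P _ mD) : lu => lu.
have c0 := C1c_ccs Cphi; have c1 := C1c_partial j Cphi.
rewrite (I_eq (g := fun x => c * (u x i ord0 * partial j phi x))); last first.
  by move=> x _; rewrite mxE mulrA.
rewrite [in RHS](I_eq (g := fun x => c * (G x i j * phi x))); last first.
  by move=> x _; rewrite mxE mulrA.
rewrite !I_Z//; try exact: itg_ccs.
by rewrite hG// mulrN.
Qed.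

Lemma is_wjacB D u v G H : open D -> L2 D u -> L2 D v -> is_wjac D u G -> is_wjac D v H ->
  is_wjac D (fun x => u x - v x) (fun x => G x - H x).
Proof.
move=> oD lu lv hu hv; have mD := open_measurable2 oD.
have := is_wjacD oD lu (L2Z (-1) mD lv) hu (is_wjacZ (-1) oD lv hv).
by under eq_fun do rewrite scaleN1r; under [X in is_wjac _ _ X]eq_fun do rewrite scaleN1r.
Qed.

Lemma H1B D u v : open D -> H1 D u -> H1 D v -> H1 D (fun x => u x - v x).
Proof.
move=> oD [lu [G hG]] [lv [H hH]]; have mD := open_measurable2 oD; split; first exact: L2B.
by eexists; apply: is_wjacB hG hH.
Qed.

Lemma H1D D u v : open D -> H1 D u -> H1 D v -> H1 D (fun x => u x + v x).
Proof.
move=> oD [lu [G hG]] [lv [H hH]]; have mD := open_measurable2 oD; split; first exact: L2D.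
by eexists; apply: is_wjacD hG hH.
Qed.

Lemma is_wjacS D E u G : open D -> open E -> E `<=` D -> is_wjac D u G -> is_wjac E u G.
Proof.
move=> oD oE ED [lG hG].
have mD := open_measurable2 oD; have mE := open_measurable2 oE.
split => [|i j phi [C1 [K cK [KE K0]]]]; first exact: L2S lG.
have Cphi : C1c D phi by split => //; exists K => //; split => //; exact: subset_trans ED.
have p0 x : D x -> ~ E x -> partial j phi x = 0.
  move=> _ nE; apply: (partial_out _ (closed_plane cK) K0) => /KE; exact: nE.
have := hG i j phi Cphi.
rewrite (I_supp (A := E))//; last by move=> x Dx nE; rewrite p0 ?mulr0.
move=> ->; congr (- _); apply: I_supp => // x _ nE.
by rewrite K0 ?mulr0// => /KE.
Qed.

Lemma H1S D E u : open D -> open E -> E `<=` D -> H1 D u -> H1 E u.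
Proof.
move=> oD oE ED [lu [G hG]]; split; last by exists G; exact: is_wjacS hG.
by apply: L2S lu => //; exact: open_measurable2.
Qed.

Lemma wjacS D E u : open D -> open E -> E `<=` D -> H1 D u -> aeq E (wjac E u) (wjac D u).
Proof. by move=> oD oE ED hu; apply: wjac_aeq => //; exact: is_wjacS (wjacP hu). Qed.

Lemma C1_continuous (f : plane R -> R) : C1 f -> continuous f.
Proof. by move=> /C1P[g]; exact: C1d_continuous. Qed.

Lemma itg_cont_ccs D (f psi : plane R -> R) : measurable D -> continuous f -> ccs D psi ->
  itg D (fun x => f x * psi x).
Proof.
move=> mD cf [cpsi [K cK [KD K0]]]; have mK := compact_meas cK.
apply: (itg_supp mD mK KD) => [x _ nK|]; first by rewrite K0 ?mulr0.
apply: itg_continuous => //; first exact: compact_bounded.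
by move=> x; apply: cvgM; [exact: cf|exact: cpsi].
Qed.

Lemma ccs_out D psi : ccs D psi -> forall x, ~ D x -> psi x = 0.
Proof. by move=> [_ [K _ [KD K0]]] x nD; apply: K0 => /KD. Qed.

(** The product has compact support, so its partial derivatives have zero
    integral over the plane. *)
Lemma int_by_parts D (f phi : plane R -> R) j : measurable D -> C1 f -> C1c D phi ->
  \int[area]_(x in D) (f x * partial j phi x) =
  - \int[area]_(x in D) (partial j f x * phi x).
Proof.
move=> mD Cf Cphi.
have [g Cg] := (C1P _).1 Cf; have [h Ch] := (C1P _).1 Cphi.1.
have cc := C1c_ccs Cphi; have cp := C1c_partial j Cphi; have [M hM] := ccs_box cc.
have CF := C1dM Cg Ch.
have := @int_plane0 _ _ _ M j CF; rewrite -(partialE j Cg.1) -(partialE j Ch.1) => F0.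
have cdf : continuous (partial j f) by have [_] := Cf j.
apply/eqP; rewrite -addr_eq0; apply/eqP.
rewrite -I_D//; [|exact: itg_cont_ccs (C1_continuous Cf) cp|exact: itg_cont_ccs cdf cc].
rewrite -[RHS]F0; last by move=> x /hM ->; rewrite mulr0.
rewrite (I_supp (D := setT) (A := D))//.
  by apply: I_eq => x _; rewrite [X in _ + X]mulrC.
by move=> x _ nD; rewrite (ccs_out cc nD) (ccs_out cp nD) mulr0 mul0r addr0.
Qed.

Lemma C1_L2 D u : measurable D -> bounded_set D -> C1_field u -> L2 D u.
Proof.
move=> mD bD Cu; apply: L2_cont => // i j; rewrite (ord1 j); exact: C1_continuous.
Qed.

Lemma jac_L2 D u : measurable D -> bounded_set D -> C1_field u -> L2 D (jac u).
Proof.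
move=> mD bD Cu; apply: L2_cont => // i j; have [_] := Cu i j.
by rewrite (_ : (fun x => jac u x i j) = partial j (fun y => u y i ord0))//; apply/funext => x; rewrite mxE.
Qed.

Lemma C1_is_wjac D u : open D -> bounded_set D -> C1_field u -> is_wjac D u (jac u).
Proof.
move=> oD bD Cu; have mD := open_measurable2 oD; split; first exact: jac_L2.
move=> i j phi Cphi; rewrite (int_by_parts j mD (Cu i) Cphi); congr (- _).
by apply: I_eq => x _; rewrite mxE.
Qed.

Lemma C1_H1 D u : open D -> bounded_set D -> C1_field u -> H1 D u.
Proof.
move=> oD bD Cu; have mD := open_measurable2 oD; split; first exact: C1_L2.
by exists (jac u); exact: C1_is_wjac.
Qed.

Lemma wjac_L2 D u : H1 D u -> L2 D (wjac D u).
Proof. by move=> /wjacP[]. Qed.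

(** The definition of the seminorm selects a weak gradient; any other one
    gives the same integral. *)
Lemma semi1E D u G : open D -> is_wjac D u G ->
  semi1sq D u = \int[area]_(x in D) frob (G x) (G x).
Proof.
move=> oD hG; have mD := open_measurable2 oD.
have lG := hG.1; have hu : is_wjac D u (wjac D u) by apply: xgetPex; exists G.
have lw := hu.1.
by apply: I_aeq_frob => //; [exact: itg_frob|exact: itg_frob|exact: wjac_aeq|exact: wjac_aeq].
Qed.

End Weak.

(** * Algebra of the elasticity tensor *)

Section Elastic.
Context {R : realType}.
Variables (mu lam : R).
Implicit Types (A B : 'M[R]_2).

Lemma sum2 (F : 'I_2 -> R) : \sum_i F i = F ord0 + F ord_max.
Proof. by rewrite big_ord_recl big_ord1; congr (_ + F _); exact: val_inj. Qed.

Lemma ord2P (i : 'I_2) : i = ord0 \/ i = ord_max.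
Proof. by case: i => [[|[|//]] ?]; [left|right]; exact: val_inj. Qed.

Lemma frob2 A B : frob A B = A ord0 ord0 * B ord0 ord0 + A ord0 ord_max * B ord0 ord_max +
  (A ord_max ord0 * B ord_max ord0 + A ord_max ord_max * B ord_max ord_max).
Proof. by rewrite /frob !sum2. Qed.

Lemma frobv (a b : 'cV[R]_2) : frob a b = a ord0 ord0 * b ord0 ord0 + a ord_max ord0 * b ord_max ord0.
Proof. by rewrite /frob sum2 !big_ord1. Qed.

Lemma symD A B : sym (A + B) = sym A + sym B.
Proof. by apply/matrixP => i j; rewrite /sym !mxE; ring. Qed.

Lemma symZ (c : R) A : sym (c *: A) = c *: sym A.
Proof. by apply/matrixP => i j; rewrite /sym !mxE; ring. Qed.

Lemma symB A B : sym (A - B) = sym A - sym B.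
Proof. by rewrite -scaleN1r symD symZ scaleN1r. Qed.

Lemma mxtr2 A : \tr A = A ord0 ord0 + A ord_max ord_max.
Proof. exact: sum2. Qed.

Lemma stiffD A B : stiff mu lam (A + B) = stiff mu lam A + stiff mu lam B.
Proof. apply/matrixP => i j; rewrite /stiff !mxE !mxtr2 !mxE.
by case: (i == j); rewrite ?mulr1n ?mulr0n; ring. Qed.

Lemma stiffZ (c : R) A : stiff mu lam (c *: A) = c *: stiff mu lam A.
Proof.
apply/matrixP => i j; rewrite /stiff !mxE !mxtr2 !mxE.
by case: (i == j); rewrite ?mulr1n ?mulr0n; ring.
Qed.

Lemma stiffB A B : stiff mu lam (A - B) = stiff mu lam A - stiff mu lam B.
Proof. by rewrite -scaleN1r stiffD stiffZ scaleN1r. Qed.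

Lemma stiff_sym_frob A B : frob (stiff mu lam (sym A)) (sym B) = frob (stiff mu lam (sym A)) B.
Proof. by rewrite !frob2 /stiff /sym !mxE !mxtr2 !mxE /=; field. Qed.

Lemma stiff_frobC A B : frob (stiff mu lam A) B = frob A (stiff mu lam B).
Proof. by rewrite !frob2 /stiff !mxE !mxtr2 /=; ring. Qed.

(** A bound for the squared norm of A |-> stiff (sym A), positive whatever
    the coefficients are. *)
Definition stiffK := 8 * (mu ^+ 2 + lam ^+ 2) + 1.

Lemma stiffK_gt0 : 0 < stiffK.
Proof. by rewrite /stiffK; have := sqr_ge0 mu; have := sqr_ge0 lam; lra. Qed.

Lemma stiff_sym_bound A :
  frob (stiff mu lam (sym A)) (stiff mu lam (sym A)) <= stiffK * frob A A.
Proof.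
rewrite !frob2 /stiff /sym !mxE !mxtr2 !mxE /= /stiffK.
set a := A ord0 ord0; set b := A ord0 ord_max; set c := A ord_max ord0; set d := A ord_max ord_max.
have h1 := sqr_ge0 (2 * mu * a - lam * (a + d)).
have h2 := sqr_ge0 (2 * mu * d - lam * (a + d)).
have h3 := sqr_ge0 (lam * (a - d)); have h4 := sqr_ge0 (mu * (b - c)).
have h5 := sqr_ge0 (mu * b); have h6 := sqr_ge0 (mu * c).
have h7 := sqr_ge0 (lam * b); have h8 := sqr_ge0 (lam * c).
have h9 := sqr_ge0 a; have h10 := sqr_ge0 b; have h11 := sqr_ge0 c; have h12 := sqr_ge0 d.
rewrite ?mulr1n ?mulr0n ?addr0.
have half (z : R) : 2^-1 * (z + z) = z by field.
have -> : 2 * mu * (2^-1 * (b + c)) = mu * (b + c) by field.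
have -> : 2 * mu * (2^-1 * (c + b)) = mu * (b + c) by field.
rewrite !half; lra.
Qed.

End Elastic.

(** * Scaled bounds for polynomials *)

Section Poly2.
Context {R : realType}.
Implicit Types (m : nat).

Lemma poly2_0 m : poly2 m (fun _ : plane R => 0 : R).
Proof.
exists (fun _ _ => 0) => x; rewrite big1// => i _; rewrite big1// => j _.
by rewrite !mul0r.
Qed.

Lemma poly2D m (f g : plane R -> R) : poly2 m f -> poly2 m g -> poly2 m (fun x => f x + g x).
Proof.
move=> [c hc] [d hd]; exists (fun i j => c i j + d i j) => x.
rewrite hc hd -big_split; apply: eq_bigr => i _; rewrite -big_split.
by apply: eq_bigr => j _; rewrite !mulrDl.
Qed.

Lemma poly2Z m (a : R) f : poly2 m f -> poly2 m (fun x => a * f x).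
Proof.
move=> [c hc]; exists (fun i j => a * c i j) => x.
rewrite hc mulr_sumr; apply: eq_bigr => i _; rewrite mulr_sumr.
by apply: eq_bigr => j _; rewrite !mulrA.
Qed.

Lemma eq_poly2 m (f g : plane R -> R) : (forall x, f x = g x) -> poly2 m f -> poly2 m g.
Proof. by move=> fg [c hc]; exists c => x; rewrite -fg. Qed.

Lemma poly2B m (f g : plane R -> R) : poly2 m f -> poly2 m g -> poly2 m (fun x => f x - g x).
Proof.
move=> pf pg; apply: (eq_poly2 _ (poly2D pf (poly2Z (-1) pg))) => x.
by rewrite mulN1r.
Qed.

Lemma poly2_sum m (I : Type) (s : seq I) (P : pred I) (F : I -> plane R -> R) :
  (forall i, P i -> poly2 m (F i)) -> poly2 m (fun x => \sum_(i <- s | P i) F i x).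
Proof.
move=> pF; elim: s => [|i s IH].
  by apply: (eq_poly2 _ (poly2_0 m)) => x; rewrite big_nil.
case: (boolP (P i)) => Pi.
  by apply: (eq_poly2 _ (poly2D (pF i Pi) IH)) => x; rewrite big_cons Pi.
by apply: (eq_poly2 _ IH) => x; rewrite big_cons (negbTE Pi).
Qed.

Lemma poly2_mono m i j : (i + j < m)%N -> poly2 m (fun x : plane R => x.1 ^+ i * x.2 ^+ j).
Proof.
move=> ijm; exists (fun a b => ((a == i) && (b == j))%:R) => x.
have im : (i < m)%N := leq_ltn_trans (leq_addr j i) ijm.
have jm : (j < m)%N := leq_ltn_trans (leq_addl i j) ijm.
rewrite (bigD1 (Ordinal im))//= [X in _ + X]big1 ?addr0; last first.
  move=> a ai; rewrite big1// => b _; rewrite (_ : (nat_of_ord a == i) = false) ?mul0r//.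
  by apply/negbTE; apply: contra ai => /eqP ai; apply/eqP/val_inj.
rewrite (bigD1 (Ordinal jm))//= [X in _ + X]big1 ?addr0.
  by rewrite !eqxx mul1r.
move=> b /andP[_ bj]; rewrite (_ : (nat_of_ord b == j) = false) ?andbF ?mul0r//.
by apply/negbTE; apply: contra bj => /eqP bj; apply/eqP/val_inj.
Qed.

Lemma poly2_C1d m (f : plane R -> R) : poly2 m f -> exists g, C1d f g /\ forall j, poly2 m (g j).
Proof.
move=> [c hc].
pose F (i j : nat) (x : plane R) := c i j * (x.1 ^+ i * x.2 ^+ j).
have CF i j : (i + j < m)%N -> exists g, C1d (F i j) g /\ forall l, poly2 m (g l).
  move=> ijm; have C1 := C1dZ (c i j) (C1dM (C1dX i (@C1d_fst R)) (C1dX j (@C1d_snd R))).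
  eexists; split; first exact: C1 => //=.
  move=> l /=; apply: poly2Z; apply: poly2D.
    apply: (eq_poly2 _ (poly2Z (j%:R * (l != ord0)%:R) (_ : poly2 m (fun x => x.1 ^+ i * x.2 ^+ j.-1)))).
      by move=> x /=; ring.
    by apply: poly2_mono; apply: leq_ltn_trans ijm; rewrite leq_add2l leq_pred.
  apply: (eq_poly2 _ (poly2Z (i%:R * (l == ord0)%:R) (_ : poly2 m (fun x => x.1 ^+ i.-1 * x.2 ^+ j)))).
    by move=> x /=; ring.
  by apply: poly2_mono; apply: leq_ltn_trans ijm; rewrite leq_add2r leq_pred.
have /choice[G hG] : forall p : 'I_m * 'I_m, exists g, (p.1 + p.2 < m)%N ->
    C1d (F p.1 p.2) g /\ forall l, poly2 m (g l).
  move=> [i j]; case: (ltnP (i + j) m) => h; last by exists (fun _ _ => 0).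
  by have [g hg] := CF _ _ h; exists g.
exists (fun l x => \sum_(p : 'I_m * 'I_m) (if (p.1 + p.2 < m)%N then G p l x else 0)); split.
  have CF' (p : 'I_m * 'I_m) : C1d (fun x => if (p.1 + p.2 < m)%N then F p.1 p.2 x else 0)
      (fun l x => if (p.1 + p.2 < m)%N then G p l x else 0).
    case: (boolP (p.1 + p.2 < m)%N) => h; last exact: C1d_cst.
    exact: (hG p h).1.
  apply: (C1d_ext (C1d_sum (index_enum _) CF')) => //.
  move=> x; rewrite hc pair_big_dep/= [RHS]big_mkcond.
  by apply: eq_bigr => p _; case: ifP => // _; rewrite /F mulrA.
move=> l; apply: poly2_sum => p _; case: (boolP (p.1 + p.2 < m)%N) => h; last exact: poly2_0.
exact: (hG p h).2.
Qed.

Lemma poly2_C1 m (f : plane R -> R) : poly2 m f -> C1 f.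
Proof. by move=> /poly2_C1d[g [Cg _]]; apply/C1P; exists g. Qed.

Lemma poly2_partial m (f : plane R -> R) j : poly2 m f -> poly2 m (partial j f).
Proof. by move=> /poly2_C1d[g [Cg pg]]; rewrite (partialE j Cg.1). Qed.

Lemma poly2_line m f (P d : plane R) : poly2 m f ->
  exists2 p : {poly R}, (size p <= m)%N & forall t, f (P + t *: d) = p.[t].
Proof.
move=> [c hc].
exists (\sum_(i < m) \sum_(j < m | (i + j < m)%N)
   (c i j *: ((P.1%:P + d.1 *: 'X) ^+ i * (P.2%:P + d.2 *: 'X) ^+ j))).
  have s1 (a b : R) : (size (a%:P + b *: 'X)%R <= 2)%N.
    apply: leq_trans (size_polyD _ _) _; rewrite geq_max; apply/andP; split.
      by apply: leq_trans (size_polyC_leq1 _) _.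
    by apply: leq_trans (size_scale_leq _ _) _; rewrite size_polyX.
  have s2 (a b : R) n : (size ((a%:P + b *: 'X) ^+ n)%R <= n.+1)%N.
    apply: leq_trans (size_poly_exp_leq _ _) _; rewrite ltnS.
    apply: leq_trans (_ : 1 * n <= _)%N; last by rewrite mul1n.
    by rewrite leq_mul2r; apply/orP; right; have := s1 a b; case: size.
  apply: leq_trans (size_sum _ _ _) _; apply/bigmax_leqP => i _.
  apply: leq_trans (size_sum _ _ _) _; apply/bigmax_leqP => j ijm.
  apply: leq_trans (size_scale_leq _ _) _; apply: leq_trans (size_polyMleq _ _) _.
  have a1 := s2 P.1 d.1 i; have a2 := s2 P.2 d.2 j.
  have := leq_add a1 a2; rewrite addSn addnS => h.
  by rewrite -subn1 leq_subLR add1n; apply: leq_trans h _; rewrite ltnS.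
move=> t; rewrite hc horner_sum; apply: eq_bigr => i _; rewrite horner_sum.
apply: eq_bigr => j _; rewrite hornerZ hornerM !horner_exp !hornerD !hornerC !hornerZ !hornerX -mulrA.
by rewrite (mulrC d.1) (mulrC d.2).
Qed.

Lemma poly_poly2 m (p : {poly R}) : (size p <= m)%N -> poly2 m (fun x => p.[x.1]).
Proof.
move=> sp; apply: (eq_poly2 (f := fun x => \sum_(i < m) (p`_i * (x.1 ^+ i * x.2 ^+ 0)))).
  move=> x; rewrite (horner_coef_wide _ sp); apply: eq_bigr => i _.
  by rewrite expr0 mulr1.
by apply: poly2_sum => i _; apply: poly2Z; apply: poly2_mono; rewrite addn0.
Qed.

Lemma is_derive_horner (p : {poly R}) (t : R) : is_derive t 1 (fun t => p.[t]) p^`().[t].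
Proof.
elim/poly_ind: p => [|p c IH].
  rewrite deriv0 horner0 (_ : (fun t => _) = fun=> 0); first exact: is_derive_cst.
  by apply/funext => s; rewrite horner0.
rewrite derivMXaddC hornerD hornerMX.
have -> : (fun t0 => (p * 'X + c%:P).[t0]) = (fun s => p.[s] * s + c).
  by apply/funext => s; rewrite !hornerE.
apply: is_derive_eq; rewrite /GRing.scale/=; ring.
Qed.

Lemma continuous_horner2 (p : {poly R}) : continuous (fun t => p.[t]).
Proof.
move=> t; apply: differentiable_continuous; apply/derivable1_diffP.
by have [] := is_derive_horner p t.
Qed.

Lemma poly_bound (p : {poly R}) (A : R) : exists B, forall t, `|t| <= A -> `|p.[t]| <= B.
Proof.
elim/poly_ind: p => [|p c [B hB]].
  by exists 0 => t _; rewrite horner0 normr0.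
exists (`|B| * `|A| + `|c|) => t tA; rewrite !hornerE.
apply: le_trans (ler_normD _ _) _; rewrite lerD2r normrM.
by apply: ler_pM => //; [exact: le_trans (hB t tA) (ler_norm _)|exact: le_trans tA (ler_norm _)].
Qed.

End Poly2.

Section Lagrange.
Context {R : realType} (m : nat).

(** The nodes lie in [0, 1/2], so that boxes of radius r / 2 centred at
    points of the grid of size r stay within distance r of its corner. *)
Definition node (j : 'I_m) : R := j%:R / (2 * m)%:R.

Lemma node_inj : injective node.
Proof.
move=> i j; have m0 : (2 * m)%:R != 0 :> R.
  by rewrite pnatr_eq0 muln_eq0/= -lt0n (leq_ltn_trans _ (ltn_ord i)).
by move=> /(divIf m0)/eqP; rewrite eqr_nat => /eqP/val_inj.
Qed.

Lemma node_le j : 0 <= node j <= 1/2.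
Proof.
have m0 : (0 < m)%N by rewrite (leq_ltn_trans _ (ltn_ord j)).
have m0' : 0 < (2 * m)%:R :> R by rewrite ltr0n muln_gt0.
rewrite /node divr_ge0//= ler_pdivrMr// natrM mulrA mul1r mulVf// mul1r ler_nat.
exact: ltnW.
Qed.

Definition lag (j : 'I_m) : {poly R} :=
  \prod_(i | i != j) ((node j - node i)^-1 *: ('X - (node i)%:P)).

Lemma lagE i j : (lag j).[node i] = (i == j)%:R.
Proof.
rewrite /lag horner_prod; have [->|ij] := eqVneq i j.
  rewrite big1// => a aj; rewrite hornerZ hornerXsubC mulVf// subr_eq0.
  by apply: contra aj => /eqP/node_inj ->.
by rewrite (bigD1 i)//= hornerZ hornerXsubC subrr mulr0 mul0r.
Qed.

Lemma size_lag j : (size (lag j) <= m)%N.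
Proof.
rewrite /lag.
have -> : \prod_(i | i != j) ((node j - node i)^-1 *: ('X - (node i)%:P)) =
  \prod_(i | i != j) ((node j - node i)^-1) *: \prod_(i | i != j) ('X - (node i)%:P).
  by rewrite scaler_prod.
apply: leq_trans (size_scale_leq _ _) _.
rewrite (eq_bigl (mem (predC1 j)))// -big_enum size_prod_XsubC -cardE cardC1 card_ord.
by rewrite prednK// (leq_ltn_trans _ (ltn_ord j)).
Qed.

Lemma lagrange_eq (p : {poly R}) : (size p <= m)%N -> p = \sum_j p.[node j] *: lag j.
Proof.
move=> sp; apply/eqP; rewrite -subr_eq0; apply/eqP.
apply: (@roots_geq_poly_eq0 _ _ [seq node j | j <- enum 'I_m]).
- apply/allP => _ /mapP[i _ ->]; rewrite /root !hornerE horner_sum (bigD1 i)//=.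
  rewrite hornerZ lagE eqxx mulr1 big1 ?addr0 ?subrr// => j ji.
  by rewrite hornerZ lagE eq_sym (negbTE ji) mulr0.
- by rewrite map_inj_uniq ?enum_uniq//; exact: node_inj.
- rewrite size_map size_enum_ord; apply: leq_trans (size_polyD _ _) _.
  rewrite geq_max sp size_polyN; apply: leq_trans (size_sum _ _ _) _.
  by apply/bigmax_leqP => j _; apply: leq_trans (size_scale_leq _ _) (size_lag j).
Qed.

Definition gridpt (x0 : plane R) (r : R) (i j : 'I_m) : plane R :=
  (x0.1 + r * node i, x0.2 + r * node j).

(** Interpolation in the first variable and then in the second one: the
    total degree bounds the degree in each variable. *)
Lemma poly2_interp f (x0 : plane R) (r : R) : poly2 m f -> r != 0 -> forall x,
  f x = \sum_i \sum_j f (gridpt x0 r i j) *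
    ((lag i).[r^-1 * (x.1 - x0.1)] * (lag j).[r^-1 * (x.2 - x0.2)]).
Proof.
move=> pf r0 x; set s := r^-1 * (x.1 - x0.1); set t := r^-1 * (x.2 - x0.2).
have x1 : x.1 = x0.1 + r * s by rewrite /s mulVKf// addrC subrK.
have x2 : x.2 = x0.2 + r * t by rewrite /t mulVKf// addrC subrK.
have h1 (y : R) (s' : R) : f (x0.1 + r * s', y) = \sum_i f (x0.1 + r * node i, y) * (lag i).[s'].
  have [p sp hp] := poly2_line (x0.1, y) (r, 0) pf.
  have e (q : R) : f (x0.1 + r * q, y) = p.[q].
    rewrite -hp; congr f; apply: injective_projections; rewrite /= /GRing.scale/= ?mulr0 ?addr0//.
    by rewrite mulrC.
  rewrite e {1}(lagrange_eq sp) horner_sum; apply: eq_bigr => i _.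
  by rewrite hornerZ e.
have h2 (y : R) (s' : R) : f (y, x0.2 + r * s') = \sum_i f (y, x0.2 + r * node i) * (lag i).[s'].
  have [p sp hp] := poly2_line (y, x0.2) (0, r) pf.
  have e (q : R) : f (y, x0.2 + r * q) = p.[q].
    rewrite -hp; congr f; apply: injective_projections; rewrite /= /GRing.scale/= ?mulr0 ?addr0//.
    by rewrite mulrC.
  rewrite e {1}(lagrange_eq sp) horner_sum; apply: eq_bigr => i _.
  by rewrite hornerZ e.
rewrite [x]surjective_pairing x1 x2 h1; apply: eq_bigr => i _.
rewrite h2 mulr_suml; apply: eq_bigr => j _; by rewrite /gridpt -mulrA (mulrC (lag j).[_]).
Qed.

End Lagrange.

Section PolyBounds.
Context {R : realType}.

(** In the interpolation formula the coefficients of the grid values depend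
    on the rescaled point only, which stays in a bounded set. *)
Lemma poly2_grid_bound m (A : R) : exists2 K, 1 <= K &
  forall f g (x0 : plane R) (r M : R), poly2 m f -> hasd f g -> 0 < r -> 0 <= M ->
  (forall i j, `|f (@gridpt R m x0 r i j)| <= M) ->
  forall x, `|x.1 - x0.1| <= A * r -> `|x.2 - x0.2| <= A * r ->
  `|f x| <= K * M /\ forall l, r * `|g l x| <= K * M.
Proof.
have [B hB] : exists B, forall (i : 'I_m) t, `|t| <= A -> `|(@lag R m i).[t]| <= B.
  have /choice[B hB] : forall i : 'I_m, exists B, forall t, `|t| <= A -> `|(@lag R m i).[t]| <= B.
    by move=> i; exact: poly_bound.
  exists (\sum_i `|B i|) => i t tA; apply: le_trans (hB i t tA) _.
  by rewrite (bigD1 i)//= (le_trans (ler_norm _))// lerDl sumr_ge0.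
have [B' hB'] : exists B, forall (i : 'I_m) t, `|t| <= A -> `|(@lag R m i)^`().[t]| <= B.
  have /choice[B' hB'] : forall i : 'I_m, exists B, forall t, `|t| <= A -> `|(@lag R m i)^`().[t]| <= B.
    by move=> i; exact: poly_bound.
  exists (\sum_i `|B' i|) => i t tA; apply: le_trans (hB' i t tA) _.
  by rewrite (bigD1 i)//= (le_trans (ler_norm _))// lerDl sumr_ge0.
pose Bm := `|B| + `|B'|.
have Bm0 : 0 <= Bm by rewrite addr_ge0.
have b1 i t : `|t| <= A -> `|(@lag R m i).[t]| <= Bm.
  by move=> /(hB i) h; apply: le_trans h _; rewrite (le_trans (ler_norm _))// lerDl.
have b2 i t : `|t| <= A -> `|(@lag R m i)^`().[t]| <= Bm.
  by move=> /(hB' i) h; apply: le_trans h _; rewrite (le_trans (ler_norm _))// lerDr.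
pose K := 1 + (m * m)%:R * Bm ^+ 2.
exists K; first by rewrite lerDl mulr_ge0 ?ler0n// sqr_ge0.
move=> f g x0 r M pf dg r0 M0 fM x xA1 xA2.
have sc (z : R) : `|z| <= A * r -> `|r^-1 * z| <= A.
  by move=> h; rewrite normrM gtr0_norm ?invr_gt0// ler_pdivrMl// mulrC.
set s := r^-1 * (x.1 - x0.1); set t := r^-1 * (x.2 - x0.2).
have sA : `|s| <= A by exact: sc. have tA : `|t| <= A by exact: sc.
have sumb (F : 'I_m -> 'I_m -> R) : (forall i j, `|F i j| <= M * Bm ^+ 2) ->
    `|\sum_i \sum_j F i j| <= K * M.
  move=> hF; apply: le_trans (_ : (m * m)%:R * (M * Bm ^+ 2) <= _).
    apply: le_trans (ler_norm_sum _ _ _) _.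
    apply: le_trans (_ : \sum_(i < m) (m%:R * (M * Bm ^+ 2)) <= _).
      apply: ler_sum => i _; apply: le_trans (ler_norm_sum _ _ _) _.
      apply: le_trans (_ : \sum_(j < m) (M * Bm ^+ 2) <= _); first exact: ler_sum.
      by rewrite sumr_const card_ord mulr_natl.
    by rewrite sumr_const card_ord -[X in X <= _]mulr_natl mulrA natrM.
  by rewrite /K mulrDl mul1r; rewrite -[X in X <= _]add0r lerD//; rewrite mulrAC -mulrA.
have prodb (a b c : R) : `|a| <= M -> `|b| <= Bm -> `|c| <= Bm -> `|a * (b * c)| <= M * Bm ^+ 2.
  by move=> ha hb hc; rewrite !normrM expr2; do 2! apply: ler_pM => //; rewrite ?mulr_ge0.
split.
  rewrite (poly2_interp x0 pf (lt0r_neq0 r0)); apply: sumb => i j.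
  by apply: prodb; [exact: fM|exact: b1|exact: b1].
have Cf : C1d f (fun l x => \sum_i \sum_j f (@gridpt R m x0 r i j) *
   (if l == ord0 then r^-1 * ((@lag R m i)^`().[r^-1 * (x.1 - x0.1)] * (@lag R m j).[r^-1 * (x.2 - x0.2)])
    else r^-1 * ((@lag R m i).[r^-1 * (x.1 - x0.1)] * (@lag R m j)^`().[r^-1 * (x.2 - x0.2)]))).
  have Cs (a c : R) : C1d (fun x : plane R => r^-1 * (x.1 - a)) (fun l _ => r^-1 * ((l == ord0)%:R - 0)).
    exact: C1dZ (C1dB (@C1d_fst R) (C1d_cst a)).
  have Ct (a c : R) : C1d (fun x : plane R => r^-1 * (x.2 - a)) (fun l _ => r^-1 * ((l != ord0)%:R - 0)).
    exact: C1dZ (C1dB (@C1d_snd R) (C1d_cst a)).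
  have C1 := C1d_sum (index_enum 'I_m) (fun i => C1d_sum (index_enum 'I_m) (fun j =>
    C1dZ (f (@gridpt R m x0 r i j)) (C1dM
      (C1d_comp (is_derive_horner (@lag R m i)) (@continuous_horner2 R _) (Cs x0.1 0))
      (C1d_comp (is_derive_horner (@lag R m j)) (@continuous_horner2 R _) (Ct x0.2 0))))).
  apply: (C1d_ext C1) => [y|l y]; first by rewrite [RHS](poly2_interp x0 pf (lt0r_neq0 r0)).
  apply: eq_bigr => i _; apply: eq_bigr => j _; congr (_ * _).
  by case: eqP => _ /=; ring.
move=> l; have -> : g l = (fun x => \sum_i \sum_j f (@gridpt R m x0 r i j) *
   (if l == ord0 then r^-1 * ((@lag R m i)^`().[r^-1 * (x.1 - x0.1)] * (@lag R m j).[r^-1 * (x.2 - x0.2)])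
    else r^-1 * ((@lag R m i).[r^-1 * (x.1 - x0.1)] * (@lag R m j)^`().[r^-1 * (x.2 - x0.2)]))).
  by rewrite -(partialE l dg) (partialE l Cf.1).
rewrite -{1}(gtr0_norm r0) -normrM mulr_sumr.
under eq_bigr do rewrite mulr_sumr.
apply: sumb => i j; rewrite -/s -/t mulrCA; case: ifP => _.
  by rewrite mulVKf ?gt_eqF//; apply: prodb; [exact: fM|exact: b2|exact: b1].
by rewrite mulVKf ?gt_eqF//; apply: prodb; [exact: fM|exact: b1|exact: b2].
Qed.

Lemma poly2_grad m (f : plane R -> R) : poly2 m f -> hasd f (fun l => partial l f).
Proof. by move=> /poly2_C1d[g [Cg _]] l x; rewrite (partialE l Cg.1); exact: Cg.1. Qed.

(** Let M be the largest value of |f| on the grid. The gradient is at most K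
    M / r by [poly2_grid_bound], so |f| remains above M / 2 within distance
    rho r of the grid point where M is attained. *)
Lemma poly2_peak m (A : R) : 1 <= A -> exists K rho, [/\ 0 < K, 0 < rho, rho <= 1/4 &
  forall f (x0 : plane R) (r : R), poly2 m f -> 0 < r ->
  exists M z, [/\ 0 <= M, forall y, box z (rho * r) y -> M / 2 <= `|f y|,
    0 <= z.1 - x0.1 <= r / 2, 0 <= z.2 - x0.2 <= r / 2 &
   forall x, `|x.1 - x0.1| <= A * r -> `|x.2 - x0.2| <= A * r ->
    `|f x| <= K * M /\ forall l, r * `|partial l f x| <= K * M]].
Proof.
move=> A1; have [K K1 hK] := poly2_grid_bound m A.
have K0 : 0 < K by rewrite (lt_le_trans ltr01).
pose rho := (4 * K)^-1.
have rho0 : 0 < rho by rewrite invr_gt0 mulr_gt0.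
have rho4 : rho <= 1/4.
  by rewrite /rho invfM div1r ler_piMr ?invr_ge0// invf_le1.
exists K, rho; split => // f x0 r pf r0.
have dg := poly2_grad pf.
have [m0|m0] := posnP m.
  exists 0, x0; rewrite !subrr; split => //.
  - by move=> y _; rewrite mul0r.
  - by rewrite lexx divr_ge0// ltW.
  - by rewrite lexx divr_ge0// ltW.
  - move=> x h1 h2; apply: (hK f _ x0 r 0 pf dg r0 (lexx 0) _ x h1 h2) => i.
    by have := ltn_ord i; rewrite {2}m0.
have [p _ hp] : exists2 p : 'I_m * 'I_m, true & forall q : 'I_m * 'I_m,
    `|f (gridpt x0 r q.1 q.2)| <= `|f (gridpt x0 r p.1 p.2)|.
  case: (@arg_maxP _ _ _ (Ordinal m0, Ordinal m0) xpredT (fun q : 'I_m * 'I_m => `|f (gridpt x0 r q.1 q.2)|)) => // p _ hp.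
  by exists p => // q; exact: hp.
pose z := gridpt x0 r p.1 p.2; pose M := `|f z|.
have B := hK _ _ x0 r M pf dg r0 (normr_ge0 _) (fun i j => hp (i, j)).
have zr (i : 'I_m) : 0 <= r * node i <= r / 2.
  have /andP[a b] := @node_le R m i; rewrite mulr_ge0 ?(ltW r0)//=.
  by rewrite ler_wpM2l ?(ltW r0)//; lra.
have z1 : 0 <= z.1 - x0.1 <= r / 2 by rewrite /z/= addrC addKr.
have z2 : 0 <= z.2 - x0.2 <= r / 2 by rewrite /z/= addrC addKr.
exists M, z; split => //; first exact: normr_ge0.
move=> y zy.
have gM l w : box z (rho * r) w -> `|partial l f w| <= K * M / r.
  move=> [w1 w2]; rewrite ler_pdivlMr// mulrC; have [||_] := B w; last by [].
    have := ler_normD (w.1 - z.1) (z.1 - x0.1); rewrite addrA subrK.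
    case/andP: z1 => a b; rewrite (ger0_norm a); nra.
  have := ler_normD (w.2 - z.2) (z.2 - x0.2); rewrite addrA subrK.
  case/andP: z2 => a b; rewrite (ger0_norm a); nra.
have L := hasd_lip dg gM zy (box_center z (mulr_gt0 rho0 r0)).
have [y1 y2] := zy.
have L2 : `|f y - f z| <= M / 2.
  apply: le_trans L _.
  have -> : M / 2 = K * M / r * (rho * r + rho * r).
    by rewrite /rho; field; rewrite !gt_eqF.
  rewrite ler_wpM2l//; first by rewrite divr_ge0 ?(ltW r0)// mulr_ge0// ?normr_ge0// ltW.
  by rewrite lerD// ltW.
have := ler_normD (f y) (f z - f y); rewrite addrC subrK => h.
rewrite distrC in h; rewrite -/M in h; lra.
Qed.

(** The inverse estimates for polynomials: the box of [poly2_peak] alone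
    contributes a fixed fraction of M^2 r^2 to the integral. *)
Lemma poly2_int_bound m (A : R) : 1 <= A -> exists2 K, 0 < K &
  forall f (x0 : plane R) (r : R), poly2 m f -> 0 < r ->
  forall x, `|x.1 - x0.1| <= A * r -> `|x.2 - x0.2| <= A * r ->
    f x ^+ 2 <= K * r ^- 2 * \int[area]_(y in box x0 r) f y ^+ 2 /\
    forall l, (r * partial l f x) ^+ 2 <= K * r ^- 2 * \int[area]_(y in box x0 r) f y ^+ 2.
Proof.
move=> A1; have [K [rho [K0 rho0 rho4 hK]]] := poly2_peak m A1.
exists (K ^+ 2 / rho ^+ 2); first by rewrite divr_gt0// exprn_gt0.
move=> f x0 r pf r0 x h1 h2.
have [M [z [M0 fz z1 z2 hM]]] := hK f x0 r pf r0.
have rr0 : 0 < rho * r by exact: mulr_gt0.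
have [g [Cg _]] := poly2_C1d pf; have cf := C1d_continuous Cg.
have I1 : M ^+ 2 / 4 * (2 * (rho * r)) ^+ 2 <= \int[area]_(y in box x0 r) f y ^+ 2.
  apply: (@I_ge_box _ _ _ z (rho * r)).
  - exact: measurable_box.
  - apply: itg_continuous; [exact: measurable_box|exact: box_bounded|].
    by move=> y; apply: cvgM; exact: cf.
  - exact: ltW.
  - by move=> y _; exact: sqr_ge0.
  - move=> y [y1 y2]; split.
      have := ler_normD (y.1 - z.1) (z.1 - x0.1); rewrite addrA subrK.
      case/andP: z1 => a b; rewrite (ger0_norm a); nra.
    have := ler_normD (y.2 - z.2) (z.2 - x0.2); rewrite addrA subrK.
    case/andP: z2 => a b; rewrite (ger0_norm a); nra.
  - move=> y /fz h; rewrite -[f y ^+ 2]real_normK ?num_real//.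
    by have := normr_ge0 (f y); nra.
set I := \int[area]_(_ in _) _ in I1 *.
have I2 : (K * M) ^+ 2 <= K ^+ 2 / rho ^+ 2 * r ^- 2 * I.
  have -> : (K * M) ^+ 2 = K ^+ 2 / rho ^+ 2 * r ^- 2 * (M ^+ 2 / 4 * (2 * (rho * r)) ^+ 2).
    by field; rewrite !gt_eqF.
  rewrite ler_wpM2l//; rewrite mulr_ge0// ?invr_ge0 ?exprn_ge0 ?(ltW r0)//.
  by rewrite divr_ge0 ?exprn_ge0 ?(ltW K0) ?(ltW rho0).
have [f1 f2] := hM x h1 h2; split.
  apply: le_trans I2; rewrite -[f x ^+ 2]real_normK ?num_real//.
  by rewrite ler_sqr ?nnegrE ?mulr_ge0 ?(ltW K0).
move=> l; apply: le_trans I2; rewrite -[(r * _) ^+ 2]real_normK ?num_real//.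
by rewrite normrM (gtr0_norm r0) ler_sqr ?nnegrE ?mulr_ge0 ?(ltW K0) ?(ltW r0).
Qed.

Lemma poly2_eq0 m f (x0 : plane R) (r : R) : poly2 m f -> 0 < r ->
  \int[area]_(y in box x0 r) f y ^+ 2 = 0 -> forall x, f x = 0.
Proof.
move=> pf r0 I0 x; pose A := 1 + `|x.1 - x0.1| / r + `|x.2 - x0.2| / r.
have A1 : 1 <= A by rewrite /A -addrA lerDl addr_ge0// divr_ge0 ?(ltW r0).
have [K K0 hK] := poly2_int_bound m A1.
have rp z : 0 <= `|z| / r by rewrite divr_ge0 ?(ltW r0).
have Ar : A * r = r + `|x.1 - x0.1| + `|x.2 - x0.2|.
  by rewrite /A; field; rewrite gt_eqF.
have n1 := normr_ge0 (x.1 - x0.1); have n2 := normr_ge0 (x.2 - x0.2).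
have [||] := hK f x0 r pf r0 x; rewrite ?Ar; [lra|lra|].
rewrite I0 mulr0 => h _; apply/eqP; rewrite -sqrf_eq0; apply/eqP/le_anti.
by rewrite h sqr_ge0.
Qed.

End PolyBounds.

(** * Distances and segments *)

Section Eucl.
Context {R : realType}.
Implicit Types (x y z p q : plane R) (A : set (plane R)).

Definition dist2 x y : R := (x.1 - y.1) ^+ 2 + (x.2 - y.2) ^+ 2.

Lemma dist2_ge0 x y : 0 <= dist2 x y.
Proof. by rewrite /dist2 addr_ge0 ?sqr_ge0. Qed.

Lemma eucl_sq x y : eucl x y ^+ 2 = dist2 x y.
Proof. by rewrite /eucl sqr_sqrtr// dist2_ge0. Qed.

Lemma eucl_ge0 x y : 0 <= eucl x y. Proof. exact: sqrtr_ge0. Qed.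

Lemma eucl_le x y (r : R) : 0 <= r -> (eucl x y <= r) = (dist2 x y <= r ^+ 2).
Proof. by move=> r0; rewrite -eucl_sq ler_sqr ?nnegrE ?eucl_ge0. Qed.

Lemma eucl_lt x y (r : R) : 0 <= r -> (eucl x y < r) = (dist2 x y < r ^+ 2).
Proof. by move=> r0; rewrite -eucl_sq ltr_sqr ?nnegrE ?eucl_ge0. Qed.

Lemma euclC x y : eucl x y = eucl y x.
Proof. by rewrite /eucl; congr Num.sqrt; ring. Qed.

Lemma abs1_le_eucl x y : `|x.1 - y.1| <= eucl x y.
Proof.
rewrite -ler_sqr ?nnegrE ?eucl_ge0// eucl_sq real_normK ?num_real//.
by rewrite lerDl sqr_ge0.
Qed.

Lemma abs2_le_eucl x y : `|x.2 - y.2| <= eucl x y.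
Proof.
rewrite -ler_sqr ?nnegrE ?eucl_ge0// eucl_sq real_normK ?num_real//.
by rewrite lerDr sqr_ge0.
Qed.

Lemma eucl_box x y (r : R) : box x r y -> 0 <= r -> eucl x y <= 2 * r.
Proof.
move=> [/ltW a /ltW b] r0; rewrite eucl_le ?mulr_ge0// /dist2.
have h (t : R) : `|t| <= r -> t ^+ 2 <= r ^+ 2.
  by move=> tr; rewrite -[t ^+ 2]real_normK ?num_real// ler_sqr ?nnegrE.
have := h _ a; have := h _ b; have := sqr_ge0 r => ? ? ?.
have -> : (x.1 - y.1) ^+ 2 = (y.1 - x.1) ^+ 2 by ring.
have -> : (x.2 - y.2) ^+ 2 = (y.2 - x.2) ^+ 2 by ring.
by rewrite exprMn; nra.
Qed.

Lemma bounded_eucl A : bounded_set A -> exists2 M : R, 0 <= M & forall x y, A x -> A y -> eucl x y <= M.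
Proof.
move=> /bounded_sub_box[M M0 AM]; exists (2 * (2 * M)); first by rewrite !mulr_ge0 ?(ltW M0).
move=> x y /AM[x1 x2] /AM[y1 y2]; apply: eucl_box; last by rewrite mulr_ge0 ?(ltW M0).
move: x1 x2 y1 y2 => /=; rewrite !subr0 !ltr_norml => /andP[? ?] /andP[? ?] /andP[? ?] /andP[? ?].
by split; rewrite ltr_norml; apply/andP; split; lra.
Qed.

Lemma ediam_fin A : bounded_set A -> (ediam A < +oo)%E.
Proof.
move=> /bounded_eucl[M M0 hM]; apply: (@le_lt_trans _ _ M%:E); last exact: ltry.
apply: ge_ereal_sup => _ [->|[[x y] [/= Ax Ay] <-]]; first by rewrite lee_fin.
by rewrite lee_fin; exact: hM.
Qed.

Lemma ediam_ge0 A : (0 <= ediam A)%E.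
Proof. by apply: ereal_sup_ubound; left. Qed.

Lemma eucl_ediam A x y : bounded_set A -> A x -> A y -> eucl x y <= fine (ediam A).
Proof.
move=> bA Ax Ay; rewrite -lee_fin fineK; last first.
  by rewrite ge0_fin_numE ?ediam_ge0// ediam_fin.
by apply: ereal_sup_ubound; right; exists (x, y).
Qed.

Lemma closure_boxP A x : closure A x <-> forall r, 0 < r -> exists2 y, A y & box x r y.
Proof.
split=> [cA r r0|h B /nbhs_box[r r0 rB]].
  have [] := cA (box x r); first by apply/nbhs_box; exists r.
  by move=> y [Ay By]; exists y.
by have [y Ay By] := h r r0; exists y; split => //; exact: rB.
Qed.

(** Points of the closure are approximated by points of A. *)
Lemma eucl_closure A x y : bounded_set A -> closure A x -> closure A y ->
  eucl x y <= fine (ediam A).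
Proof.
move=> bA /closure_boxP cx /closure_boxP cy.
have h0 : 0 <= fine (ediam A) by rewrite fine_ge0// ediam_ge0.
set h := fine _ in h0 *.
have [M M0 bM] := bounded_eucl bA.
rewrite eucl_le// leNgt; apply/negP => hlt.
pose D := `|x.1 - y.1| + `|x.2 - y.2| + 1.
have D0 : 0 < D by rewrite ltr_wpDl// addr_ge0.
(* moving both points by e changes the squared distance by at most 8 D e *)
pose e := Num.min 1 ((dist2 x y - h ^+ 2) / (9 * D)).
have e0 : 0 < e by rewrite lt_min ltr01/= divr_gt0 ?subr_gt0// mulr_gt0.
have e1 : e <= 1 by rewrite ge_min lexx.
have e2 : 9 * D * e <= dist2 x y - h ^+ 2.
  by rewrite mulrC -ler_pdivlMr ?mulr_gt0// ge_min lexx orbT.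
have [x' Ax' [bx1 bx2]] := cx e e0; have [y' Ay' [by1 by2]] := cy e e0.
have := eucl_ediam bA Ax' Ay'; rewrite -/h eucl_le// leNgt => /negP; apply.
suff : dist2 x y <= dist2 x' y' + 8 * D * e.
  by have := mulr_gt0 D0 e0; lra.
rewrite /dist2.
have est (a b a' b' : R) : `|a' - a| < e -> `|b' - b| < e ->
    (a - b) ^+ 2 <= (a' - b') ^+ 2 + 4 * `|a - b| * e.
  rewrite !ltr_norml => /andP[h1 h2] /andP[h3 h4].
  have n0 := normr_ge0 (a - b).
  have e3 : `|(a' - b') - (a - b)| <= 2 * e by rewrite ler_norml; apply/andP; split; lra.
  set u := a - b in n0 *; set v := a' - b' in e3 *.
  have e4 : `|u * (v - u)| <= `|u| * (2 * e) by rewrite normrM ler_wpM2l.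
  move: e4; rewrite ler_norml => /andP[e5 e6]; have := sqr_ge0 (v - u); nra.
have := est _ _ _ _ bx1 by1; have := est _ _ _ _ bx2 by2.
by rewrite /D; have := normr_ge0 (x.1 - y.1); have := normr_ge0 (x.2 - y.2); nra.
Qed.

Lemma lerpE p q t : lerp p q t = p + t *: (q - p).
Proof. by rewrite /lerp scalerBl scale1r scalerBr -addrA; congr (_ + _); rewrite addrC. Qed.

Lemma lerp1 p q t : (lerp p q t).1 = p.1 + t * (q.1 - p.1).
Proof. by rewrite lerpE. Qed.

Lemma lerp2 p q t : (lerp p q t).2 = p.2 + t * (q.2 - p.2).
Proof. by rewrite lerpE. Qed.

Lemma continuous_lerp p q : continuous (fun t : R => lerp p q t).
Proof.
have -> : (fun t : R => lerp p q t) = (fun t => (p.1 + t * (q.1 - p.1), p.2 + t * (q.2 - p.2))).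
  by apply/funext => t; rewrite [LHS]surjective_pairing lerp1 lerp2.
by apply: continuous_pair => t; apply: cvgD; try exact: cvg_cst; apply: cvgM; try exact: cvg_cst; exact: cvg_id.
Qed.

Lemma closed_seg p q : closed (seg p q).
Proof.
apply: closed_plane; apply: continuous_compact; last exact: segment_compact.
by apply: continuous_subspaceT => t; exact: continuous_lerp.
Qed.

(** The part of the segment inside A is nonempty, open and, by hypothesis,
    closed. *)
Lemma seg_in A x y : open A -> A x -> (forall z, seg x y z -> closure A z -> A z) ->
  seg x y `<=` A.
Proof.
move=> oA Ax nb.
have cs : continuous (fun t : R => lerp x y t) := @continuous_lerp x y.
pose f t := lerp x y t; pose I := `[(0 : R), 1]%classic.
have f0 : f 0 = x by rewrite /f lerpE scale0r addr0.
have := @segment_connected R 0 1.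
rewrite -/I => /(_ (I `&` f @^-1` A)) H.
have IE : I `&` f @^-1` A = I.
  apply: H.
  - exists 0; split; first by rewrite /I/= in_itv/= lexx ler01.
    by rewrite /preimage/=; move: f0; rewrite /f => ->.
  - by exists (f @^-1` A) => //; apply: open_comp => // t _; exact: cs.
  - exists (f @^-1` closure A); first by apply: closed_comp => [t _|]; [exact: cs|exact: closed_closure].
    apply/seteqP; split => t [It /= h]; split => //; first exact: subset_closure.
    by apply: nb => //; exists t.
by move=> _ [t It <-]; have [] : (I `&` f @^-1` A) t by rewrite IE.
Qed.

End Eucl.

(** * Sides of the edges of a star-shaped polygon *)

Section EdgeSide.
Context {R : realType}.
Implicit Types (x y z c P Q : plane R) (E : polygon R).

(** Twice the signed area of the triangle P Q x: the sign is the side of the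
    line PQ on which x lies, and the size is the distance to this line times
    the length of PQ. *)
Definition cr P Q x : R := (Q.1 - P.1) * (x.2 - P.2) - (Q.2 - P.2) * (x.1 - P.1).

Lemma cr_lerp P Q x y t : cr P Q (lerp x y t) = (1 - t) * cr P Q x + t * cr P Q y.
Proof. by rewrite /cr !lerp1 !lerp2; ring. Qed.

Lemma cr_line P Q t : cr P Q (lerp P Q t) = 0.
Proof. by rewrite /cr !lerp1 !lerp2; ring. Qed.

Lemma crC P Q x : cr Q P x = - cr P Q x.
Proof. by rewrite /cr; ring. Qed.

Lemma lerpC P Q (t : R) : lerp Q P t = lerp P Q (1 - t).
Proof. by apply: injective_projections; rewrite ?lerp1 ?lerp2; ring. Qed.

Lemma open_segC P Q : open_seg Q P = open_seg P Q.
Proof.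
have h (p q : plane R) : open_seg p q `<=` open_seg q p.
  move=> z [t /=]; rewrite in_itv/= => /andP[t0 t1] <-; exists (1 - t) => /=.
    by rewrite in_itv/= subr_gt0 t1/= gtrBl.
  by rewrite lerpC opprB addrC subrK.
by apply/seteqP; split; exact: h.
Qed.

(** The orientation of an edge: s is 1 if the polygon lies to the left of
    the edge going from P to Q, and -1 if it lies to the right. *)
Definition edge_side E P Q (s : R) := s ^+ 2 = 1 /\
  forall y, open_seg P Q y -> exists2 r : R, 0 < r & forall x, box y r x -> (region E x <-> 0 < s * cr P Q x).

Lemma edge_sideC E P Q s : edge_side E P Q s -> edge_side E Q P (- s).
Proof.
move=> [s1 h]; split; first by rewrite sqrrN.
move=> y; rewrite open_segC => /h[r r0 hr]; exists r => // x Bx.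
by rewrite crC mulrNN; exact: hr.
Qed.

Lemma size_edges E : size (edges E) = size (verts E).
Proof. by rewrite /edges size_zip size_rot minnn. Qed.

Lemma nth_edges E i : (i < size (verts E))%N ->
  nth (0, 0) (edges E) i = (vert E i, vert E i.+1).
Proof.
move=> iN; rewrite /edges nth_zip ?size_rot// /vert modn_small//; congr pair.
have n1 : (1 <= size (verts E))%N by rewrite (leq_ltn_trans _ iN).
rewrite /rot nth_cat size_drop nth_drop add1n.
case: ltnP => h; first by rewrite ltn_subRL add1n in h; rewrite modn_small.
have -> : i = (size (verts E)).-1 by apply/eqP; rewrite eqn_leq -ltnS prednK// iN -subn1 h.
by rewrite prednK// modnn subn1 subnn nth_take.
Qed.

Lemma edgesP E l : l \in edges E <-> exists2 i, (i < size (verts E))%N & l = (vert E i, vert E i.+1).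
Proof.
split=> [/(nthP (0, 0))[i]|[i iN ->]].
  by rewrite size_edges => iN <-; exists i; rewrite // nth_edges.
by rewrite -nth_edges// mem_nth// size_edges.
Qed.

Lemma open_seg_ends P Q y : P != Q -> open_seg P Q y -> y != P /\ y != Q.
Proof.
move=> PQ [t /=]; rewrite in_itv/= => /andP[t0 t1] <-; rewrite lerpE; split.
  rewrite -subr_eq0 addrC addKr scaler_eq0 subr_eq0 negb_or (eq_sym Q) PQ gt_eqF//.
rewrite -subr_eq0.
have -> : P + t *: (Q - P) - Q = (t - 1) *: (Q - P).
  by rewrite scalerBl scale1r opprB addrCA addrA.
by rewrite scaler_eq0 subr_eq0 (lt_eqF t1) subr_eq0 eq_sym.
Qed.

Lemma open_seg_seg P Q : open_seg P Q `<=` seg P Q.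
Proof.
move=> z [t /=]; rewrite in_itv/= => /andP[t0 t1] <-; exists t => //=.
by rewrite in_itv/= !ltW.
Qed.

(** Edges of a simple polygon meet at vertices only, and an open edge
    contains no endpoint of its own. *)
Lemma other_edge E l l' y : simple_polygon E -> l.1 != l.2 ->
  l \in edges E -> l' \in edges E -> open_seg l.1 l.2 y -> seg l'.1 l'.2 y -> l = l'.
Proof.
move=> [[n3 _] meet _ _ _] PQ /edgesP[i iN lE] /edgesP[j jN l'E] oy sy.
have [ij|ji|ij] := ltngtP i j; last by rewrite lE l'E ij.
- have yl : seg (vert E i) (vert E i.+1) y by move: (open_seg_seg oy); rewrite lE.
  have yl' : seg (vert E j) (vert E j.+1) y by move: sy; rewrite l'E.
  have h : (i < j < size (verts E))%N by rewrite ij.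
  have [[ji yj]|[i0 [jn y0]]] := meet i j y h yl yl'.
    have [_] := open_seg_ends PQ oy; rewrite lE/= -ji yj eqxx//.
  have [] := open_seg_ends PQ oy; rewrite lE/= i0 y0 eqxx//.
- have yl : seg (vert E i) (vert E i.+1) y by move: (open_seg_seg oy); rewrite lE.
  have yl' : seg (vert E j) (vert E j.+1) y by move: sy; rewrite l'E.
  have h : (j < i < size (verts E))%N by rewrite ji.
  have [[ij yi]|[j0 [iN' y0]]] := meet j i y h yl' yl.
    have [] := open_seg_ends PQ oy; rewrite lE/= yi eqxx//.
  have [_] := open_seg_ends PQ oy.
  by rewrite lE/= y0 iN' prednK ?(leq_ltn_trans _ iN)// /vert modnn mod0n eqxx.
Qed.

Lemma isolate (s : seq (plane R * plane R)) y : (forall l, l \in s -> ~ seg l.1 l.2 y) ->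
  exists2 r : R, 0 < r & forall l x, l \in s -> box y r x -> ~ seg l.1 l.2 x.
Proof.
elim: s => [|l s IH] h; first by exists 1.
have [|r r0 hr] := IH; first by move=> l' ls; apply: h; rewrite inE ls orbT.
have nl : ~ seg l.1 l.2 y by apply: h; rewrite inE eqxx.
have : open (~` seg l.1 l.2) by apply: closed_openC; exact: closed_seg.
move=> /open_boxP/(_ y nl)[r' r'0 hr'].
exists (Num.min r r'); first by rewrite lt_min r0.
move=> l' x; rewrite inE => /orP[/eqP ->|ls] [x1 x2].
  by apply: hr'; split; [apply: lt_le_trans x1 _|apply: lt_le_trans x2 _]; rewrite ge_min lexx orbT.
by apply: hr => //; split; [apply: lt_le_trans x1 _|apply: lt_le_trans x2 _]; rewrite ge_min lexx.
Qed.

(** The affine coordinate along the line, 0 at P and 1 at Q. *)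
Definition tc P Q x : R :=
  ((Q.1 - P.1) * (x.1 - P.1) + (Q.2 - P.2) * (x.2 - P.2)) / dist2 Q P.

Lemma dist2_gt0 P Q : P != Q -> 0 < dist2 Q P.
Proof.
move=> PQ; rewrite lt_neqAle dist2_ge0 andbT eq_sym; apply: contra PQ.
rewrite /dist2 paddr_eq0 ?sqr_ge0// !sqrf_eq0 !subr_eq0 => /andP[/eqP a /eqP b].
by apply/eqP/injective_projections.
Qed.

Lemma edge_coords P Q x : P != Q ->
  x = P + tc P Q x *: (Q - P) + (cr P Q x / dist2 Q P) *: (- (Q.2 - P.2), Q.1 - P.1).
Proof.
move=> /dist2_gt0 d0; have d0' : (Q.1 - P.1) ^+ 2 + (Q.2 - P.2) ^+ 2 != 0 by rewrite gt_eqF.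
by apply: injective_projections; rewrite /= /GRing.scale/= /tc /cr /dist2; field.
Qed.

Lemma tc_lerp P Q t : P != Q -> tc P Q (lerp P Q t) = t.
Proof.
move=> /dist2_gt0 d0; have d0' : (Q.1 - P.1) ^+ 2 + (Q.2 - P.2) ^+ 2 != 0 by rewrite gt_eqF.
by rewrite /tc lerp1 lerp2 /dist2; field.
Qed.

Lemma C1d_tc P Q : C1d (tc P Q) (fun j _ => (if j == ord0 then Q.1 - P.1 else Q.2 - P.2) / dist2 Q P).
Proof.
have C := C1dZ (dist2 Q P)^-1 (C1dD (C1dZ (Q.1 - P.1) (C1dB (@C1d_fst R) (C1d_cst P.1)))
  (C1dZ (Q.2 - P.2) (C1dB (@C1d_snd R) (C1d_cst P.2)))).
apply: (C1d_ext C) => [x|j x]; first by rewrite /tc mulrC.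
by rewrite mulrC; congr (_ * _); case: eqP => _ /=; ring.
Qed.

Lemma C1d_cr P Q : C1d (cr P Q) (fun j _ => if j == ord0 then - (Q.2 - P.2) else Q.1 - P.1).
Proof.
have C := C1dB (C1dZ (Q.1 - P.1) (C1dB (@C1d_snd R) (C1d_cst P.2)))
  (C1dZ (Q.2 - P.2) (C1dB (@C1d_fst R) (C1d_cst P.1))).
by apply: (C1d_ext C) => // j x; case: eqP => _ /=; ring.
Qed.

Lemma line_in_seg P Q y : P != Q -> open_seg P Q y -> exists2 r : R, 0 < r &
  forall x, box y r x -> cr P Q x = 0 -> seg P Q x.
Proof.
move=> PQ [t0 /=]; rewrite in_itv/= => t01 yE.
have ct := C1d_continuous (@C1d_tc P Q).
have : open (tc P Q @^-1` `]0, 1[%classic).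
  by apply: open_comp; [move=> x _; exact: ct|exact: interval_open].
move=> /open_boxP/(_ y)[|r r0 hr].
  by rewrite /= -yE tc_lerp// in_itv.
exists r => // x Bx cx; have /= := hr x Bx; rewrite in_itv/= => /andP[a b].
exists (tc P Q x); first by rewrite /= in_itv/= !ltW.
by rewrite [RHS](edge_coords x PQ) cx mul0r scale0r addr0 lerpE.
Qed.

Lemma box_lerp y (r : R) a b t : box y r a -> box y r b -> 0 <= t <= 1 -> box y r (lerp a b t).
Proof.
move=> [a1 a2] [b1 b2] /andP[t0 t1]; have h (u v w : R) : `|u - w| < r -> `|v - w| < r ->
    `|u + t * (v - u) - w| < r.
  move=> h1 h2; pose m := Num.max `|u - w| `|v - w|.
  have mr : m < r by rewrite gt_max h1 h2.
  apply: le_lt_trans mr.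
  have : `|u - w| <= m by rewrite le_max lexx.
  have : `|v - w| <= m by rewrite le_max lexx orbT.
  rewrite !ler_norml => /andP[? ?] /andP[? ?]; apply/andP; split; nra.
by split; rewrite ?lerp1 ?lerp2; exact: h.
Qed.

Lemma box_push y v (r : R) : 0 < r -> exists2 e : R, 0 < e & forall t, `|t| <= e -> box y r (y + t *: v).
Proof.
move=> r0; have d0 : 0 < 1 + `|v.1| + `|v.2| by rewrite !ltr_wpDr.
exists (r / (2 * (1 + `|v.1| + `|v.2|))); first by rewrite divr_gt0// mulr_gt0.
move=> t; rewrite ler_pdivlMr ?mulr_gt0// => h.
have t0 := normr_ge0 t; have v1 := normr_ge0 v.1; have v2 := normr_ge0 v.2.
by split; rewrite /= /GRing.scale/= addrC addKr normrM; nra.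
Qed.

Lemma open_eball x (r : R) : open (eball x r).
Proof.
have [r0|r0] := ltP 0 r; last first.
  rewrite (_ : eball x r = set0); first exact: open0.
  by rewrite -subset0 => y; rewrite /eball/= ltNge (le_trans r0 (eucl_ge0 _ _)).
have -> : eball x r = (dist2 x) @^-1` [set t | t < r ^+ 2].
  by apply/seteqP; split => y; rewrite /eball/= eucl_lt// ltW.
apply: open_comp => [y _|]; last exact: open_lt.
have C := C1dD (C1dX 2 (C1dB (C1d_cst x.1) (@C1d_fst R))) (C1dX 2 (C1dB (C1d_cst x.2) (@C1d_snd R))).
exact: (C1d_continuous C).
Qed.

Lemma cr_push P Q y (e : R) : cr P Q (y + e *: (- (Q.2 - P.2), Q.1 - P.1)) = cr P Q y + e * dist2 Q P.
Proof. by rewrite /cr /dist2 /= /GRing.scale/=; ring. Qed.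

Lemma open_seg_mid P Q : open_seg P Q (lerp P Q 2^-1).
Proof. by exists 2^-1 => //=; rewrite in_itv/= invr_gt0 ltr0n/= invf_lt1 ?ltr1n. Qed.

Lemma box_min y (r1 r2 : R) x : box y (Num.min r1 r2) x -> box y r1 x /\ box y r2 x.
Proof.
move=> [x1 x2]; split; split; [apply: lt_le_trans x1 _|apply: lt_le_trans x2 _|
  apply: lt_le_trans x1 _|apply: lt_le_trans x2 _]; by rewrite ge_min lexx ?orbT.
Qed.

Lemma edge_side_inj E P Q s s' : P != Q -> edge_side E P Q s -> edge_side E P Q s' -> s = s'.
Proof.
move=> PQ [s1 hs] [s'1 hs'].
have [r r0 hr] := hs _ (open_seg_mid P Q); have [r' r'0 hr'] := hs' _ (open_seg_mid P Q).
have rr : 0 < Num.min r r' by rewrite lt_min r0.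
have [e e0 he] := box_push (lerp P Q 2^-1) (- (Q.2 - P.2), Q.1 - P.1) rr.
have := he e; rewrite gtr0_norm// lexx => /(_ isT) /box_min[/hr h /hr' h'].
have := dist2_gt0 PQ; move: h h'; rewrite cr_push cr_line add0r => h h' d0.
have d1 := mulr_gt0 e0 d0; set t := e * _ in h h' d1.
move/eqP: s1; move/eqP: s'1; rewrite !sqrf_eq1 => /orP[/eqP s'E|/eqP s'E] /orP[/eqP sE|/eqP sE];
  rewrite s'E sE// in h h' *; exfalso.
- have /h : region E (lerp P Q 2^-1 + e *: (- (Q.2 - P.2), Q.1 - P.1)) by apply/h'; lra.
  lra.
- have /h' : region E (lerp P Q 2^-1 + e *: (- (Q.2 - P.2), Q.1 - P.1)) by apply/h; lra.
  lra.
Qed.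

(** A whole ball of centres keeps them away from the lines through the
    edges. *)
Definition star E x0 (r0 : R) := [/\ 0 < r0, eball x0 r0 `<=` region E &
  forall y x, eball x0 r0 y -> region E x -> seg y x `<=` region E].

Lemma edge_neq E P Q : simple_polygon E -> (P, Q) \in edges E -> P != Q.
Proof.
move=> [[n3 uv] _ _ _ _] /edgesP[i iN [-> ->]].
have n0 : (0 < size (verts E))%N by apply: leq_trans n3.
rewrite /vert nth_uniq ?ltn_mod// modn_small//.
have [h|h] := ltnP i.+1 (size (verts E)); first by rewrite modn_small// neq_ltn ltnSn.
have E1 : i.+1 = size (verts E) by apply/eqP; rewrite eqn_leq iN h.
by rewrite E1 modnn -lt0n -ltnS E1 (leq_trans _ n3).
Qed.

Lemma bdP E y : simple_polygon E -> bd E y <-> closure E y /\ ~ region E y.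
Proof. by move=> [_ _ [_ oE] _ _]; rewrite /bd (proj1 (interior_id _) oE). Qed.

Lemma open_edge_notin E P Q y : simple_polygon E -> (P, Q) \in edges E -> open_seg P Q y -> closure E y /\ ~ region E y.
Proof.
move=> sE PQE oy; apply/bdP => //; have [_ _ _ _ ->] := sE.
by exists (P, Q) => //=; exact: open_seg_seg.
Qed.

(** The other edges are closed and avoid y, so they stay at a positive
    distance from it. *)
Lemma bd_local E P Q y : simple_polygon E -> (P, Q) \in edges E -> open_seg P Q y ->
  exists2 r : R, 0 < r & forall x, box y r x -> (bd E x <-> cr P Q x = 0).
Proof.
move=> sE PQE oy; have PQ := edge_neq sE PQE; have [_ _ _ _ bdE] := sE.
have [r1 r10 hr1] := line_in_seg PQ oy.
have [l|r2 r20 hr2] := @isolate [seq l <- edges E | l != (P, Q)] y.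
  rewrite mem_filter => /andP[lPQ lE] sy; move/eqP: lPQ; apply.
  by apply/esym; exact: (@other_edge E (P, Q) l y sE PQ PQE lE oy sy).
exists (Num.min r1 r2); first by rewrite lt_min r10.
move=> x /box_min[x1 x2]; split.
  rewrite bdE => -[l lE sx]; have [ll|nl] := eqVneq l (P, Q).
    by move: sx; rewrite ll => -[t _ <-]; exact: cr_line.
  exfalso; apply: (hr2 l x) => //; first by rewrite mem_filter nl.
by move=> cx; rewrite bdE; exists (P, Q) => //=; exact: hr1.
Qed.

(** Near y, whatever part of the polygon lies on one side of the line fills
    this side. If the polygon were present beyond the edge, the segment from
    the centre c to a point beyond y would stay in the polygon although it
    meets the edge at y. *)
Lemma star_side E x0 r0 P Q c s : simple_polygon E -> star E x0 r0 -> (P, Q) \in edges E ->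
  eball x0 r0 c -> s ^+ 2 = 1 -> 0 < s * cr P Q c -> edge_side E P Q s.
Proof.
move=> sE [r00 B0E star] PQE Bc s1 sc; split=> // y oy.
have PQ := edge_neq sE PQE; have [_ _ [_ oE] _ _] := sE.
have [r r_gt0 hr] := bd_local sE PQE oy; exists r => //.
have cry : cr P Q y = 0 by case: oy => t _ <-; exact: cr_line.
have [cy nEy] := open_edge_notin sE PQE oy.
have half (s' : R) x z : box y r x -> box y r z -> region E x ->
    0 < s' * cr P Q x -> 0 < s' * cr P Q z -> region E z.
  move=> Bx Bz Ex sx sz; apply: (seg_in (x := x) (y := z) oE Ex).
    move=> w [t /=]; rewrite in_itv/= => t01 <- cw.
    apply: contrapT => nw; have Bw := box_lerp Bx Bz t01.
    have /(hr _ Bw) : bd E (lerp x z t) by apply/bdP.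
    rewrite cr_lerp => /(congr1 ( *%R s')); rewrite mulr0 mulrDr !(mulrCA s').
    case/andP: t01 => t0 t1 e0.
    have [t00|t00] := eqVneq t 0.
      by move: e0; rewrite t00 mul0r addr0 subr0 mul1r => e0; rewrite e0 ltxx in sx.
    have tp : 0 < t by rewrite lt_neqAle eq_sym t00.
    by have := mulr_gt0 tp sz; have := mulr_ge0 (_ : 0 <= 1 - t) (ltW sx); rewrite subr_ge0 => /(_ t1); lra.
  by exists 1; rewrite /= ?in_itv/= ?ler01 ?lexx// lerpE scale1r addrC subrK.
have far x : box y r x -> region E x -> ~ s * cr P Q x < 0.
  move=> Bx Ex sx; have [e e0 he] := box_push y (y - c) r_gt0.
  have := he e; rewrite gtr0_norm// lexx => /(_ isT); set z := y + _ => Bz.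
  have crz : cr P Q z = - e * cr P Q c.
    by rewrite -[RHS]addr0 -[X in _ + X](mulr0 (1 + e)) -cry /z /cr /= /GRing.scale/=; ring.
  have /(star c) : region E z.
    by apply: (half (- s) x z) => //; rewrite ?crz; have := mulr_gt0 e0 sc; lra.
  move=> hz; apply: nEy; apply: (hz Bc); exists (1 + e)^-1.
    rewrite /= in_itv/= invr_ge0 addr_ge0 ?(ltW e0)//= invf_le1 ?lerDl ?ltW//.
    by rewrite ltr_wpDl.
  rewrite /z lerpE addrAC -[X in X + e *: _](scale1r (y - c)) -scalerDl scalerA mulVf ?scale1r.
    by rewrite addrC subrK.
  by rewrite gt_eqF// addr_gt0.
have ne0 x : box y r x -> region E x -> s * cr P Q x != 0.
  move=> Bx Ex; have s0 : s != 0 by rewrite -sqrf_eq0 s1 oner_eq0.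
  rewrite mulf_neq0//; apply/eqP => /(hr _ Bx)/(bdP _ sE)[_]; exact.
have pos x : box y r x -> region E x -> 0 < s * cr P Q x.
  by move=> Bx Ex; rewrite lt_neqAle eq_sym ne0//= leNgt; apply/negP; exact: far.
move=> x Bx; split; first exact: pos.
move=> sx; have /closure_boxP/(_ r r_gt0)[z Ez Bz] := cy.
exact: (half s z x Bz Bx Ez (pos z Bz Ez) sx).
Qed.

(** A centre on the line could be moved slightly to both sides, and
    [star_side] would orient the edge in both ways. *)
Lemma star_sided E x0 r0 P Q c : simple_polygon E -> star E x0 r0 -> (P, Q) \in edges E ->
  eball x0 r0 c -> cr P Q c != 0.
Proof.
move=> sE stE PQE Bc; apply/eqP => c0; have PQ := edge_neq sE PQE.
have /open_boxP/(_ c Bc)[r r_gt0 hr] := @open_eball x0 r0.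
have [e e0 he] := box_push c (- (Q.2 - P.2), Q.1 - P.1) r_gt0.
have d0 := mulr_gt0 e0 (dist2_gt0 PQ).
have s1 : edge_side E P Q 1.
  apply: (star_side sE stE PQE (hr _ (he e _))); rewrite ?gtr0_norm// ?expr1n//.
  by rewrite cr_push c0 add0r mul1r.
have s2 : edge_side E P Q (-1).
  apply: (star_side sE stE PQE (hr _ (he (- e) _))); rewrite ?normrN ?gtr0_norm// ?sqrrN ?expr1n//.
  by rewrite cr_push c0 add0r mulN1r mulNr opprK.
by have := edge_side_inj PQ s1 s2; lra.
Qed.

(** Each centre orients the edge by [star_side], and the orientation is
    unique. *)
Lemma edge_side_exists E x0 r0 P Q : simple_polygon E -> star E x0 r0 -> (P, Q) \in edges E ->
  exists2 s, edge_side E P Q s & forall c, eball x0 r0 c -> 0 < s * cr P Q c.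
Proof.
move=> sE stE PQE; have PQ := edge_neq sE PQE; have [r00 _ _] := stE.
have Bx0 : eball x0 r0 x0 by rewrite /eball/= eucl_lt ?(ltW r00)// /dist2 !subrr expr0n addr0 exprn_gt0.
have sg c : eball x0 r0 c -> [/\ Num.sg (cr P Q c) ^+ 2 = 1, 0 < Num.sg (cr P Q c) * cr P Q c & edge_side E P Q (Num.sg (cr P Q c))].
  move=> Bc; have c0 := star_sided sE stE PQE Bc.
  have a : Num.sg (cr P Q c) ^+ 2 = 1 by rewrite sqr_sg c0.
  have b : 0 < Num.sg (cr P Q c) * cr P Q c by rewrite -normrEsg normr_gt0.
  by split => //; exact: (star_side sE stE PQE Bc).
exists (Num.sg (cr P Q x0)); first by have [] := sg _ Bx0.
move=> c Bc; have [_ _ h] := sg _ Bx0; have [_ h1 h2] := sg _ Bc.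
by rewrite (edge_side_inj PQ h h2).
Qed.

End EdgeSide.

(** * Shape-regular polygons *)

Section Shape.
Context {R : realType}.
Implicit Types (x y z c P Q : plane R) (E : polygon R).

Lemma diam_gt0 E : simple_polygon E -> 0 < diam E.
Proof.
move=> [_ _ [[e Ee] oE] [bE _] _].
have [r r0 hr] := (open_boxP _).1 oE e Ee.
have h : region E (e + (r / 2, 0)).
  by apply: hr; split; rewrite /= addrC addKr ?normr0// gtr0_norm ?divr_gt0//; lra.
have := eucl_ediam bE Ee h; have := abs1_le_eucl e (e + (r / 2, 0)).
rewrite /= opprD addrA subrr add0r normrN gtr0_norm ?divr_gt0// => h1 h2.
by apply: lt_le_trans h2; apply: lt_le_trans h1; rewrite divr_gt0.
Qed.

Definition regular (CT : R) E := [/\ simple_polygon E, 0 < CT & shape_regular CT E].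

Lemma regular_star CT E : regular CT E -> exists x0, star E x0 (CT * diam E).
Proof.
move=> [sE CT0 [_ [x0 [B st]]]]; exists x0; split => //.
by rewrite mulr_gt0 ?diam_gt0.
Qed.

Lemma edge_closure E l x : simple_polygon E -> l \in edges E -> seg l.1 l.2 x -> closure E x.
Proof.
move=> sE lE sx; have /(bdP _ sE)[] // : bd E x.
by have [_ _ _ _ ->] := sE; exists l.
Qed.

Lemma seg_end1 P Q : seg P Q P.
Proof. by exists 0; rewrite /= ?in_itv/= ?lexx ?ler01// lerpE scale0r addr0. Qed.

Lemma seg_end2 P Q : seg P Q Q.
Proof. by exists 1; rewrite /= ?in_itv/= ?lexx ?ler01// lerpE scale1r addrC subrK. Qed.

Lemma edge_len E CT l : regular CT E -> l \in edges E ->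
  CT * diam E < eucl l.1 l.2 /\ eucl l.1 l.2 <= diam E.
Proof.
move=> [sE _ [h _]] lE; split; first exact: h.
have [_ _ _ [bE _] _] := sE.
apply: eucl_closure => //; apply: (edge_closure sE lE); [exact: seg_end1|exact: seg_end2].
Qed.

Lemma regular_lt1 E CT : regular CT E -> CT < 1.
Proof.
move=> rE; have [sE CT0 _] := rE.
have [[n3 _] _ _ _ _] := sE.
have lE : (vert E 0, vert E 1) \in edges E.
  by apply/edgesP; exists 0%N => //; apply: leq_trans n3.
have [h1 h2] := edge_len rE lE.
have d0 := diam_gt0 sE; have := lt_le_trans h1 h2; nra.
Qed.

(** A centre moved towards the line by half the radius is still on the inner
    side. *)
Lemma star_far E x0 r0 P Q s : simple_polygon E -> star E x0 r0 -> (P, Q) \in edges E ->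
  edge_side E P Q s -> r0 / 2 * eucl P Q < s * cr P Q x0.
Proof.
move=> sE stE PQE es; have PQ := edge_neq sE PQE; have [r00 _ _] := stE.
have [s' es' h] := edge_side_exists sE stE PQE.
have ss := edge_side_inj PQ es es'; rewrite -{s' es'}ss in h.
have [s1 _] := es.
have d0 := dist2_gt0 PQ; have L0 : 0 < eucl P Q by rewrite euclC /eucl sqrtr_gt0.
have LL := eucl_sq P Q; have dC : dist2 P Q = dist2 Q P by rewrite /dist2; ring.
rewrite dC in LL.
have hB : eball x0 r0 (x0 + (- (s * (r0 / 2) / eucl P Q)) *: (- (Q.2 - P.2), Q.1 - P.1)).
  rewrite /eball/= eucl_lt ?(ltW r00)// /dist2/=.
  have -> : (x0.1 - (x0 + (- (s * (r0 / 2) / eucl P Q)) *: (- (Q.2 - P.2), Q.1 - P.1)).1) ^+ 2 +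
    (x0.2 - (x0 + (- (s * (r0 / 2) / eucl P Q)) *: (- (Q.2 - P.2), Q.1 - P.1)).2) ^+ 2
    = s ^+ 2 * (r0 / 2) ^+ 2 * (dist2 Q P / eucl P Q ^+ 2).
    by rewrite /= /GRing.scale/= /dist2; field; rewrite gt_eqF.
  by rewrite s1 LL divff ?gt_eqF// mulr1 mul1r; nra.
have := h _ hB; rewrite cr_push.
have -> : s * (cr P Q x0 + - (s * (r0 / 2) / eucl P Q) * dist2 Q P) =
  s * cr P Q x0 - s ^+ 2 * (r0 / 2 * (eucl P Q ^+ 2 / eucl P Q)).
  by rewrite LL; field; rewrite gt_eqF.
by rewrite s1 expr2 mulfK ?gt_eqF// mul1r subr_gt0.
Qed.

(** Close to y the ray is on the inner side of the edge, and star-shapedness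
    takes care of the rest. *)
Lemma ray_in E x0 r0 P Q y (t : R) : simple_polygon E -> star E x0 r0 -> (P, Q) \in edges E ->
  open_seg P Q y -> 0 <= t -> t < 1 -> region E (lerp x0 y t).
Proof.
move=> sE stE PQE oy t0 t1; have [s es far] := edge_side_exists sE stE PQE.
have [r00 Bx st] := stE; have [s1 hs] := es; have [r r_gt0 hr] := hs y oy.
have Bx0 : eball x0 r0 x0 by rewrite /eball/= eucl_lt ?(ltW r00)// /dist2 !subrr expr0n addr0 exprn_gt0.
have [e e0 he] := box_push y (x0 - y) r_gt0.
have t1' : 0 < 1 - t by rewrite subr_gt0.
pose d := Num.min e (1 - t); have d0 : 0 < d by rewrite lt_min e0.
have de : d <= e by rewrite ge_min lexx.
have dt : d <= 1 - t by rewrite ge_min lexx orbT.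
have d1 : d < 1 \/ t = 0.
  by have [->|tn] := eqVneq t 0; [right|left; have : 0 < t by [rewrite lt_neqAle eq_sym tn]; lra].
case: d1 => [d1|->]; last by rewrite lerpE scale0r addr0; exact: Bx.
have zE : region E (lerp x0 y (1 - d)).
  have -> : lerp x0 y (1 - d) = y + d *: (x0 - y).
    by apply: injective_projections; rewrite ?lerp1 ?lerp2 /= /GRing.scale/=; ring.
  apply/hr; first by apply: he; rewrite gtr0_norm.
  have cy : cr P Q y = 0 by case: oy => u _ <-; exact: cr_line.
  have -> : y + d *: (x0 - y) = lerp y x0 d by rewrite lerpE.
  by rewrite cr_lerp cy mulr0 add0r mulrCA mulr_gt0// far.
apply: (st x0 _ Bx0 zE); exists (t / (1 - d)).
  by rewrite /= in_itv/= divr_ge0 ?subr_ge0 ?(ltW d1)//= ler_pdivrMr ?subr_gt0// mul1r; lra.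
apply: injective_projections; rewrite ?lerp1 ?lerp2; field; rewrite subr_eq0 gt_eqF//.
Qed.

(** Otherwise the end of one ray is an inner point of the other one, which
    lies in the polygon by [ray_in], or the two edges have a common point. *)
Lemma ray_inj E x0 r0 l l' y y' (t t' : R) : simple_polygon E -> star E x0 r0 ->
  l \in edges E -> l' \in edges E -> open_seg l.1 l.2 y -> open_seg l'.1 l'.2 y' ->
  0 < t -> t < 1 -> 0 < t' -> t' < 1 -> lerp x0 y t = lerp x0 y' t' -> l = l'.
Proof.
move=> sE stE; wlog le : l l' y y' t t' / t <= t'.
  move=> W lE l'E oy oy' t0 t1 t'0 t'1 tt'; have [le|le] := leP t t'; first exact: (W l l' y y' t t').
  by apply/esym; apply: (W l' l y' y t' t) => //; exact: ltW.
move=> lE l'E oy oy' t0 t1 t'0 t'1 tt'.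
  have tn : t' != 0 by rewrite gt_eqF.
  have y'E : y' = lerp x0 y (t / t').
    have h1 := congr1 fst tt'; have h2 := congr1 snd tt'.
    rewrite !lerp1 in h1; rewrite !lerp2 in h2.
    apply: injective_projections; rewrite ?lerp1 ?lerp2.
      by have -> : y'.1 = x0.1 + (x0.1 + t' * (y'.1 - x0.1) - x0.1) / t' by [field]; rewrite -h1; field.
    by have -> : y'.2 = x0.2 + (x0.2 + t' * (y'.2 - x0.2) - x0.2) / t' by [field]; rewrite -h2; field.
  case: l' => P' Q' in l'E oy' *; case: l => P Q in lE oy *.
  have [tt|tt] := eqVneq t t'.
    have yy : y' = y by rewrite y'E tt divff// lerpE scale1r addrC subrK.
    apply: (@other_edge R E (P, Q) (P', Q') y sE (edge_neq sE lE) lE l'E oy).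
    by rewrite -yy; exact: open_seg_seg.
  have [_] := open_edge_notin sE l'E oy'; rewrite y'E => -[].
  apply: (ray_in sE stE lE oy); first by rewrite divr_ge0// ltW.
  by rewrite ltr_pdivrMr// mul1r lt_neqAle tt.
Qed.

(** The ray from the centre through x reaches the line of the edge. Since x
    is low in comparison with the centre ([star_far]) and the position of
    the centre along the line is bounded by 1 / CT, the foot is close to
    that of x and remains inside the edge. *)
Lemma rect_ray E CT x0 P Q s x : regular CT E -> star E x0 (CT * diam E) -> (P, Q) \in edges E ->
  edge_side E P Q s -> 4^-1 <= tc P Q x <= 3 / 4 -> 0 < s * cr P Q x ->
  s * cr P Q x <= CT ^+ 2 / 64 * dist2 Q P ->
  exists y t, [/\ open_seg P Q y, 0 < t, t < 1 & x = lerp x0 y t].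
Proof.
move=> rE stE PQE es tx cx0 cx; have [sE CT0 _] := rE.
have PQ := edge_neq sE PQE; have d0 := diam_gt0 sE; have CT1 := regular_lt1 rE.
have [Ll Lu] := edge_len rE PQE; rewrite /= in Ll Lu.
have far := star_far sE stE PQE es.
have dd : dist2 Q P = eucl P Q ^+ 2 by rewrite eucl_sq /dist2; ring.
have L0 : 0 < eucl P Q by apply: lt_trans Ll; rewrite mulr_gt0.
set L := eucl P Q in Ll Lu far dd L0; set D := diam E in d0 Ll Lu far.
set h := s * cr P Q x0 in far; set q := s * cr P Q x in cx0 cx.
have h0 : 0 < h by apply: lt_trans far; rewrite mulr_gt0// divr_gt0// mulr_gt0.
(* 1 - t is the relative height of x *)
have qh : q <= CT / 32 * h.
  rewrite dd in cx; apply: le_trans cx _.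
  have : CT / 32 * (CT * D / 2 * L) <= CT / 32 * h by rewrite ler_pM2l ?ltW// divr_gt0.
  apply: le_trans; have -> : CT / 32 * (CT * D / 2 * L) = CT ^+ 2 / 64 * (D * L) by field.
  by rewrite ler_wpM2l ?expr2 ?ler_wpM2r// ?(ltW L0)// divr_ge0// mulr_ge0// ltW.
pose t := 1 - q / h; have hn : h != 0 by rewrite gt_eqF.
have qh' : q / h <= CT / 32 by rewrite ler_pdivrMr.
have qh0 : 0 < q / h by rewrite divr_gt0.
have t0 : 2^-1 < t by rewrite /t; lra.
have tn : t != 0 by rewrite gt_eqF//; lra.
exists (x0 + t^-1 *: (x - x0)), t; split; last first.
- by rewrite lerpE addrAC subrr add0r scalerA divff// scale1r addrC subrK.
- by rewrite /t; lra.
- by lra.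
have Bx0 : closure E x0.
  apply: subset_closure; have [r00 + _] := stE; apply.
  by rewrite /eball/= eucl_lt ?(ltW r00)// /dist2 !subrr expr0n addr0 exprn_gt0.
have bE : bounded_set (region E) by have [_ _ _ []] := sE.
have e1 : eucl x0 P <= D by apply: eucl_closure => //; apply: (edge_closure sE PQE); exact: seg_end1.
have tcb : `|tc P Q x0| <= CT^-1.
  have cs : ((Q.1 - P.1) * (x0.1 - P.1) + (Q.2 - P.2) * (x0.2 - P.2)) ^+ 2 <= (L * D) ^+ 2.
    apply: (@le_trans _ _ (dist2 Q P * dist2 x0 P)).
      rewrite -subr_ge0.
      have -> : dist2 Q P * dist2 x0 P - ((Q.1 - P.1) * (x0.1 - P.1) + (Q.2 - P.2) * (x0.2 - P.2)) ^+ 2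
        = ((Q.1 - P.1) * (x0.2 - P.2) - (Q.2 - P.2) * (x0.1 - P.1)) ^+ 2 by rewrite /dist2; ring.
      exact: sqr_ge0.
    rewrite dd exprMn ler_wpM2l ?sqr_ge0// -eucl_sq ler_sqr ?nnegrE ?eucl_ge0// ltW//.
  rewrite /tc dd normrM normfV (ger0_norm (sqr_ge0 L)) ler_pdivrMr ?exprn_gt0//.
  apply: (@le_trans _ _ (L * D)).
    rewrite -ler_sqr ?nnegrE ?mulr_ge0 ?(ltW L0) ?(ltW d0)//.
    by rewrite real_normK ?num_real.
  by rewrite expr2 mulrCA ler_wpM2l ?(ltW L0)// mulrC ler_pdivlMr// mulrC ltW.
set y := x0 + _.
have tcy : tc P Q y = tc P Q x + (1 - t) / t * (tc P Q x - tc P Q x0).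
  by rewrite /y /tc /= /GRing.scale/=; field; rewrite tn gt_eqF// dd exprn_gt0.
have cry : cr P Q y = 0.
  have s1 := es.1; have sn : s != 0 by rewrite -sqrf_eq0 s1 oner_eq0.
  apply: (mulfI sn); rewrite mulr0.
  have -> : s * cr P Q y = h + t^-1 * (q - h).
    by rewrite /h /q /y /cr /= /GRing.scale/=; ring.
  by rewrite /t; field; rewrite hn subr_eq0 gt_eqF//; nra.
have shift : `|(1 - t) / t * (tc P Q x - tc P Q x0)| <= 16^-1 + CT / 16.
  have a1 : 0 <= (1 - t) / t <= CT / 16.
    rewrite divr_ge0 ?ler_pdivrMr /=; rewrite /t; try lra; nra.
  have a2 : `|tc P Q x - tc P Q x0| <= 1 + CT^-1.
    by apply: le_trans (ler_normB _ _) _; rewrite lerD// ger0_norm; lra.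
  rewrite normrM (ger0_norm (andP a1).1).
  have -> : 16^-1 + CT / 16 = CT / 16 * (1 + CT^-1) by field; rewrite gt_eqF.
  by rewrite ler_pM ?(andP a1).1 ?(andP a1).2.
exists (tc P Q y); last by rewrite [RHS](edge_coords _ PQ) cry mul0r scale0r addr0 lerpE.
move: shift; rewrite ler_norml => /andP[? ?]; rewrite /= in_itv/=.
by apply/andP; split; rewrite tcy; lra.
Qed.

Lemma rect_in E CT P Q s x : regular CT E -> (P, Q) \in edges E ->
  edge_side E P Q s -> 4^-1 <= tc P Q x <= 3 / 4 -> 0 < s * cr P Q x ->
  s * cr P Q x <= CT ^+ 2 / 64 * dist2 Q P -> region E x.
Proof.
move=> rE PQE es tx c0 c1; have [x0 stE] := regular_star rE; have [sE _ _] := rE.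
have [y [t [oy t0 t1 ->]]] := rect_ray rE stE PQE es tx c0 c1.
by apply: (ray_in sE stE PQE oy) => //; exact: ltW.
Qed.

Lemma tc_box P Q y x (c : R) : P != Q -> 0 <= c -> box y (c * eucl P Q) x ->
  `|tc P Q x - tc P Q y| <= 2 * c /\ `|cr P Q x - cr P Q y| <= 2 * c * dist2 Q P.
Proof.
move=> PQ c0 [x1 x2]; have d0 := dist2_gt0 PQ.
have dd : dist2 Q P = eucl P Q ^+ 2 by rewrite eucl_sq /dist2; ring.
have L0 : 0 < eucl P Q by rewrite euclC /eucl sqrtr_gt0.
have d1 : `|Q.1 - P.1| <= eucl P Q by rewrite euclC; exact: abs1_le_eucl.
have d2 : `|Q.2 - P.2| <= eucl P Q by rewrite euclC; exact: abs2_le_eucl.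
have b (u v u' v' : R) : `|u| <= eucl P Q -> `|v| <= eucl P Q -> `|u'| <= c * eucl P Q ->
    `|v'| <= c * eucl P Q -> `|u * u' + v * v'| <= 2 * c * dist2 Q P.
  move=> hu hv hu' hv'; apply: le_trans (ler_normD _ _) _; rewrite !normrM dd.
  have := ler_pM (normr_ge0 _) (normr_ge0 _) hu hu'; have := ler_pM (normr_ge0 _) (normr_ge0 _) hv hv'.
  lra.
split.
  have -> : tc P Q x - tc P Q y = ((Q.1 - P.1) * (x.1 - y.1) + (Q.2 - P.2) * (x.2 - y.2)) / dist2 Q P.
    by rewrite /tc; field; rewrite gt_eqF.
  by rewrite normrM normfV (gtr0_norm d0) ler_pdivrMr//; apply: b => //; exact: ltW.
have -> : cr P Q x - cr P Q y = (Q.1 - P.1) * (x.2 - y.2) + (- (Q.2 - P.2)) * (x.1 - y.1).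
  by rewrite /cr; ring.
by apply: b; rewrite ?normrN//; exact: ltW.
Qed.

Lemma half_box_in E CT P Q s x : regular CT E -> (P, Q) \in edges E -> edge_side E P Q s ->
  box (lerp P Q 2^-1) (CT ^+ 2 / 128 * eucl P Q) x -> 0 < s * cr P Q x -> region E x.
Proof.
move=> rE PQE es Bx cx; have [sE CT0 _] := rE; have PQ := edge_neq sE PQE.
have CT1 := regular_lt1 rE.
have k0 : 0 <= CT ^+ 2 / 128 by rewrite divr_ge0// sqr_ge0.
have k1 : CT ^+ 2 < 1 by rewrite expr2; nra.
have [] := tc_box PQ k0 Bx; rewrite cr_line subr0 (tc_lerp _ PQ) => h1 h2.
apply: (rect_in rE PQE es) => //.
  by move: h1; rewrite ler_norml => /andP[? ?]; apply/andP; split; lra.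
apply: le_trans (ler_norm _) _; rewrite normrM.
have -> : `|s| = 1 by apply/eqP; rewrite -sqrp_eq1 // real_normK ?num_real// es.1.
by rewrite mul1r; lra.
Qed.

End Shape.

Section EdgeCount.
Context {R : realType}.
Implicit Types (x y z c P Q : plane R) (E : polygon R).

(** The box is centred at half the height of the rectangle in [rect_ray].
    Its size is a multiple of the diameter, which does not depend on the
    edge. *)
Lemma edge_box E CT x0 l : regular CT E -> star E x0 (CT * diam E) -> l \in edges E ->
  exists c, forall x, box c (CT ^+ 3 / 64 / 8 * diam E) x ->
    region E x /\ exists y t, [/\ open_seg l.1 l.2 y, 0 < t, t < 1 & x = lerp x0 y t].
Proof.
case: l => P Q rE stE lE /=; have [sE CT0 _] := rE; have PQ := edge_neq sE lE.
have [s es _] := edge_side_exists sE stE lE; have CT1 := regular_lt1 rE.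
have [Ll _] := edge_len rE lE; rewrite /= in Ll; have D0 := diam_gt0 sE.
have d0 := dist2_gt0 PQ; have s1 := es.1.
have sn : `|s| = 1 by apply/eqP; rewrite -sqrp_eq1 // real_normK ?num_real// s1.
pose k := CT ^+ 2 / 64; have k0 : 0 < k by rewrite divr_gt0// exprn_gt0.
have k1 : k < 1/64 by rewrite /k ltr_pM2r// expr2; nra.
pose c := lerp P Q 2^-1 + (s * (k / 2)) *: (- (Q.2 - P.2), Q.1 - P.1).
exists c => x Bx.
have {}Bx : box c (k / 8 * eucl P Q) x.
  have h : CT ^+ 3 / 64 / 8 * diam E < k / 8 * eucl P Q.
    have -> : CT ^+ 3 / 64 / 8 * diam E = k / 8 * (CT * diam E) by rewrite /k; field.
    by rewrite ltr_pM2l// divr_gt0.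
  by case: Bx => b1 b2; split; [apply: lt_trans b1 h|apply: lt_trans b2 h].
have [] := tc_box PQ (_ : 0 <= k / 8) Bx; first by rewrite divr_ge0// ltW.
have -> : tc P Q c = 2^-1.
  rewrite -[RHS](tc_lerp 2^-1 PQ) /c /tc; congr (_ / _); rewrite /= /GRing.scale/=; ring.
rewrite cr_push cr_line add0r => h1 h2.
have h3 : `|s * cr P Q x - k / 2 * dist2 Q P| <= k / 4 * dist2 Q P.
  have -> : s * cr P Q x - k / 2 * dist2 Q P = s * (cr P Q x - s * (k / 2) * dist2 Q P).
    have -> : s * (cr P Q x - s * (k / 2) * dist2 Q P) = s * cr P Q x - s ^+ 2 * (k / 2 * dist2 Q P) by ring.
    by rewrite s1 mul1r.
  by rewrite normrM sn mul1r; apply: le_trans h2 _; lra.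
have kd : 0 < k * dist2 Q P by rewrite mulr_gt0.
move: h1 h3; rewrite !ler_norml => /andP[? ?] /andP[? ?].
have h4 : 4^-1 <= tc P Q x <= 3 / 4 by apply/andP; split; lra.
have h5 : 0 < s * cr P Q x by lra.
have h6 : s * cr P Q x <= CT ^+ 2 / 64 * dist2 Q P by rewrite -/k; lra.
split; first exact: (rect_in rE lE es h4 h5 h6).
exact: (rect_ray rE stE lE es h4 h5 h6).
Qed.

(** Bump functions on the boxes of [edge_box] have disjoint supports by
    [ray_inj], so their sum is at most 1. Integration over a box of size
    comparable to the polygon counts them. *)
Lemma edges_bound (CT : R) : exists2 M : R, 0 < M & forall E, regular CT E -> (size (edges E))%:R <= M.
Proof.
(* the summand 1 makes the bound positive even for a = 0 *)
pose a := CT ^+ 3 / 64 / 8; exists (64 * a ^- 2 + 1).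
  by rewrite ltr_wpDl// mulr_ge0// invr_ge0 sqr_ge0.
move=> E rE; have [x0 stE] := regular_star rE; have [sE CT0 _] := rE; have D0 := diam_gt0 sE.
have a0 : 0 < a by apply: divr_gt0; [apply: divr_gt0; [exact: exprn_gt0|]|].
set D := diam E in D0; have r0 : 0 < a * D by rewrite mulr_gt0.
have [n3 un] : (3 <= size (verts E))%N /\ uniq (verts E) by case: sE.
have ue : uniq (edges E).
  apply: (@map_uniq _ _ fst); rewrite -/(unzip1 _) unzip1_zip// size_rot//.
have /choice[c hc] : forall l, exists c, l \in edges E -> forall x, box c (a * D) x ->
    region E x /\ exists y t, [/\ open_seg l.1 l.2 y, 0 < t, t < 1 & x = lerp x0 y t].
  move=> l; have [lE|] := boolP (l \in edges E); last by exists 0.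
  by have [c hc] := edge_box rE stE lE; exists c.
pose B := box x0 (2 * D); have mB : measurable B by exact: measurable_box.
have Ex0 : region E x0.
  by have [r00 + _] := stE; apply; rewrite /eball/= eucl_lt ?(ltW r00)// /dist2 !subrr expr0n addr0 exprn_gt0.
have EB : region E `<=` B.
  move=> x Ex; have bE : bounded_set (region E) by have [_ _ _ []] := sE.
  have := eucl_ediam bE Ex Ex0; rewrite -/(diam E) -/D => h.
  split; [have := abs1_le_eucl x x0|have := abs2_le_eucl x x0]; lra.
pose F l := bump (c l) (a * D).
have Fi l : itg B (F l).
  apply: itg_continuous => //; first exact: box_bounded.
  exact: (C1d_continuous (C1d_bump _ _)).
have F1 x : B x -> \sum_(l <- edges E) F l x <= 1.
  move=> _; have [[l lE Fl]|h] := pselect (exists2 l, l \in edges E & F l x != 0); last first.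
    rewrite big_seq big1// => l lE; apply/eqP; apply: contrapT => /negP Fl; apply: h; by exists l.
  rewrite (big_rem l lE)/= big_seq big1 ?addr0 ?bump_le1// => l'.
  rewrite (mem_rem_uniq l ue) inE => /andP[ll l'E].
  apply/eqP; apply: contrapT => /negP Fl'; move/eqP: ll; apply.
  have inb l0 : F l0 x != 0 -> box (c l0) (a * D) x.
    by move=> h; apply: contrapT => nb; move: h; rewrite /F bump_out ?eqxx.
  have [_ [y [t [oy t0 t1 xE]]]] := hc l lE x (inb l Fl).
  have [_ [y' [t' [oy' t'0 t'1 xE']]]] := hc l' l'E x (inb l' Fl').
  by apply: (ray_inj sE stE l'E lE oy' oy t'0 t'1 t0 t1); rewrite -xE -xE'.
have mi : itg B (fun=> 1) by apply: itg_continuous => //; [exact: box_bounded|move=> ?; exact: cvg_cst].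
have S1 := I_le mB (itg_sum (edges E) mB Fi) mi F1.
move: S1; rewrite I_sum// I_cst// area_box ?mulr_ge0 ?(ltW D0)//= mul1r => S1.
have S2 l : l \in edges E -> 4^-1 * (a * D) ^+ 2 <= \int[area]_(y in B) F l y.
  move=> lE; have -> : 4^-1 * (a * D) ^+ 2 = 4^-1 * (2 * (a * D / 2)) ^+ 2 by congr (_ * _ ^+ 2); field.
  apply: (@I_ge_box _ B (F l) (c l)) => //.
  - by rewrite divr_ge0// ltW.
  - by move=> y _; exact: bump_ge0.
  - by move=> y [y1 y2]; apply: EB; apply: (hc l lE y _).1; split; lra.
  - by move=> y By; have := bump_half r0 By; rewrite div1r.
have : \sum_(l <- edges E) (4^-1 * (a * D) ^+ 2) <= (2 * (2 * D)) ^+ 2.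
  by apply: le_trans S1; rewrite big_seq [leRHS]big_seq; apply: ler_sum => l; exact: S2.
rewrite big_const_seq count_predT iter_addr_0 -[X in X <= _]mulr_natl.
set n := (size _)%:R => S3.
have nE : n * a ^+ 2 <= 64.
  rewrite -(ler_pM2r (_ : 0 < D ^+ 2)) ?exprn_gt0//.
  have -> : n * a ^+ 2 * D ^+ 2 = 4 * (n * (4^-1 * (a * D) ^+ 2)) by field.
  have -> : 64 * D ^+ 2 = 4 * (2 * (2 * D)) ^+ 2 by ring.
  by rewrite ler_pM2l.
apply: (@le_trans _ _ (64 * a ^- 2)); last by rewrite lerDl.
by rewrite ler_pdivlMr ?exprn_gt0.
Qed.

End EdgeCount.

(** * Outer normals *)

Section Sides.
Context {R : realType}.
Implicit Types (x y z P Q : plane R) (E : polygon R).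

(** The part of the box beyond the line is open and misses the polygon. *)
Lemma far_not_closure E P Q s y (r : R) x : (forall z, box y r z -> (region E z <-> 0 < s * cr P Q z)) ->
  box y r x -> s * cr P Q x < 0 -> ~ closure E x.
Proof.
move=> hr Bx sx cE.
have oU : open (box y r `&` (fun z => s * cr P Q z) @^-1` [set t | t < 0]).
  apply: openI; first exact: open_box.
  apply: open_comp => [z _|]; last exact: open_lt.
  exact: (C1d_continuous (C1dZ s (C1d_cr P Q))).
have [z [Ez [Bz /= sz]]] : (E `&` (box y r `&` (fun z => s * cr P Q z) @^-1` [set t | t < 0])) !=set0.
  by apply: cE; apply: open_nbhs_nbhs; split.
by have := (hr z Bz).1 Ez; rewrite ltNge (ltW sz).
Qed.

(** The unit normal of PQ that points away from the side s. *)
Definition nvec P Q (s : R) : 'cV[R]_2 :=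
  \col_i (if i == ord0 then s * (Q.2 - P.2) / eucl P Q else - (s * (Q.1 - P.1) / eucl P Q)).

(** Unit length and orthogonality to the edge leave two opposite vectors,
    and the position of the polygon near the midpoint selects one of them. *)
Lemma outer_normalE E P Q s : P != Q -> edge_side E P Q s -> outer_normal E (P, Q) = nvec P Q s.
Proof.
move=> PQ [s1 hs]; have d0 := dist2_gt0 PQ.
have L0 : 0 < eucl P Q by rewrite euclC /eucl sqrtr_gt0.
have dd : eucl P Q ^+ 2 = dist2 Q P by rewrite eucl_sq /dist2; ring.
have Ln : eucl P Q != 0 by rewrite gt_eqF.
have [r r0 hr] := hs _ (open_seg_mid P Q).
have crm (n : 'cV[R]_2) t : cr P Q (lerp P Q 2^-1 + t *: (n ord0 ord0, n ord_max ord0)) =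
    t * ((Q.1 - P.1) * n ord_max ord0 - (Q.2 - P.2) * n ord0 ord0).
  by rewrite -[RHS]addr0 -(cr_line P Q 2^-1) /cr /= /GRing.scale/=; ring.
apply: xget_unique => [|n [nn nd nn']].
  split.
  - rewrite frobv !mxE/=.
    have -> : s * (Q.2 - P.2) / eucl P Q * (s * (Q.2 - P.2) / eucl P Q) +
      - (s * (Q.1 - P.1) / eucl P Q) * - (s * (Q.1 - P.1) / eucl P Q) = s ^+ 2 * (dist2 Q P / eucl P Q ^+ 2).
      by rewrite /dist2; field.
    by rewrite s1 dd divff ?gt_eqF// mulr1.
  - by rewrite !mxE/=; field.
  have [e e0 he] := box_push (lerp P Q 2^-1) (nvec P Q s ord0 ord0, nvec P Q s ord_max ord0) r0.
  have crn t : s * cr P Q (lerp P Q 2^-1 + t *: (nvec P Q s ord0 ord0, nvec P Q s ord_max ord0)) = - (t * eucl P Q).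
    rewrite crm !mxE/=.
    have -> : s * (t * ((Q.1 - P.1) * - (s * (Q.1 - P.1) / eucl P Q) -
      (Q.2 - P.2) * (s * (Q.2 - P.2) / eucl P Q))) = - (t * (s ^+ 2 * (dist2 Q P / eucl P Q))).
      by rewrite /dist2; field.
    by rewrite s1 -dd; field.
  near=> t.
  have t0 : 0 < t by near: t; exact: nbhs_right_gt.
  have te : t < e by near: t; exact: nbhs_right_lt.
  split.
    apply: (far_not_closure hr); first by apply: he; rewrite gtr0_norm// ltW.
    by rewrite crn oppr_lt0 mulr_gt0.
  apply/hr; first by apply: he; rewrite normrN gtr0_norm// ltW.
  by rewrite crn mulNr opprK mulr_gt0.
have [e e0 he] := box_push (lerp P Q 2^-1) (n ord0 ord0, n ord_max ord0) r0.
near (0 : R)^'+ => t.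
have [_ Et] : ~ closure E (lerp P Q 2^-1 + t *: (n ord0 ord0, n ord_max ord0)) /\
  region E (lerp P Q 2^-1 + (- t) *: (n ord0 ord0, n ord_max ord0)) by near: t.
have t0 : 0 < t by near: t; exact: nbhs_right_gt.
have te : t < e by near: t; exact: nbhs_right_lt.
have := (hr _ (he (- t) _)).1 Et; rewrite normrN gtr0_norm// => /(_ (ltW te)).
rewrite crm; move: nn nd; rewrite frobv/=.
set n1 := n ord0 ord0; set n2 := n ord_max ord0 => nn nd.
set m := _ * n2 - _ => hm.
have m2 : m ^+ 2 = dist2 Q P.
  have -> : m ^+ 2 = dist2 Q P * (n1 * n1 + n2 * n2) - (n1 * (Q.1 - P.1) + n2 * (Q.2 - P.2)) ^+ 2.
    by rewrite /m /dist2; ring.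
  by rewrite nn nd expr0n/= subr0 mulr1.
have sm : s * m < 0 by have := pmulr_lgt0 (- (s * m)) t0; have -> : - (s * m) * t = s * (- t * m) by [ring]; lra.
have mE : m = - (s * eucl P Q).
  have : (s * m) ^+ 2 = eucl P Q ^+ 2 by rewrite exprMn s1 mul1r m2 dd.
  move/eqP; rewrite eqf_sqr => /orP[/eqP h|/eqP h]; first by lra.
  have : s * (s * m) = s * - eucl P Q by rewrite h.
  by rewrite mulrA -expr2 s1 mul1r mulrN.
apply/matrixP => i j; rewrite (ord1 j) !mxE.
have [->|->] := ord2P i => /=; rewrite -/n1 -/n2.
  have -> : n1 = (n1 * (Q.1 - P.1) + n2 * (Q.2 - P.2)) * (Q.1 - P.1) / dist2 Q P - m * (Q.2 - P.2) / dist2 Q P.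
    by rewrite /m; have : dist2 Q P != 0 by [rewrite gt_eqF]; rewrite /dist2 => ?; field.
  by rewrite nd mE mul0r -dd; field.
have -> : n2 = (n1 * (Q.1 - P.1) + n2 * (Q.2 - P.2)) * (Q.2 - P.2) / dist2 Q P + m * (Q.1 - P.1) / dist2 Q P.
  by rewrite /m; have : dist2 Q P != 0 by [rewrite gt_eqF]; rewrite /dist2 => ?; field.
by rewrite nd mE mul0r -dd; field.
Unshelve. all: by end_near.
Qed.

(** Otherwise both polygons contain the points near the middle of the edge
    on one of its sides. *)
Lemma side_opp E E' P Q s s' : P != Q -> region E `&` region E' = set0 ->
  edge_side E P Q s -> edge_side E' P Q s' -> s' = - s.
Proof.
move=> PQ EE' [s1 hs] [s'1 hs'].
have [r r0 hr] := hs _ (open_seg_mid P Q); have [r' r'0 hr'] := hs' _ (open_seg_mid P Q).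
have rr : 0 < Num.min r r' by rewrite lt_min r0.
have [e e0 he] := box_push (lerp P Q 2^-1) (- (Q.2 - P.2), Q.1 - P.1) rr.
have d0 := mulr_gt0 e0 (dist2_gt0 PQ).
have ns t : `|t| <= e -> 0 < s * (t * dist2 Q P) -> ~ 0 < s' * (t * dist2 Q P).
  move=> te h h'; have [b b'] := box_min (he t te).
  rewrite -[False]/(set0 (lerp P Q 2^-1 + t *: (- (Q.2 - P.2), Q.1 - P.1))) -EE'; split.
    by apply/hr => //; rewrite cr_push cr_line add0r.
  by apply/hr' => //; rewrite cr_push cr_line add0r.
have := ns e; have := ns (- e); rewrite normrN !gtr0_norm// lexx => /(_ isT) A /(_ isT) B.
move: A B; rewrite mulNr; set t := e * _ in d0 * => A B.
move/eqP: s1; move/eqP: s'1; rewrite !sqrf_eq1 => /orP[/eqP s'E|/eqP s'E] /orP[/eqP sE|/eqP sE];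
  rewrite s'E sE in A B *; first [lra|exfalso; apply: B; lra|exfalso; apply: A; lra].
Qed.

Lemma has_edge_side E x0 r0 P Q : simple_polygon E -> star E x0 r0 -> has_edge E (P, Q) ->
  P != Q /\ exists s, edge_side E P Q s.
Proof.
move=> sE stE /orP[PQE|QPE].
  by split; [exact: edge_neq PQE|have [s es _] := edge_side_exists sE stE PQE; exists s].
have QP := edge_neq sE QPE; split; first by rewrite eq_sym.
by have [s es _] := edge_side_exists sE stE QPE; exists (- s); exact: edge_sideC.
Qed.

End Sides.

(** * Edges in a Lipschitz boundary *)

Section LipschitzBoundary.
Context {R : realType}.
Implicit Types (x y z P Q : plane R) (E : polygon R) (Om : set (plane R)).

Lemma rot_box (c s e : R) x y : c ^+ 2 + s ^+ 2 = 1 -> box y e x ->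
  `|c * x.1 + s * x.2 - (c * y.1 + s * y.2)| <= 2 * e /\
  `|c * x.2 - s * x.1 - (c * y.2 - s * y.1)| <= 2 * e.
Proof.
move=> cs [/ltW b1 /ltW b2].
have le1 (t : R) : t ^+ 2 <= 1 -> `|t| <= 1 by move=> h; rewrite ler_norml; apply/andP; split; nra.
have c1 : `|c| <= 1 by apply: le1; have := sqr_ge0 s; lra.
have s1 : `|s| <= 1 by apply: le1; have := sqr_ge0 c; lra.
have h (u v a b : R) : `|u| <= 1 -> `|v| <= 1 -> `|a| <= e -> `|b| <= e -> `|u * a + v * b| <= 2 * e.
  move=> hu hv ha hb; apply: le_trans (ler_normD _ _) _; rewrite !normrM.
  have := ler_pM (normr_ge0 _) (normr_ge0 _) hu ha; have := ler_pM (normr_ge0 _) (normr_ge0 _) hv hb; lra.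
split.
  have -> : c * x.1 + s * x.2 - (c * y.1 + s * y.2) = c * (x.1 - y.1) + s * (x.2 - y.2) by ring.
  exact: h.
have -> : c * x.2 - s * x.1 - (c * y.2 - s * y.1) = c * (x.2 - y.2) + (- s) * (x.1 - y.1) by ring.
by apply: h; rewrite ?normrN.
Qed.

(** In comparison with the definition of a Lipschitz domain, boxes replace
    balls and the boundary is known to lie on the graph. *)
Definition lip_chart Om y (r c s : R) (g : R -> R) (M : R) :=
  [/\ 0 < r, c ^+ 2 + s ^+ 2 = 1, 0 < M /\ (forall t u, `|g t - g u| <= M * `|t - u|),
   forall x, box y r x -> (Om x <-> g (c * x.1 + s * x.2) < c * x.2 - s * x.1) &
   forall x, box y r x -> bd Om x -> g (c * x.1 + s * x.2) = c * x.2 - s * x.1].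

(** A point strictly below a Lipschitz graph has a neighbourhood below it. *)
Lemma chart_closure Om y (r c s : R) g (M : R) x : 0 < r -> c ^+ 2 + s ^+ 2 = 1 -> 0 < M ->
  (forall t u, `|g t - g u| <= M * `|t - u|) ->
  (forall x, box y r x -> (Om x <-> g (c * x.1 + s * x.2) < c * x.2 - s * x.1)) ->
  box y (r / 2) x -> closure Om x -> g (c * x.1 + s * x.2) <= c * x.2 - s * x.1.
Proof.
move=> r0 cs M0 hM loc Bx cx; rewrite leNgt; apply/negP => lt.
pose gap := g (c * x.1 + s * x.2) - (c * x.2 - s * x.1).
have g0 : 0 < gap by rewrite subr_gt0.
have M2 : 0 < 2 + 2 * M by lra.
pose e := Num.min (r / 2) (gap / (2 + 2 * M)).
have e0 : 0 < e by rewrite lt_min !divr_gt0.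
have er : e <= r / 2 by rewrite ge_min lexx.
have eg : (2 + 2 * M) * e <= gap by rewrite mulrC -ler_pdivlMr// ge_min lexx orbT.
have [z Oz Bz] := (closure_boxP _ _).1 cx e e0.
have Byz : box y r z.
  case: Bx Bz => + + [].
  rewrite !ltr_norml => /andP[? ?] /andP[? ?] /andP[? ?] /andP[? ?].
  by split; rewrite ltr_norml; apply/andP; split; lra.
have := (loc _ Byz).1 Oz; have [h1 h2] := rot_box cs Bz.
have := hM (c * z.1 + s * z.2) (c * x.1 + s * x.2).
have : M * `|c * z.1 + s * z.2 - (c * x.1 + s * x.2)| <= M * (2 * e) by rewrite ler_pM2l.
move: h2 g0 eg; rewrite /gap.
set gz := g (c * z.1 + s * z.2); set gx := g _; set z2 := c * z.2 - _; set x2 := c * x.2 - _.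
set n := `|_ - (c * x.1 + s * x.2)|.
rewrite !ler_norml => /andP[? ?] ? ? ? /andP[? ?] ?.
lra.
Qed.

Lemma lipschitz_bd Om y : open Om -> lipschitz_domain Om -> bd Om y ->
  exists r c s g M, lip_chart Om y r c s g M.
Proof.
move=> oOm lip /lip[r [c [s [g [r0 cs [M [_ hM]] loc]]]]].
have {hM} [M1 M10 hM] : exists2 M1 : R, 0 < M1 & forall t u, `|g t - g u| <= M1 * `|t - u|.
  exists (Num.max M 0 + 1); first by rewrite ltr_wpDl// le_max lexx orbT.
  move=> t u; have := hM (Num.max M 0 + 1) _ (t, u) (conj I I); apply.
  by rewrite ltr_pwDr// le_max lexx.
have r3 : 0 < r / 3 by rewrite divr_gt0.
have loc' x : box y (r / 3) x -> (Om x <-> g (c * x.1 + s * x.2) < c * x.2 - s * x.1).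
  move=> Bx; apply: loc; rewrite /eball/=; apply: le_lt_trans (eucl_box Bx (ltW r3)) _; lra.
exists (r / 6), c, s, g, M1; split=> //; first by rewrite divr_gt0.
  by move=> x [b1 b2]; apply: loc'; split; lra.
move=> x [b1 b2] [cx nx]; rewrite (proj1 (interior_id _) oOm) in nx.
apply/eqP; rewrite eq_le; apply/andP; split.
  by apply: (chart_closure r3 cs M10 hM loc' _ cx); split; lra.
rewrite leNgt; apply/negP => h; apply: nx; apply/loc' => //; split; lra.
Qed.

(** The points just below the graph. This excludes slits, near which the
    domain is on both sides of its boundary. *)
Lemma lipschitz_outside Om y (e : R) : open Om -> lipschitz_domain Om -> bd Om y -> 0 < e ->
  exists2 x, box y e x & ~ closure Om x.
Proof.
move=> oOm lip bdy e0; have [r [c [s [g [M [r0 cs [M0 hM] loc bdl]]]]]] := lipschitz_bd oOm lip bdy.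
pose v : plane R := (s, - c).
have rm : 0 < Num.min e (r / 2) by rewrite lt_min e0 divr_gt0.
have [t t0 ht] := box_push y v rm.
have := ht t; rewrite gtr0_norm// lexx => /(_ isT) /box_min[Be Br].
exists (y + t *: v) => // cx.
have := chart_closure r0 cs M0 hM loc Br cx.
have -> : c * (y + t *: v).1 + s * (y + t *: v).2 = c * y.1 + s * y.2 by rewrite /= /GRing.scale/=; ring.
have -> : c * (y + t *: v).2 - s * (y + t *: v).1 = c * y.2 - s * y.1 - t * (c ^+ 2 + s ^+ 2) by rewrite /= /GRing.scale/=; ring.
by rewrite cs mulr1 (bdl y (box_center y r0) bdy) => ?; lra.
Qed.

(** In a chart the edge is a part of the graph and the direction of the
    chart is transverse to the line PQ. Points of the domain on both sides
    of the line would lie above the graph, but those above the line in the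
    direction of the chart are all on one of its sides. *)
Lemma lipschitz_one_side Om E P Q s y : open Om -> lipschitz_domain Om -> region E `<=` Om -> P != Q ->
  edge_side E P Q s -> open_seg P Q `<=` bd Om -> open_seg P Q y ->
  exists2 r : R, 0 < r & forall x, box y r x -> s * cr P Q x <= 0 -> ~ Om x.
Proof.
move=> oOm lip EO PQ [s1 hs] eb oy.
have [r [c [s' [g [M [r0 cs _ loc bdl]]]]]] := lipschitz_bd oOm lip (eb y oy).
have [r1 r10 hr1] := hs y oy.
have cy : cr P Q y = 0 by case: oy => ? _ <-; exact: cr_line.
have bdE z : box y r z -> open_seg P Q z -> g (c * z.1 + s' * z.2) = c * z.2 - s' * z.1.
  by move=> Bz /eb; exact: bdl.
have nO z : open_seg P Q z -> ~ Om z.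
  by move=> /eb[_]; rewrite (proj1 (interior_id _) oOm).
pose v : plane R := (s', - c).
(* the chart direction is transverse to the edge *)
pose nu := (Q.1 - P.1) * v.2 - (Q.2 - P.2) * v.1.
have d0 := dist2_gt0 PQ.
have onl (z : plane R) : cr P Q z = 0 -> 0 < tc P Q z < 1 -> open_seg P Q z.
  move=> cz tz; exists (tc P Q z); first by rewrite /= in_itv.
  by rewrite [RHS](edge_coords z PQ) cz mul0r scale0r addr0 lerpE.
have oT : open (tc P Q @^-1` `]0, 1[%classic).
  by apply: open_comp; [move=> x _; exact: (C1d_continuous (@C1d_tc R P Q))|exact: interval_open].
have [r2 r20 hr2] : exists2 r2 : R, 0 < r2 & forall z, box y r2 z -> cr P Q z = 0 -> open_seg P Q z.
  have := (open_boxP _).1 oT y; case.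
    by case: oy => t /= t01 <-; rewrite tc_lerp.
  move=> r2 r20 h; exists r2 => // z /h /= + cz; rewrite in_itv/= => ?; exact: onl.
have X1 (z : plane R) (t : R) : c * (z + t *: v).1 + s' * (z + t *: v).2 = c * z.1 + s' * z.2.
  by rewrite /= /GRing.scale/=; ring.
have X2 (z : plane R) (t : R) : c * (z + t *: v).2 - s' * (z + t *: v).1 = c * z.2 - s' * z.1 - t.
  rewrite -[X in _ = _ - X](mulr1 t) -cs /= /GRing.scale/=; ring.
have crv (z : plane R) (t : R) : cr P Q (z + t *: v) = cr P Q z + t * nu.
  by rewrite /cr /nu /= /GRing.scale/=; ring.
have rm : 0 < Num.min r r2 by rewrite lt_min r0.
(* along the direction of the chart the graph cannot contain a segment *)
have nu0 : nu != 0.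
  apply/eqP => nu0; have [t t0 ht] := box_push y v rm.
  have := ht t; rewrite gtr0_norm// lexx => /(_ isT) /box_min[Br Br2].
  have oz : open_seg P Q (y + t *: v) by apply: hr2 => //; rewrite crv nu0 mulr0 addr0.
  by have := bdE _ Br oz; rewrite X1 X2 (bdE y (box_center y r0) oy); lra.
(* vertical projection to the line *)
pose pr x := x + (- (cr P Q x / nu)) *: v.
have crp x : cr P Q (pr x) = 0 by rewrite /pr crv mulNr divfK// subrr.
have abv x : box y r x -> box y r2 (pr x) -> box y r (pr x) -> Om x -> 0 < - (cr P Q x / nu).
  move=> Bx B2 B1 /(loc _ Bx).
  have := bdE _ B1 (hr2 _ B2 (crp x)); rewrite X1 X2 => ->; lra.
have [r3 r30 hr3] : exists2 r3 : R, 0 < r3 & forall x, box y r3 x -> box y r2 (pr x) /\ box y r (pr x).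
  have cp : open (pr @^-1` box y (Num.min r r2)).
    apply: open_comp => [x _|]; last exact: open_box.
    have C := C1dZ (- nu^-1) (C1d_cr P Q).
    have C1 := C1d_continuous (C1dD (@C1d_fst R) (C1dM C (C1d_cst v.1))).
    have C2 := C1d_continuous (C1dD (@C1d_snd R) (C1dM C (C1d_cst v.2))).
    have -> : pr = fun x => (x.1 + (- nu^-1 * cr P Q x) * v.1, x.2 + (- nu^-1 * cr P Q x) * v.2).
      by apply/funext => z; apply: injective_projections; rewrite /pr /= /GRing.scale/=; ring.
    exact: (cvg_pair (C1 x) (C2 x)).
  have := (open_boxP _).1 cp y; case.
    by rewrite /= /pr cy mul0r oppr0 scale0r addr0; exact: box_center.
  by move=> r3 r30 h; exists r3 => // x /h /= /box_min[].
(* a point of the polygon lies above the line too *)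
have rr : 0 < Num.min r1 (Num.min r r3) by rewrite !lt_min r10 r0.
have [e e0 he] := box_push y (- (Q.2 - P.2), Q.1 - P.1) rr.
pose z := y + (s * e) *: (- (Q.2 - P.2), Q.1 - P.1).
have sn : `|s| = 1 by apply/eqP; rewrite -sqrp_eq1 // real_normK ?num_real// s1.
have := he (s * e); rewrite normrM sn mul1r gtr0_norm// lexx => /(_ isT) /box_min[z1 /box_min[zr z3]].
have scz : s * cr P Q z = e * dist2 Q P.
  by rewrite /z cr_push cy add0r !mulrA -expr2 s1 mul1r.
have edp := mulr_gt0 e0 d0.
have Ez : Om z by apply: EO; apply/hr1 => //; rewrite scz.
have [pz2 pz] := hr3 _ z3; have az := abv z zr pz2 pz Ez.
exists (Num.min r2 (Num.min r r3)); first by rewrite !lt_min r20 r0.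
move=> x /box_min[x2 /box_min[xr x3]] sx Ox.
have [px2 px] := hr3 _ x3; have ax := abv x xr px2 px Ox.
have [c0|c0] := eqVneq (cr P Q x) 0; first by apply: (nO x) => //; exact: hr2.
have s2 : s * cr P Q x < 0.
  rewrite lt_neqAle sx andbT mulf_neq0//; by rewrite -normr_eq0 sn oner_eq0.
have p1 : 0 < (cr P Q x / nu) * (cr P Q z / nu) by rewrite nmulr_rgt0; lra.
have p2 : (s * cr P Q x) * (s * cr P Q z) < 0 by rewrite scz nmulr_rlt0.
have : (s * cr P Q x) * (s * cr P Q z) = s ^+ 2 * nu ^+ 2 * ((cr P Q x / nu) * (cr P Q z / nu)).
  by field.
rewrite s1 mul1r => h; move: p2; rewrite h ltNge mulr_ge0 ?sqr_ge0// ltW//.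
Qed.

(** Compactness of the middle half of the edge makes the radii of
    [lipschitz_one_side] uniform. *)
Lemma empty_strip Om E P Q s : open Om -> lipschitz_domain Om -> region E `<=` Om -> P != Q ->
  edge_side E P Q s -> open_seg P Q `<=` bd Om ->
  exists2 d : R, 0 < d & forall x, 4^-1 <= tc P Q x <= 3 / 4 -> - d <= s * cr P Q x <= 0 -> ~ Om x.
Proof.
move=> oOm lip EO PQ es eb; have d0 := dist2_gt0 PQ; have s1 := es.1.
have sn : `|s| = 1 by apply/eqP; rewrite -sqrp_eq1 // real_normK ?num_real// s1.
have := (@compact_near_coveringP R `[4^-1, 3 / 4]%classic).1 (@segment_compact R _ _).
move=> /(_ R (0^'+) (fun d t => forall x, tc P Q x = t -> - d <= s * cr P Q x <= 0 -> ~ Om x)).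
have L0 : 0 < eucl P Q by rewrite euclC /eucl sqrtr_gt0.
have dd : eucl P Q ^+ 2 = dist2 Q P by rewrite eucl_sq /dist2; ring.
move=> hn.
have hd : \forall d \near 0^'+, `[4^-1, 3 / 4]%classic `<=`
    (fun t => forall x, tc P Q x = t -> - d <= s * cr P Q x <= 0 -> ~ Om x).
  apply: hn => t /=; rewrite in_itv/= => /andP[ta tb].
  have oy : open_seg P Q (lerp P Q t) by exists t => //=; rewrite in_itv/=; apply/andP; split; lra.
  have [r r0 hr] := lipschitz_one_side oOm lip EO PQ es eb oy.
  near=> t' d => x /= tx cx; apply: hr; last by case/andP: cx.
  have h1 : `|t' - t| < r / (2 * eucl P Q).
    rewrite distrC; near: t'; apply/nbhs_ballP; exists (r / (2 * eucl P Q)) => //=; by rewrite divr_gt0// mulr_gt0.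
  have h2 : d < r * eucl P Q / 2 by near: d; apply: nbhs_right_lt; rewrite !divr_gt0// mulr_gt0.
  have hc : `|cr P Q x / dist2 Q P| < r / (2 * eucl P Q).
    rewrite normrM normfV (gtr0_norm d0) ltr_pdivrMr// -dd.
    have -> : r / (2 * eucl P Q) * eucl P Q ^+ 2 = r * eucl P Q / 2 by field; rewrite gt_eqF.
    apply: le_lt_trans h2; rewrite -[`|_|]mul1r -sn -normrM ler_norml.
    by case/andP: cx => *; apply/andP; split; lra.
  have xE : x = lerp P Q t' + (cr P Q x / dist2 Q P) *: (- (Q.2 - P.2), Q.1 - P.1).
    by rewrite [LHS](edge_coords x PQ) tx lerpE.
  set q := cr P Q x / dist2 Q P in hc xE.
  have hd1 : `|Q.1 - P.1| <= eucl P Q by rewrite euclC; exact: abs1_le_eucl.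
  have hd2 : `|Q.2 - P.2| <= eucl P Q by rewrite euclC; exact: abs2_le_eucl.
  have bd2 (u v a b : R) : `|u| <= eucl P Q -> `|v| <= eucl P Q -> `|a| < r / (2 * eucl P Q) ->
      `|b| < r / (2 * eucl P Q) -> `|a * u + b * v| < r.
    move=> hu hv ha hb; apply: le_lt_trans (ler_normD _ _) _; rewrite !normrM.
    have e1 : `|a| * `|u| <= `|a| * eucl P Q by rewrite ler_wpM2l.
    have e2 : `|b| * `|v| <= `|b| * eucl P Q by rewrite ler_wpM2l.
    have : `|a| * eucl P Q < r / (2 * eucl P Q) * eucl P Q by rewrite ltr_pM2r.
    have : `|b| * eucl P Q < r / (2 * eucl P Q) * eucl P Q by rewrite ltr_pM2r.
    have -> : r / (2 * eucl P Q) * eucl P Q = r / 2 by field; rewrite gt_eqF.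
    lra.
  split.
    have -> : x.1 - (lerp P Q t).1 = (t' - t) * (Q.1 - P.1) + q * - (Q.2 - P.2).
      by rewrite xE !lerpE /= /GRing.scale/=; ring.
    by apply: bd2; rewrite ?normrN.
  have -> : x.2 - (lerp P Q t).2 = (t' - t) * (Q.2 - P.2) + q * (Q.1 - P.1).
    by rewrite xE !lerpE /= /GRing.scale/=; ring.
  exact: bd2.
near (0 : R)^'+ => d; exists d; first by near: d; exact: nbhs_right_gt.
move=> x tx cx.
have : `[4^-1, 3 / 4]%classic `<=` (fun t => forall x, tc P Q x = t -> - d <= s * cr P Q x <= 0 -> ~ Om x) by near: d.
by move=> /(_ (tc P Q x)); apply; rewrite //= in_itv.
Unshelve. all: by end_near.
Qed.

End LipschitzBoundary.

(** * Sobolev norms and traces *)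

Section Norms.
Context {R : realType}.
Implicit Types (D E : set (plane R)) (u v : vfield R).

Lemma int_sqD m n D (U V : plane R -> 'M[R]_(m, n)) : measurable D -> L2 D U -> L2 D V ->
  \int[area]_(x in D) frob (U x + V x) (U x + V x) <=
  2 * \int[area]_(x in D) frob (U x) (U x) + 2 * \int[area]_(x in D) frob (V x) (V x).
Proof.
move=> mD Lu Lv.
have iu := itg_frob mD Lu Lu; have iv := itg_frob mD Lv Lv.
rewrite -(I_Z 2 mD iu) -(I_Z 2 mD iv) -I_D//; try exact: itgZ.
apply: I_le => //; first by apply: itg_frob => //; exact: L2D.
  by apply: itgD => //; exact: itgZ.
by move=> x _; exact: frob_sqD.
Qed.

Lemma L2N m n D (U : plane R -> 'M[R]_(m, n)) : measurable D -> L2 D U -> L2 D (fun x => - U x).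
Proof.
move=> mD LU; have -> : (fun x => - U x) = (fun x => (-1) *: U x) by apply/funext => x; rewrite scaleN1r.
exact: L2Z.
Qed.

Lemma int_sqB m n D (U V : plane R -> 'M[R]_(m, n)) : measurable D -> L2 D U -> L2 D V ->
  \int[area]_(x in D) frob (U x - V x) (U x - V x) <=
  2 * \int[area]_(x in D) frob (U x) (U x) + 2 * \int[area]_(x in D) frob (V x) (V x).
Proof.
move=> mD Lu Lv; have := int_sqD mD Lu (L2N mD Lv).
suff -> : \int[area]_(x in D) frob (- V x) (- V x) = \int[area]_(x in D) frob (V x) (V x) by [].
by apply: I_eq => x _; rewrite frobNl frobNr opprK.
Qed.

Lemma norm0B D u v : measurable D -> L2 D u -> L2 D v ->
  norm0sq D (fun x => u x - v x) <= 2 * norm0sq D u + 2 * norm0sq D v.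
Proof. exact: int_sqB. Qed.

Lemma norm0_ge0 D u : 0 <= norm0sq D u.
Proof. by apply: I_ge0 => x _; exact: frob_ge0. Qed.

Lemma semi1_ge0 D u : 0 <= semi1sq D u.
Proof. by apply: I_ge0 => x _; exact: frob_ge0. Qed.

Lemma norm1_ge0 D u : 0 <= norm1sq D u.
Proof. by rewrite addr_ge0 ?norm0_ge0 ?semi1_ge0. Qed.

Lemma semi1B D u v : open D -> H1 D u -> H1 D v ->
  semi1sq D (fun x => u x - v x) <= 2 * semi1sq D u + 2 * semi1sq D v.
Proof.
move=> oD Hu Hv; have mD := open_measurable2 oD.
have Lu := wjac_L2 Hu; have Lv := wjac_L2 Hv.
have -> : semi1sq D (fun x => u x - v x) =
    \int[area]_(x in D) frob (wjac D u x - wjac D v x) (wjac D u x - wjac D v x).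
  by apply: semi1E => //; apply: is_wjacB => //; [exact: Hu.1|exact: Hv.1|exact: wjacP|exact: wjacP].
exact: int_sqB.
Qed.

Lemma add_doubled_le (a b c d e f : R) : a <= 2 * c + 2 * d -> b <= 2 * e + 2 * f ->
  a + b <= 2 * (c + e) + 2 * (d + f).
Proof. lra. Qed.

Lemma norm1B D u v : open D -> H1 D u -> H1 D v ->
  norm1sq D (fun x => u x - v x) <= 2 * norm1sq D u + 2 * norm1sq D v.
Proof.
move=> oD Hu Hv; have mD := open_measurable2 oD.
have h1 := semi1B oD Hu Hv; have h2 := norm0B mD Hu.1 Hv.1.
exact: add_doubled_le h2 h1.
Qed.

Lemma norm1_C1 D u : open D -> bounded_set D -> C1_field u -> norm1sq D u =
  \int[area]_(x in D) (frob (u x) (u x) + frob (jac u x) (jac u x)).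
Proof.
move=> oD bD Cu; have mD := open_measurable2 oD.
rewrite I_D//; last first.
- by apply: itg_frob => //; exact: jac_L2.
- by apply: itg_frob => //; exact: C1_L2.
by rewrite /norm1sq (semi1E oD (C1_is_wjac oD bD Cu)).
Qed.

Lemma C1_C1d (f : plane R -> R) : C1 f -> C1d f (fun j => partial j f).
Proof.
move=> /C1P[g Cg]; have gE j : partial j f = g j by exact: partialE Cg.1.
by have -> : (fun j => partial j f) = g by apply/funext => j; exact: gE.
Qed.

Lemma frob2v (A B : 'M[R]_2) : frob A B = \sum_j (A ord0 j * B ord0 j + A ord_max j * B ord_max j).
Proof. by rewrite /frob sum2 -big_split. Qed.

End Norms.

Section Trace.
Context {R : realType}.
Implicit Types (E : polygon R) (P Q y x : plane R) (u v : vfield R).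

Lemma cutoff_bound (b db q a0 a1 p0 p1 S : R) : 0 <= b -> b <= 1 -> `|db| <= 4 * q -> 0 <= 4 * q ->
  p0 * p0 + p1 * p1 <= S ->
  `|b * (a0 * p0 + a0 * p0 + (a1 * p1 + a1 * p1)) + (a0 * a0 + a1 * a1) * db| <=
  (1 + 4 * q) * (a0 * a0 + a1 * a1 + S).
Proof.
move=> b0 b1 hdb q0 hS.
have N0 : 0 <= a0 * a0 + a1 * a1 by rewrite -!expr2 addr_ge0 ?sqr_ge0.
have S0 : 0 <= S by apply: le_trans hS; rewrite -!expr2 addr_ge0 ?sqr_ge0.
apply: le_trans (ler_normD _ _) _; rewrite normrM [`|_ * db|]normrM (ger0_norm b0) (ger0_norm N0).
have e1 : `|a0 * p0 + a0 * p0 + (a1 * p1 + a1 * p1)| <= a0 * a0 + a1 * a1 + S.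
  rewrite ler_norml; have := sqr_ge0 (a0 - p0); have := sqr_ge0 (a0 + p0).
  have := sqr_ge0 (a1 - p1); have := sqr_ge0 (a1 + p1) => *; apply/andP; split; nra.
have e2 : b * `|a0 * p0 + a0 * p0 + (a1 * p1 + a1 * p1)| <= a0 * a0 + a1 * a1 + S.
  by apply: le_trans e1; have := normr_ge0 (a0 * p0 + a0 * p0 + (a1 * p1 + a1 * p1)); nra.
have e3 : (a0 * a0 + a1 * a1) * `|db| <= (a0 * a0 + a1 * a1) * (4 * q) by rewrite ler_wpM2l.
have e4 : 0 <= 4 * q * S by rewrite mulr_ge0.
lra.
Qed.

(** The bump restricts |u|^2 to a set where the polygon is a half-plane. The
    identities of [divergence_halfplane] for both partial derivatives,
    multiplied by the components of the normal, add up to |Q - P|^2 times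
    the integral over the edge. *)
Lemma trace_edge E P Q s y : simple_polygon E -> P != Q -> edge_side E P Q s -> open_seg P Q y ->
  exists r C : R, [/\ 0 < r, 0 <= C & forall u, C1_field u ->
    \int[lebesgue_measure]_(t in `[0, 1]) (bump y r (lerp P Q t) * frob (u (lerp P Q t)) (u (lerp P Q t)))
    <= C * norm1sq E u].
Proof.
move=> [_ _ [_ oE] [bE _] _] PQ [s1 hs] oy; have mE := open_measurable2 oE.
have [r1 r10 hr1] := hs y oy; have [r2 r20 hr2] := line_in_seg PQ oy.
have d0 := dist2_gt0 PQ; have L0 : 0 < eucl P Q by rewrite euclC /eucl sqrtr_gt0.
have dd : eucl P Q ^+ 2 = dist2 Q P by rewrite eucl_sq /dist2; ring.
pose r := Num.min r1 r2; have r0 : 0 < r by rewrite lt_min r10.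
have sn : `|s| = 1 by apply/eqP; rewrite -sqrp_eq1 // real_normK ?num_real// s1.
pose K := 1 + 4 * r^-1; have K0 : 0 <= K by rewrite addr_ge0// mulr_ge0// invr_ge0 ltW.
exists r, (2 * K / eucl P Q); split => //; first by rewrite divr_ge0 ?mulr_ge0// ltW.
move=> u Cu.
have D0 := C1_C1d (Cu ord0); have D1 := C1_C1d (Cu ord_max).
set u0 := (fun x => u x ord0 ord0) in D0; set u1 := (fun x => u x ord_max ord0) in D1.
have DB := C1d_bump y r.
have DF := C1dM DB (C1dD (C1dM D0 D0) (C1dM D1 D1)).
set F := (fun x => _ : R) in DF; set F' := (fun (j : 'I_2) (x : plane R) => _ : R) in DF.
have FE x : F x = bump y r x * frob (u x) (u x) by rewrite /F frobv.
have [M hM] : exists M : R, forall x, ~ box (0, 0) M x -> F x = 0.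
  have [M M0 hM] := bounded_sub_box (@box_bounded R y r).
  by exists M => x nb; rewrite /F bump_out ?mul0r// => /hM.
have Fl (t : R) : ~ (0 <= t <= 1) -> F (P + t *: (Q - P)) = 0.
  move=> nt; rewrite /F bump_out ?mul0r// => Bt; apply: nt.
  have [_ B2] := box_min Bt; have := hr2 _ B2; rewrite -lerpE cr_line => /(_ erefl) [t' /= t'01 tt].
  by have := congr1 (tc P Q) tt; rewrite !tc_lerp// => <-; move: t'01; rewrite in_itv.
have div j := divergence_halfplane j DF hM s1 Fl; rewrite /= in div.
set H := [set x | _] in div.
have HE x : H x <-> 0 < s * cr P Q x.
  rewrite /H/= /cr; have -> : - s * (Q.2 - P.2) * (x.1 - P.1) + s * (Q.1 - P.1) * (x.2 - P.2) =
    s * ((Q.1 - P.1) * (x.2 - P.2) - (Q.2 - P.2) * (x.1 - P.1)) by ring.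
  by [].
have F'0 j x : ~ box y r x -> F' j x = 0.
  by move=> nb; rewrite /F' bump_out// dbump_out// mul0r mulr0 addr0.
have intE j : \int[area]_(x in H) F' j x = \int[area]_(x in E) F' j x.
  rewrite (@I_supp _ H (H `&` E)) ?(@I_supp _ E (H `&` E))//; try exact: subIsetl; try exact: subIsetr.
    move=> x Ex nHE; apply: F'0 => /box_min[B1 _]; apply: nHE; split => //.
    by apply/HE; apply/hr1.
  move=> x Hx nHE; apply: F'0 => /box_min[B1 _]; apply: nHE; split => //.
  by apply/hr1 => //; apply/HE.
have nF x : frob (u x) (u x) + frob (jac u x) (jac u x) = u0 x * u0 x + u1 x * u1 x +
    \sum_j (partial j u0 x * partial j u0 x + partial j u1 x * partial j u1 x).
  by rewrite frobv frob2v; congr (_ + _); apply: eq_bigr => j _; rewrite !mxE.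
have bF j x : `|F' j x| <= K * (frob (u x) (u x) + frob (jac u x) (jac u x)).
  have := dbump_le y j x r0; have := bump_ge0 y r x; have := bump_le1 y r x.
  have : partial j u0 x * partial j u0 x + partial j u1 x * partial j u1 x <=
     \sum_j (partial j u0 x * partial j u0 x + partial j u1 x * partial j u1 x).
    by rewrite (bigD1 j)//= lerDl sumr_ge0// => i _; rewrite -!expr2 addr_ge0 ?sqr_ge0.
  rewrite nF /F' /K; set S := \sum_j _; set b := bump y r x; set db := dbump y r j x; set q := r^-1.
  set a0 := u0 x; set a1 := u1 x; set p0 := partial j u0 x; set p1 := partial j u1 x => hS b1 b0 hdb.
  by apply: cutoff_bound => //; rewrite mulr_ge0// invr_ge0 ltW.
have LK0 : 0 <= eucl P Q * K by rewrite mulr_ge0// ltW.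
have iN : itg E (fun x => frob (u x) (u x) + frob (jac u x) (jac u x)).
  by apply: itgD => //; apply: itg_frob => //; [exact: C1_L2|exact: C1_L2|exact: jac_L2|exact: jac_L2].
have iF' j : itg E (F' j) by apply: itg_continuous => //; exact: DF.2.
have aj j : `|pcoord j (- s * (Q.2 - P.2), s * (Q.1 - P.1))| <= eucl P Q.
  rewrite /pcoord euclC; case: eqP => _ /=; rewrite normrM ?normrN sn mul1r.
    exact: abs2_le_eucl.
  exact: abs1_le_eucl.
have bj j : - pcoord j (- s * (Q.2 - P.2), s * (Q.1 - P.1)) * \int[area]_(x in H) F' j x <=
    eucl P Q * K * norm1sq E u.
  rewrite intE (norm1_C1 oE bE Cu) -(I_Z _ mE (iF' j)) -(I_Z _ mE iN).
  apply: I_le => // [||x _]; [exact: itgZ|exact: itgZ|].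
  apply: le_trans (ler_norm _) _; rewrite normrM normrN -mulrA.
  by apply: ler_pM => //; exact: bF.
(* the components of the normal weight the two identities *)
have {bj} := lerD (bj ord0) (bj ord_max); rewrite !div.
rewrite (_ : \int[lebesgue_measure]_(t in _) (bump y r _ * _) =
  \int[lebesgue_measure]_(t in `[0, 1]) F (P + t *: (Q - P))); last first.
  by apply: eq_Rintegral => t _; rewrite FE lerpE.
set J := \int[_]_(t in _) _; set nn := norm1sq E u; rewrite /pcoord /=.
have -> : - (- s * (Q.2 - P.2)) * (- (- s * (Q.2 - P.2)) * J) + - (s * (Q.1 - P.1)) * (- (s * (Q.1 - P.1)) * J)
  = s ^+ 2 * dist2 Q P * J by rewrite /dist2; ring.
rewrite s1 mul1r -dd => hJ.
rewrite -(ler_pM2l (exprn_gt0 2 L0)); apply: le_trans hJ _.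
rewrite le_eqVlt; apply/orP; left; apply/eqP; field; rewrite gt_eqF//.
Qed.

End Trace.

Section UnitInterval.
Context {R : realType}.
Local Notation leb := (@lebesgue_measure R).
Local Notation I01 := `[(0 : R), 1]%classic.

(** Traces are continuous on the boundary of an element, hence along an edge
    on the closed unit interval only. *)
Definition c01 (k : R -> R) := {within I01, continuous k}.

Lemma c01D k k' : c01 k -> c01 k' -> c01 (fun t => k t + k' t).
Proof. by move=> ck ck' t; apply: cvgD; [exact: ck|exact: ck']. Qed.

Lemma c01M k k' : c01 k -> c01 k' -> c01 (fun t => k t * k' t).
Proof. by move=> ck ck' t; apply: cvgM; [exact: ck|exact: ck']. Qed.

Lemma c01_cont k : continuous k -> c01 k.
Proof. exact: continuous_subspaceT. Qed.

Lemma c01_int k : c01 k -> leb.-integrable I01 (EFin \o k).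
Proof. by move=> ck; apply: continuous_compact_integrable => //; exact: segment_compact. Qed.

Lemma c01_le k k' : c01 k -> c01 k' -> (forall t : R, 0 <= t <= 1 -> k t <= k' t) ->
  \int[leb]_(t in I01) k t <= \int[leb]_(t in I01) k' t.
Proof.
move=> ck ck' kk'; apply: le_Rintegral; [exact: measurable_itv|exact: c01_int|exact: c01_int|].
by move=> t /=; rewrite in_itv/=; exact: kk'.
Qed.

Lemma c01_ge k (z e c : R) : c01 k -> (forall t : R, 0 <= t <= 1 -> 0 <= k t) -> 0 < e ->
  0 <= z - e -> z + e <= 1 -> (forall t, z - e <= t <= z + e -> c <= k t) ->
  c * (2 * e) <= \int[leb]_(t in I01) k t.
Proof.
move=> ck k0 e0 z0 z1 hc; pose A := `[z - e, z + e]%classic.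
have AI : A `<=` I01.
  by move=> t /=; rewrite /A/= !in_itv/= => /andP[? ?]; apply/andP; split; lra.
have mA : measurable A by exact: measurable_itv.
have iA : leb.-integrable A (EFin \o k) by apply: integrableS (c01_int ck).
have h1 : \int[leb]_(t in A) c <= \int[leb]_(t in A) k t.
  apply: le_Rintegral => //.
    apply: continuous_compact_integrable; first exact: segment_compact.
    by apply: continuous_subspaceT => t; exact: cvg_cst.
have h2 : \int[leb]_(t in A) k t <= \int[leb]_(t in I01) k t.
  rewrite /Rintegral fine_le//.
  - exact: integrable_fin_num.
  - by apply: integrable_fin_num => //; exact: c01_int.
  - by apply: ge0_subset_integral => //; first by have /measurable_int := c01_int ck.
apply: (le_trans _ (le_trans h1 h2)).
rewrite Rintegral_cst//= lebesgue_measure_itv/= lte_fin ifT; last by lra.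
by rewrite -EFinB/= (_ : z + e - (z - e) = 2 * e)//; ring.
Qed.

Lemma c01_eq0 k (t0 : R) : c01 k -> (forall t : R, 0 <= t <= 1 -> 0 <= k t) ->
  \int[leb]_(t in I01) k t <= 0 -> 0 < t0 < 1 -> k t0 = 0.
Proof.
move=> ck k0 int0 t01; have h01 : (0 : R) < 1 by exact: ltr01.
apply/eqP; rewrite eq_le; apply/andP; split; last by apply: k0; case/andP: t01 => *; rewrite !ltW.
rewrite leNgt; apply/negP => kt0.
have := within_continuous_continuous h01 ck.
move=> /(_ t0); rewrite in_itv/= => /(_ t01) /cvgrPdist_lt/(_ (k t0 / 2)).
rewrite divr_gt0// => /(_ isT) /nbhs_ballP[d /= d0 hd].
case/andP: t01 => ta tb.
pose e := Num.min (d / 2) (Num.min (t0 / 2) ((1 - t0) / 2)).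
have e0 : 0 < e by rewrite !lt_min !divr_gt0// subr_gt0.
have e1 : e <= d / 2 by rewrite ge_min lexx.
have e2 : e <= t0 / 2 by rewrite ge_min ge_min lexx orbT.
have e3 : e <= (1 - t0) / 2 by rewrite !ge_min lexx !orbT.
have := @c01_ge k t0 e (k t0 / 2) ck k0 e0.
move=> H; have {H} : k t0 / 2 * (2 * e) <= \int[leb]_(t in I01) k t.
  apply: H; [lra|lra|move=> t /andP[? ?]].
  have := hd t; rewrite /ball/= => H.
  have : `|t0 - t| < d by rewrite ltr_norml; apply/andP; split; lra.
  by move=> /H; rewrite ltr_norml => /andP[? ?]; lra.
move=> /le_trans/(_ int0); rewrite leNgt mulr_gt0// ?divr_gt0// mulr_gt0//.
Qed.

End UnitInterval.

Section TraceUnique.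
Context {R : realType}.
Implicit Types (E : polygon R) (P Q y x : plane R) (u v g : vfield R).
Local Notation leb := (@lebesgue_measure R).
Local Notation I01 := `[(0 : R), 1]%classic.

Lemma edge_bd E l t : simple_polygon E -> l \in edges E -> 0 <= t <= 1 -> bd E (lerp l.1 l.2 t).
Proof.
move=> [_ _ _ _ ->] lE t01; exists l => //; exists t => //=; by rewrite in_itv.
Qed.

Lemma c01_edge E l g i : simple_polygon E -> l \in edges E -> {within bd E, continuous g} ->
  c01 (fun t => g (lerp l.1 l.2 t) i ord0).
Proof.
move=> sE lE /subspace_continuousP cg; apply/subspace_continuousP => t /=.
rewrite in_itv/= => t01; have cl := @continuous_lerp R l.1 l.2 t.
have ce := @coord_continuous R 2 1 i ord0 (g (lerp l.1 l.2 t)).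
move=> A /= /ce nA; have H := cl _ (cg _ (edge_bd sE lE t01) _ nA).
apply: (@filterS _ (nbhs t) _ _ _ _ H) => u /= hu; rewrite in_itv/= => u01; apply: hu; exact: edge_bd.
Qed.

Lemma seg_le_bd E l F : l \in edges E -> (forall x, 0 <= F x) -> seg_int l F <= bd_int E F.
Proof.
move=> lE F0; rewrite /bd_int (big_rem l lE)/= lerDl sumr_ge0// => l' _.
by rewrite /seg_int mulr_ge0 ?eucl_ge0//; apply: Rintegral_ge0.
Qed.

(** The C^1 fields converging to the two traces differ by a null sequence in
    H^1, hence by [trace_edge] in the weighted L^2 norm of the edge, whose
    weight is positive at y. *)
Lemma ctrace_edge E x0 r0 v g g' P Q y : simple_polygon E -> star E x0 r0 ->
  is_ctrace E v g -> is_ctrace E v g' -> (P, Q) \in edges E -> open_seg P Q y -> g y = g' y.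
Proof.
move=> sE stE [cg [Hv [p [Cp np bp]]]] [cg' [_ [p' [Cp' np' bp']]]] PQE oy.
have PQ := edge_neq sE PQE; have [s es _] := edge_side_exists sE stE PQE.
have [_ _ [_ oE] [bE _] _] := sE.
have L0 : 0 < eucl P Q by have := dist2_gt0 PQ; rewrite euclC /eucl sqrtr_gt0.
have [r [C [r_gt0 C0 hC]]] := trace_edge sE PQ es oy.
pose b t := bump y r (lerp P Q t); pose L t := lerp P Q t.
pose h (u u' : vfield R) t := frob (u (L t) - u' (L t)) (u (L t) - u' (L t)).
have cb : c01 b.
  apply: c01_cont => t; apply: (@continuous_comp _ _ _ L (bump y r)); first exact: continuous_lerp.
  exact: (C1d_continuous (C1d_bump _ _)).
have cF u : C1_field u -> forall i, c01 (fun t => u (L t) i ord0).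
  move=> Cu i; apply: c01_cont => t; apply: (@continuous_comp _ _ _ L (fun x => u x i ord0)); first exact: continuous_lerp.
  exact: (C1d_continuous (C1_C1d (Cu i))).
have cG g0 : {within bd E, continuous g0} -> forall i, c01 (fun t => g0 (L t) i ord0).
  by move=> cg0 i; have := c01_edge sE PQE cg0.
have ch u u' : (forall i, c01 (fun t => u (L t) i ord0)) -> (forall i, c01 (fun t => u' (L t) i ord0)) -> c01 (h u u').
  move=> cu cu'; have cd i : c01 (fun t => (u (L t) - u' (L t)) i ord0).
    have -> : (fun t => (u (L t) - u' (L t)) i ord0) = (fun t => u (L t) i ord0 + (-1) * u' (L t) i ord0).
      by apply/funext => t; rewrite !mxE mulN1r.
    by apply: c01D => //; apply: c01M => //; apply: c01_cont => t; exact: cvg_cst.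
  have -> : h u u' = fun t => (u (L t) - u' (L t)) ord0 ord0 * (u (L t) - u' (L t)) ord0 ord0 +
     (u (L t) - u' (L t)) ord_max ord0 * (u (L t) - u' (L t)) ord_max ord0.
    by apply/funext => t; rewrite /h frobv.
  by apply: c01D; apply: c01M.
have c4 : c01 (fun=> 4 : R) by apply: c01_cont => t; exact: cvg_cst.
have ctot := c01M cb (ch _ _ (cG _ cg) (cG _ cg')).
have Jtr u g0 : 0 <= \int[leb]_(t in I01) h u g0 t -> eucl P Q * \int[leb]_(t in I01) h u g0 t <=
   bd_int E (fun x => frob (u x - g0 x) (u x - g0 x)).
  by move=> _; apply: (seg_le_bd PQE) => x; exact: frob_ge0.
have bound m : \int[leb]_(t in I01) (b t * h g g' t) <=
    4 * (bd_int E (fun x => frob (p m x - g x) (p m x - g x)) / eucl P Q +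
         C * (2 * norm1sq E (fun x => p m x - v x) + 2 * norm1sq E (fun x => p' m x - v x)) +
         bd_int E (fun x => frob (p' m x - g' x) (p' m x - g' x)) / eucl P Q).
  have Hp : H1 E (p m) by exact: C1_H1.
  have Hp' : H1 E (p' m) by exact: C1_H1.
  have c1 := ch _ _ (cF _ (Cp m)) (cG _ cg); have c2 := ch _ _ (cF _ (Cp m)) (cF _ (Cp' m)).
  have c3 := ch _ _ (cF _ (Cp' m)) (cG _ cg').
  have cb2 := c01M cb c2.
  have i1 := c01_int c1; have i2 := c01_int cb2; have i3 := c01_int c3.
  apply: (@le_trans _ _ (\int[leb]_(t in I01) (4 * (h (p m) g t + b t * h (p m) (p' m) t + h (p' m) g' t)))).
    apply: c01_le => //; first by apply: c01M => //; apply: c01D => //; apply: c01D.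
    move=> t _; have b0 := bump_ge0 y r (L t); have b1 := bump_le1 y r (L t).
    have := frob_sqD ((g (L t) - p m (L t)) + (p m (L t) - p' m (L t))) (p' m (L t) - g' (L t)).
    have := frob_sqD (g (L t) - p m (L t)) (p m (L t) - p' m (L t)).
    rewrite !subrKA /h /b (frob_sqC (g (L t)) (p m (L t))).
    set A := frob (p m _ - g _) _; set B := frob (p m _ - p' m _) _; set D := frob (p' m _ - _) _.
    set G := frob (g _ - g' _) _; set H := frob (g _ - p' m _) _ => hH hG.
    have A0 : 0 <= A by exact: frob_ge0. have B0 : 0 <= B by exact: frob_ge0.
    have D0 : 0 <= D by exact: frob_ge0.
    move: b0 b1; set bb := bump y r (L t) => b0 b1.
    have hG2 : G <= 4 * A + 4 * B + 2 * D by lra.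
    apply: (le_trans (ler_wpM2l b0 hG2)); have := mulr_ge0 b0 A0; have := mulr_ge0 b0 B0; nra.
  rewrite RintegralZl//; last first.
    by apply: c01_int; apply: c01D => //; apply: c01D.
  rewrite RintegralD//; last by apply: c01_int; apply: c01D.
  rewrite RintegralD// ler_wpM2l//.
  apply: lerD; first apply: lerD.
  - rewrite ler_pdivlMr// mulrC; apply: Jtr; apply: Rintegral_ge0 => t _; exact: frob_ge0.
  - have Cd : C1_field (fun x => p m x - p' m x).
      move=> i; apply/C1P; exists (fun j x => partial j (fun x => p m x i ord0) x - partial j (fun x => p' m x i ord0) x).
      by apply: (C1d_ext (C1dB (C1_C1d (Cp m i)) (C1_C1d (Cp' m i)))) => // x; rewrite !mxE.
    apply: le_trans (hC _ Cd) _; rewrite ler_wpM2l//.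
    have -> : (fun x => p m x - p' m x) = (fun x => (p m x - v x) - (p' m x - v x)).
      by apply/funext => x; rewrite opprB addrA subrK.
    by apply: norm1B => //; apply: H1B.
  - rewrite ler_pdivlMr// mulrC; apply: Jtr; apply: Rintegral_ge0 => t _; exact: frob_ge0.
have lim0 : \int[leb]_(t in I01) (b t * h g g' t) <= 0.
  have bp1 : bd_int E (fun x => frob (p m x - g x) (p m x - g x)) @[m --> \oo] --> 0 by exact: (fine_cvg bp).
  have bp2 : bd_int E (fun x => frob (p' m x - g' x) (p' m x - g' x)) @[m --> \oo] --> 0 by exact: (fine_cvg bp').
  have cc (a : R) : (fun _ : nat => a) @ \oo --> a by exact: cvg_cst.
  have cv : (4 * (bd_int E (fun x => frob (p m x - g x) (p m x - g x)) / eucl P Q +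
         C * (2 * norm1sq E (fun x => p m x - v x) + 2 * norm1sq E (fun x => p' m x - v x)) +
         bd_int E (fun x => frob (p' m x - g' x) (p' m x - g' x)) / eucl P Q)) @[m --> \oo] -->
     4 * (0 / eucl P Q + C * (2 * 0 + 2 * 0) + 0 / eucl P Q).
    have q1 : (fun m => norm1sq E (fun x => p m x - v x)) @ \oo --> 0 by exact: np.
    have q2 : (fun m => norm1sq E (fun x => p' m x - v x)) @ \oo --> 0 by exact: np'.
    apply: (cvgM (cc _)); apply: cvgD; first apply: cvgD.
    - exact: (cvgM bp1 (cc _)).
    - exact: (cvgM (cc _) (cvgD (cvgM (cc _) q1) (cvgM (cc _) q2))).
    - exact: (cvgM bp2 (cc _)).
  rewrite !mul0r !mulr0 !addr0 mulr0 addr0 mulr0 in cv.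
  have cJ := cc (\int[leb]_(t in I01) (b t * h g g' t)).
  by apply: (ler_cvg_to cJ cv); exact: nearW.
have [t /=] := oy; rewrite in_itv/= => t01 yE.
have := c01_eq0 ctot _ lim0 t01; rewrite /h /b /L yE => H.
have {}H : bump y r y * frob (g y - g' y) (g y - g' y) = 0.
  by apply: H => u _; rewrite mulr_ge0 ?bump_ge0 ?frob_ge0.
have bp0 := bump_gt0 r_gt0 (box_center y r_gt0).
move/eqP: H; rewrite mulf_eq0 gt_eqF//= => /eqP/frob_eq0/eqP; rewrite subr_eq0 => /eqP.
by [].
Qed.

(** By continuity along an edge that starts at x. *)
Lemma ctrace_vert E x0 r0 v g g' x : simple_polygon E -> star E x0 r0 ->
  is_ctrace E v g -> is_ctrace E v g' -> x \in verts E -> g x = g' x.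
Proof.
move=> sE stE tg tg' xE; have [[n3 uv] _ _ _ _] := sE.
have [i iN xi] : exists2 i, (i < size (verts E))%N & x = vert E i.
  by move/(nthP 0): xE => [i iN <-]; exists i => //; rewrite /vert modn_small.
have lE : (vert E i, vert E i.+1) \in edges E by apply/edgesP; exists i.
have PQ := edge_neq sE lE; rewrite -xi in lE PQ.
apply/matrixP => k j; rewrite (ord1 j).
have c1 := c01_edge (i := k) sE lE tg.1; have c2 := c01_edge (i := k) sE lE tg'.1.
pose f t := g (lerp x (vert E i.+1) t) k ord0 + (-1) * g' (lerp x (vert E i.+1) t) k ord0.
have cf : c01 f by apply: c01D => //; apply: c01M => //; apply: c01_cont => t; exact: cvg_cst.
have f0 (t : R) : 0 < t < 1 -> f t = 0.
  move=> t01; have oy : open_seg x (vert E i.+1) (lerp x (vert E i.+1) t) by exists t => //=; rewrite in_itv.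
  by rewrite /f (ctrace_edge sE stE tg tg' lE oy) mulN1r subrr.
have : f 0 = 0.
  apply/eqP; apply: contrapT => /negP f00.
  move/subspace_continuousP: cf => /(_ 0); rewrite /= in_itv/= lexx ler01 => /(_ isT).
  move=> /cvgrPdist_lt/(_ `|f 0|); rewrite normr_gt0 => /(_ f00).
  move=> /nbhs_ballP[d /= d0 hd].
  pose t := Num.min (d / 2) 2^-1.
  have t0 : 0 < t by rewrite lt_min; apply/andP; split; lra.
  have t1 : t <= 2^-1 by rewrite ge_min lexx orbT.
  have td : t <= d / 2 by rewrite ge_min lexx.
  have := hd t; rewrite /ball/= sub0r normrN gtr0_norm// in_itv/= (ltW t0)/=.
  have -> : t < d by lra.
  have -> : t <= 1 by lra.
  have ft : f t = 0 by apply: f0; rewrite t0/=; lra.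
  by move=> /(_ isT isT); rewrite /from_subspace ft subr0 ltxx.
by rewrite /f lerpE scale0r addr0 mulN1r => /eqP; rewrite subr_eq0 => /eqP.
Qed.

End TraceUnique.

(** * The elastic energy *)

Section Aform.
Context {R : realType}.
Variables (mu lam : R).
Implicit Types (D : set (plane R)) (u v w : vfield R) (G H : plane R -> 'M[R]_2).

Lemma stiff_symE (A : 'M[R]_2) i j : stiff mu lam (sym A) i j =
  mu * A i j + mu * A j i + (lam *+ (i == j)) * A ord0 ord0 + (lam *+ (i == j)) * A ord_max ord_max.
Proof.
by rewrite /stiff /sym !mxE mxtr2 !mxE; case: (i == j); rewrite ?mulr1n ?mulr0n; field.
Qed.

Lemma L2_stiff D G : measurable D -> L2 D G -> L2 D (fun x => stiff mu lam (sym (G x))).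
Proof.
move=> mD /(L2P _ mD) LG; apply/(L2P _ mD) => i j.
apply: (eq_l2 mD (f := fun x => mu * G x i j + mu * G x j i + (lam *+ (i == j)) * G x ord0 ord0 + (lam *+ (i == j)) * G x ord_max ord_max)).
  by move=> x _; rewrite stiff_symE.
by do !apply: (l2D mD); apply: l2Z.
Qed.

Lemma stiff_symCC (A B : 'M[R]_2) : frob (stiff mu lam (sym A)) (sym B) = frob (stiff mu lam (sym B)) (sym A).
Proof. by rewrite stiff_frobC frobC. Qed.

(** The form may be computed with any weak gradients, and as stresses are
    symmetric it is enough to symmetrise one of them. *)
Lemma aformE D u v G H : open D -> is_wjac D u G -> is_wjac D v H ->
  aform mu lam D u v = \int[area]_(x in D) frob (stiff mu lam (sym (G x))) (H x).
Proof.
move=> oD uG vH; have mD := open_measurable2 oD.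
have ru := wjac_aeq oD uG; have rv := wjac_aeq oD vH.
have wu : L2 D (wjac D u) by have [] : is_wjac D u (wjac D u) by apply: xgetPex; exists G.
have wv : L2 D (wjac D v) by have [] : is_wjac D v (wjac D v) by apply: xgetPex; exists H.
rewrite /aform (@I_eq _ D _ (fun x => frob (stiff mu lam (sym (wjac D u x))) (wjac D v x))); last first.
  by move=> x _; rewrite stiff_sym_frob.
apply: I_aeq_frob => //; try (by apply: itg_frob => //; exact: L2_stiff).
  by apply: itg_frob => //; [apply: L2_stiff => //; exact: uG.1|exact: vH.1].
exact: (aeq_op (fun A _ => stiff mu lam (sym A)) ru ru).
Qed.

Lemma aform_sym D u v : aform mu lam D u v = aform mu lam D v u.
Proof. by apply: I_eq => x _; exact: stiff_symCC. Qed.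

Lemma itg_aform D G H : measurable D -> L2 D G -> L2 D H ->
  itg D (fun x => frob (stiff mu lam (sym (G x))) (H x)).
Proof. by move=> mD LG LH; apply: itg_frob => //; exact: L2_stiff. Qed.

Lemma aformDl D u v w : open D -> H1 D u -> H1 D v -> H1 D w ->
  aform mu lam D (fun x => u x + v x) w = aform mu lam D u w + aform mu lam D v w.
Proof.
move=> oD Hu Hv Hw; have mD := open_measurable2 oD.
have wu := wjacP Hu; have wv := wjacP Hv; have ww := wjacP Hw.
rewrite (aformE oD (is_wjacD oD Hu.1 Hv.1 wu wv) ww) (aformE oD wu ww) (aformE oD wv ww).
rewrite -I_D//; try by apply: itg_aform => //; [exact: wu.1|exact: ww.1].
- by apply: I_eq => x _; rewrite symD stiffD frobDl.
- by apply: itg_aform => //; [exact: wv.1|exact: ww.1].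
Qed.

Lemma H1Z D c u : open D -> H1 D u -> H1 D (fun x => c *: u x).
Proof.
move=> oD Hu; split; first by apply: L2Z; [exact: open_measurable2|exact: Hu.1].
by exists (fun x => c *: wjac D u x); apply: is_wjacZ => //; [exact: Hu.1|exact: wjacP].
Qed.

Lemma aformZl D c u w : open D -> H1 D u -> H1 D w ->
  aform mu lam D (fun x => c *: u x) w = c * aform mu lam D u w.
Proof.
move=> oD Hu Hw; have mD := open_measurable2 oD.
have wu := wjacP Hu; have ww := wjacP Hw.
rewrite (aformE oD (is_wjacZ c oD Hu.1 wu) ww) (aformE oD wu ww).
rewrite -I_Z//; last by apply: itg_aform => //; [exact: wu.1|exact: ww.1].
by apply: I_eq => x _; rewrite symZ stiffZ frobZl.
Qed.

Lemma aformBl D u v w : open D -> H1 D u -> H1 D v -> H1 D w ->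
  aform mu lam D (fun x => u x - v x) w = aform mu lam D u w - aform mu lam D v w.
Proof.
move=> oD Hu Hv Hw; have h := aformDl oD Hu (H1Z (-1) oD Hv) Hw.
have e : (fun x => u x - v x) = (fun x => u x + -1 *: v x) by apply/funext => x; rewrite scaleN1r.
by rewrite e h (aformZl (-1) oD Hv Hw) mulN1r.
Qed.

Lemma aformBr D u v w : open D -> H1 D u -> H1 D v -> H1 D w ->
  aform mu lam D w (fun x => u x - v x) = aform mu lam D w u - aform mu lam D w v.
Proof. by move=> oD Hu Hv Hw; rewrite !(aform_sym _ w) aformBl. Qed.

Lemma H1_0 D : open D -> H1 D (fun=> 0).
Proof.
move=> oD; have mD := open_measurable2 oD.
have L0 m n : L2 D (fun=> 0 : 'M[R]_(m, n)).
  by apply/(L2P _ mD) => i j; apply: eq_l2 mD _ (l2_0 mD) => x _; rewrite mxE.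
split; first exact: L0.
exists (fun=> 0); split; first exact: L0.
move=> i j phi _; rewrite (@I_eq _ D _ (fun=> 0)) ?(@I_eq _ D (fun x => _ * phi x) (fun=> 0)) ?I_0 ?oppr0//.
  by move=> x _; rewrite mxE mul0r.
by move=> x _; rewrite mxE mul0r.
Qed.

Lemma H1_sum D (I : Type) (s : seq I) (F : I -> vfield R) (c : I -> R) : open D ->
  (forall i, H1 D (F i)) -> H1 D (fun x => \sum_(i <- s) c i *: F i x).
Proof.
move=> oD HF; elim: s => [|i s IH].
  have -> : (fun x => \sum_(i <- [::]) c i *: F i x) = fun=> 0 by apply/funext => x; rewrite big_nil.
  exact: H1_0.
have -> : (fun x => \sum_(i <- i :: s) c i *: F i x) = fun x => c i *: F i x + \sum_(i <- s) c i *: F i x.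
  by apply/funext => x; rewrite big_cons.
by apply: H1D => //; exact: H1Z.
Qed.

Lemma aform_suml D (I : Type) (s : seq I) (F : I -> vfield R) (c : I -> R) w : open D ->
  (forall i, H1 D (F i)) -> H1 D w ->
  aform mu lam D (fun x => \sum_(i <- s) c i *: F i x) w = \sum_(i <- s) c i * aform mu lam D (F i) w.
Proof.
move=> oD HF Hw; elim: s => [|i s IH].
  rewrite big_nil; have -> : (fun x => \sum_(i <- [::]) c i *: F i x) = fun x => 0 *: w x.
    by apply/funext => x; rewrite big_nil scale0r.
  by rewrite aformZl// mul0r.
have h := aformDl oD (H1Z (c i) oD (HF i)) (H1_sum s c oD HF) Hw.
have e : (fun x => \sum_(i0 <- i :: s) c i0 *: F i0 x) = fun x => c i *: F i x + \sum_(i <- s) c i *: F i x.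
  by apply/funext => x; rewrite big_cons.
by rewrite e h (aformZl (c i) oD (HF i) Hw) IH big_cons.
Qed.

Lemma L2_int_young m n D (U V : plane R -> 'M[R]_(m, n)) : measurable D -> L2 D U -> L2 D V ->
  2 * \int[area]_(x in D) frob (U x) (V x) <=
  \int[area]_(x in D) frob (U x) (U x) + \int[area]_(x in D) frob (V x) (V x).
Proof.
move=> mD LU LV; have iu := itg_frob mD LU LU; have iv := itg_frob mD LV LV.
have iuv := itg_frob mD LU LV; rewrite -(I_Z _ mD iuv) -I_D//.
apply: I_le => //; [exact: itgZ|exact: itgD|].
by move=> x _; have := frob_young (U x) (V x) (@ltr01 R); rewrite invr1 !mul1r.
Qed.

Lemma aform_bound D u : open D -> H1 D u ->
  aform mu lam D u u <= stiffK mu lam * semi1sq D u.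
Proof.
move=> oD Hu; have mD := open_measurable2 oD; have wu := wjacP Hu.
have Ls := L2_stiff mD wu.1.
rewrite (aformE oD wu wu).
have h := L2_int_young mD Ls wu.1.
have iu := itg_frob mD wu.1 wu.1; have is' := itg_frob mD Ls Ls.
have h2 : \int[area]_(x in D) frob (stiff mu lam (sym (wjac D u x))) (stiff mu lam (sym (wjac D u x))) <=
   stiffK mu lam * semi1sq D u.
  rewrite /semi1sq -(I_Z _ mD iu); apply: I_le => //; first exact: itgZ.
  by move=> x _; exact: stiff_sym_bound.
have h3 : semi1sq D u <= stiffK mu lam * semi1sq D u.
  rewrite ler_peMl ?semi1_ge0// /stiffK lerDr mulr_ge0// addr_ge0 ?sqr_ge0//.
rewrite -/(semi1sq D u) in h; move: h h2 h3.
set a := \int[area]_(x in D) _; set b := \int[area]_(x in D) _; set c := _ * semi1sq _ _; set d := semi1sq _ _.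
lra.
Qed.

End Aform.

(** * The energy projection onto polynomials *)

Section Projection.
Context {R : realType}.

(** A singular linear system is solvable if its right-hand side vanishes on
    the kernel. *)
Lemma row_solve n (A : 'M[R]_n) (l : 'rV[R]_n) :
  (forall x : 'cV[R]_n, A *m x = 0 -> l *m x = 0) -> exists D : 'rV[R]_n, l = D *m A.
Proof.
move=> h; apply/submxP; rewrite submxE; apply/eqP/matrixP => i j.
have e m (B : 'M[R]_(m, n)) : B *m col j (cokermx A) = col j (B *m cokermx A).
  by apply/matrixP => a b; rewrite !mxE; apply: eq_bigr => k _; rewrite !mxE.
have := h (col j (cokermx A)); rewrite !e mulmx_coker.
have -> : col j (0 : 'M[R]_n) = 0 by apply/matrixP => a b; rewrite !mxE.
by move=> /(_ erefl)/matrixP/(_ i ord0); rewrite !mxE.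
Qed.

End Projection.

Section Spaces.
Context {R : realType}.
Implicit Types (m k : nat) (p q : vfield R).

Lemma vpoly_C1 m p : vpoly m p -> C1_field p.
Proof. by move=> hp i; exact: poly2_C1 (hp i). Qed.

Lemma vpolyB m p q : vpoly m p -> vpoly m q -> vpoly m (fun x => p x - q x).
Proof.
by move=> hp hq i; apply: (eq_poly2 _ (poly2B (hp i) (hq i))) => x; rewrite !mxE.
Qed.

Lemma vpolyD m p q : vpoly m p -> vpoly m q -> vpoly m (fun x => p x + q x).
Proof.
by move=> hp hq i; apply: (eq_poly2 _ (poly2D (hp i) (hq i))) => x; rewrite !mxE.
Qed.

Lemma vpoly_0 m : vpoly m (fun=> 0 : 'cV[R]_2).
Proof. by move=> i; apply: (eq_poly2 _ (@poly2_0 R m)) => x; rewrite mxE. Qed.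

Lemma vpoly_sum m (I : Type) (s : seq I) (F : I -> vfield R) (c : I -> R) :
  (forall i, vpoly m (F i)) -> vpoly m (fun x => \sum_(i <- s) c i *: F i x).
Proof.
move=> HF j; apply: (@eq_poly2 _ _ (fun x => \sum_(i <- s) c i * F i x j ord0)).
  by move=> x; rewrite summxE; apply: eq_bigr => i _; rewrite mxE.
by apply: poly2_sum => i _; apply: poly2Z; exact: HF.
Qed.

Lemma vpoly_span m : exists n (e : 'I_n -> vfield R), (forall i, vpoly m (e i)) /\
  forall p, vpoly m p -> exists c : 'rV[R]_n, forall x, p x = \sum_i c ord0 i *: e i x.
Proof.
pose I := ('I_2 * 'I_m * 'I_m)%type.
pose e0 (a : I) (x : plane R) : 'cV[R]_2 :=
  (if (a.1.2 + a.2 < m)%N then x.1 ^+ a.1.2 * x.2 ^+ a.2 else 0) *: delta_mx a.1.1 ord0.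
have he0 a : vpoly m (e0 a).
  move=> i; have [h|/negbTE h] := boolP (a.1.2 + a.2 < m)%N.
    apply: (eq_poly2 _ (poly2Z (i == a.1.1)%:R (poly2_mono h))) => x.
    by rewrite /e0 h !mxE eqxx andbT mulrC.
  by apply: (eq_poly2 _ (@poly2_0 R m)) => x; rewrite /e0 h !mxE mul0r.
exists #|{: I}|, (fun i => e0 (enum_val i)); split => // p hp.
have /choice[c hc] : forall i, exists c : nat -> nat -> R, forall x,
    p x i ord0 = \sum_(a < m) \sum_(b < m | (a + b < m)%N) c a b * x.1 ^+ a * x.2 ^+ b.
  by move=> i; have [c hc] := hp i; exists c.
pose cc (a : I) : R := c a.1.1 a.1.2 a.2.
exists (\row_i cc (enum_val i)) => x.
rewrite (eq_bigr (fun i => (fun a : I => cc a *: e0 a x) (enum_val i))); last first.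
  by move=> i _; rewrite mxE.
rewrite -(big_enum_val (fun a : I => cc a *: e0 a x)) (eq_bigl (fun=> true))//.
apply/matrixP => i j; rewrite (ord1 j) hc summxE.
rewrite -(pair_bigA _ (fun (a : 'I_2 * 'I_m) (b : 'I_m) => (cc (a, b) *: e0 (a, b) x) i ord0))/=.
rewrite -(pair_bigA _ (fun (a : 'I_2) (a' : 'I_m) => \sum_(b : 'I_m) (cc (a, a', b) *: e0 (a, a', b) x) i ord0))/=.
rewrite (bigD1 i)//= [X in _ = _ + X]big1 ?addr0; last first.
  move=> a ai; rewrite big1// => a' _; rewrite big1// => b _.
  by rewrite /e0 !mxE eq_sym (negbTE ai) mulr0 mulr0.
apply: eq_bigr => a _; rewrite big_mkcond; apply: eq_bigr => b _.
by rewrite /e0 !mxE /= !eqxx mulr1; case: ifP => _; rewrite ?mulr0 ?mulrA.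
Qed.

Lemma C1d_const (f : plane R -> R) g : C1d f g -> (forall j x, g j x = 0) -> forall x y, f x = f y.
Proof.
move=> [hf _] g0 x y; apply/eqP; rewrite -subr_eq0 -normr_le0.
pose r := `|y.1 - x.1| + `|y.2 - x.2| + 1.
have r0 : 0 < r by rewrite ltr_wpDl// addr_ge0.
have By : box x r y by split; rewrite /r; have := normr_ge0 (y.1 - x.1); have := normr_ge0 (y.2 - x.2); lra.
have := @hasd_lip R f g x r 0 hf _ x y (box_center x r0) By; rewrite mul0r; apply.
by move=> j z _; rewrite g0 normr0.
Qed.

(** Since the gradient is skew, q0 depends on the second variable only and
    q1 on the first one; their derivatives are opposite and hence constant. *)
Lemma rigid_affine (q : vfield R) : C1_field q -> (forall x, sym (jac q x) = 0) ->
  exists b : R, forall x y, (q x - q y) ord0 ord0 = - b * (x.2 - y.2) /\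
    (q x - q y) ord_max ord0 = b * (x.1 - y.1).
Proof.
move=> Cq s0; have C0 := C1_C1d (Cq ord0); have C1' := C1_C1d (Cq ord_max).
set q0 := (fun x => q x ord0 ord0) in C0; set q1 := (fun x => q x ord_max ord0) in C1'.
have sE i j x : partial j (fun y => q y i ord0) x + partial i (fun y => q y j ord0) x = 0.
  have /matrixP/(_ i j) := s0 x; rewrite /sym !mxE => /eqP.
  by rewrite mulf_eq0 invr_eq0 pnatr_eq0/= => /eqP.
have p00 x : partial ord0 q0 x = 0 by have := sE ord0 ord0 x; rewrite -/q0; lra.
have p11 x : partial ord_max q1 x = 0 by have := sE ord_max ord_max x; rewrite -/q1; lra.
have p01 x : partial ord_max q0 x = - partial ord0 q1 x by have := sE ord0 ord_max x; rewrite -/q0 -/q1; lra.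
(* q0 does not depend on the first coordinate, q1 not on the second *)
have e0 x1 x2 y : q0 (x1, y) = q0 (x2, y).
  apply/eqP; rewrite -subr_eq0 -normr_le0 -(mul0r `|x1 - x2|).
  apply: (MVT_bound (k := fun t => q0 (t, y)) (k' := fun t => partial ord0 q0 (t, y))) => [t|t _].
    exact: (hasd_slice1 C0.1).
  by rewrite p00 normr0.
have e1 x y1 y2 : q1 (x, y1) = q1 (x, y2).
  apply/eqP; rewrite -subr_eq0 -normr_le0 -(mul0r `|y1 - y2|).
  apply: (MVT_bound (k := fun t => q1 (x, t)) (k' := fun t => partial ord_max q1 (x, t))) => [t|t _].
    exact: (hasd_slice2 C1'.1).
  by rewrite p11 normr0.
have d0 x1 x2 y : partial ord_max q0 (x1, y) = partial ord_max q0 (x2, y).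
  have h1 := hasd_slice2 C0.1 x1 y; have h2 := hasd_slice2 C0.1 x2 y.
  have e : (fun s => q0 (x1, s)) = (fun s => q0 (x2, s)) by apply/funext => s; exact: e0.
  rewrite -e in h2; rewrite -(@derive_val _ _ _ _ _ _ _ h1); exact: (@derive_val _ _ _ _ _ _ _ h2).
have d1 x y1 y2 : partial ord0 q1 (x, y1) = partial ord0 q1 (x, y2).
  have h1 := hasd_slice1 C1'.1 y1 x; have h2 := hasd_slice1 C1'.1 y2 x.
  have e : (fun s => q1 (s, y1)) = (fun s => q1 (s, y2)) by apply/funext => s; exact: e1.
  rewrite -e in h2; rewrite -(@derive_val _ _ _ _ _ _ _ h1); exact: (@derive_val _ _ _ _ _ _ _ h2).
pose b := partial ord0 q1 (0, 0).
have b1 x : partial ord0 q1 x = b.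
  case: x => x y; rewrite (d1 x y 0).
  have := p01 (x, 0); have := p01 (0, 0); rewrite (d0 x 0 0) -/b; lra.
have b0 x : partial ord_max q0 x = - b by rewrite p01 b1.
exists b => x y.
have D0 := C1dD C0 (C1dZ b (@C1d_snd R)); have D1 := C1dB C1' (C1dZ b (@C1d_fst R)).
have z0 := C1d_const D0 _ x y; have z1 := C1d_const D1 _ x y.
rewrite !mxE -/(q0 x) -/(q0 y) -/(q1 x) -/(q1 y).
have {}z0 : q0 x + b * x.2 = q0 y + b * y.2.
  apply: z0 => j z; have [->|->] := ord2P j => /=; rewrite ?p00 ?b0 ?mulr0 ?addr0// mulr1 addNr//.
have {}z1 : q1 x - b * x.1 = q1 y - b * y.1.
  apply: z1 => j z; have [->|->] := ord2P j => /=; rewrite ?p11 ?b1 ?mulr0 ?subr0// mulr1 subrr//.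
by split; lra.
Qed.

Lemma cont_int_eq0 (D : set (plane R)) (f : plane R -> R) : open D -> bounded_set D -> continuous f ->
  (forall x, 0 <= f x) -> \int[area]_(x in D) f x = 0 -> forall x, D x -> f x = 0.
Proof.
move=> oD bD cf f0 int0 x Dx; have mD := open_measurable2 oD.
apply/eqP; rewrite eq_le f0 andbT leNgt; apply/negP => fx.
have oU : open (D `&` f @^-1` [set t | f x / 2 < t]).
  by apply: openI => //; apply: open_comp => [y _|]; [exact: cf|exact: open_gt].
have [|r r0 hr] := (open_boxP _).1 oU x; first by split => //=; lra.
have fi : itg D f by exact: itg_continuous.
have := @I_ge_box R D f x r (f x / 2) mD fi (ltW r0) (fun y _ => f0 y).
rewrite int0 => H; have : f x / 2 * (2 * r) ^+ 2 <= 0.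
  by apply: H => y /hr[]// _ /ltW.
by rewrite leNgt mulr_gt0// ?exprn_gt0 ?mulr_gt0// divr_gt0.
Qed.

End Spaces.

Section PiEps.
Context {R : realType}.
Variables (mu lam : R) (k : nat).
Hypothesis pd : stiff_posdef mu lam.
Implicit Types (E : polygon R) (p q v : vfield R).

Lemma frob0r m n (A : 'M[R]_(m, n)) : frob A 0 = 0.
Proof. by rewrite /frob big1// => i _; rewrite big1// => j _; rewrite [X in _ * X]mxE mulr0. Qed.

Lemma sym_tr (A : 'M[R]_2) : (sym A)^T = sym A.
Proof. by apply/matrixP => i j; rewrite !mxE addrC. Qed.

(** Positive definiteness makes the continuous integrand nonnegative, so it
    vanishes at every point. *)
Lemma aform_eq0 E q : open E -> bounded_set E -> C1_field q ->
  aform mu lam E q q = 0 -> forall x, region E x -> sym (jac q x) = 0.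
Proof.
move=> oE bE Cq; have mE := open_measurable2 oE.
have Wq := C1_is_wjac oE bE Cq.
rewrite (aformE mu lam oE Wq Wq) => a0 x Ex.
have cj i j : continuous (fun x => jac q x i j).
  have -> : (fun x => jac q x i j) = partial j (fun y => q y i ord0) by apply/funext => z; rewrite mxE.
  exact: (C1_C1d (Cq i)).2.
have fE z : frob (stiff mu lam (sym (jac q z))) (jac q z) = frob (stiff mu lam (sym (jac q z))) (sym (jac q z)).
  by rewrite stiff_sym_frob.
have f0 z : 0 <= frob (stiff mu lam (sym (jac q z))) (jac q z).
  rewrite fE; have [->|s0] := eqVneq (sym (jac q z)) 0; last exact/ltW/pd/s0/sym_tr.
  by rewrite frob0r.
have cf : continuous (fun z => frob (stiff mu lam (sym (jac q z))) (jac q z)).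
  have -> : (fun z => frob (stiff mu lam (sym (jac q z))) (jac q z)) = fun z =>
    let h i j := (mu * jac q z i j + mu * jac q z j i + (lam *+ (i == j)) * jac q z ord0 ord0 +
     (lam *+ (i == j)) * jac q z ord_max ord_max) * jac q z i j in
    h ord0 ord0 + h ord0 ord_max + (h ord_max ord0 + h ord_max ord_max).
    by apply/funext => z; rewrite /frob !sum2 !stiff_symE.
  have cZ (b : R) i j : continuous (fun z => b * jac q z i j).
    by move=> z; apply: cvgM; [exact: cvg_cst|exact: cj].
  have ch i j : continuous (fun z => (mu * jac q z i j + mu * jac q z j i + (lam *+ (i == j)) * jac q z ord0 ord0 +
     (lam *+ (i == j)) * jac q z ord_max ord_max) * jac q z i j).
    move=> z; apply: cvgM; last exact: cj.
    by apply: cvgD; [apply: cvgD; [apply: cvgD|]|]; exact: cZ.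
  by move=> z; apply: cvgD; apply: cvgD; exact: ch.
have := cont_int_eq0 oE bE cf f0 a0 Ex; rewrite fE => s0.
by apply: contrapT => /eqP sn; have := pd (sym_tr (jac q x)) sn; rewrite s0 ltxx.
Qed.

Lemma kernel_aform E q v : open E -> bounded_set E -> C1_field q -> H1 E v ->
  aform mu lam E q q = 0 -> aform mu lam E q v = 0.
Proof.
move=> oE bE Cq Hv /(aform_eq0 oE bE Cq) s0.
rewrite (aformE mu lam oE (C1_is_wjac oE bE Cq) (wjacP Hv)).
rewrite (@I_eq _ E _ (fun=> 0)) ?I_0// => x Ex; rewrite s0//.
rewrite /frob big1// => i _; rewrite big1// => j _.
by rewrite /stiff !mxE mulr0 mxtr2 !mxE addr0 mulr0 mul0rn addr0 mul0r.
Qed.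

(** On a finite spanning family, the equations for the elastic form are a
    symmetric system whose right-hand side vanishes on the kernel. A
    solution is corrected by an element of the kernel of the form, which
    solves a second system of the same kind for the vertex averages. *)
Lemma Pi_eps_exists E v : simple_polygon E -> H1 E v -> exists p, is_Pi_eps mu lam k E v p.
Proof.
move=> [[n3 _] _ [_ oE] [bE _] _] Hv; have mE := open_measurable2 oE.
have [n [e [he sp]]] := @vpoly_span R k.+1.
have Ce i := vpoly_C1 (he i); have He i : H1 E (e i) by exact: C1_H1.
pose comb (c : 'rV[R]_n) : vfield R := fun x => \sum_i c ord0 i *: e i x.
have vc c : vpoly k.+1 (comb c) by exact: vpoly_sum.
have Hc c : H1 E (comb c) by exact: C1_H1 (vpoly_C1 (vc c)).
pose a := aform mu lam E.
have al c w : H1 E w -> a (comb c) w = \sum_i c ord0 i * a (e i) w by move=> Hw; exact: aform_suml.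
pose A : 'M[R]_n := \matrix_(i, j) a (e i) (e j).
have aA (c : 'rV[R]_n) j : a (comb c) (e j) = (c *m A) ord0 j.
  by rewrite al// mxE; apply: eq_bigr => i _; rewrite mxE.
have aAc (c d : 'rV[R]_n) : a (comb d) (comb c) = \sum_j d ord0 j * (c *m A) ord0 j.
  by rewrite al//; apply: eq_bigr => j _; rewrite /a aform_sym -/a aA.
have kerA (c : 'rV[R]_n) w : c *m A = 0 -> H1 E w -> a (comb c) w = 0.
  move=> cA Hw; apply: (kernel_aform oE bE (vpoly_C1 (vc c)) Hw).
  by rewrite -/a aAc big1// => j _; rewrite cA mxE mulr0.
have AT : A^T = A by apply/matrixP => i j; rewrite !mxE /a aform_sym.
(* comb D solves the equations of the elastic form *)
have [D hD] : exists D : 'rV[R]_n, (\row_j a (e j) v) = D *m A.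
  apply: row_solve => x Ax.
  have xA : x^T *m A = 0 by rewrite -AT -trmx_mul Ax trmx0.
  apply/matrixP => i j; rewrite (ord1 i) (ord1 j) [RHS]mxE -(kerA _ v xA Hv) al//.
  by rewrite !mxE; apply: eq_bigr => l _; rewrite !mxE mulrC.
pose K := kermx A.
pose r (j : 'I_n) : vfield R := comb (row j K).
have rK j : row j K *m A = 0.
  by rewrite -row_mul mulmx_ker; apply/matrixP => ? ?; rewrite !mxE.
have hr j : ker_a mu lam k E (r j) by split => [|w Hw]; [exact: vc|exact: kerA].
pose z x := ctrace E v x - comb D x.
pose va := vert_avg E.
pose B : 'M[R]_n := \matrix_(i, j) va (r i) (r j).
have vaC p q : va p q = va q p.
  by rewrite /va /vert_avg; congr (_ / _); apply: eq_bigr => x _; rewrite frobC.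
have val (c : 'I_n -> R) w : va (fun x => \sum_i c i *: r i x) w = \sum_i c i * va (r i) w.
  rewrite /va /vert_avg; under [RHS]eq_bigr do rewrite mulrA.
  rewrite -mulr_suml; congr (_ / _); under [RHS]eq_bigr do rewrite mulr_sumr.
  rewrite [RHS]exchange_big/=; apply: eq_bigr => x _; elim/big_ind2: _ => //.
  - by rewrite /frob big1// => i _; rewrite big1// => j _; rewrite mxE mul0r.
  - by move=> ? ? ? ? h1 h2; rewrite frobDl h1 h2.
  - by move=> i _; rewrite frobZl.
have n0 : 0 < (size (verts E))%:R :> R by rewrite ltr0n (leq_trans _ n3).
have va0 w u : va w w = 0 -> va w u = 0.
  move/eqP; rewrite /va /vert_avg mulf_eq0 invr_eq0 (gt_eqF n0) orbF.
  rewrite psumr_eq0 => [/allP h|x _]; last exact: frob_ge0.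
  rewrite big_seq big1 ?mul0r// => x /h/= /eqP/frob_eq0 ->.
  by rewrite frobC frob0r.
(* D' are the coefficients of the rigid motion that corrects the vertex
   averages *)
have [D' hD'] : exists D' : 'rV[R]_n, (\row_j va (r j) z) = D' *m B.
  apply: row_solve => x Bx; apply/matrixP => i j; rewrite (ord1 i) (ord1 j) [RHS]mxE.
  have h w : va (fun y => \sum_i x i ord0 *: r i y) w = \sum_i x i ord0 * va (r i) w by exact: val.
  rewrite -(va0 (fun y => \sum_i x i ord0 *: r i y) z).
    by rewrite h !mxE; apply: eq_bigr => l _; rewrite !mxE mulrC.
  rewrite h big1// => l _; rewrite vaC h.
  have /matrixP/(_ l ord0) := Bx; rewrite !mxE => e0.
  have -> : \sum_i x i ord0 * va (r i) (r l) = 0.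
    by rewrite -[RHS]e0; apply: eq_bigr => i' _; rewrite !mxE vaC mulrC.
  exact: mulr0.
pose rho : vfield R := fun x => \sum_j D' ord0 j *: r j x.
have vrho : vpoly k.+1 rho by apply: vpoly_sum => j; exact: vc.
have vaDr q u w : va q (fun x => u x + w x) = va q u + va q w.
  rewrite /va /vert_avg -mulrDl -big_split/=; congr (_ / _); apply: eq_bigr => x _.
  by rewrite frobDr.
have toC q : vpoly k.+1 q -> exists c, q = comb c.
  by move=> /sp[c hc]; exists c; apply/funext.
exists (fun x => comb D x + rho x); split.
- by apply: vpolyD.
- move=> q /toC[c ->]; rewrite aform_sym aformDl//; last exact: C1_H1 (vpoly_C1 vrho).
  have -> : aform mu lam E rho (comb c) = \sum_j D' ord0 j * a (r j) (comb c).
    by apply: aform_suml => // i; exact: Hc.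
  rewrite [X in _ + X]big1 ?addr0; last by move=> j _; rewrite /r kerA// mulr0.
  rewrite /a aform_sym -/a aAc -hD al//; apply: eq_bigr => j _; by rewrite mxE.
- move=> q [/toC[c ->] kc].
  have cA : c *m A = 0.
    by apply/matrixP => i j; rewrite (ord1 i) -aA /a kc ?mxE.
  have /submxP[d cE] : (c <= K)%MS by apply/sub_kermxP.
  have qE : comb c = fun x => \sum_j d ord0 j *: r j x.
    apply/funext => x; rewrite /r /comb; under [RHS]eq_bigr do rewrite scaler_sumr.
    rewrite exchange_big/=; apply: eq_bigr => i _; rewrite cE mxE scaler_suml.
    by apply: eq_bigr => j _; rewrite [row _ _ _ _]mxE scalerA.
  rewrite -/va qE !val; apply: eq_bigr => j _; congr (_ * _).
  have /matrixP/(_ ord0 j) := hD'; rewrite !mxE => e0.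
  rewrite vaDr [va _ rho]vaC /rho val (eq_bigr (fun l => D' ord0 l * B l j)); last first.
    by move=> l _; rewrite mxE.
  rewrite -e0 /z -vaDr; congr (va _ _); apply/funext => x.
  by rewrite addrC subrK.
Qed.

(** The difference of two projections has no energy, so it is a rigid
    motion, and it vanishes at two distinct vertices. *)
Lemma Pi_eps_unique E v p p' : simple_polygon E -> H1 E v ->
  is_Pi_eps mu lam k E v p -> is_Pi_eps mu lam k E v p' -> p = p'.
Proof.
move=> sE Hv [vp ap bp] [vp' ap' bp'].
have [[n3 uv] _ [[x0 Ex0] oE] [bE _] _] := sE; have mE := open_measurable2 oE.
pose q : vfield R := fun x => p x - p' x.
have vq : vpoly k.+1 q by exact: vpolyB.
have Cq := vpoly_C1 vq.
have Hp := C1_H1 oE bE (vpoly_C1 vp); have Hp' := C1_H1 oE bE (vpoly_C1 vp').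
have aq : aform mu lam E q q = 0.
  by rewrite aformBr//; [rewrite ap// ap'// subrr|exact: C1_H1].
have s0 := aform_eq0 oE bE Cq aq.
have kq : ker_a mu lam k E q by split; [exact: vq|move=> w Hw; exact: (kernel_aform oE bE Cq Hw aq)].
have vq0 x : x \in verts E -> q x = 0.
  have n0 : 0 < (size (verts E))%:R :> R by rewrite ltr0n (leq_trans _ n3).
  have : vert_avg E q q = 0.
    have : vert_avg E q p = vert_avg E q p' by rewrite bp// bp'.
    rewrite /vert_avg => /(mulIf (invr_neq0 (lt0r_neq0 n0))) h.
    rewrite (eq_bigr (fun x => frob (q x) (p x) - frob (q x) (p' x))); last first.
      by move=> y _; rewrite -frobBr.
    by rewrite sumrB h subrr mul0r.
  move/eqP; rewrite /vert_avg mulf_eq0 invr_eq0 (gt_eqF n0) orbF.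
  rewrite psumr_eq0 => [/allP h xE|y _]; last exact: frob_ge0.
  by apply: frob_eq0; apply/eqP; exact: h.
(* the symmetric gradient is a polynomial, so it vanishes everywhere *)
have sall x : sym (jac q x) = 0.
  apply/matrixP => i j; rewrite [RHS]mxE.
  have hp : poly2 k.+1 (fun x => sym (jac q x) i j).
    apply: (eq_poly2 _ (poly2Z 2^-1 (poly2D (poly2_partial j (vq i)) (poly2_partial i (vq j))))) => z.
    by rewrite /sym !mxE.
  have [r r0 hr] := (open_boxP _).1 oE x0 Ex0.
  apply: (poly2_eq0 (x0 := x0) (r := r) hp r0).
  rewrite (@I_eq _ _ _ (fun=> 0)) ?I_0// => z Bz.
  by rewrite s0 ?mxE ?expr0n//; exact: hr.
have [b hb] := rigid_affine Cq sall.
have v01 : nth 0 (verts E) 0 != nth 0 (verts E) 1.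
  by rewrite nth_uniq//; apply: leq_trans n3.
have m0 : nth 0 (verts E) 0 \in verts E by rewrite mem_nth//; apply: leq_trans n3.
have m1 : nth 0 (verts E) 1 \in verts E by rewrite mem_nth//; apply: leq_trans n3.
have [h0 h1] := hb (nth 0 (verts E) 0) (nth 0 (verts E) 1).
rewrite !vq0// subrr !mxE in h0 h1.
have b0 : b = 0.
  apply/eqP; apply: contrapT => /negP bn; move/eqP: v01; apply.
  have e1 : (nth 0 (verts E) 0).1 - (nth 0 (verts E) 1).1 = 0 by apply: (mulfI bn); rewrite mulr0.
  have e2 : (nth 0 (verts E) 0).2 - (nth 0 (verts E) 1).2 = 0 by apply: (mulfI bn); rewrite mulr0; lra.
  by apply: injective_projections; apply/eqP; rewrite -subr_eq0 ?e1 ?e2.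
apply/funext => x; apply/eqP; rewrite -subr_eq0 -/(q x); apply/eqP/matrixP => i j.
have [g0 g1] := hb x (nth 0 (verts E) 0); rewrite (vq0 _ m0) subr0 b0 ?oppr0 !mul0r in g0 g1.
by rewrite (ord1 j) [RHS]mxE; have [->|->] := ord2P i.
Qed.

Lemma Pi_epsP E v : simple_polygon E -> H1 E v -> is_Pi_eps mu lam k E v (Pi_eps mu lam k E v).
Proof. by move=> sE Hv; apply: xgetPex; exact: Pi_eps_exists. Qed.

Lemma Pi_eps_eq E v p : simple_polygon E -> H1 E v -> is_Pi_eps mu lam k E v p -> Pi_eps mu lam k E v = p.
Proof. by move=> sE Hv hp; apply: (Pi_eps_unique sE Hv _ hp); exact: Pi_epsP. Qed.

End PiEps.

(** * The stabilisation terms *)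

Section SpaceSub.
Context {R : realType}.
Variables (mu lam : R) (k : nat).
Hypothesis pd : stiff_posdef mu lam.
Implicit Types (E : polygon R) (p q v g : vfield R).

Lemma continuous_field (p : vfield R) : (forall i, continuous (fun x => p x i ord0)) -> continuous p.
Proof.
move=> cp; have -> : p = fun x => p x ord0 ord0 *: (delta_mx ord0 ord0 : 'cV[R]_2) + p x ord_max ord0 *: delta_mx ord_max ord0.
  apply/funext => x; apply/matrixP => i j; rewrite (ord1 j) !mxE.
  by have [->|->] := ord2P i; rewrite /= ?mulr1 ?mulr0 ?addr0 ?add0r.
by move=> x; apply: cvgD; apply: cvgZr_tmp; exact: cp.
Qed.

Lemma is_ctrace_sub E v g p : open E -> C1_field p -> is_ctrace E v g ->
  bounded_set E -> is_ctrace E (v - p) (fun x => g x - p x).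
Proof.
move=> oE Cp [cg [Hv [phi [Cphi nphi bphi]]]] bE; split.
  move=> x; apply: cvgB; first exact: cg.
  apply: continuous_subspaceT; apply: continuous_field => i; exact: (C1d_continuous (C1_C1d (Cp i))).
split; first by apply: H1B => //; exact: C1_H1.
exists (fun m x => phi m x - p x); split.
- move=> m i; apply/C1P; exists (fun j x => partial j (fun x => phi m x i ord0) x - partial j (fun x => p x i ord0) x).
  by apply: (C1d_ext (C1dB (C1_C1d (Cphi m i)) (C1_C1d (Cp i)))) => // x; rewrite !mxE.
- have -> : (fun m => norm1sq E ((fun x => phi m x - p x) - (v - p))) = fun m => norm1sq E (phi m - v).
    apply/funext => m; congr (norm1sq E _); apply/funext => x.
    by rewrite /= !fctE; rewrite opprB addrA subrK.
  exact: nphi.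
- have -> : (fun m => (bd_int E (fun x => frob (phi m x - p x - (g x - p x)) (phi m x - p x - (g x - p x))))%:E) =
    fun m => (bd_int E (fun x => frob (phi m x - g x) (phi m x - g x)))%:E.
    apply/funext => m; congr (EFin (bd_int E _)); apply/funext => x.
    by rewrite opprB addrA subrK.
  exact: bphi.
Qed.

Lemma space_W_sub E v p : simple_polygon E -> space_W k E v -> vpoly k.+1 p -> space_W k E (v - p).
Proof.
move=> [_ _ [_ oE] [bE _] _] [Hv [f vf Lf] [g tg hg]] vp; have mE := open_measurable2 oE.
have Cp := vpoly_C1 vp; split.
- by apply: H1B => //; exact: C1_H1.
- exists (fun x => f x - \col_i \sum_j partial j (partial j (fun y => p y i ord0)) x).
    apply: vpolyB => // i.
    apply: (@eq_poly2 _ _ (fun x => \sum_j partial j (partial j (fun y => p y i ord0)) x)).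
      by move=> x; rewrite mxE.
    by apply: poly2_sum => j _; do 2!apply: poly2_partial; exact: vp.
  move=> i phi Cphi.
  have ccp j : ccs E (partial j phi) := C1c_partial j Cphi.
  have wv := wjacP Hv; have wp := C1_is_wjac oE bE Cp.
  have [Z [mZ Z0 hZ]] := wjac_aeq oE (is_wjacB oE Hv.1 (C1_L2 mE bE Cp) wv wp).
  have lv : forall a b, l2 E (fun x => wjac E v x a b) by apply/(L2P _ mE); exact: wv.1.
  have lp : forall a b, l2 E (fun x => jac p x a b) by apply/(L2P _ mE); exact: wp.1.
  have Hvp : H1 E (v - p) by apply: H1B => //; exact: C1_H1.
  have lvp : forall a b, l2 E (fun x => wjac E (v - p) x a b) by apply/(L2P _ mE); exact: wjac_L2.
  have isum (G : plane R -> 'M[R]_2) : (forall a b, l2 E (fun x => G x a b)) ->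
      itg E (fun x => \sum_j G x i j * partial j phi x).
    by move=> lG; apply: itg_sum => // j; apply: itg_ccs.
  rewrite (I_aeq mE mZ Z0 (isum _ lvp) (itgB mE (isum _ lv) (isum _ lp))); last first.
    move=> x Ex nZ; rewrite hZ// -sumrB; apply: eq_bigr => j _.
    by rewrite !mxE mulrBl.
  rewrite I_B//; [|exact: isum|exact: isum].
  rewrite (Lf i phi Cphi) (@I_sum R E _ _ (fun j x => jac p x i j * partial j phi x) mE); last first.
    by move=> j; apply: itg_ccs.
  have C1p j : C1 (partial j (fun y => p y i ord0)) by apply: poly2_C1; apply: poly2_partial; exact: vp.
  have cphi := C1c_ccs Cphi.
  have ip j : itg E (fun x => partial j (partial j (fun y => p y i ord0)) x * phi x).
    by apply: itg_cont_ccs => //; exact: (C1_C1d (C1p j)).2.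
  rewrite (eq_bigr (fun j => - \int[area]_(x in E) (partial j (partial j (fun y => p y i ord0)) x * phi x))); last first.
    move=> j _; rewrite -(int_by_parts j mE (C1p j) Cphi); apply: I_eq => x _; by rewrite mxE.
  rewrite sumrN -(@I_sum R E _ _ _ mE ip) opprK.
  have lf : l2 E (fun x => f x i ord0).
    by apply: l2_cont => //; exact: (C1d_continuous (C1_C1d (vpoly_C1 vf i))).
  have i1 : itg E (fun x => f x i ord0 * phi x) by exact: itg_ccs.
  have e := I_B mE i1 (itg_sum (index_enum 'I_2) mE ip).
  rewrite addrC -opprB -e; congr (- _).
  by apply: I_eq => x _; rewrite !mxE mulrBl mulr_suml.
- exists (fun x => g x - p x); first exact: is_ctrace_sub.
  move=> l lE; have [q vq hq] := hg l lE; exists (fun x => q x - p x); first exact: vpolyB.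
  by move=> x sx; rewrite hq.
Qed.

(** The definition of the projection selects a continuous trace of v - p,
    which at the vertices has to agree with the trace of v minus p by
    [ctrace_vert]. *)
Lemma Pi_eps_sub E x0 r0 v p : simple_polygon E -> star E x0 r0 -> space_W k E v -> vpoly k.+1 p ->
  Pi_eps mu lam k E (v - p) = Pi_eps mu lam k E v - p.
Proof.
move=> sE stE Wv vp; have [Hv _ [g tg _]] := Wv.
have [_ _ [_ oE] [bE _] _] := sE.
have Cp := vpoly_C1 vp; have Hp : H1 E p by exact: C1_H1.
have Hvp : H1 E (v - p) by exact: H1B.
have [vP aP bP] := Pi_epsP k pd sE Hv.
have HP : H1 E (Pi_eps mu lam k E v) := C1_H1 oE bE (vpoly_C1 vP).
have Tv : is_ctrace E v (ctrace E v) by apply: xgetPex; exists g.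
have Tvp := is_ctrace_sub oE Cp Tv bE.
have Tvp' : is_ctrace E (v - p) (ctrace E (v - p)) by apply: xgetPex; exists (fun x => ctrace E v x - p x).
apply: (Pi_eps_eq pd sE Hvp); split.
- exact: vpolyB.
- move=> q vq; have Hq := C1_H1 oE bE (vpoly_C1 vq).
  have h1 := aformBr mu lam oE HP Hp Hq; have h2 := aformBr mu lam oE Hv Hp Hq.
  rewrite (aP q vq) in h1; exact: (etrans h1 (esym h2)).
- move=> q kq; have h := bP q kq.
  have vB u u' : vert_avg E q (fun x => u x - u' x) = vert_avg E q u - vert_avg E q u'.
    by rewrite /vert_avg -mulrBl -sumrB; congr (_ / _); apply: eq_bigr => x _; rewrite frobBr.
  rewrite vB h -vB /vert_avg; congr (_ / _); rewrite big_seq [RHS]big_seq.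
  by apply: eq_bigr => x xE; congr (frob _ _); exact: (ctrace_vert sE stE Tvp Tvp' xE).
Qed.

Lemma ip0B E (q u w : vfield R) : measurable E -> L2 E q -> L2 E u -> L2 E w ->
  ip0 E q (fun x => u x - w x) = ip0 E q u - ip0 E q w.
Proof.
move=> mE Lq Lu Lw; rewrite /ip0 -I_B//; try exact: itg_frob.
by apply: I_eq => x _; rewrite frobBr.
Qed.

(** Hence the stabilisations may be evaluated at the defects of the
    projections. *)
Lemma space_V_sub E x0 r0 v p : simple_polygon E -> star E x0 r0 -> space_V mu lam k E v -> vpoly k.+1 p ->
  space_V mu lam k E (v - p).
Proof.
move=> sE stE [Wv hv] vp; split; first exact: space_W_sub.
move=> q vq qo; have [_ _ [_ oE] [bE _] _] := sE; have mE := open_measurable2 oE.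
have Hv : H1 E v by case: Wv.
have Lpoly r : vpoly k.+1 r -> L2 E r by move=> vr; apply: C1_L2 => //; exact: vpoly_C1 vr.
have [vP _ _] := Pi_epsP k pd sE Hv.
rewrite (Pi_eps_sub sE stE Wv vp) (ip0B mE (Lpoly _ vq) (Lpoly _ vP) (Lpoly _ vp)).
by rewrite hv// (ip0B mE (Lpoly _ vq) Hv.1 (Lpoly _ vp)).
Qed.

Lemma Pi_0_unique E v p p' : simple_polygon E -> L2 E v -> is_Pi_0 k E v p -> is_Pi_0 k E v p' -> p = p'.
Proof.
move=> [_ _ [[x0 Ex0] oE] [bE _] _] Lv [vp ip] [vp' ip']; have mE := open_measurable2 oE.
have Lpoly r : vpoly k.+1 r -> L2 E r by move=> vr; apply: C1_L2 => //; exact: vpoly_C1 vr.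
pose q : vfield R := fun x => p x - p' x.
have vq : vpoly k.+1 q by exact: vpolyB.
have q0 : ip0 E q q = 0.
  by rewrite /q (ip0B mE (Lpoly _ vq) (Lpoly _ vp) (Lpoly _ vp')) ip// ip'// subrr.
have cq i : continuous (fun x => q x i ord0) := C1d_continuous (C1_C1d (vpoly_C1 vq i)).
have cf : continuous (fun x => frob (q x) (q x)).
  have -> : (fun x => frob (q x) (q x)) = fun x => q x ord0 ord0 * q x ord0 ord0 + q x ord_max ord0 * q x ord_max ord0.
    by apply/funext => x; rewrite frobv.
  by move=> x; apply: cvgD; apply: cvgM; exact: cq.
have qE := cont_int_eq0 oE bE cf (fun x => frob_ge0 (q x)) q0.
have [r r0 hr] := (open_boxP _).1 oE x0 Ex0.
apply/funext => x; apply/eqP; rewrite -subr_eq0; apply/eqP/matrixP => i j.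
rewrite (ord1 j) [RHS]mxE -/(q x); apply: (poly2_eq0 (x0 := x0) (r := r) (vq i) r0).
rewrite (@I_eq _ _ _ (fun=> 0)) ?I_0// => z /hr /qE /frob_eq0 ->.
by rewrite mxE expr0n.
Qed.

(** The default value of the selection is the zero field, a polynomial. *)
Lemma Pi_0_vpoly E v : vpoly k.+1 (Pi_0 k E v).
Proof.
have [ex|nex] := pselect (exists p, is_Pi_0 k E v p); first by have [] := xgetPex (fun=> 0) ex.
rewrite /Pi_0 xgetPN; first exact: vpoly_0.
by move=> p hp; apply: nex; exists p.
Qed.

(** If v has no projection, the default value 0 makes both sides vanish. *)
Lemma Pi_0_sub E v : simple_polygon E -> L2 E v -> Pi_0 k E (v - Pi_0 k E v) = fun=> 0.
Proof.
move=> sE Lv; have [_ _ [_ oE] [bE _] _] := sE; have mE := open_measurable2 oE.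
have Lpoly r : vpoly k.+1 r -> L2 E r by move=> vr; apply: C1_L2 => //; exact: vpoly_C1 vr.
have [ex|nex] := pselect (exists p, is_Pi_0 k E v p); last first.
  have e : Pi_0 k E v = fun=> 0 by apply: xgetPN => p hp; apply: nex; exists p.
  have e2 : v - (fun=> 0) = v by apply/funext => x; rewrite !fctE subr0.
  by rewrite e e2 e.
have [vP hP] : is_Pi_0 k E v (Pi_0 k E v) := xgetPex (fun=> 0) ex.
have h0 : is_Pi_0 k E (v - Pi_0 k E v) (fun=> 0).
  split; first exact: vpoly_0.
  move=> q vq; rewrite (ip0B mE (Lpoly _ vq) Lv (Lpoly _ vP)) hP// subrr.
  by rewrite /ip0 (@I_eq _ _ _ (fun=> 0)) ?I_0// => x _; rewrite frob0r.
have Lvp : L2 E (v - Pi_0 k E v) by apply: L2B => //; exact: Lpoly.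
by apply: (Pi_0_unique sE Lvp _ h0); apply: xgetPex; exists (fun=> 0).
Qed.

Lemma stiffK_ge0 : 0 <= stiffK mu lam. Proof. exact/ltW/stiffK_gt0. Qed.

(** The defects belong to the local space and are annihilated by the
    corresponding projection, so only their stabilisation terms remain. The
    upper bounds of the stabilisations lead to the norms of wh - Pi_0 wh and
    wh - Pi_eps wh, which are split at w. *)
Lemma theta_bound E x0 r0 (rho c1 d1 : R) (Seps S0 : vfield R -> vfield R -> R) (w wh : vfield R) :
  simple_polygon E -> star E x0 r0 -> 0 < rho -> 0 < c1 -> 0 < d1 ->
  space_V mu lam k E wh -> H1 E w ->
  (forall v, space_V mu lam k E v -> Pi_eps mu lam k E v = (fun=> 0) ->
    Seps v v <= c1 * aform mu lam E v v) ->
  (forall v, space_V mu lam k E v -> S0 v v <= d1 * bform rho E v v) ->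
  theta2 mu lam rho k Seps S0 E wh <=
    2 * d1 * rho * (norm0sq E (w - wh) + norm0sq E (w - Pi_0 k E wh)) +
    2 * c1 * stiffK mu lam * (semi1sq E (w - wh) + semi1sq E (w - Pi_eps mu lam k E wh)).
Proof.
move=> sE stE rho0 c10 d10 Vh Hw hSe hS0; have [_ _ [_ oE] [bE _] _] := sE; have mE := open_measurable2 oE.
have [Wh _] := Vh; have Hh : H1 E wh by case: Wh.
set P0 := Pi_0 k E wh; set Pe := Pi_eps mu lam k E wh.
have vP0 : vpoly k.+1 P0 by exact: Pi_0_vpoly.
have [vPe _ _] : is_Pi_eps mu lam k E wh Pe by exact: Pi_epsP.
have HPe : H1 E Pe := C1_H1 oE bE (vpoly_C1 vPe).
have HP0 : H1 E P0 := C1_H1 oE bE (vpoly_C1 vP0).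
have sub0 (u : vfield R) : u - (fun=> 0) = u by apply/funext => x; rewrite !fctE subr0.
apply: lerD.
- have e0 : Pi_0 k E (wh - P0) = fun=> 0 by apply: Pi_0_sub => //; exact: Hh.1.
  have b0 : bform rho E (fun=> 0) (fun=> 0) = 0.
    by rewrite /bform (@I_eq _ _ _ (fun=> 0)) ?I_0// => x _; rewrite frob0r mulr0.
  rewrite /bform_hE e0 b0 add0r sub0; apply: (le_trans (hS0 _ (space_V_sub sE stE Vh vP0))).
  have LB : L2 E (wh - P0) by apply: L2B => //; [exact: Hh.1|exact: HP0.1].
  have -> : bform rho E (wh - P0) (wh - P0) = rho * norm0sq E (wh - P0).
    by apply: I_Z => //; exact: itg_frob.
  have h : norm0sq E (wh - P0) <= 2 * norm0sq E (w - wh) + 2 * norm0sq E (w - P0).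
    have e : wh - P0 = fun x => (w - P0) x - (w - wh) x.
      by apply/funext => x; rewrite !fctE opprB [RHS]addrC addrA subrK.
    rewrite e [leRHS]addrC; apply: norm0B => //; apply: L2B => //; [exact: Hw.1|exact: HP0.1|exact: Hw.1|exact: Hh.1].
  move: h; set a := norm0sq _ _; set b := norm0sq _ _; set c := norm0sq _ _ => h.
  have -> : 2 * d1 * rho * (b + c) = d1 * (rho * (2 * b + 2 * c)) by ring.
  by rewrite ler_pM2l// ler_pM2l.
- have e0 : Pi_eps mu lam k E (wh - Pe) = fun=> 0.
    rewrite (Pi_eps_sub sE stE Wh vPe); apply/funext => x; exact: subrr.
  have a0 : aform mu lam E (fun=> 0) (fun=> 0) = 0.
    have e : (fun=> 0) = (fun x : plane R => (0 : R) *: (0 : 'cV[R]_2)) by apply/funext => x; rewrite scale0r.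
    by rewrite {1}e (aformZl mu lam 0 oE (H1_0 oE) (H1_0 oE)) mul0r.
  rewrite /aform_hE e0 a0 add0r sub0.
  apply: (le_trans (hSe _ (space_V_sub sE stE Vh vPe) e0)).
  have HB : H1 E (wh - Pe) by exact: H1B.
  have hb := aform_bound mu lam oE HB.
  have h : semi1sq E (wh - Pe) <= 2 * semi1sq E (w - wh) + 2 * semi1sq E (w - Pe).
    have e : wh - Pe = fun x => (w - Pe) x - (w - wh) x.
      by apply/funext => x; rewrite !fctE opprB [RHS]addrC addrA subrK.
    by rewrite e [leRHS]addrC; apply: semi1B => //; exact: H1B.
  move: hb h; set a := semi1sq _ _; set b := semi1sq _ _; set c := semi1sq _ _; set aa := aform _ _ _ _ _ => hb h.
  have -> : 2 * c1 * stiffK mu lam * (b + c) = c1 * (stiffK mu lam * (2 * b + 2 * c)) by ring.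
  rewrite ler_pM2l//; apply: le_trans hb _; by rewrite ler_wpM2l// stiffK_ge0.
Qed.

End SpaceSub.

(** * Element residuals *)

Section Residual.
Context {R : realType}.
Implicit Types (E : polygon R) (D : set (plane R)) (u v p q r : vfield R).

Lemma young_int m n D (U V : plane R -> 'M[R]_(m, n)) (t : R) : measurable D -> L2 D U -> L2 D V ->
  0 < t -> 2 * \int[area]_(x in D) frob (U x) (V x) <=
  t * \int[area]_(x in D) frob (U x) (U x) + t^-1 * \int[area]_(x in D) frob (V x) (V x).
Proof.
move=> mD LU LV t0; have iu := itg_frob mD LU LU; have iv := itg_frob mD LV LV.
have iuv := itg_frob mD LU LV; rewrite -(I_Z 2 mD iuv) -(I_Z t mD iu) -(I_Z t^-1 mD iv) -I_D//; try exact: itgZ.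
apply: I_le => //; [exact: itgZ|by apply: itgD => //; exact: itgZ|].
by move=> x _; exact: frob_young.
Qed.

Lemma C1d_prod (b : plane R -> R) b' u i : C1d b b' -> C1_field u ->
  C1d (fun x => (b x *: u x) i ord0) (fun j x => b x * jac u x i j + u x i ord0 * b' j x).
Proof.
move=> Cb Cu; apply: (C1d_ext (C1dM Cb (C1_C1d (Cu i)))) => [x|j x]; first by rewrite mxE.
by rewrite mxE.
Qed.

Lemma C1_prod (b : plane R -> R) b' u : C1d b b' -> C1_field u -> C1_field (fun x => b x *: u x).
Proof. by move=> Cb Cu i; apply/C1P; eexists; exact: (C1d_prod i Cb Cu). Qed.

Lemma jac_prod (b : plane R -> R) b' u x i j : C1d b b' -> C1_field u ->
  jac (fun x => b x *: u x) x i j = b x * jac u x i j + u x i ord0 * b' j x.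
Proof. by move=> Cb Cu; rewrite mxE (partialE j (C1d_prod i Cb Cu).1). Qed.

Lemma sq_le_of_abs (a b : R) : `|a| <= b -> a ^+ 2 <= b ^+ 2.
Proof. by move=> h; rewrite -[a ^+ 2]real_normK ?num_real// ler_sqr ?nnegrE// (le_trans _ h). Qed.

Lemma prod_bounds (b : plane R -> R) b' u (B S T x0 x1 : R) x : C1d b b' -> C1_field u ->
  `|b x| <= 1 -> (forall j, `|b' j x| <= B) ->
  (u x ord0 ord0) ^+ 2 <= S * x0 -> (u x ord_max ord0) ^+ 2 <= S * x1 ->
  (forall j, (jac u x ord0 j) ^+ 2 <= T * x0) -> (forall j, (jac u x ord_max j) ^+ 2 <= T * x1) ->
  frob (b x *: u x) (b x *: u x) <= S * (x0 + x1) /\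
  frob (jac (fun x => b x *: u x) x) (jac (fun x => b x *: u x) x) <= (4 * B ^+ 2 * S + 4 * T) * (x0 + x1).
Proof.
move=> Cb Cu b1 hB s0 s1 t0 t1; have bb : b x ^+ 2 <= 1 by rewrite -(expr1n _ 2); exact: sq_le_of_abs.
have bb0 := sqr_ge0 (b x).
split.
  rewrite frobZl frobZr mulrA -expr2 frobv.
  apply: (@le_trans _ _ (u x ord0 ord0 * u x ord0 ord0 + u x ord_max ord0 * u x ord_max ord0)).
    by rewrite ler_piMl// -!expr2 addr_ge0 ?sqr_ge0.
  by rewrite -!expr2 mulrDr lerD.
have e i j := jac_prod x i j Cb Cu.
rewrite frob2v sum2 !e.
have k (uu jj bj S' T' : R) : uu ^+ 2 <= S' -> jj ^+ 2 <= T' -> `|bj| <= B ->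
    (b x * jj + uu * bj) * (b x * jj + uu * bj) <= 2 * B ^+ 2 * S' + 2 * T'.
  move=> hu hj /sq_le_of_abs hb.
  have e1 : (uu * bj) ^+ 2 <= S' * B ^+ 2 by rewrite exprMn ler_pM ?sqr_ge0.
  have e2 : (b x * jj) ^+ 2 <= T'.
    by rewrite exprMn; apply: le_trans hj; rewrite ler_piMl ?sqr_ge0.
  by have := sqr_ge0 (b x * jj - uu * bj); nra.
have := k _ _ _ _ _ s0 (t0 ord0) (hB ord0); have := k _ _ _ _ _ s0 (t0 ord_max) (hB ord_max).
have := k _ _ _ _ _ s1 (t1 ord0) (hB ord0); have := k _ _ _ _ _ s1 (t1 ord_max) (hB ord_max).
lra.
Qed.

Lemma cross_terms (p q a b : R) : 0 <= p * b -> 0 <= q * a -> p * a + q * b <= (p + q) * (a + b).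
Proof. by move=> pb qa; rewrite mulrDl !mulrDr; lra. Qed.

(** The test field is r times a bump on a box among the star centres. By
    [poly2_int_bound] the integral of r^2 over this box controls r and the
    test field on the element, and Young's inequality absorbs the test
    field. *)
Lemma element_residual (m : nat) (CT : R) : 0 < CT -> exists2 C : R, 0 < C &
  forall E r (d : vfield R) (G : plane R -> 'M[R]_2), regular CT E -> vpoly m r -> L2 E d -> L2 E G ->
  (forall v, C1_field v -> (forall i, C1c E (fun x => v x i ord0)) ->
     \int[area]_(x in E) frob (r x) (v x) =
     \int[area]_(x in E) frob (d x) (v x) + \int[area]_(x in E) frob (G x) (jac v x)) ->
  diam E ^+ 2 * norm0sq E r <=
    C * (diam E ^+ 2 * norm0sq E d + \int[area]_(x in E) frob (G x) (G x)).
Proof.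
move=> CT0; have A1 : 1 <= 16 / CT + 1 by rewrite lerDr divr_ge0// ltW.
have [K K0 hK] := @poly2_int_bound R m (16 / CT + 1) A1.
pose Q := (16 / CT) ^+ 2; have Q0 : 0 < Q by apply: exprn_gt0; exact: divr_gt0.
pose N := 16 * Q * K; pose S := 16 * (20 * Q) * K.
have N0 : 0 < N by apply: mulr_gt0 K0; apply: mulr_gt0.
have S0 : 0 < S by apply: mulr_gt0 K0; apply: mulr_gt0 => //; exact: mulr_gt0.
exists (32 * N ^+ 2 + 32 * N * S * Q).
  by apply: addr_gt0; [apply: mulr_gt0 => //; exact: exprn_gt0|apply: mulr_gt0 Q0; apply: mulr_gt0 S0; exact: mulr_gt0].
move=> E r d G rE vr Ld LG eqn; have [x0 stE] := regular_star rE; have [sE _ _] := rE.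
have [_ _ [_ oE] [bE _] _] := sE; have mE := open_measurable2 oE.
have D0 := diam_gt0 sE; set D := diam E in stE D0 *.
(* the box of radius 4 s around x0 lies in the ball of star centres *)
pose s := CT * D / 16; have s0 : 0 < s by apply: divr_gt0 => //; exact: mulr_gt0.
have sQ : s ^- 2 = Q * D ^- 2 by rewrite /s /Q; field; rewrite !gt_eqF.
have Ex0 : region E x0.
  by have [r00 + _] := stE; apply; rewrite /eball/= eucl_lt ?(ltW r00)// /dist2 !subrr expr0n addr0 exprn_gt0.
have B4E : box x0 (4 * s) `<=` region E.
  move=> x Bx; have [_ + _] := stE; apply; rewrite /eball/=.
  have s4 : 0 <= 4 * s by rewrite mulr_ge0// ltW.
  by apply: le_lt_trans (eucl_box Bx s4) _; rewrite /s; have := mulr_gt0 CT0 D0; lra.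
have EB : region E `<=` box x0 (2 * D).
  move=> x Ex; have := eucl_ediam bE Ex Ex0; rewrite -/(diam E) -/D => h.
  split; [have := abs1_le_eucl x x0|have := abs2_le_eucl x x0]; lra.
have near x : region E x -> `|x.1 - x0.1| <= (16 / CT + 1) * s /\ `|x.2 - x0.2| <= (16 / CT + 1) * s.
  move=> Ex; have := eucl_ediam bE Ex Ex0; rewrite -/(diam E) -/D => h.
  have -> : (16 / CT + 1) * s = D + s by rewrite /s; field; rewrite gt_eqF.
  by split; [have := abs1_le_eucl x x0|have := abs2_le_eucl x x0]; lra.
pose I i := \int[area]_(y in box x0 s) (r y i ord0) ^+ 2.
have I0 i : 0 <= I i by apply: I_ge0 => x _; exact: sqr_ge0.
pose II := I ord0 + I ord_max; have II0 : 0 <= II by exact: addr_ge0.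
have Cr := vpoly_C1 vr.
have cr i : continuous (fun x => r x i ord0) := C1d_continuous (C1_C1d (Cr i)).
have rb i x : region E x -> (r x i ord0) ^+ 2 <= K * s ^- 2 * I i.
  by move=> /near[n1 n2]; have [] := hK _ x0 s (vr i) s0 x n1 n2.
have jb i j x : region E x -> (jac r x i j) ^+ 2 <= K * s ^- 2 * s ^- 2 * I i.
  move=> /near[n1 n2]; have [_ /(_ j)] := hK _ x0 s (vr i) s0 x n1 n2.
  rewrite mxE exprMn mulrC -ler_pdivlMr ?exprn_gt0// => h; apply: le_trans h _.
  by rewrite le_eqVlt; apply/orP; left; apply/eqP; rewrite /I; ring.
pose b := bump x0 (2 * s); have Cb : C1d b (dbump x0 (2 * s)) := C1d_bump _ _.
have s2 : 0 < 2 * s by rewrite mulr_gt0.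
pose v x := b x *: r x; have Cv : C1_field v := C1_prod Cb Cr.
have vc i : C1c E (fun x => v x i ord0).
  apply: (C1c_box (C1d_prod i Cb Cr) (_ : 2 * s < 4 * s) _ B4E); first by lra.
  by move=> y nB; rewrite mxE /b bump_out// mul0r.
have vb x : region E x -> frob (v x) (v x) <= K * s ^- 2 * II /\
    frob (jac v x) (jac v x) <= 20 * K * s ^- 4 * II.
  move=> Ex; have b0 := bump_ge0 x0 (2 * s) x.
  have h := @prod_bounds b _ r (4 * (2 * s)^-1) (K * s ^- 2) (K * s ^- 2 * s ^- 2) (I ord0) (I ord_max) x Cb Cr.
  have [] := h _ (fun j => dbump_le x0 j x s2) (rb ord0 x Ex) (rb ord_max x Ex) (fun j => jb ord0 j x Ex) (fun j => jb ord_max j x Ex).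
    by rewrite /b ger0_norm ?bump_le1.
  move=> h1 h2; split => //; apply: le_trans h2 _.
  by rewrite le_eqVlt; apply/orP; left; apply/eqP; rewrite /II; field; rewrite gt_eqF.
have Lr : L2 E r by exact: C1_L2. have Lv : L2 E v by exact: C1_L2.
have Lj : L2 E (jac v) by exact: jac_L2.
have a4 : (2 * (2 * D)) ^+ 2 * s ^- 2 = 16 * Q by rewrite sQ; field; rewrite gt_eqF.
have D20 : 0 <= 2 * D by rewrite mulr_ge0// ltW.
have Ks : 0 <= K * s ^- 2 * II by rewrite !mulr_ge0 ?invr_ge0 ?sqr_ge0// ltW.
have nr : norm0sq E r <= N * II.
  have -> : N * II = K * s ^- 2 * II * (2 * (2 * D)) ^+ 2.
    by rewrite /N -a4; ring.
  apply: (@I_le_box R E _ x0) => //; first exact: itg_frob.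
  by move=> x Ex; rewrite frobv -!expr2 /II mulrDr lerD ?rb.
have nv : \int[area]_(x in E) frob (v x) (v x) <= N * II.
  have -> : N * II = K * s ^- 2 * II * (2 * (2 * D)) ^+ 2.
    by rewrite /N -a4; ring.
  apply: (@I_le_box R E _ x0) => //; first exact: itg_frob.
  by move=> x Ex; have [] := vb x Ex.
have nj : \int[area]_(x in E) frob (jac v x) (jac v x) <= S * s ^- 2 * II.
  have -> : S * s ^- 2 * II = 20 * K * s ^- 4 * II * (2 * (2 * D)) ^+ 2.
    have -> : S = 20 * K * (16 * Q) by rewrite /S; ring.
    by rewrite -a4; field; rewrite gt_eqF.
  apply: (@I_le_box R E _ x0) => //; first exact: itg_frob.
    by rewrite !mulr_ge0 ?invr_ge0 ?exprn_ge0// ltW.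
  by move=> x Ex; have [] := vb x Ex.
(* the bump is at least 1/4 on the box over which II integrates *)
have low : 4^-1 * II <= \int[area]_(x in E) frob (r x) (v x).
  have mB := @measurable_box R x0 s.
  have Bs : box x0 s `<=` region E.
    by move=> x [x1 x2]; apply: B4E; split; clear -x1 x2 s0; lra.
  have iB i : itg (box x0 s) (fun y => (r y i ord0) ^+ 2).
    apply: itg_continuous => //; first exact: box_bounded.
    by move=> x; apply: cvgM; exact: cr.
  have iv : itg E (fun x => frob (r x) (v x)) by exact: itg_frob.
  have pos x : 0 <= frob (r x) (v x) by rewrite /v frobZr mulr_ge0 ?bump_ge0 ?frob_ge0.
  apply: le_trans (I_sub mE mB Bs iv (fun x _ => pos x)).
  rewrite /II -I_D// -(I_Z _ mB); last exact: itgD.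
  apply: I_le => //; first by apply: itgZ => //; exact: itgD.
    exact: itgS iv.
  move=> x Bx; have Bx2 : box x0 (2 * s / 2) x by have -> : 2 * s / 2 = s by field.
  have := bump_half s2 Bx2; rewrite div1r /v frobZr frobv -!expr2 => hb.
  by rewrite ler_wpM2r// addr_ge0 ?sqr_ge0.
rewrite (eqn v Cv vc) in low.
(* with the weights 8 N and 8 S / s^2 the test field contributes at most II
   / 8 to each of the two terms, and II / 4 can be absorbed *)
have t1 : 0 < 8 * N by exact: mulr_gt0.
have t2 : 0 < 8 * (S * s ^- 2) by apply: mulr_gt0 => //; apply: mulr_gt0 => //; rewrite invr_gt0 exprn_gt0.
have y2 := young_int mE LG Lj t2.
have y1 : _ <= 8 * N * norm0sq E d + _ := young_int mE Ld Lv t1.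
move: low nr nv nj y1 y2.
set dv := \int[area]_(x in E) frob (d x) (v x); set Gj := \int[area]_(x in E) frob (G x) (jac v x).
set vv := \int[area]_(x in E) frob (v x) (v x); set jj := \int[area]_(x in E) frob (jac v x) (jac v x).
set GG := \int[area]_(x in E) frob (G x) (G x); set rr := norm0sq E r; set dd := norm0sq E d.
move=> low nr nv nj y1 y2.
have v8 : (8 * N)^-1 * vv <= 8^-1 * II.
  rewrite invfM -mulrA ler_pM2l ?invr_gt0// mulrC ler_pdivrMr// mulrC//.
have j8 : (8 * (S * s ^- 2))^-1 * jj <= 8^-1 * II.
  rewrite invfM -mulrA ler_pM2l ?invr_gt0// mulrC ler_pdivrMr ?mulr_gt0 ?invr_gt0 ?exprn_gt0// mulrC//.
have IIb : II <= 32 * N * dd + 32 * (S * s ^- 2) * GG by clear -low y1 y2 v8 j8; lra.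
have D2 : 0 < D ^+ 2 by exact: exprn_gt0.
have GG0 : 0 <= GG by apply: I_ge0 => x _; exact: frob_ge0.
have dd0 : 0 <= dd by exact: norm0_ge0.
have h1 : D ^+ 2 * rr <= D ^+ 2 * (N * (32 * N * dd + 32 * (S * s ^- 2) * GG)).
  rewrite ler_pM2l//; apply: le_trans nr _; by rewrite ler_pM2l.
apply: le_trans h1 _.
have -> : D ^+ 2 * (N * (32 * N * dd + 32 * (S * s ^- 2) * GG)) =
   32 * N ^+ 2 * (D ^+ 2 * dd) + 32 * N * S * Q * GG.
  by rewrite sQ; field; rewrite gt_eqF.
have c1 : 0 <= 32 * N ^+ 2 * GG by apply: mulr_ge0 => //; apply: mulr_ge0 => //; exact: sqr_ge0.
have c2 : 0 <= 32 * N * S * Q * (D ^+ 2 * dd).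
  have NS := mulr_ge0 (mulr_ge0 (ltW N0) (ltW S0)) (ltW Q0).
  have -> : 32 * N * S * Q * (D ^+ 2 * dd) = 32 * (N * S * Q) * (D ^+ 2 * dd) by ring.
  by apply: mulr_ge0; [exact: mulr_ge0|apply: mulr_ge0 => //; exact: ltW].
exact: (cross_terms c1 c2).
Qed.

End Residual.

(** * Edge residuals *)

Section Green.
Context {R : realType}.
Implicit Types (E : polygon R) (P Q x : plane R) (u v : vfield R).
Local Notation leb := (@lebesgue_measure R).
Local Notation I01 := `[(0 : R), 1]%classic.

Lemma c01_lerp (f : plane R -> R) P Q : continuous f -> c01 (fun t => f (lerp P Q t)).
Proof.
move=> cf; apply: c01_cont => t; apply: (@continuous_comp _ _ _ (lerp P Q) f); first exact: continuous_lerp.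
exact: cf.
Qed.

(** Where the test field lives the polygon is a half-plane, and
    [divergence_halfplane] applies to the columns of the stress contracted
    with the test field. *)
Lemma green_edge E P Q s (B : set (plane R)) (z : plane R -> R) z' u (sg : plane R -> 'M[R]_2) :
  simple_polygon E -> P != Q -> s ^+ 2 = 1 ->
  (forall x, B x -> (region E x <-> 0 < s * cr P Q x)) ->
  bounded_set B -> (forall t, B (lerp P Q t) -> 0 <= t <= 1) ->
  C1d z z' -> (forall x, ~ B x -> z x = 0) -> (forall j x, ~ B x -> z' j x = 0) ->
  C1_field u -> (forall i j, C1 (fun x => sg x i j)) ->
  \int[area]_(x in E) (frob (sg x) (jac (fun x => z x *: u x) x) + frob (divt sg x) (z x *: u x)) =
  eucl P Q * \int[leb]_(t in I01) frob (sg (lerp P Q t) *m nvec P Q s) (z (lerp P Q t) *: u (lerp P Q t)).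
Proof.
move=> [_ _ [_ oE] [bE _] _] PQ s1 hB bB lB Cz z0 z'0 Cu Csg; have mE := open_measurable2 oE.
have L0 : 0 < eucl P Q by have := dist2_gt0 PQ; rewrite euclC /eucl sqrtr_gt0.
set v := (fun x => z x *: u x); have Cv : C1_field v := C1_prod Cz Cu.
have vE i : C1d (fun x => v x i ord0) (fun j x => jac v x i j).
  by apply: (C1d_ext (C1_C1d (Cv i))) => // j x; rewrite mxE.
have v0 i x : ~ B x -> v x i ord0 = 0 by move=> /z0 e; rewrite mxE e mul0r.
have jv0 i j x : ~ B x -> jac v x i j = 0.
  by move=> nB; rewrite (jac_prod x i j Cz Cu) z0// z'0// mul0r mulr0 addr0.
pose F j x := sg x ord0 j * v x ord0 ord0 + sg x ord_max j * v x ord_max ord0.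
have CF j := C1dD (C1dM (C1_C1d (Csg ord0 j)) (vE ord0)) (C1dM (C1_C1d (Csg ord_max j)) (vE ord_max)).
pose F' j l x := sg x ord0 j * jac v x ord0 l + v x ord0 ord0 * partial l (fun y => sg y ord0 j) x +
  (sg x ord_max j * jac v x ord_max l + v x ord_max ord0 * partial l (fun y => sg y ord_max j) x).
have {}CF j : C1d (F j) (F' j) := CF j.
have F'0 j l x : ~ B x -> F' j l x = 0.
  by move=> nB; rewrite /F' !v0// !jv0// !mulr0 !mul0r !addr0.
have [M M0 hM] := bounded_sub_box bB.
have Fout j x : ~ box (0, 0) M x -> F j x = 0.
  by move=> nb; rewrite /F !v0 ?mulr0 ?addr0// => /hM.
have Fl j (t : R) : ~ (0 <= t <= 1) -> F j (P + t *: (Q - P)) = 0.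
  by move=> nt; rewrite -lerpE /F !v0 ?mulr0 ?addr0// => /lB.
have div j := divergence_halfplane j (CF j) (Fout j) s1 (Fl j); rewrite /= in div.
set H := [set x | _] in div.
have HE x : H x <-> 0 < s * cr P Q x.
  rewrite /H/= /cr; have -> : - s * (Q.2 - P.2) * (x.1 - P.1) + s * (Q.1 - P.1) * (x.2 - P.2) =
    s * ((Q.1 - P.1) * (x.2 - P.2) - (Q.2 - P.2) * (x.1 - P.1)) by ring.
  by [].
have intE j : \int[area]_(x in H) F' j j x = \int[area]_(x in E) F' j j x.
  rewrite (@I_supp _ H (H `&` E)) ?(@I_supp _ E (H `&` E))//; try exact: subIsetl; try exact: subIsetr.
    move=> x Ex nHE; apply: F'0 => Bx; apply: nHE; split => //.
    by apply/HE; apply/hB.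
  move=> x Hx nHE; apply: F'0 => Bx; apply: nHE; split => //.
  by apply/hB => //; apply/HE.
have iF j : itg E (F' j j) by apply: itg_continuous => //; exact: (CF j).2.
rewrite (@I_eq _ E _ (fun x => F' ord0 ord0 x + F' ord_max ord_max x)); last first.
  move=> x Ex; rewrite frob2 (frobv (divt _ _)) /divt !mxE !sum2 /F' /v !mxE; ring.
rewrite I_D// -!intE !div.
have cF j : c01 (fun t => F j (lerp P Q t)) by apply: c01_lerp; exact: (C1d_continuous (CF j)).
have e j : \int[leb]_(t in I01) F j (P + t *: (Q - P)) = \int[leb]_(t in I01) F j (lerp P Q t).
  by apply: eq_Rintegral => t _; rewrite lerpE.
have cc (a : R) : c01 (fun=> a) by apply: c01_cont => t; exact: cvg_cst.
rewrite /pcoord /= !e -RintegralZl//; last exact: c01_int.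
rewrite -RintegralZl//; last exact: c01_int.
rewrite -RintegralD//; [|exact: c01_int (c01M (cc _) (cF _))|exact: c01_int (c01M (cc _) (cF _))].
rewrite -RintegralZl//; last first.
  apply: c01_int.
  have -> : (fun t => frob (sg (lerp P Q t) *m nvec P Q s) (z (lerp P Q t) *: u (lerp P Q t))) = fun t =>
    s * (Q.2 - P.2) / eucl P Q * F ord0 (lerp P Q t) + (- (s * (Q.1 - P.1) / eucl P Q)) * F ord_max (lerp P Q t).
    by apply/funext => t; rewrite frobv !mxE !sum2 !mxE /= /F /v !mxE; ring.
  by apply: c01D; apply: c01M.
apply: eq_Rintegral => t _; rewrite frobv !mxE !sum2 !mxE /= /F /v !mxE; field; rewrite gt_eqF//.
Qed.

(** The restriction of J to the line is extended as a function of [tc]. The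
    squares of the peak values of its components, given by [poly2_peak],
    bound the extension, and near the peaks the bump is not small. *)
Lemma edge_poly (m : nat) (c : R) : 0 < c -> c <= 1 -> exists K c3, [/\ 0 < K, 0 < c3 &
  forall P Q (J : vfield R), P != Q -> vpoly m J -> exists u M0 M1,
  [/\ C1_field u, forall t, u (lerp P Q t) = J (lerp P Q t), 0 <= M0 /\ 0 <= M1,
    forall x, `|tc P Q x - 2^-1| <= 1 ->
     [/\ u x ord0 ord0 ^+ 2 <= K * M0, u x ord_max ord0 ^+ 2 <= K * M1,
      forall j, jac u x ord0 j ^+ 2 <= K * eucl P Q ^- 2 * M0 &
      forall j, jac u x ord_max j ^+ 2 <= K * eucl P Q ^- 2 * M1] &
    c3 * (M0 + M1) <= \int[leb]_(t in I01)
      (bump (lerp P Q 2^-1) (c * eucl P Q) (lerp P Q t) * frob (J (lerp P Q t)) (J (lerp P Q t)))]].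
Proof.
move=> c0 c1; pose r := c / 2; have r0 : 0 < r by rewrite divr_gt0.
pose A := r^-1 + 1; have A1 : 1 <= A by rewrite lerDr invr_ge0 ltW.
have Ar : 1 <= A * r by rewrite /A mulrDl mulVf ?gt_eqF// mul1r lerDl ltW.
have [K [rho [K0 rho0 rho4 hK]]] := @poly2_peak R m A A1.
pose K' := K ^+ 2 + (K / r) ^+ 2.
have KK : K ^+ 2 <= K' by rewrite lerDl sqr_ge0.
have KK' : (K / r) ^+ 2 <= K' by rewrite lerDr sqr_ge0.
exists K', (rho * r / 16); split.
- by rewrite ltr_pwDl ?exprn_gt0 ?sqr_ge0.
- by rewrite divr_gt0// mulr_gt0.
move=> P Q J PQ vJ; have d0 := dist2_gt0 PQ.
have L0 : 0 < eucl P Q by rewrite euclC /eucl sqrtr_gt0.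
have dd : eucl P Q ^+ 2 = dist2 Q P by rewrite eucl_sq /dist2; ring.
have /choice[p hp] : forall i : 'I_2, exists p : {poly R}, (size p <= m)%N /\
    forall t, J (lerp P Q t) i ord0 = p.[t].
  move=> i; have [p sp hp] := poly2_line P (Q - P) (vJ i); exists p; split => // t.
  by rewrite lerpE hp.
(* regarding the polynomial as one of two variables, with the corner of the
   grid at the middle of the edge, puts the peak where the bump is large *)
have pk i := hK _ (2^-1, 0) r (poly_poly2 (hp i).1) r0.
have /choice[Mz hM] : forall i, exists Mz : R * plane R, [/\ 0 <= Mz.1,
   forall t, `|t - Mz.2.1| < rho * r -> Mz.1 / 2 <= `|(p i).[t]|, 0 <= Mz.2.1 - 2^-1 <= r / 2 &
   forall t, `|t - 2^-1| <= 1 -> `|(p i).[t]| <= K * Mz.1 /\ r * `|(p i)^`().[t]| <= K * Mz.1].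
  move=> i; have [M [z [M0 hz z1 z2 hb]]] := pk i; exists (M, z); split => //.
    move=> t tz; apply: (hz (t, z.2)); split => //=.
    by rewrite subrr normr0 mulr_gt0.
  move=> t t1; have [||h1 /(_ ord0) h2] := hb (t, 0).
  - by apply: le_trans t1 Ar.
  - by rewrite subrr normr0 (le_trans ler01).
  split => //; move: h2.
  have Cp := C1d_comp (is_derive_horner (p i)) (@continuous_horner2 R (p i)^`()) (@C1d_fst R).
  by rewrite (partialE ord0 Cp.1)/= mulr1.
pose u x : 'cV[R]_2 := \col_i (p i).[tc P Q x].
have Cu i : C1d (fun x => u x i ord0) (fun j x => (p i)^`().[tc P Q x] *
    ((if j == ord0 then Q.1 - P.1 else Q.2 - P.2) / dist2 Q P)).
  have Cp := C1d_comp (is_derive_horner (p i)) (@continuous_horner2 R (p i)^`()) (@C1d_tc R P Q).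
  by apply: (C1d_ext Cp) => // x; rewrite mxE.
have uJ t : u (lerp P Q t) = J (lerp P Q t).
  by apply/matrixP => i j; rewrite (ord1 j) !mxE (tc_lerp _ PQ) (hp i).2.
exists u, ((Mz ord0).1 ^+ 2), ((Mz ord_max).1 ^+ 2); split => //.
- by move=> i; apply/C1P; eexists; exact: Cu.
- by rewrite !sqr_ge0.
- have ub i x : `|tc P Q x - 2^-1| <= 1 -> u x i ord0 ^+ 2 <= K' * (Mz i).1 ^+ 2.
    move=> tx; have [_ _ _ /(_ _ tx)[h _]] := hM i; rewrite mxE.
    by apply: le_trans (sq_le_of_abs h) _; rewrite exprMn ler_wpM2r ?sqr_ge0.
  have jb i j x : `|tc P Q x - 2^-1| <= 1 -> jac u x i j ^+ 2 <= K' * eucl P Q ^- 2 * (Mz i).1 ^+ 2.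
    move=> tx; have [_ _ _ /(_ _ tx)[_ h]] := hM i; rewrite mxE (partialE j (Cu i).1).
    rewrite exprMn; set dj := (if _ then _ else _).
    have hd : `|dj| <= eucl P Q by rewrite /dj euclC; case: eqP => _; [exact: abs1_le_eucl|exact: abs2_le_eucl].
    have e1 : (dj / dist2 Q P) ^+ 2 <= eucl P Q ^- 2.
      rewrite -dd expr_div_n ler_pdivrMr ?exprn_gt0 ?exprn_gt0//.
      have -> : eucl P Q ^- 2 * (eucl P Q ^+ 2) ^+ 2 = eucl P Q ^+ 2 by field; rewrite gt_eqF.
      exact: sq_le_of_abs.
    have e2 : ((p i)^`().[tc P Q x]) ^+ 2 <= K' * (Mz i).1 ^+ 2.
      have h' : `|(p i)^`().[tc P Q x]| <= K / r * (Mz i).1.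
        by rewrite mulrAC ler_pdivlMr// mulrC.
      by apply: le_trans (sq_le_of_abs h') _; rewrite exprMn ler_wpM2r ?sqr_ge0.
    by rewrite [leRHS]mulrAC; apply: ler_pM; rewrite ?sqr_ge0.
  by move=> x tx; split; [exact: ub|exact: ub|move=> j; exact: jb|move=> j; exact: jb].
- have cJ i : continuous (fun x => J x i ord0) := C1d_continuous (C1_C1d (vpoly_C1 vJ i)).
  pose b t := bump (lerp P Q 2^-1) (c * eucl P Q) (lerp P Q t).
  have cb : c01 b by apply: c01_lerp; exact: (C1d_continuous (C1d_bump _ _)).
  pose k i t := b t * (J (lerp P Q t) i ord0 * J (lerp P Q t) i ord0).
  have ck i : c01 (k i) by apply: c01M => //; apply: c01M; apply: (c01_lerp (f := fun x => J x i ord0)).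
  have cL : 0 < c * eucl P Q by exact: mulr_gt0.
  have low i : rho * r / 16 * (Mz i).1 ^+ 2 <= \int[leb]_(t in I01) k i t.
    have [M0 hz /andP[z1 z2] _] := hM i.
    have e0 : 0 < rho * r / 2 by rewrite divr_gt0// mulr_gt0.
    have e1 : rho * r <= r / 4 by rewrite mulrC ler_pM2l// -div1r.
    have -> : rho * r / 16 * (Mz i).1 ^+ 2 = (4^-1 * ((Mz i).1 / 2) ^+ 2) * (2 * (rho * r / 2)) by field.
    have r2 : r <= 2^-1 by rewrite /r; clear -c1; lra.
    apply: (@c01_ge _ (k i) (Mz i).2.1) => //; try by clear -z1 z2 e0 e1 r2 r0; lra.
      by move=> t _; rewrite mulr_ge0 ?bump_ge0// -expr2 sqr_ge0.
    move=> t /andP[t1 t2]; have tz : `|t - (Mz i).2.1| < rho * r.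
      by clear -t1 t2 e0; rewrite ltr_norml; apply/andP; split; lra.
    have hpt := hz t tz.
    have bt : 4^-1 <= b t.
      rewrite -div1r; apply: (bump_half cL).
      have tr : `|t - 2^-1| < r.
        by clear -t1 t2 z1 z2 e1 r0; rewrite ltr_norml; apply/andP; split; lra.
      have g (dj : R) : `|dj| <= eucl P Q -> `|(t - 2^-1) * dj| < c * eucl P Q / 2.
        move=> hd; rewrite normrM; apply: (@le_lt_trans _ _ (`|t - 2^-1| * eucl P Q)).
          by rewrite ler_wpM2l.
        by rewrite mulrAC ltr_pM2r.
      split.
        have -> : (lerp P Q t).1 - (lerp P Q 2^-1).1 = (t - 2^-1) * (Q.1 - P.1) by rewrite !lerp1; ring.
        by apply: g; rewrite euclC; exact: abs1_le_eucl.
      have -> : (lerp P Q t).2 - (lerp P Q 2^-1).2 = (t - 2^-1) * (Q.2 - P.2) by rewrite !lerp2; ring.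
      by apply: g; rewrite euclC; exact: abs2_le_eucl.
    rewrite /k (hp i).2; apply: ler_pM => //; first exact: sqr_ge0.
    rewrite -expr2 -[X in _ <= X]real_normK ?num_real// ler_sqr ?nnegrE// divr_ge0//.
  have := lerD (low ord0) (low ord_max); rewrite -mulrDr -RintegralD//; [|exact: c01_int|exact: c01_int].
  congr (_ <= _); apply: eq_Rintegral => t _; rewrite /k frobv -mulrDr//.
Qed.

End Green.

Section EdgeResidual.
Context {R : realType}.
Implicit Types (P Q x : plane R) (u v : vfield R).
Local Notation leb := (@lebesgue_measure R).
Local Notation I01 := `[(0 : R), 1]%classic.

Lemma L2S0 m n (D A : set (plane R)) (U : plane R -> 'M[R]_(m, n)) (k : R) x (r : R) : measurable D -> measurable A ->
  L2 D U -> (forall y, ~ A y -> U y = 0) -> A `<=` box x r -> 0 <= r -> 0 <= k ->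
  (forall y, D y -> A y -> frob (U y) (U y) <= k) ->
  \int[area]_(y in D) frob (U y) (U y) <= k * (2 * r) ^+ 2.
Proof.
move=> mD mA LU U0 AB r0 k0 hk; have iU := itg_frob mD LU LU.
rewrite (@I_supp _ D (D `&` A)); last exact: subIsetl.
  apply: (@I_le_box R _ _ x) => //.
  - exact: measurableI.
  - by apply: (itgS mD _ _ iU); [exact: measurableI|exact: subIsetl].
  - by move=> y [_ /AB].
  - by move=> y [Dy Ay]; exact: hk.
move=> y Dy nDA; rewrite U0 ?frob0r// => Ay; exact: nDA.
Qed.

(** Each of at most two elements absorbs half of X. *)
Lemma half_le2 (X : R) (n : nat) : 0 <= X -> (n <= 2)%N -> X / 2 *+ n <= X.
Proof.
move=> X0 n2; have h : n%:R <= 2 :> R by rewrite ler_nat.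
by rewrite -[leLHS]mulr_natr; move: h X0; set q : R := n%:R; nra.
Qed.

Lemma absorb2 (X Y Z W : R) : X <= Y -> 2 * Y <= Z + W -> W <= X -> X <= Z.
Proof. lra. Qed.

Lemma absorb (k a1 a5 t1 t2 a2 a6 i1 i2 X : R) :
  2 * (k * a1) <= t1 * (k ^+ 2 * a2) + i1 -> 2 * (k * a5) <= t2 * (k ^+ 2 * a6) + i2 ->
  i1 <= X / 4 -> i2 <= X / 4 -> 2 * (k * (a1 + a5)) <= k ^+ 2 * (t1 * a2 + t2 * a6) + X / 2.
Proof. lra. Qed.

(** The test field is the jump, extended by [edge_poly] and multiplied by
    the cut-off function z. By [green_edge] the left-hand side of the
    equation becomes the integral of the squared jump over the edge, and
    Young's inequality absorbs the test field in the adjacent elements. *)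
Lemma edge_residual (m : nat) (c : R) : 0 < c -> c <= 4^-1 -> exists2 C : R, 0 < C &
  forall (I : eqType) (js : seq I) (E : I -> polygon R) (sd : I -> R) (sg : I -> plane R -> 'M[R]_2)
    (e : I -> vfield R) (G : I -> plane R -> 'M[R]_2) P Q (kap : R) (J : vfield R)
    (B : set (plane R)) z z',
  P != Q -> (size js <= 2)%N -> vpoly m J ->
  (forall x, J x = kap *: \sum_(i <- js) sg i x *m nvec P Q (sd i)) ->
  B `<=` box (lerp P Q 2^-1) (c * eucl P Q) -> measurable B ->
  C1d z z' -> (forall x, ~ B x -> z x = 0) -> (forall j x, ~ B x -> z' j x = 0) ->
  (forall t, z (lerp P Q t) = bump (lerp P Q 2^-1) (c * eucl P Q) (lerp P Q t)) ->
  (forall i, i \in js -> [/\ simple_polygon (E i), sd i ^+ 2 = 1,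
     forall x, B x -> (region (E i) x <-> 0 < sd i * cr P Q x),
     forall x, region (E i) x -> `|z x| <= 1 /\ forall j, `|z' j x| <= 4 * (c * eucl P Q)^-1 &
     [/\ forall a b, C1 (fun x => sg i x a b), L2 (E i) (e i) & L2 (E i) (G i)]]) ->
  (forall u, C1_field u -> let v := fun x => z x *: u x in
    \sum_(i <- js) \int[area]_(x in E i) (frob (sg i x) (jac v x) + frob (divt (sg i) x) (v x)) =
    \sum_(i <- js) (\int[area]_(x in E i) frob (e i x) (v x) + \int[area]_(x in E i) frob (G i x) (jac v x))) ->
  eucl P Q * seg_int (P, Q) (fun x => frob (J x) (J x)) <=
    C * kap ^+ 2 * \sum_(i <- js) (eucl P Q ^+ 2 * norm0sq (E i) (e i) + \int[area]_(x in E i) frob (G i x) (G i x)).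
Proof.
move=> c0 c1; have c1' : c <= 1 by lra.
have [K [c3 [K0 c30 hK]]] := @edge_poly R m c c0 c1'.
pose K5 := (64 * c ^- 2 + 4) * K.
have K50 : 0 < K5 by apply: mulr_gt0 => //; rewrite ltr_wpDl// mulr_ge0// invr_ge0 sqr_ge0.
exists (4 * K / c3 ^+ 2 * (K + K5)).
  by rewrite mulr_gt0 ?addr_gt0// divr_gt0 ?exprn_gt0// mulr_gt0.
move=> I js E sd sg e G P Q kap J B z z' PQ js2 vJ JE BB mB Cz z0 z'0 zl hE eqn.
have [u [M0 [M1 [Cu uJ [M00 M10] ub low]]]] := hK P Q J PQ vJ.
have L0 : 0 < eucl P Q by have := dist2_gt0 PQ; rewrite euclC /eucl sqrtr_gt0.
set L := eucl P Q in L0 BB zl hE ub low *.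
pose M := M0 + M1; have M_0 : 0 <= M by exact: addr_ge0.
pose v x := z x *: u x; have Cv : C1_field v := C1_prod Cz Cu.
have cL0 : 0 < c * L by exact: mulr_gt0.
have tcB x : B x -> `|tc P Q x - 2^-1| <= 1.
  move=> /BB Bx; have [+ _] := tc_box PQ (ltW c0) Bx; rewrite (tc_lerp _ PQ) => h.
  by apply: le_trans h _; lra.
have lB (t : R) : B (lerp P Q t) -> 0 <= t <= 1.
  move=> /BB Bx; have [+ _] := tc_box PQ (ltW c0) Bx; rewrite !(tc_lerp _ PQ) ler_norml => /andP[h1 h2].
  by clear -h1 h2 c1; apply/andP; split; lra.
have bB : bounded_set B.
  by have [N [Nr hN]] := @box_bounded R (lerp P Q 2^-1) (c * L); exists N; split => // N' hN' x /BB; exact: hN.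
(* testing the equation gives a lower bound by the edge integral *)
have cJ i : continuous (fun x => J x i ord0) := C1d_continuous (C1_C1d (vpoly_C1 vJ i)).
pose b t := bump (lerp P Q 2^-1) (c * L) (lerp P Q t).
have cb : c01 b by apply: c01_lerp; exact: (C1d_continuous (C1d_bump _ _)).
have green : kap * \sum_(i <- js) \int[area]_(x in E i) (frob (sg i x) (jac v x) + frob (divt (sg i) x) (v x)) =
   L * \int[leb]_(t in I01) (b t * frob (J (lerp P Q t)) (J (lerp P Q t))).
  pose f i t := frob (sg i (lerp P Q t) *m nvec P Q (sd i)) (z (lerp P Q t) *: u (lerp P Q t)).
  have ge i : i \in js -> \int[area]_(x in E i) (frob (sg i x) (jac v x) + frob (divt (sg i) x) (v x)) =
      L * \int[leb]_(t in I01) f i t.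
    move=> ij; have [sE s1 hB _ [Csg _ _]] := hE i ij.
    exact: (green_edge sE PQ s1 hB bB lB Cz z0 z'0 Cu Csg).
  have cf i : i \in js -> c01 (f i).
    move=> ij; have [_ _ _ _ [Csg _ _]] := hE i ij.
    have csg a a' : continuous (fun x => sg i x a a') := C1d_continuous (C1_C1d (Csg a a')).
    have -> : f i = fun t => b t * ((sg i (lerp P Q t) ord0 ord0 * nvec P Q (sd i) ord0 ord0 +
        sg i (lerp P Q t) ord0 ord_max * nvec P Q (sd i) ord_max ord0) * J (lerp P Q t) ord0 ord0 +
       (sg i (lerp P Q t) ord_max ord0 * nvec P Q (sd i) ord0 ord0 +
        sg i (lerp P Q t) ord_max ord_max * nvec P Q (sd i) ord_max ord0) * J (lerp P Q t) ord_max ord0).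
      apply/funext => t; rewrite /f zl uJ -/(b t) frobZr; congr (_ * _).
      by rewrite frobv; congr (_ * _ + _ * _); rewrite mxE sum2.
    have cc (a : R) : c01 (fun=> a) by apply: c01_cont => t; exact: cvg_cst.
    have cs a a' : c01 (fun t => sg i (lerp P Q t) a a') by apply: (c01_lerp (f := fun x => sg i x a a')).
    have cj a : c01 (fun t => J (lerp P Q t) a ord0) by apply: (c01_lerp (f := fun x => J x a ord0)).
    by apply: c01M => //; apply: c01D; apply: c01M => //; apply: c01D; apply: c01M.
  rewrite big_seq (eq_bigr _ ge) -big_seq -mulr_sumr mulrCA; congr (_ * _).
  have sumI (ks : seq I) : {subset ks <= js} -> c01 (fun t => \sum_(i <- ks) f i t) /\
     \sum_(i <- ks) \int[leb]_(t in I01) f i t = \int[leb]_(t in I01) \sum_(i <- ks) f i t.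
    elim: ks => [|i ks IH] sub.
      split; first by apply: c01_cont; under eq_fun do rewrite big_nil; move=> t; exact: cvg_cst.
      have -> : (fun t => \sum_(i <- [::]) f i t) = fun=> 0 by apply/funext => t; rewrite big_nil.
      by rewrite big_nil Rintegral_cst// mul0r.
    have [|c4 IH2] := IH; first by move=> j jk; apply: sub; rewrite inE jk orbT.
    have ij : i \in js by apply: sub; rewrite inE eqxx.
    split.
      have -> : (fun t => \sum_(j <- i :: ks) f j t) = fun t => f i t + \sum_(j <- ks) f j t.
        by apply/funext => t; rewrite big_cons.
      by apply: c01D => //; exact: cf.
    rewrite big_cons IH2 -RintegralD//; [|exact: c01_int (cf i ij)|exact: c01_int].
    by apply: eq_Rintegral => t _; rewrite big_cons.
  have [c5 ->] := sumI js (fun i h => h).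
  rewrite -RintegralZl//; last exact: c01_int.
  apply: eq_Rintegral => t _; rewrite /f.
  rewrite [X in frob X _]JE frobZl mulrCA; congr (_ * _).
  elim: (js) => [|i ks IH]; first by rewrite !big_nil frobC frob0r mulr0.
  by rewrite !big_cons frobDl mulrDr IH zl uJ -/(b t) frobZr.
have lowL : c3 * L * M <= kap * \sum_(i <- js) (\int[area]_(x in E i) frob (e i x) (v x) + \int[area]_(x in E i) frob (G i x) (jac v x)).
  rewrite -eqn// green; have := low; rewrite -/(b _) => low'.
  by rewrite mulrAC mulrC ler_pM2l.
have KM0 : 0 <= K * M by rewrite mulr_ge0// ltW.
have vb i : i \in js -> norm0sq (E i) v <= K * M * L ^+ 2 /\
    \int[area]_(x in E i) frob (jac v x) (jac v x) <= K5 * M.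
  move=> ij; have [sE s1 hB zb _] := hE i ij; have [_ _ [_ oE] [bE _] _] := sE.
  have mE := open_measurable2 oE.
  have pw x : region (E i) x -> B x -> frob (v x) (v x) <= K * M /\
      frob (jac v x) (jac v x) <= K5 * L ^- 2 * M.
    move=> Ex /tcB tx; have [u0 u1 j0 j1] := ub x tx; have [z1 zj] := zb x Ex.
    have [p1 p2] := prod_bounds Cz Cu z1 zj u0 u1 j0 j1.
    split => //; apply: le_trans p2 _; rewrite -/M le_eqVlt; apply/orP; left; apply/eqP.
    by rewrite /K5; field; rewrite !gt_eqF.
  have cc1 : (2 * (c * L)) ^+ 2 <= L ^+ 2.
    by rewrite ler_sqr ?nnegrE ?mulr_ge0 ?(ltW L0) ?(ltW c0)//; nra.
  have v00 y : ~ B y -> v y = 0 by move=> nB; rewrite /v z0// scale0r.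
  have jv0 y : ~ B y -> jac v y = 0.
    move=> nB; apply/matrixP => a a'; rewrite (jac_prod y a a' Cz Cu) z0// z'0// mul0r mulr0 addr0.
    by rewrite mxE.
  split.
    apply: (@le_trans _ _ (K * M * (2 * (c * L)) ^+ 2)); last by rewrite ler_wpM2l.
    apply: (L2S0 mE mB _ v00 BB (ltW cL0) KM0); first exact: C1_L2.
    by move=> y Ey By; have [] := pw y Ey By.
  have K5M : 0 <= K5 * L ^- 2 * M by rewrite mulr_ge0// mulr_ge0 ?invr_ge0 ?sqr_ge0// ltW.
  apply: (@le_trans _ _ (K5 * L ^- 2 * M * (2 * (c * L)) ^+ 2)).
    apply: (L2S0 mE mB _ jv0 BB (ltW cL0) K5M); first exact: jac_L2.
    by move=> y Ey By; have [] := pw y Ey By.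
  apply: (@le_trans _ _ (K5 * L ^- 2 * M * L ^+ 2)); first by rewrite ler_wpM2l.
  by rewrite le_eqVlt; apply/orP; left; apply/eqP; field; rewrite gt_eqF.
(* with these weights the test field contributes c3 * L * M / 4 to each term,
   in total at most half of twice the lower bound lowL *)
pose t1 := 4 * K * L / c3; pose t2 := 4 * K5 / (c3 * L).
have t10 : 0 < t1 by rewrite divr_gt0// !mulr_gt0.
have t20 : 0 < t2 by apply: divr_gt0; apply: mulr_gt0.
have yg i : i \in js -> 2 * (kap * (\int[area]_(x in E i) frob (e i x) (v x) + \int[area]_(x in E i) frob (G i x) (jac v x))) <=
    kap ^+ 2 * (t1 * norm0sq (E i) (e i) + t2 * \int[area]_(x in E i) frob (G i x) (G i x)) + c3 * L * M / 2.
  move=> ij; have [sE s1 hB zb [_ Le LG]] := hE i ij; have [_ _ [_ oE] [bE _] _] := sE.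
  have mE := open_measurable2 oE; have [nv nj] := vb i ij.
  have Lv : L2 (E i) v by exact: C1_L2. have Lj : L2 (E i) (jac v) by exact: jac_L2.
  have y1 := young_int mE (L2Z kap mE Le) Lv t10; have y2 := young_int mE (L2Z kap mE LG) Lj t20.
  have e1 : \int[area]_(x in E i) frob (kap *: e i x) (v x) = kap * \int[area]_(x in E i) frob (e i x) (v x).
    by rewrite -(I_Z _ mE); [apply: I_eq => x _; rewrite frobZl|exact: itg_frob].
  have e2 : \int[area]_(x in E i) frob (kap *: G i x) (jac v x) = kap * \int[area]_(x in E i) frob (G i x) (jac v x).
    by rewrite -(I_Z _ mE); [apply: I_eq => x _; rewrite frobZl|exact: itg_frob].
  have e3 : \int[area]_(x in E i) frob (kap *: e i x) (kap *: e i x) = kap ^+ 2 * norm0sq (E i) (e i).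
    by rewrite -(I_Z _ mE); [apply: I_eq => x _; rewrite frobZl frobZr mulrA|exact: itg_frob].
  have e4 : \int[area]_(x in E i) frob (kap *: G i x) (kap *: G i x) = kap ^+ 2 * \int[area]_(x in E i) frob (G i x) (G i x).
    by rewrite -(I_Z _ mE); [apply: I_eq => x _; rewrite frobZl frobZr mulrA|exact: itg_frob].
  rewrite e1 e3 in y1; rewrite e2 e4 in y2.
  have z1 : t1^-1 * norm0sq (E i) v <= c3 * L * M / 4.
    rewrite mulrC ler_pdivrMr//; apply: le_trans nv _.
    by rewrite le_eqVlt; apply/orP; left; apply/eqP; rewrite /t1; field; rewrite gt_eqF.
  have z2 : t2^-1 * \int[area]_(x in E i) frob (jac v x) (jac v x) <= c3 * L * M / 4.
    rewrite mulrC ler_pdivrMr//; apply: le_trans nj _.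
    by rewrite le_eqVlt; apply/orP; left; apply/eqP; rewrite /t2; field; rewrite !gt_eqF.
  exact: (absorb y1 y2 z1 z2).
have sum2c : \sum_(i <- js) (c3 * L * M / 2) <= c3 * L * M.
  have X0 : 0 <= c3 * L * M by rewrite !mulr_ge0// ltW.
  rewrite big_const_seq count_predT iter_addr_0; exact: half_le2.
pose Sm := \sum_(i <- js) (t1 * norm0sq (E i) (e i) + t2 * \int[area]_(x in E i) frob (G i x) (G i x)).
have main : c3 * L * M <= kap ^+ 2 * Sm.
  have h : 2 * (kap * \sum_(i <- js) (\int[area]_(x in E i) frob (e i x) (v x) + \int[area]_(x in E i) frob (G i x) (jac v x)))
     <= kap ^+ 2 * Sm + \sum_(i <- js) (c3 * L * M / 2).
    rewrite mulr_sumr mulr_sumr /Sm mulr_sumr -big_split/= big_seq [leRHS]big_seq.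
    by apply: ler_sum => i; exact: yg.
  exact: (absorb2 lowL h sum2c).
have segb : seg_int (P, Q) (fun x => frob (J x) (J x)) <= L * (K * M).
  rewrite /seg_int/= -/L ler_pM2l//.
  have cc (a : R) : c01 (fun=> a) by apply: c01_cont => t; exact: cvg_cst.
  have cj a : c01 (fun t => J (lerp P Q t) a ord0) by apply: (c01_lerp (f := fun x => J x a ord0)).
  have cJJ : c01 (fun t => frob (J (lerp P Q t)) (J (lerp P Q t))).
    have -> : (fun t => frob (J (lerp P Q t)) (J (lerp P Q t))) = fun t =>
      J (lerp P Q t) ord0 ord0 * J (lerp P Q t) ord0 ord0 + J (lerp P Q t) ord_max ord0 * J (lerp P Q t) ord_max ord0.
      by apply/funext => t; rewrite frobv.
    by apply: c01D; apply: c01M.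
  have := c01_le cJJ (cc (K * M)); rewrite Rintegral_cst//= lebesgue_measure_itv/= lte_fin ltr01.
  rewrite -EFinB/= subr0 mulr1; apply => t /andP[ta tb].
  have [|u0 u1 _ _] := ub (lerp P Q t).
    by rewrite (tc_lerp _ PQ) ler_norml; clear -ta tb; apply/andP; split; lra.
  by rewrite -uJ frobv -!expr2 /M mulrDr lerD.
apply: (@le_trans _ _ (L * (L * (K * M)))); first by rewrite ler_pM2l.
have h1 : L * (L * (K * M)) <= K * L / c3 * (kap ^+ 2 * Sm).
  have -> : L * (L * (K * M)) = K * L / c3 * (c3 * L * M) by field; rewrite gt_eqF.
  by rewrite ler_pM2l// divr_gt0// mulr_gt0.
apply: le_trans h1 _.
have -> : 4 * K / c3 ^+ 2 * (K + K5) * kap ^+ 2 * \sum_(i <- js) (L ^+ 2 * norm0sq (E i) (e i) + \int[area]_(x in E i) frob (G i x) (G i x)) =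
  K * L / c3 * (kap ^+ 2 * \sum_(i <- js) (4 / (c3 * L) * (K + K5) * (L ^+ 2 * norm0sq (E i) (e i) + \int[area]_(x in E i) frob (G i x) (G i x)))).
  by rewrite -mulr_sumr; field; rewrite !gt_eqF.
rewrite ler_wpM2l ?divr_ge0 ?mulr_ge0 ?(ltW K0) ?(ltW L0) ?(ltW c30)//.
rewrite ler_wpM2l ?sqr_ge0//; apply: ler_sum => i _.
have GG0 : 0 <= \int[area]_(x in E i) frob (G i x) (G i x) by apply: I_ge0 => x _; exact: frob_ge0.
have ee0 := norm0_ge0 (E i) (e i).
move: GG0 ee0; set g := \int[area]_(x in E i) _; set n := norm0sq _ _ => g0 n0.
have -> : 4 / (c3 * L) * (K + K5) * (L ^+ 2 * n + g) = (t1 * n + t2 * g) + (4 / (c3 * L)) * (K5 * (L ^+ 2 * n) + K * g).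
  by rewrite /t1 /t2; field; rewrite !gt_eqF.
have q0 : 0 <= 4 / (c3 * L) by rewrite divr_ge0// ltW// mulr_gt0.
have L2 : 0 <= L ^+ 2 * n by rewrite mulr_ge0// sqr_ge0.
by rewrite lerDl mulr_ge0// addr_ge0// mulr_ge0// ltW.
Qed.

End EdgeResidual.

(** * Testing the eigenvalue equation *)

Section WeakForm.
Context {R : realType}.
Implicit Types (D A E : set (plane R)) (u v p : vfield R).

Lemma ediam_set0 : ediam (set0 : set (plane R)) = 0%E.
Proof.
apply/eqP; rewrite eq_le ediam_ge0 andbT; apply: ge_ereal_sup => _ [->//|[x [] []]].
Qed.

Lemma hausdorff1_set0 : hausdorff1 (set0 : set (plane R)) = 0%E.
Proof.
have d0 (d : R) : 0 < d -> hausdorff1_delta d (set0 : set (plane R)) = 0%E.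
  move=> dp; apply/eqP; rewrite eq_le; apply/andP; split.
    apply: ereal_inf_lbound; exists (fun=> set0); first split => //.
      by move=> i; rewrite ediam_set0 lee_fin ltW.
    by apply: eseries0 => i _ _; rewrite ediam_set0.
  apply: le_ereal_inf_tmp => _ [U _ <-]; apply: nneseries_ge0 => i _ _; exact: ediam_ge0.
apply/eqP; rewrite eq_le; apply/andP; split.
  by apply: ge_ereal_sup => _ [d dp <-]; rewrite d0.
by apply: ereal_sup_ubound; exists 1 => //=; exact: d0.
Qed.

(** The constant sequence approximates v, and there is nothing to integrate
    on A. *)
Lemma H1_zero_C1 D A v : open D -> bounded_set D -> C1_field v -> (forall x, A x -> v x = 0) ->
  H1_zero D A v.
Proof.
move=> oD bD Cv v0; split; first exact: C1_H1.
exists (fun=> v); split => //.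
- have e : v - v = fun=> 0 by apply/funext => x; rewrite !fctE subrr.
  have z0 : norm1sq D (fun=> 0) = 0.
    have C0 : C1_field (fun=> 0 : 'cV[R]_2) := vpoly_C1 (@vpoly_0 R 1).
    rewrite (norm1_C1 oD bD C0) (@I_eq _ D _ (fun=> 0)) ?I_0// => x _.
    have -> : jac (fun=> 0 : 'cV[R]_2) x = 0.
      apply/matrixP => i j; rewrite !mxE; have := partialE j (C1d_cst (0 : R)).1 => h.
      by rewrite h.
    by rewrite !frob0r addr0.
  by rewrite e z0; exact: cvg_cst.
- have -> : arc_int A (fun x => frob (v x - 0) (v x - 0)) = 0%E.
    rewrite /arc_int; apply: integral0_eq => t; rewrite /= in_itv/= andbT => t0.
    rewrite (_ : A `&` _ = set0) ?hausdorff1_set0// -subset0 => x [/v0 vx /=].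
    by rewrite vx subr0 frob0r ltNge (ltW t0).
  exact: cvg_cst.
Qed.

Variables (mu lam rho : R).

Lemma weak_form D A w ev v : open D -> bounded_set D -> H1 D w ->
  (forall v, H1_zero D A v -> aform mu lam D w v = ev * bform rho D w v) ->
  C1_field v -> (forall x, A x -> v x = 0) ->
  \int[area]_(x in D) frob (stiff mu lam (sym (wjac D w x))) (jac v x) =
  ev * \int[area]_(x in D) (rho * frob (w x) (v x)).
Proof.
move=> oD bD Hw eqn Cv v0; rewrite -/(bform rho D w v) -eqn; last exact: H1_zero_C1.
by rewrite (aformE mu lam oD (wjacP Hw) (C1_is_wjac oD bD Cv)).
Qed.

Lemma stiff_local D E w v : open D -> open E -> bounded_set E -> E `<=` D -> H1 D w -> C1_field v ->
  \int[area]_(x in E) frob (stiff mu lam (sym (wjac D w x))) (jac v x) =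
  \int[area]_(x in E) frob (stiff mu lam (sym (wjac E w x))) (jac v x).
Proof.
move=> oD oE bE ED Hw Cv; have mE := open_measurable2 oE; have mD := open_measurable2 oD.
have HwE := H1S oD oE ED Hw; have LD := L2S mD mE ED (wjac_L2 Hw).
have Lv := jac_L2 mE bE Cv.
apply: I_aeq_frob => //.
- exact: itg_aform.
- by apply: itg_aform => //; exact: wjac_L2.
- have h : aeq E (wjac D w) (wjac E w) by apply: aeq_sym; exact: wjacS.
  exact: (aeq_op (fun (M : 'M[R]_2) _ => stiff mu lam (sym M)) h h).
- exact: aeq_refl.
Qed.

Lemma stress_poly m p i j : vpoly m p -> poly2 m (fun x => stress mu lam p x i j).
Proof.
move=> vp; have jp a b : poly2 m (fun x => jac p x a b).
  by apply: (eq_poly2 _ (poly2_partial b (vp a))) => x; rewrite mxE.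
apply: (eq_poly2 _ (poly2D (poly2D (poly2D (poly2Z mu (jp i j)) (poly2Z mu (jp j i)))
  (poly2Z (lam *+ (i == j)) (jp ord0 ord0))) (poly2Z (lam *+ (i == j)) (jp ord_max ord_max)))) => x.
by rewrite /stress stiff_symE.
Qed.

Lemma stress_C1 m p i j : vpoly m p -> C1 (fun x => stress mu lam p x i j).
Proof. by move=> /(stress_poly i j); exact: poly2_C1. Qed.

Lemma divt_poly m p : vpoly m p -> vpoly m (divt (stress mu lam p)).
Proof.
move=> vp i; apply: (@eq_poly2 _ _ (fun x => \sum_j partial j (fun y => stress mu lam p y i j) x)).
  by move=> x; rewrite mxE.
by apply: poly2_sum => j _; apply: poly2_partial; exact: stress_poly.
Qed.

(** The stress of the error w - p inside E. *)
Definition defect (E : set (plane R)) w p x := stiff mu lam (sym (wjac E w x - jac p x)).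

Lemma defect_bound E w p : open E -> bounded_set E -> H1 E w -> C1_field p ->
  L2 E (defect E w p) /\
  \int[area]_(x in E) frob (defect E w p x) (defect E w p x) <= stiffK mu lam * semi1sq E (w - p).
Proof.
move=> oE bE Hw Cp; have mE := open_measurable2 oE; have Lj := jac_L2 mE bE Cp.
have LG : L2 E (fun x => wjac E w x - jac p x) by apply: L2B => //; exact: wjac_L2.
have Ld : L2 E (defect E w p) by exact: (@L2_stiff _ mu lam _ (fun x => wjac E w x - jac p x)).
split => //; rewrite (semi1E oE (is_wjacB oE Hw.1 (C1_L2 mE bE Cp) (wjacP Hw) (C1_is_wjac oE bE Cp))).
rewrite -(I_Z _ mE); last exact: itg_frob.
apply: I_le => //; [exact: itg_frob|by apply: itgZ => //; exact: itg_frob|].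
by move=> x _; exact: stiff_sym_bound.
Qed.

Lemma int_defect E w p v : open E -> bounded_set E -> H1 E w -> C1_field p -> C1_field v ->
  \int[area]_(x in E) frob (defect E w p x) (jac v x) =
  \int[area]_(x in E) frob (stiff mu lam (sym (wjac E w x))) (jac v x) -
  \int[area]_(x in E) frob (stress mu lam p x) (jac v x).
Proof.
move=> oE bE Hw Cp Cv; have mE := open_measurable2 oE; have Lj := jac_L2 mE bE Cv.
have Lp := jac_L2 mE bE Cp.
rewrite -I_B//; [|by apply: itg_aform => //; exact: wjac_L2|exact: itg_aform].
by apply: I_eq => x _; rewrite /defect /stress symB stiffB frobBl.
Qed.

(** A field with compact support in E is a test field for w on the whole
    domain, and the polynomial stress can be integrated by parts. *)
Lemma element_equation (D E A : set (plane R)) w ev lamh (p0 pe : vfield R) m v :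
  open D -> bounded_set D -> open E -> bounded_set E -> E `<=` D -> H1 D w ->
  (forall v, H1_zero D A v -> aform mu lam D w v = ev * bform rho D w v) ->
  (forall x, A x -> ~ D x) -> vpoly m p0 -> vpoly m pe ->
  C1_field v -> (forall i, C1c E (fun x => v x i ord0)) ->
  \int[area]_(x in E) frob ((lamh * rho) *: p0 x + divt (stress mu lam pe) x) (v x) =
  \int[area]_(x in E) frob ((lamh * rho) *: p0 x - (ev * rho) *: w x) (v x) +
  \int[area]_(x in E) frob (defect E w pe x) (jac v x).
Proof.
move=> oD bD oE bE ED Hw eqn AD v0 ve Cv cv; have mE := open_measurable2 oE; have mD := open_measurable2 oD.
have HwE := H1S oD oE ED Hw; have Lv := C1_L2 mE bE Cv.
have LpE q : vpoly m q -> L2 E q by move=> vq; apply: C1_L2 => //; exact: vpoly_C1 vq.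
have vE x : ~ E x -> v x = 0.
  by move=> nE; apply/matrixP => i j; rewrite (ord1 j) [RHS]mxE; exact: (ccs_out (C1c_ccs (cv i))).
have jE x : ~ E x -> jac v x = 0.
  by move=> nE; apply/matrixP => i j; rewrite !mxE; exact: (ccs_out (C1c_partial j (cv i))).
have := weak_form oD bD Hw eqn Cv (fun x Ax => vE x (fun Ex => AD x Ax (ED x Ex))).
rewrite (@I_supp _ D E) //; last by move=> x _ /jE ->; rewrite frob0r.
rewrite (@I_supp _ D E (fun x => rho * _))//; last by move=> x _ /vE ->; rewrite frob0r mulr0.
rewrite (stiff_local oD oE bE ED Hw Cv) => wk.
rewrite (int_defect oE bE HwE (vpoly_C1 ve) Cv) wk.
have ld := LpE _ (divt_poly ve).
have parts : \int[area]_(x in E) frob (divt (stress mu lam pe) x) (v x) =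
    - \int[area]_(x in E) frob (stress mu lam pe x) (jac v x).
  have Cs i j : C1 (fun x => stress mu lam pe x i j) := stress_C1 i j ve.
  have is1 i j : itg E (fun x => partial j (fun y => stress mu lam pe y i j) x * v x i ord0).
    by apply: itg_cont_ccs => //; [exact: (C1_C1d (Cs i j)).2|exact: C1c_ccs].
  have is2 i j : itg E (fun x => stress mu lam pe x i j * partial j (fun y => v y i ord0) x).
    by apply: itg_cont_ccs => //; [exact: (C1d_continuous (C1_C1d (Cs i j)))|exact: C1c_partial].
  rewrite (@I_eq _ E _ (fun x => \sum_i \sum_j partial j (fun y => stress mu lam pe y i j) x * v x i ord0)); last first.
    move=> x _; rewrite /frob; apply: eq_bigr => i _; rewrite big_ord1 mxE.
    by rewrite mulr_suml.
  rewrite (@I_sum R E _ _ (fun i x => \sum_j _) mE); last by move=> i; exact: itg_sum.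
  rewrite [in RHS](@I_eq _ E _ (fun x => \sum_i \sum_j stress mu lam pe x i j * partial j (fun y => v y i ord0) x)); last first.
    by move=> x _; apply: eq_bigr => i _; apply: eq_bigr => j _; rewrite [jac _ _ _ _]mxE.
  rewrite (@I_sum R E _ _ (fun i x => \sum_j stress mu lam pe x i j * _) mE); last by move=> i; exact: itg_sum.
  rewrite -sumrN; apply: eq_bigr => i _.
  rewrite (@I_sum R E _ _ (fun j x => _ * v x i ord0) mE)// (@I_sum R E _ _ (fun j x => _ * partial j _ x) mE)// -sumrN.
  by apply: eq_bigr => j _; rewrite (int_by_parts j mE (Cs i j) (cv i)) opprK.
have l0 := L2Z (lamh * rho) mE (LpE _ v0); have lw := L2Z (ev * rho) mE HwE.1.
have i0 := itg_frob mE l0 Lv; have iw := itg_frob mE lw Lv; have idv := itg_frob mE ld Lv.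
rewrite (@I_eq _ E _ (fun x => frob ((lamh * rho) *: p0 x) (v x) + frob (divt (stress mu lam pe) x) (v x))); last first.
  by move=> x _; rewrite frobDl.
rewrite [in RHS](@I_eq _ E _ (fun x => frob ((lamh * rho) *: p0 x) (v x) - frob ((ev * rho) *: w x) (v x))); last first.
  by move=> x _; rewrite frobBl.
rewrite I_D// I_B// parts -addrA; congr (_ + _).
rewrite addrA [- _ + _](_ : _ = 0) ?add0r//.
rewrite -(I_Z ev mE); last by apply: itgZ => //; apply: itg_frob => //; exact: HwE.1.
rewrite addrC; apply/eqP; rewrite subr_eq0; apply/eqP; apply: I_eq => x _.
by rewrite frobZl mulrA.
Qed.

(** In the applications Z is the line through an edge between the elements. *)
Lemma int_cover (D A Z : set (plane R)) f : measurable D -> measurable A -> measurable Z -> area Z = 0%E ->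
  A `<=` D -> itg D f -> (forall x, D x -> ~ A x -> ~ Z x -> f x = 0) ->
  \int[area]_(x in D) f x = \int[area]_(x in A) f x.
Proof.
move=> mD mA mZ Z0 AD fi f0; have fA := itgS mD mA AD fi.
rewrite (I_null mD mZ Z0 fi) (I_null mA mZ Z0 fA); apply: I_supp; last by move=> x [/AD].
by move=> x [Dx nZ] nA; apply: f0 => // Ax; apply: nA.
Qed.

End WeakForm.

(** * Cut-off functions for the edges of a mesh *)

Section EdgeGeom.
Context {R : realType}.
Implicit Types (E : polygon R) (P Q x : plane R).

Lemma half_box_has E (CT c : R) P Q s x : regular CT E -> has_edge E (P, Q) -> edge_side E P Q s ->
  c <= CT ^+ 2 / 128 -> box (lerp P Q 2^-1) (c * eucl P Q) x -> 0 < s * cr P Q x -> region E x.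
Proof.
move=> rE hE es cc [b1 b2] sx; have le : c * eucl P Q <= CT ^+ 2 / 128 * eucl P Q.
  by rewrite ler_wpM2r// eucl_ge0.
have Bx : box (lerp P Q 2^-1) (CT ^+ 2 / 128 * eucl P Q) x.
  by split; [apply: lt_le_trans b1 le|apply: lt_le_trans b2 le].
case/orP: hE => lE; first exact: (half_box_in rE lE es).
apply: (half_box_in rE lE (edge_sideC es)); last by rewrite crC mulrNN.
have e : 1 - 2^-1 = 2^-1 :> R by field.
by rewrite euclC lerpC e.
Qed.

Lemma open_has_edge_notin E P Q y : simple_polygon E -> has_edge E (P, Q) -> open_seg P Q y -> ~ region E y.
Proof.
move=> sE /orP[lE|lE] oy; first by have [] := open_edge_notin sE lE oy.
by rewrite -open_segC in oy; have [] := open_edge_notin sE lE oy.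
Qed.

Lemma on_edge (c : R) P Q x : P != Q -> 0 <= c -> c <= 8^-1 -> box (lerp P Q 2^-1) (c * eucl P Q) x ->
  4^-1 <= tc P Q x <= 3 / 4 /\ (cr P Q x = 0 -> open_seg P Q x).
Proof.
move=> PQ c0 c8 Bx; have [+ _] := tc_box PQ c0 Bx; rewrite (tc_lerp _ PQ) ler_norml => /andP[h1 h2].
split; first by apply/andP; split; lra.
move=> cx; exists (tc P Q x); first by rewrite /= in_itv/=; apply/andP; split; lra.
by rewrite [RHS](edge_coords x PQ) cx mul0r scale0r addr0 lerpE.
Qed.

Lemma cr_line_null P Q : P != Q -> measurable [set x | cr P Q x = 0] /\ area [set x | cr P Q x = 0] = 0%E.
Proof.
move=> PQ; pose a : plane R := (- (Q.2 - P.2), Q.1 - P.1).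
have -> : [set x | cr P Q x = 0] = [set x | a.1 * x.1 + a.2 * x.2 = a.1 * P.1 + a.2 * P.2].
  by apply/seteqP; split => x /=; rewrite /cr /a /= => h; lra.
split; first exact: measurable_line.
apply: area_line; apply: contra PQ => /eqP[h1 h2].
by apply/eqP/injective_projections; lra.
Qed.

End EdgeGeom.

Section Cutoff.
Context {R : realType} (N : nat).
Variables (Om GD GN : set (plane R)) (T : 'I_N -> polygon R) (CT c : R).
Hypotheses (oOm : open Om) (lip : lipschitz_domain Om).
Hypotheses (bdO : bd Om = GD `|` GN) (disj : GD `&` GN = set0).
Hypotheses (msh : is_mesh Om GD GN T) (reg : forall i, regular CT (T i)).
Hypotheses (c0 : 0 < c) (c8 : c <= 8^-1) (cCT : c <= CT ^+ 2 / 128).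

Lemma bd_notin x : bd Om x -> ~ Om x.
Proof. by move=> [_]; rewrite (proj1 (interior_id _) oOm). Qed.

Lemma GD_notin x : GD x -> ~ Om x.
Proof. by move=> h; apply: bd_notin; rewrite bdO; left. Qed.

Lemma mesh_disj i j x : i != j -> region (T i) x -> region (T j) x -> False.
Proof. by have [_ dj _ _] := msh => /dj e a b; rewrite -[False]/(set0 x) -e. Qed.

Lemma mesh_simple i : simple_polygon (T i). Proof. by have [h _ _ _] := msh; have [] := h i. Qed.

Lemma mesh_sub i : region (T i) `<=` Om. Proof. by have [h _ _ _] := msh; have [] := h i. Qed.

Lemma mesh_side i P Q : has_edge (T i) (P, Q) -> P != Q /\ exists s, edge_side (T i) P Q s.
Proof. by have [x0 st] := regular_star (reg i); exact: has_edge_side (mesh_simple i) st. Qed.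

(** What [edge_residual] requires of a cut-off function, for both kinds of
    edges. At an interior edge B is a box. At a Neumann edge the box is
    truncated slightly beyond the edge, because it may reach other parts of
    the domain or of its boundary there. *)
Definition edge_cutoff (js : seq 'I_N) (sd : 'I_N -> R) P Q (B : set (plane R)) (z : plane R -> R) z' :=
  [/\ B `<=` box (lerp P Q 2^-1) (c * eucl P Q), measurable B,
     [/\ C1d z z', forall x, ~ B x -> z x = 0, forall j x, ~ B x -> z' j x = 0 &
       forall t, z (lerp P Q t) = bump (lerp P Q 2^-1) (c * eucl P Q) (lerp P Q t)],
     forall i, i \in js -> [/\ sd i ^+ 2 = 1, forall x, B x -> (region (T i) x <-> 0 < sd i * cr P Q x) &
       forall x, region (T i) x -> `|z x| <= 1 /\ forall j, `|z' j x| <= 4 * (c * eucl P Q)^-1] &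
     (forall x, GD x -> z x = 0) /\
     forall f, itg Om f -> (forall x, ~ B x -> f x = 0) ->
       \int[area]_(x in Om) f x = \sum_(i <- js) \int[area]_(x in T i) f x].

Lemma sides_opp i j P Q s s' : i != j -> edge_side (T i) P Q s -> edge_side (T j) P Q s' -> P != Q -> s' = - s.
Proof.
move=> ij es es' PQ; apply: (side_opp PQ _ es es').
by rewrite -subset0 => x [a b]; exact: (mesh_disj ij a b).
Qed.

(** The two elements fill the two halves of the box, so that the box lies in
    the domain; a third element would have to lie on one of the two sides. *)
Lemma interior_cutoff i j P Q s : has_edge (T i) (P, Q) -> has_edge (T j) (P, Q) -> j != i ->
  open_seg P Q `<=` Om -> edge_side (T i) P Q s ->
  (forall a, has_edge (T a) (P, Q) -> a = i \/ a = j) /\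
  exists B z z', edge_cutoff [:: i; j] (fun a => if a == i then s else - s) P Q B z z'.
Proof.
move=> hi hj ji oO esi; have [PQ [s' esj]] := mesh_side hj.
have ij : i != j by rewrite eq_sym.
have ss := sides_opp ij esi esj PQ; rewrite {s'}ss in esj.
have s1 := esi.1.
split.
  move=> a ha; have [|ai] := eqVneq a i; [by left|right]; apply/eqP; apply: contrapT => /negP aj.
  have [_ [sa esa]] := mesh_side ha.
  have e1 := sides_opp ai esa esi PQ; have e2 := sides_opp aj esa esj PQ.
  by move: s1; rewrite expr2; nra.
have L0 : 0 < eucl P Q by have := dist2_gt0 PQ; rewrite euclC /eucl sqrtr_gt0.
have cL : 0 < c * eucl P Q by exact: mulr_gt0.
pose B := box (lerp P Q 2^-1) (c * eucl P Q).
have ini x : B x -> 0 < s * cr P Q x -> region (T i) x := half_box_has (reg i) hi esi cCT (x := x).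
have inj x : B x -> 0 < - s * cr P Q x -> region (T j) x := half_box_has (reg j) hj esj cCT (x := x).
have sn : s != 0 by rewrite -sqrf_eq0 s1 oner_eq0.
have trich x : B x -> [\/ region (T i) x, region (T j) x | cr P Q x = 0].
  move=> Bx; have [h|h|h] := ltrgtP (s * cr P Q x) 0.
  - by apply: Or32; apply: inj => //; rewrite mulNr oppr_gt0.
  - by apply: Or31; exact: ini.
  - by apply: Or33; move/eqP: h; rewrite mulf_eq0 (negbTE sn)/= => /eqP.
have hBi x : B x -> (region (T i) x <-> 0 < s * cr P Q x).
  move=> Bx; split; last exact: ini.
  move=> Ti; have [h|//|h] := ltrgtP (s * cr P Q x) 0.
    by exfalso; apply: (mesh_disj ij Ti); apply: inj => //; rewrite mulNr oppr_gt0.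
  move/eqP: h; rewrite mulf_eq0 (negbTE sn)/= => /eqP/((on_edge PQ (ltW c0) c8 Bx).2) ox.
  by exfalso; exact: (open_has_edge_notin (mesh_simple i) hi ox Ti).
have hBj x : B x -> (region (T j) x <-> 0 < - s * cr P Q x).
  move=> Bx; split; last exact: inj.
  move=> Tj; have [h|//|h] := ltrgtP (- s * cr P Q x) 0.
    by exfalso; apply: (mesh_disj ji Tj); apply: ini => //; move: h; rewrite mulNr oppr_lt0.
  move/eqP: h; rewrite mulf_eq0 oppr_eq0 (negbTE sn)/= => /eqP/((on_edge PQ (ltW c0) c8 Bx).2) ox.
  by exfalso; exact: (open_has_edge_notin (mesh_simple j) hj ox Tj).
exists B, (bump (lerp P Q 2^-1) (c * eucl P Q)), (dbump (lerp P Q 2^-1) (c * eucl P Q)); split => //.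
- exact: measurable_box.
- split => //; [exact: C1d_bump|by move=> x; exact: bump_out|by move=> b x; exact: dbump_out].
- have zb x : `|bump (lerp P Q 2^-1) (c * eucl P Q) x| <= 1 /\
      forall b, `|dbump (lerp P Q 2^-1) (c * eucl P Q) b x| <= 4 * (c * eucl P Q)^-1.
    by split; [rewrite ger0_norm ?bump_le1 ?bump_ge0|move=> b; exact: dbump_le].
  move=> a; rewrite !inE => /orP[/eqP ->|/eqP ->]; rewrite ?eqxx ?(negbTE ji); split => //.
  by rewrite sqrrN.
split.
  move=> x gx; apply: bump_out => // Bx; apply: (GD_notin gx).
  case: (trich x Bx) => [|| cx]; [exact: mesh_sub|exact: mesh_sub|].
  exact: oO ((on_edge PQ (ltW c0) c8 Bx).2 cx).
move=> f fi f0; have [mZ Z0] := cr_line_null PQ.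
have mT a : measurable (region (T a)).
  by apply: open_measurable2; have [_ _ [_ ?] _ _] := mesh_simple a.
have mO := open_measurable2 oOm.
have AO : region (T i) `|` region (T j) `<=` Om by move=> x [|]; exact: mesh_sub.
rewrite !big_cons big_nil addr0 (int_cover mO (measurableU _ _ (mT i) (mT j)) mZ Z0 AO fi).
  apply: I_setU => //; first by rewrite -subset0 => x [a b]; exact: (mesh_disj ij a b).
  by apply: (itgS mO _ AO fi); exact: measurableU.
move=> x Ox nA nZ; apply: f0 => Bx; case: (trich x Bx) => h; last by apply: nZ.
  by apply: nA; left.
by apply: nA; right.
Qed.

(** Beyond the edge there is a strip without points of the domain
    ([empty_strip]). In this strip the bump is multiplied by a function g
    that decreases from 1 to 0; g is constant on the inner side, so the
    bounds in the element are unaffected. A second element would leave no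
    points outside the closure of the domain, against [lipschitz_outside]. *)
Lemma boundary_cutoff i P Q s : has_edge (T i) (P, Q) -> open_seg P Q `<=` GN ->
  edge_side (T i) P Q s ->
  (forall a, has_edge (T a) (P, Q) -> a = i) /\
  exists B z z', edge_cutoff [:: i] (fun=> s) P Q B z z'.
Proof.
move=> hi oN esi; have [PQ _] := mesh_side hi; have s1 := esi.1.
have eb : open_seg P Q `<=` bd Om by move=> x /oN; rewrite bdO; right.
have sn : s != 0 by rewrite -sqrf_eq0 s1 oner_eq0.
have L0 : 0 < eucl P Q by have := dist2_gt0 PQ; rewrite euclC /eucl sqrtr_gt0.
have cL : 0 < c * eucl P Q by exact: mulr_gt0.
pose B0 := box (lerp P Q 2^-1) (c * eucl P Q).
have ini x : B0 x -> 0 < s * cr P Q x -> region (T i) x := half_box_has (reg i) hi esi cCT (x := x).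
split.
  move=> a ha; apply/eqP; apply: contrapT => /negP ai.
  have [_ [sa esa]] := mesh_side ha; have e := sides_opp ai esa esi PQ.
  have ina x : B0 x -> 0 < sa * cr P Q x -> region (T a) x := half_box_has (reg a) ha esa cCT (x := x).
  have [x Bx ncl] := lipschitz_outside oOm lip (eb _ (open_seg_mid P Q)) cL.
  apply: ncl; have [h|h|h] := ltrgtP (s * cr P Q x) 0.
  - apply: subset_closure; apply: (@mesh_sub a); apply: ina => //.
    by have -> : sa = - s by [rewrite e opprK]; rewrite mulNr oppr_gt0.
  - by apply: subset_closure; apply: (@mesh_sub i); exact: ini.
  - move/eqP: h; rewrite mulf_eq0 (negbTE sn)/= => /eqP/((on_edge PQ (ltW c0) c8 Bx).2)/eb[]//.
(* d depends on the mesh, but it enters only the behaviour of the cut-off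
   function outside the domain *)
have [d d0 strip] := empty_strip oOm lip (@mesh_sub i) PQ esi eb.
have strip' x : B0 x -> - d < s * cr P Q x -> s * cr P Q x <= 0 -> ~ Om x.
  move=> Bx h1 h2; apply: strip; first exact: (on_edge PQ (ltW c0) c8 Bx).1.
  by rewrite h2 (ltW h1).
pose B := B0 `&` [set x | - d < s * cr P Q x].
have CS := C1dZ s (C1d_cr P Q).
have oS : open [set x | - d < s * cr P Q x].
  by apply: (@open_comp _ _ (fun x => s * cr P Q x) [set t | - d < t]) => [x _|]; [exact: (C1d_continuous CS)|exact: open_gt].
have CG := C1d_pos2 (C1dB (C1d_cst 1) (C1dZ (d ^- 2) (C1d_pos2 (C1dN CS)))).
set g := (fun x => pos2 _) in CG; set g' := (fun (j : 'I_2) (x : plane R) => _ : R) in CG.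
have CZ := C1dM (C1d_bump (lerp P Q 2^-1) (c * eucl P Q)) CG.
have gin x : 0 <= s * cr P Q x -> g x = 1 /\ forall j, g' j x = 0.
  move=> h; have m0 : Num.max 0 (- (s * cr P Q x)) = 0 by apply/max_idPl; rewrite oppr_le0.
  rewrite /g /g' /pos2 m0 expr0n mulr0 subr0; split.
    by rewrite (max_idPr _) ?expr1n.
  by move=> j; rewrite !(mulr0, mul0r) subr0 mulr0.
have gout x : s * cr P Q x <= - d -> g x = 0 /\ forall j, g' j x = 0.
  move=> h; have dy : 0 < d <= - (s * cr P Q x) by rewrite d0/=; lra.
  have m1 : Num.max 0 (- (s * cr P Q x)) = - (s * cr P Q x) by apply/max_idPr; lra.
  have m0 : Num.max 0 (1 - d ^- 2 * (- (s * cr P Q x)) ^+ 2) = 0.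
    apply/max_idPl; rewrite subr_le0 mulrC ler_pdivlMr ?exprn_gt0// mul1r ler_sqr ?nnegrE; lra.
  by rewrite /g /g' /pos2 m1 m0 expr0n mulr0; split => // j; rewrite mul0r.
have g01 x : 0 <= g x <= 1.
  rewrite /g /pos2 sqr_ge0/= expr_le1//; last by rewrite le_max lexx.
  by rewrite ge_max ler01/= gerBl mulr_ge0 ?invr_ge0 ?sqr_ge0.
have hB x : B x -> (region (T i) x <-> 0 < s * cr P Q x).
  move=> [Bx dx]; split; last exact: ini.
  by move=> Ti; rewrite ltNge; apply/negP => h; exact: (strip' x Bx dx h (mesh_sub Ti)).
have outB x : ~ B x -> ~ B0 x \/ s * cr P Q x <= - d.
  move=> nB; have [Bx|] := pselect (B0 x); [right|by left].
  by rewrite leNgt; apply/negP => h; apply: nB.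
exists B, (fun x => bump (lerp P Q 2^-1) (c * eucl P Q) x * g x),
  (fun j x => bump (lerp P Q 2^-1) (c * eucl P Q) x * g' j x + g x * dbump (lerp P Q 2^-1) (c * eucl P Q) j x).
split.
- by move=> x [].
- by apply: measurableI; [exact: measurable_box|exact: open_measurable2].
- split; first exact: CZ.
  + by move=> x /outB[/(bump_out cL) ->|/gout[-> _]]; rewrite ?mul0r ?mulr0.
  + move=> j x /outB[nB|/gout[gx g'x]]; first by rewrite (bump_out cL nB) (dbump_out j cL nB) mul0r mulr0 addr0.
    by rewrite g'x gx mulr0 mul0r addr0.
  + move=> t; have [|-> _] := gin (lerp P Q t); first by rewrite cr_line mulr0.
    by rewrite mulr1.
- move=> a; rewrite inE => /eqP ->; split => // x Ti.
  have b0 := bump_ge0 (lerp P Q 2^-1) (c * eucl P Q) x; have b1 := bump_le1 (lerp P Q 2^-1) (c * eucl P Q) x.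
  have /andP[ga gb] := g01 x; split.
    by rewrite (ger0_norm (mulr_ge0 b0 ga)); apply: mulr_ile1.
  have r4 : 0 <= 4 * (c * eucl P Q)^-1 by rewrite mulr_ge0// invr_ge0 ltW.
  move=> j; have [Bx|nB] := pselect (B0 x); last first.
    by rewrite (bump_out cL nB) (dbump_out j cL nB) mul0r mulr0 addr0 normr0.
  have [dx|/gout[-> g'x]] := ltP (- d) (s * cr P Q x); last by rewrite g'x mulr0 mul0r addr0 normr0.
  have sx : 0 < s * cr P Q x by apply/hB.
  have [gx g'x] := gin x (ltW sx).
  rewrite g'x gx mulr0 add0r mul1r; exact: dbump_le.
split.
  move=> x gx; have [Bx|nB] := pselect (B x); last first.
    by have [/(bump_out cL) ->|/gout[-> _]] := outB x nB; rewrite ?mul0r ?mulr0.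
  exfalso; have [Bx0 dx] := Bx; have [h|h|h] := ltrgtP (s * cr P Q x) 0.
  - have : bd Om x by rewrite bdO; left.
    move=> [cx _].
    have oU : open (B0 `&` ([set x | - d < s * cr P Q x] `&` [set x | s * cr P Q x < 0])).
      apply: openI; [exact: open_box|apply: openI => //].
      by apply: (@open_comp _ _ (fun x => s * cr P Q x) [set t | t < 0]) => [y _|]; [exact: (C1d_continuous CS)|exact: open_lt].
    have [y [Oy [By [dy ny]]]] : (Om `&` (B0 `&` ([set x | - d < s * cr P Q x] `&` [set x | s * cr P Q x < 0]))) !=set0.
      by apply: cx; apply: open_nbhs_nbhs; split.
    by apply: (strip' y By dy (ltW ny) Oy).
  - by apply: (GD_notin gx); apply: (@mesh_sub i); exact: ini.
  - move/eqP: h; rewrite mulf_eq0 (negbTE sn)/= => /eqP/((on_edge PQ (ltW c0) c8 Bx0).2)/oN nx.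
    by rewrite -[False]/(set0 x) -disj.
move=> f fi f0; have [mZ Z0] := cr_line_null PQ.
have mT : measurable (region (T i)).
  by apply: open_measurable2; have [_ _ [_ ?] _ _] := mesh_simple i.
rewrite big_seq1 (int_cover (open_measurable2 oOm) mT mZ Z0 (@mesh_sub i) fi)// => x Ox nT nZ.
apply: f0 => -[Bx dx]; have [h|h] := ltP 0 (s * cr P Q x); first by apply: nT; exact: ini.
exact: (strip' x Bx dx h Ox).
Qed.

End Cutoff.

(** * Estimates on one mesh *)

Section Estimates.
Context {R : realType}.
Variables (mu lam rho : R) (k : nat) (CT : R).
Hypotheses (pd : stiff_posdef mu lam) (CT0 : 0 < CT).

(** The data of one mesh are collected in order to quantify constants before
    them. *)
Definition setting (Om GD GN : set (plane R)) N (T : 'I_N -> polygon R) (ev : R) (w wh : vfield R) :=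
  [/\ [/\ open Om, bounded_set Om, lipschitz_domain Om, bd Om = GD `|` GN & GD `&` GN = set0],
      is_mesh Om GD GN T, forall i, regular CT (T i),
      H1 Om w /\ (forall v, H1_zero Om GD v -> aform mu lam Om w v = ev * bform rho Om w v) &
      forall i, space_V mu lam k (T i) wh].

Section OneMesh.
Context {N : nat}.
Variables (T : 'I_N -> polygon R) (ev lamh : R) (w wh : vfield R).

Definition data_diff (a : 'I_N) : vfield R := fun x => (lamh * rho) *: Pi_0 k (T a) wh x - (ev * rho) *: w x.

Definition residual_field (a : 'I_N) : vfield R := fun x =>
  (lamh * rho) *: Pi_0 k (T a) wh x + divt (stress mu lam (Pi_eps mu lam k (T a) wh)) x.

(** The size of the data in the equations of the residuals. It bounds the
    residuals and is bounded by the error. *)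
Definition data_size (a : 'I_N) : R := diam (T a) ^+ 2 * norm0sq (T a) (data_diff a) +
  let S := defect mu lam (T a) w (Pi_eps mu lam k (T a) wh) in \int[area]_(x in T a) frob (S x) (S x).

Lemma data_size_ge0 a : 0 <= data_size a.
Proof.
rewrite /data_size; apply: addr_ge0; first by apply: mulr_ge0; [exact: sqr_ge0|exact: norm0_ge0].
by apply: I_ge0 => x _; exact: frob_ge0.
Qed.

End OneMesh.

Section Setting.
Variables (Om GD GN : set (plane R)) (N : nat) (T : 'I_N -> polygon R) (ev : R) (w wh : vfield R).
Hypothesis st : setting Om GD GN T ev w wh.

Lemma setting_elem a : [/\ simple_polygon (T a), open (region (T a)), bounded_set (region (T a)),
  region (T a) `<=` Om & H1 (T a) w].
Proof.
have [[oOm bOm _ _ _] msh _ [Hw _] _] := st; have sE := mesh_simple msh a; have sO := mesh_sub msh (i := a).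
have [_ _ [_ oE] [bE _] _] := sE; split => //; exact: H1S Hw.
Qed.

Lemma setting_poly a : [/\ H1 (T a) wh, vpoly k.+1 (Pi_0 k (T a) wh) & vpoly k.+1 (Pi_eps mu lam k (T a) wh)].
Proof.
have [_ _ _ _ /(_ a)[[Hh _ _] _]] := st; have [sE _ _ _ _] := setting_elem a.
by split => //; [exact: Pi_0_vpoly|have [] := Pi_epsP k pd sE Hh].
Qed.

Lemma setting_fields lamh a : [/\ L2 (T a) (data_diff T ev lamh w wh a), vpoly k.+1 (residual_field T lamh wh a),
  L2 (T a) (residual_field T lamh wh a) &
  L2 (T a) (defect mu lam (T a) w (Pi_eps mu lam k (T a) wh))].
Proof.
have [sE oE bE EO HwE] := setting_elem a; have [Hh v0 ve] := setting_poly a.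
have mE := open_measurable2 oE.
have LpE q : vpoly k.+1 q -> L2 (T a) q by move=> vq; apply: C1_L2 => //; exact: vpoly_C1 vq.
have vr : vpoly k.+1 (residual_field T lamh wh a).
  apply: vpolyD; last exact: divt_poly.
  by move=> i; apply: (eq_poly2 _ (poly2Z (lamh * rho) (v0 i))) => x; rewrite mxE.
split => //; last by have [] := defect_bound mu lam oE bE HwE (vpoly_C1 ve).
  by apply: L2B => //; apply: L2Z => //; [exact: LpE|exact: HwE.1].
exact: LpE.
Qed.

End Setting.

(** [element_equation] provides the hypothesis of [element_residual]. *)
Lemma element_estimate : exists2 C : R, 0 < C & forall Om GD GN N (T : 'I_N -> polygon R) ev lamh w wh,
  setting Om GD GN T ev w wh -> forall a,
  diam (T a) ^+ 2 * norm0sq (T a) (residual_field T lamh wh a) <= C * data_size T ev lamh w wh a.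
Proof.
have [C C0 hC] := element_residual k.+1 CT0; exists C => // Om GD GN N T ev lamh w wh st a.
have [sE oE bE EO HwE] := setting_elem st a; have [Hh v0 ve] := setting_poly st a.
have [Ld vr _ LG] := setting_fields st lamh a.
have [[oOm bOm _ bdO _] _ reg [Hw eqn] _] := st.
apply: (hC _ _ _ _ (reg a) vr Ld LG) => v Cv cv.
exact: (@element_equation _ mu lam rho _ _ _ _ _ lamh _ _ _ _ oOm bOm oE bE EO Hw eqn (GD_notin oOm bdO) v0 ve Cv cv).
Qed.

Lemma has_edge_len (E : polygon R) P Q : regular CT E -> has_edge E (P, Q) ->
  CT * diam E < eucl P Q /\ eucl P Q <= diam E.
Proof. by move=> rE /orP[|] /(edge_len rE)//=; rewrite euclC. Qed.

Lemma jump_equation_alg (s d W t : R) : s + d = d + W - (t - s) + (t - W).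
Proof. by ring. Qed.

Lemma jump_data_alg (L2 D2 ne nr nd g C : R) : L2 <= D2 -> 0 <= D2 -> 0 <= ne -> ne <= 2 * nr + 2 * nd -> D2 * nr <= C * (D2 * nd + g) ->
  0 <= g -> 0 <= C -> 0 <= nd -> L2 * ne + g <= (2 * C + 3) * (D2 * nd + g).
Proof.
move=> LD D0 n0 nn hr g0 C0 d0.
have h1 : L2 * ne <= D2 * ne := ler_wpM2r n0 LD.
have h2 : D2 * ne <= D2 * (2 * nr + 2 * nd) := ler_wpM2l D0 nn.
have h3 : 0 <= D2 * nd := mulr_ge0 D0 d0.
lra.
Qed.

(** [edge_residual] for the elementwise stresses: the weak equation tested
    with the cut-off field splits into its parts over the adjacent elements.
    The right-hand side contains the element residuals, for which
    [element_estimate] is available. *)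
Lemma stress_jump_estimate : exists2 C : R, 0 < C & forall Om GD GN N (T : 'I_N -> polygon R) ev lamh w wh c,
  setting Om GD GN T ev w wh -> c = Num.min (CT ^+ 2 / 128) 8^-1 ->
  forall (js : seq 'I_N) (sd : 'I_N -> R) P Q B z z' (kap : R) (J : vfield R),
  P != Q -> uniq js -> (size js <= 2)%N -> (forall a, a \in js -> has_edge (T a) (P, Q)) ->
  edge_cutoff Om GD T c js sd P Q B z z' -> kap ^+ 2 <= 1 ->
  (forall x, J x = kap *: \sum_(a <- js) stress mu lam (Pi_eps mu lam k (T a) wh) x *m nvec P Q (sd a)) ->
  eucl P Q * seg_int (P, Q) (fun x => frob (J x) (J x)) <= C * \sum_(a <- js) data_size T ev lamh w wh a.
Proof.
have [C1 C10 hC1] := element_estimate.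
pose c := Num.min (CT ^+ 2 / 128) 8^-1.
have cp : 0 < c by rewrite lt_min divr_gt0 ?exprn_gt0//= invr_gt0.
have c4 : c <= 4^-1.
  have : c <= 8^-1 by rewrite ge_min lexx orbT.
  by lra.
have [C2 C20 hC2] := edge_residual k.+1 cp c4.
exists (C2 * (2 * C1 + 3)); first by rewrite mulr_gt0// ltr_wpDl// mulr_ge0// ltW.
move=> Om GD GN N T ev lamh w wh _ st -> js sd P Q B z z' kap J PQ ujs js2 hjs cut kap1 JE.
have [[oOm bOm _ bdO _] msh reg [Hw eqn] _] := st; have mO := open_measurable2 oOm.
have [BB mB [Cz z0 z'0 zl] hcut [zGD split_int]] := cut.
pose pe a := Pi_eps mu lam k (T a) wh.
pose e a : vfield R := fun x => residual_field T lamh wh a x - data_diff T ev lamh w wh a x.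
pose G a : plane R -> 'M[R]_2 := fun x => - defect mu lam (T a) w (pe a) x.
have vJ : vpoly k.+1 J.
  move=> i; apply: (@eq_poly2 _ _ (fun x => kap * \sum_(a <- js) (stress mu lam (pe a) x i ord0 * nvec P Q (sd a) ord0 ord0 +
     stress mu lam (pe a) x i ord_max * nvec P Q (sd a) ord_max ord0))).
    move=> x; rewrite JE mxE summxE; congr (_ * _); apply: eq_bigr => a _.
    by rewrite [RHS]mxE sum2.
  apply: poly2Z; apply: poly2_sum => a _; have [_ _ ve] := setting_poly st a.
  by apply: poly2D; apply: (eq_poly2 _ (poly2Z _ (stress_poly mu lam i _ ve))) => x; rewrite mulrC.
have Le a : L2 (T a) (e a).
  have [sE oE bE EO HwE] := setting_elem st a; have mE := open_measurable2 oE.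
  by have [Ld _ Lr _] := setting_fields st lamh a; exact: L2B.
have LG a : L2 (T a) (G a).
  have [sE oE bE EO HwE] := setting_elem st a; have mE := open_measurable2 oE.
  by have [_ _ _ Ldf] := setting_fields st lamh a; exact: L2N.
have key := hC2 _ js T sd (fun a => stress mu lam (pe a)) e G P Q kap J B z z' PQ js2 vJ JE BB mB Cz z0 z'0 zl.
have {}key := key _ _; apply: le_trans (key _ _) _.
- move=> a aj; have [s1 hB zb] := hcut a aj; have [sE oE bE EO HwE] := setting_elem st a.
  have [_ _ ve] := setting_poly st a; split => //; split => // i j; exact: stress_C1 ve.
- move=> u Cu v; have Cv : C1_field v := C1_prod Cz Cu.
  have vB x : ~ B x -> v x = 0 by move=> nB; rewrite /v z0// scale0r.
  have jB x : ~ B x -> jac v x = 0.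
    move=> nB; apply/matrixP => a a'; rewrite (jac_prod x a a' Cz Cu) z0// z'0// mul0r mulr0 addr0.
    by rewrite mxE.
  have v0 x : GD x -> v x = 0 by move=> gx; rewrite /v zGD// scale0r.
  have wk := weak_form oOm bOm Hw eqn Cv v0.
  have Lv := C1_L2 mO bOm Cv; have Lj := jac_L2 mO bOm Cv.
  have Ljw := wjac_L2 Hw.
  have i1 : itg Om (fun x => frob (stiff mu lam (sym (wjac Om w x))) (jac v x)) by exact: itg_aform.
  have i2 : itg Om (fun x => rho * frob (w x) (v x)).
    by apply: itgZ => //; apply: itg_frob => //; exact: Hw.1.
  rewrite (split_int _ i1) in wk; last by move=> x /jB ->; rewrite frob0r.
  rewrite (split_int _ i2) in wk; last by move=> x /vB ->; rewrite frob0r mulr0.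
  have loc a : \int[area]_(x in T a) (frob (stress mu lam (pe a) x) (jac v x) + frob (divt (stress mu lam (pe a)) x) (v x)) =
      \int[area]_(x in T a) frob (e a x) (v x) + \int[area]_(x in T a) frob (G a x) (jac v x)
      + (\int[area]_(x in T a) frob (stiff mu lam (sym (wjac Om w x))) (jac v x)
         - ev * \int[area]_(x in T a) (rho * frob (w x) (v x))).
    have [sE oE bE EO HwE] := setting_elem st a; have mE := open_measurable2 oE.
    have [_ _ ve] := setting_poly st a.
    have LvE := C1_L2 mE bE Cv; have LjE := jac_L2 mE bE Cv.
    have Ld : L2 (T a) (divt (stress mu lam (pe a))).
      by apply: C1_L2 => //; exact: vpoly_C1 (divt_poly mu lam ve).
    have idv := itg_frob mE Ld LvE.
    have iwv := itg_frob mE HwE.1 LvE.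
    have isj : itg (T a) (fun x => frob (stress mu lam (pe a) x) (jac v x)).
      by apply: itg_aform => //; apply: jac_L2 => //; exact: vpoly_C1 ve.
    rewrite (@I_eq _ _ (fun x => frob (e a x) (v x)) (fun x => frob (divt (stress mu lam (pe a)) x) (v x) +
      ev * (rho * frob (w x) (v x)))); last first.
      move=> x _; rewrite /e /residual_field /data_diff mulrA -frobZl -frobDl; congr (frob _ _).
      by rewrite addrAC opprB [X in X + _]addrC subrK addrC.
    rewrite (@I_eq _ _ (fun x => frob (G a x) (jac v x)) (fun x => - frob (defect mu lam (T a) w (pe a) x) (jac v x))); last first.
      by move=> x _; rewrite /G -scaleN1r frobZl mulN1r.
    have [_ _ _ Ldf] := setting_fields st lamh a; have ida := itg_frob mE Ldf LjE.
    rewrite (I_N mE ida) (int_defect mu lam oE bE HwE (vpoly_C1 ve) Cv).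
    rewrite (stiff_local mu lam oOm oE bE EO Hw Cv).
    rewrite (I_D mE isj idv) (I_D mE idv); last by do 2 apply: itgZ => //.
    rewrite (I_Z ev mE); last by apply: itgZ.
    exact: jump_equation_alg.
  rewrite (eq_bigr _ (fun a _ => loc a)) [LHS]big_split /= [X in _ + X](_ : _ = 0) ?addr0//.
  by rewrite sumrB -mulr_sumr -wk subrr.
have L0 : 0 < eucl P Q by have := dist2_gt0 PQ; rewrite euclC /eucl sqrtr_gt0.
have D0 a : 0 <= data_size T ev lamh w wh a by exact: data_size_ge0.
have loc a : a \in js -> eucl P Q ^+ 2 * norm0sq (T a) (e a) + \int[area]_(x in T a) frob (G a x) (G a x) <=
   (2 * C1 + 3) * data_size T ev lamh w wh a.
  move=> aj; have [sE oE bE EO HwE] := setting_elem st a; have mE := open_measurable2 oE.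
  have [Ld _ Lr Ldf] := setting_fields st lamh a.
  have [_ Ld2] := has_edge_len (reg a) (hjs a aj).
  have LD : eucl P Q ^+ 2 <= diam (T a) ^+ 2 by rewrite ler_sqr ?nnegrE ?(ltW L0)// (le_trans (ltW L0)).
  have GE : \int[area]_(x in T a) frob (G a x) (G a x) =
    \int[area]_(x in T a) frob (defect mu lam (T a) w (pe a) x) (defect mu lam (T a) w (pe a) x).
    by apply: I_eq => x _; rewrite /G frobNl frobNr opprK.
  have ne := norm0B mE Lr Ld; have n0 := norm0_ge0 (T a) (e a).
  have er := hC1 Om GD GN N T ev lamh w wh st a.
  have g0 : 0 <= \int[area]_(x in T a) frob (defect mu lam (T a) w (pe a) x) (defect mu lam (T a) w (pe a) x).
    by apply: I_ge0 => x _; exact: frob_ge0.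
  rewrite GE; exact: (jump_data_alg LD (sqr_ge0 _) n0 ne er g0 (ltW C10) (norm0_ge0 _ _)).
have S0 : 0 <= \sum_(a <- js) data_size T ev lamh w wh a by apply: sumr_ge0.
have hs : \sum_(a <- js) (eucl P Q ^+ 2 * norm0sq (T a) (e a) + \int[area]_(x in T a) frob (G a x) (G a x)) <=
   (2 * C1 + 3) * \sum_(a <- js) data_size T ev lamh w wh a.
  by rewrite mulr_sumr big_seq [leRHS]big_seq; apply: ler_sum => a aj; exact: loc.
have q0 : 0 <= 2 * C1 + 3 by rewrite addr_ge0// mulr_ge0// ltW.
apply: le_trans (ler_wpM2l _ hs) _; first by rewrite mulr_ge0 ?sqr_ge0// ltW.
rewrite -mulrA -mulrA ler_pM2l// -[leRHS]mul1r; apply: ler_wpM2r => //.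
exact: mulr_ge0.
Qed.

End Estimates.

Section EdgeEstimate.
Context {R : realType}.
Variables (mu lam rho : R) (k : nat) (CT : R).
Hypotheses (pd : stiff_posdef mu lam) (CT0 : 0 < CT).

(** The common edge is comparable to both diameters. *)
Lemma share_edge_diam (E E' : polygon R) : regular CT E -> regular CT E' -> share_edge E E' ->
  CT * diam E' < diam E.
Proof.
move=> rE rE' /hasP[[P Q] lE' hE]; have [h _] := edge_len rE' lE'.
by have [_ h'] := has_edge_len rE hE; exact: lt_le_trans h h'.
Qed.

Lemma share_edge_refl (E : polygon R) : regular CT E -> share_edge E E.
Proof.
move=> [[[n3 _] _ _ _ _] _ _]; apply/hasP; exists (vert E 0, vert E 1); last first.
  by rewrite /has_edge; apply/orP; left; apply/edgesP; exists 0%N => //; apply: leq_trans n3.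
by apply/edgesP; exists 0%N => //; apply: leq_trans n3.
Qed.

Lemma ler_sum_sub (I : finType) (js : seq I) (P : pred I) (f : I -> R) : uniq js ->
  (forall a, a \in js -> P a) -> (forall a, 0 <= f a) -> \sum_(a <- js) f a <= \sum_(a | P a) f a.
Proof.
move=> ujs jP f0; rewrite big_uniq// big_mkcond [leRHS]big_mkcond; apply: ler_sum => a _.
by case: ifPn => [/jP ->//|_]; case: ifP.
Qed.

Lemma seg_int_ge0 l (F : plane R -> R) : (forall x, 0 <= F x) -> 0 <= seg_int l F.
Proof. by move=> F0; apply: mulr_ge0; [exact: sqrtr_ge0|apply: Rintegral_ge0]. Qed.

Lemma edge_estimate_alg (D L S C1 s1 s2 : R) : CT * D < L -> 0 <= C1 -> 0 <= S -> s1 <= s2 -> L * S <= C1 * s1 ->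
  D * S <= CT^-1 * C1 * s2.
Proof.
move=> h C0 S0 ss LS; rewrite -mulrA ler_pdivlMl// mulrA.
apply: (le_trans (ler_wpM2r S0 (ltW h))); apply: le_trans LS _; exact: ler_wpM2l.
Qed.

(** According to the case of [residual_J], the jump comes from two elements
    with the factor 1/2, from one element with the factor -1, or is zero. *)
Lemma edge_estimate : exists2 C : R, 0 < C & forall Om GD GN N (T : 'I_N -> polygon R) ev lamh w wh,
  setting mu lam rho k CT Om GD GN T ev w wh -> forall i l, l \in edges (T i) ->
  diam (T i) * seg_int l (fun x => frob (residual_J Om GN mu lam k T wh l x) (residual_J Om GN mu lam k T wh l x)) <=
  C * \sum_(a | share_edge (T i) (T a)) data_size mu lam rho k T ev lamh w wh a.
Proof.
have [C1 C10 hC1] := stress_jump_estimate rho k pd CT0.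
pose c := Num.min (CT ^+ 2 / 128) 8^-1.
have c0 : 0 < c by rewrite lt_min divr_gt0 ?exprn_gt0//= invr_gt0.
have c8 : c <= 8^-1 by rewrite ge_min lexx orbT.
have cCT : c <= CT ^+ 2 / 128 by rewrite ge_min lexx.
exists (CT^-1 * C1); first by rewrite mulr_gt0// invr_gt0.
move=> Om GD GN N T ev lamh w wh st i [P Q] lE.
have [[oOm bOm lip bdO dis] msh reg _ _] := st.
have hi : has_edge (T i) (P, Q) by rewrite /has_edge lE.
have [PQ [s esi]] := mesh_side msh reg hi.
have [hl _] := edge_len (reg i) lE.
have S0 : 0 <= \sum_(a | share_edge (T i) (T a)) data_size mu lam rho k T ev lamh w wh a.
  by apply: sumr_ge0 => a _; exact: data_size_ge0.
have main js sd kap B z z' : uniq js -> (size js <= 2)%N ->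
    (forall a, has_edge (T a) (P, Q) = (a \in js)) ->
    (forall a, a \in js -> edge_side (T a) P Q (sd a)) ->
    edge_cutoff Om GD T c js sd P Q B z z' -> kap ^+ 2 <= 1 ->
    (forall x, residual_J Om GN mu lam k T wh (P, Q) x = kap *: \sum_(a | has_edge (T a) (P, Q))
      stress mu lam (Pi_eps mu lam k (T a) wh) x *m outer_normal (T a) (P, Q)) ->
    diam (T i) * seg_int (P, Q) (fun x => frob (residual_J Om GN mu lam k T wh (P, Q) x) (residual_J Om GN mu lam k T wh (P, Q) x)) <=
    CT^-1 * C1 * \sum_(a | share_edge (T i) (T a)) data_size mu lam rho k T ev lamh w wh a.
  move=> ujs js2 hjs ejs cut k1 JE.
  have JE' x : residual_J Om GN mu lam k T wh (P, Q) x = kap *: \sum_(a <- js)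
      stress mu lam (Pi_eps mu lam k (T a) wh) x *m nvec P Q (sd a).
    rewrite JE big_uniq//; congr (_ *: _); apply: eq_big => a; first by rewrite hjs.
    by rewrite hjs => aj; rewrite (outer_normalE PQ (ejs a aj)).
  have sh a : a \in js -> share_edge (T i) (T a).
    rewrite -hjs => ha; apply/hasP; case/orP: ha => h; first by exists (P, Q).
    by exists (Q, P) => //; rewrite /has_edge /= lE orbT.
  have hm a : a \in js -> has_edge (T a) (P, Q) by rewrite hjs.
  have := hC1 Om GD GN N T ev lamh w wh c st erefl js sd P Q B z z' kap _ PQ ujs js2 hm cut k1 JE'.
  have := ler_sum_sub ujs sh (data_size_ge0 mu lam rho k T ev lamh w wh).
  have := seg_int_ge0 (P, Q) (fun x => frob_ge0 (residual_J Om GN mu lam k T wh (P, Q) x)).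
  move=> p1 p2 p3; exact: (edge_estimate_alg hl (ltW C10) p1 p2 p3).
have [Jint|Jext] := pselect (open_seg P Q `<=` Om).
  have [_ _ _ /(_ i _ lE)] := msh; move=> [[_ [j ji hj]]|oD|oN]; last 2 first.
  - by case: (GD_notin oOm bdO (oD _ (open_seg_mid P Q))); apply: Jint; exact: open_seg_mid.
  - case: (bd_notin oOm (x := lerp P Q 2^-1)); last by apply: Jint; exact: open_seg_mid.
    by rewrite bdO; right; apply: oN; exact: open_seg_mid.
  have [only [B [z [z' cut]]]] := interior_cutoff oOm bdO msh reg c0 c8 cCT hi hj ji Jint esi.
  apply: (main [:: i; j] (fun a => if a == i then s else - s) 2^-1 B z z') => //.
  - by rewrite /= inE eq_sym ji.
  - move=> a; rewrite !inE; apply/idP/idP => [/only[]->|/orP[]/eqP ->]//; by rewrite eqxx ?orbT.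
  - move=> a; rewrite !inE => /orP[]/eqP ->; first by rewrite eqxx.
    rewrite (negbTE ji); have [_ [s' esj]] := mesh_side msh reg hj.
    have ij : i != j by rewrite eq_sym.
    by rewrite -(sides_opp msh ij esi esj PQ).
  - lra.
  - by move=> x; rewrite /residual_J asboolT.
have [oN|noN] := pselect (open_seg P Q `<=` GN).
  have [only [B [z [z' cut]]]] := boundary_cutoff oOm lip bdO dis msh reg c0 c8 cCT hi oN esi.
  apply: (main [:: i] (fun=> s) (-1) B z z') => //.
  - by move=> a; rewrite !inE; apply/idP/idP => [/only ->//|/eqP ->].
  - by move=> a; rewrite inE => /eqP ->.
  - by rewrite sqrrN expr1n.
  - by move=> x; rewrite /residual_J asboolF// asboolT// scaleN1r.
rewrite /seg_int /residual_J asboolF// asboolF//=.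
rewrite (_ : (fun t => _) = fun=> 0); last by apply/funext => t; rewrite frob0r.
rewrite /Rintegral integral0 mulr0 mulr0; apply: mulr_ge0 => //.
by rewrite mulr_ge0 ?invr_ge0// ltW.
Qed.

(** The contribution of the element a to the right-hand side of the theorem
    for the element i. *)
Definition error_size N (T : 'I_N -> polygon R) ev lamh (w wh : vfield R) (i a : 'I_N) : R :=
  norm1sq (T a) (w - wh) + norm0sq (T a) (w - Pi_0 k (T a) wh) +
  semi1sq (T a) (w - Pi_eps mu lam k (T a) wh) +
  diam (T i) ^+ 2 * norm0sq (T a) (fun x => ev *: w x - lamh *: wh x).

Lemma error_size_ge0 N (T : 'I_N -> polygon R) ev lamh w wh i a : 0 <= error_size T ev lamh w wh i a.
Proof.
rewrite /error_size; apply: addr_ge0; last by apply: mulr_ge0; [exact: sqr_ge0|exact: norm0_ge0].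
apply: addr_ge0; last exact: semi1_ge0.
by apply: addr_ge0; [exact: norm1_ge0|exact: norm0_ge0].
Qed.

Lemma norm0Z (D : set (plane R)) (a : R) u : measurable D -> L2 D u ->
  norm0sq D (fun x => a *: u x) = a ^+ 2 * norm0sq D u.
Proof.
move=> mD Lu; rewrite /norm0sq /ip0 -(I_Z _ mD (itg_frob mD Lu Lu)); apply: I_eq => x _.
by rewrite frobZl frobZr mulrA.
Qed.

Lemma data_bound_alg (D Di H2 l2 L2 q r2 K a b c g s nd nA n1 : R) : 0 <= D -> D <= H2 -> D <= q * Di -> l2 <= L2 -> 0 <= l2 ->
  0 <= a -> 0 <= b -> 0 <= c -> 0 <= s -> 0 <= r2 -> 0 <= K -> a <= n1 -> 0 <= q -> 0 <= Di ->
  nd <= 2 * nA + 2 * (r2 * c) -> nA <= l2 * (2 * a + 2 * b) -> g <= K * s ->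
  D * nd + g <= (4 * (H2 * L2) + 2 * (r2 * q) + K) * (n1 + b + s + Di * c).
Proof.
move=> D0 DH DD lL l0 a0 b0 c0 s0 r0 K0 an q0 Di0 hd hA hg.
have HL : D * l2 <= H2 * L2 by exact: ler_pM.
have dl0 : 0 <= D * l2 by exact: mulr_ge0.
have hd' := ler_wpM2l D0 hd; have hA' := ler_wpM2l D0 hA.
have h1 : D * l2 * (a + b) <= H2 * L2 * (n1 + b) by apply: ler_pM => //; [exact: addr_ge0|exact: lerD].
have h2 : D * (r2 * c) <= q * Di * (r2 * c) by apply: ler_wpM2r => //; exact: mulr_ge0.
set X := n1 + b + s + Di * c.
have Dc0 : 0 <= Di * c by exact: mulr_ge0.
have X1 : n1 + b <= X by rewrite /X; lra.
have X2 : Di * c <= X by rewrite /X; lra.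
have X3 : s <= X by rewrite /X; lra.
have HL0 : 0 <= H2 * L2 by exact: le_trans HL.
have h3 : H2 * L2 * (n1 + b) <= H2 * L2 * X := ler_wpM2l HL0 X1.
have rq0 : 0 <= r2 * q by exact: mulr_ge0.
have h4 : r2 * q * (Di * c) <= r2 * q * X := ler_wpM2l rq0 X2.
have h5 : K * s <= K * X := ler_wpM2l K0 X3.
have e1 : q * Di * (r2 * c) = r2 * q * (Di * c) by ring.
rewrite e1 in h2; clearbody X; lra.
Qed.

(** In [data_diff] the part with the factor lamh is split at w - wh, so that
    the remaining part is a multiple of ev w - lamh wh. Only in this last
    part the diameter has to be kept, and it is compared with that of the
    neighbour. *)
Lemma data_bound (Om GD GN : set (plane R)) N (T : 'I_N -> polygon R) ev lamh w wh (H La : R) i a :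
  setting mu lam rho k CT Om GD GN T ev w wh -> diam (T a) <= H -> `|lamh| <= La -> share_edge (T i) (T a) ->
  data_size mu lam rho k T ev lamh w wh a <=
  (4 * (H ^+ 2 * (La * rho) ^+ 2) + 2 * (rho ^+ 2 * CT ^- 2) + stiffK mu lam) * error_size T ev lamh w wh i a.
Proof.
move=> st aH lL sh; have [sE oE bE EO HwE] := setting_elem st a; have mE := open_measurable2 oE.
have [Hh v0 ve] := setting_poly pd st a; have [_ msh reg _ _] := st.
have L0 : L2 (T a) (Pi_0 k (T a) wh) by apply: C1_L2 => //; exact: vpoly_C1 v0.
have Lw := HwE.1; have Lh := Hh.1.
have [_ hg] := defect_bound mu lam oE bE HwE (vpoly_C1 ve).
have LA1 := L2Z (lamh * rho) mE (L2B mE Lw Lh); have LA2 := L2Z (lamh * rho) mE (L2B mE Lw L0).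
have LB := L2Z rho mE (L2B mE (L2Z ev mE Lw) (L2Z lamh mE Lh)).
have hA := norm0B mE LA1 LA2.
have hd := norm0B mE (L2B mE LA1 LA2) LB.
(* w - wh is inserted to obtain the difference of the eigenvalue terms *)
have dE : data_diff rho k T ev lamh w wh a = (fun x => (lamh * rho) *: (w x - wh x) -
    (lamh * rho) *: (w x - Pi_0 k (T a) wh x) - rho *: (ev *: w x - lamh *: wh x)).
  apply/funext => x; apply/matrixP => p q; rewrite !mxE; ring.
rewrite -{}dE in hd.
rewrite (norm0Z _ mE (L2B mE Lw Lh)) (norm0Z _ mE (L2B mE Lw L0)) in hA.
rewrite (norm0Z _ mE (L2B mE (L2Z ev mE Lw) (L2Z lamh mE Lh))) in hd.
have {}hA : norm0sq (T a) (fun x => (lamh * rho) *: (w x - wh x) - (lamh * rho) *: (w x - Pi_0 k (T a) wh x)) <=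
    (lamh * rho) ^+ 2 * (2 * norm0sq (T a) (w - wh) + 2 * norm0sq (T a) (w - Pi_0 k (T a) wh)).
  by apply: le_trans hA _; rewrite mulrDr !(mulrCA ((lamh * rho) ^+ 2)).
have d0 := diam_gt0 (mesh_simple msh a); have di := diam_gt0 (mesh_simple msh i).
have hs := share_edge_diam (reg i) (reg a) sh.
have H0 : 0 <= H by exact: le_trans (ltW d0) aH.
have LL : (lamh * rho) ^+ 2 <= (La * rho) ^+ 2.
  by rewrite !exprMn; apply: ler_wpM2r; [exact: sqr_ge0|rewrite -real_normK ?num_real// ler_sqr ?nnegrE// (le_trans _ lL)].
have DD : diam (T a) ^+ 2 <= CT ^- 2 * diam (T i) ^+ 2.
  rewrite -exprVn -exprMn ler_sqr ?nnegrE ?mulr_ge0 ?invr_ge0 ?(ltW d0) ?(ltW di) ?(ltW CT0)//.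
  by rewrite ler_pdivlMl// ltW.
have DH : diam (T a) ^+ 2 <= H ^+ 2 by rewrite ler_sqr ?nnegrE// ltW.
have an : norm0sq (T a) (w - wh) <= norm1sq (T a) (w - wh) by rewrite /norm1sq lerDl semi1_ge0.
have CTn : 0 <= CT ^- 2 by rewrite invr_ge0 sqr_ge0.
rewrite /data_size /error_size.
exact: (data_bound_alg (sqr_ge0 _) DH DD LL (sqr_ge0 _) (norm0_ge0 _ (w - wh)) (norm0_ge0 _ (w - Pi_0 k (T a) wh)) (norm0_ge0 _ (fun x => ev *: w x - lamh *: wh x))
  (semi1_ge0 _ (w - Pi_eps mu lam k (T a) wh)) (sqr_ge0 rho) (stiffK_ge0 mu lam) an CTn (sqr_ge0 (diam (T i))) hd hA hg).
Qed.

End EdgeEstimate.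

(** * Uniformity over the meshes *)

Lemma cvg_bounded (R : realType) (u : nat -> R) (l : R) : u n @[n --> \oo] --> l ->
  exists M : R, forall n, `|u n| <= M.
Proof.
move=> ul; have [M [_ hM]] := cvg_seq_bounded (cvgP _ ul).
by exists (M + 1) => n; apply: hM => //; rewrite ltrDl.
Qed.

Lemma diam_le_mesh (R : realType) N (T : 'I_N -> polygon R) i : diam (T i) <= mesh_size T.
Proof. exact: le_bigmax. Qed.

Lemma eta_alg (R : realType) (th rs es tn Ct C1 Cd M C2 e ds S : R) : th <= Ct * e -> rs <= C1 * tn -> tn <= Cd * e ->
  es <= M * (C2 * ds) -> ds <= Cd * S -> e <= S -> 0 <= Ct -> 0 <= C1 -> 0 <= Cd -> 0 <= M -> 0 <= C2 ->
  th + rs + es <= (Ct + C1 * Cd + M * (C2 * Cd)) * S.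
Proof.
move=> h1 h2 h3 h4 h5 h6 t0 c0 d0 m0 c20.
have a1 : Ct * e <= Ct * S := ler_wpM2l t0 h6.
have a2 : C1 * tn <= C1 * (Cd * S) by apply: ler_wpM2l => //; apply: le_trans h3 _; exact: ler_wpM2l.
have a3 : M * (C2 * ds) <= M * (C2 * (Cd * S)) by do 2 apply: ler_wpM2l => //.
by rewrite !mulrDl -!mulrA; lra.
Qed.

Lemma theta_alg (R : realType) (A B n s p q r : R) : 0 <= A -> 0 <= B -> 0 <= n -> 0 <= s -> 0 <= p -> 0 <= q -> 0 <= r ->
  A * (n + p) + B * (s + q) <= (A + B) * (n + s + p + q + r).
Proof.
move=> A0 B0 n0 s0 p0 q0 r0.
have h1 : A * (n + p) <= A * (n + s + p + q + r) by apply: ler_wpM2l => //; lra.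
have h2 : B * (s + q) <= B * (n + s + p + q + r) by apply: ler_wpM2l => //; lra.
by rewrite mulrDl; exact: lerD.
Qed.

Theorem theorem6p3 (R : realType)
    (Omega GammaD GammaN : set (plane R)) (mu lam rho : R)
    (k : nat) (CT : R)
    (N : nat -> nat) (T : forall n, 'I_(N n) -> polygon R)
    (Seps S0 : forall n, 'I_(N n) -> vfield R -> vfield R -> R)
    (c0 c1 d0 d1 : R)
    (ev : R) (w : vfield R) (evh : nat -> R) (wh : nat -> vfield R) :
  (* continuous problem *)
  open Omega -> bounded_set Omega -> connected Omega ->
  lipschitz_domain Omega ->
  bd Omega = GammaD `|` GammaN -> GammaD `&` GammaN = set0 ->
  (0 < hausdorff1 GammaD)%E ->
  stiff_posdef mu lam -> 0 < rho ->
  (* meshes *)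
  (1 <= k)%N -> 0 < CT ->
  (forall n, is_mesh Omega GammaD GammaN (@T n)) ->
  (forall n i, shape_regular CT (T n i)) ->
  mesh_size (@T n) @[n --> \oo] --> 0 ->
  (* stabilizations *)
  0 < c0 -> 0 < c1 -> 0 < d0 -> 0 < d1 ->
  (forall n i, spd_form (T n i) (space_V mu lam k (T n i)) (Seps n i)) ->
  (forall n i, spd_form (T n i) (space_V mu lam k (T n i)) (S0 n i)) ->
  (forall n i v, space_V mu lam k (T n i) v ->
     Pi_eps mu lam k (T n i) v = (fun=> 0) ->
     c0 * aform mu lam (T n i) v v <= Seps n i v v <=
       c1 * aform mu lam (T n i) v v) ->
  (forall n i v, space_V mu lam k (T n i) v ->
     d0 * bform rho (T n i) v v <= S0 n i v v <= d1 * bform rho (T n i) v v) ->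
  (* exact eigenpair, with a simple eigenvalue *)
  H1_zero Omega GammaD w ->
  (forall v, H1_zero Omega GammaD v ->
     aform mu lam Omega w v = ev * bform rho Omega w v) ->
  (forall u, H1_zero Omega GammaD u ->
     (forall v, H1_zero Omega GammaD v ->
        aform mu lam Omega u v = ev * bform rho Omega u v) ->
     exists c : R, {ae @area R, forall x, Omega x -> u x = c *: w x}) ->
  norm0sq Omega w = 1 ->
  (* discrete eigenpairs *)
  (forall n, space_Vh Omega GammaD mu lam k (@T n) (wh n)) ->
  (forall n v, space_Vh Omega GammaD mu lam k (@T n) v ->
     aform_h mu lam k (@T n) (Seps n) (wh n) v =
     evh n * bform_h rho k (@T n) (S0 n) (wh n) v) ->
  (forall n, norm0sq Omega (wh n) = 1) ->
  evh n @[n --> \oo] --> ev ->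
  norm1sq Omega (w - wh n) @[n --> \oo] --> 0 ->
  exists2 C : R, 0 < C & forall n (i : 'I_(N n)),
    eta2 Omega GammaN mu lam rho k (@T n) (Seps n) (S0 n) i (evh n) (wh n) <=
    C * \sum_(j | share_edge (T n i) (T n j))
      (norm1sq (T n j) (w - wh n)
       + norm0sq (T n j) (w - Pi_0 k (T n j) (wh n))
       + semi1sq (T n j) (w - Pi_eps mu lam k (T n j) (wh n))
       + diam (T n i) ^+ 2
         * norm0sq (T n j) (fun x => ev *: w x - evh n *: wh n x)).
Proof.
move=> oOm bOm _ lip bdO dis _ pd rho0 _ CT0 msh reg mcv _ c10 _ d10 _ _ hSe hS0 Hw eqn _ _ hwh _ _ ecv _.
have [H hH] := cvg_bounded mcv; have [La hLa] := cvg_bounded ecv.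
have [C1 C10 hC1] := element_estimate rho k pd CT0.
have [C2 C20 hC2] := edge_estimate rho k pd CT0.
have [M M0 hM] := edges_bound CT.
pose K := stiffK mu lam; have K0 : 0 < K := stiffK_gt0 mu lam.
pose Ct := 2 * d1 * rho + 2 * c1 * K.
have A0 : 0 <= 2 * d1 * rho by rewrite !mulr_ge0// ltW.
have B0 : 0 <= 2 * c1 * K by rewrite !mulr_ge0// ltW.
pose Cd := 4 * (H ^+ 2 * (La * rho) ^+ 2) + 2 * (rho ^+ 2 * CT ^- 2) + K.
have Cd0 : 0 < Cd by rewrite ltr_wpDl// addr_ge0// mulr_ge0// mulr_ge0 ?sqr_ge0// invr_ge0 sqr_ge0.
exists (Ct + C1 * Cd + M * (C2 * Cd)).
  by rewrite addr_gt0 ?mulr_gt0// ltr_wpDl ?mulr_gt0// addr_ge0.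
move=> n i.
have rg a : regular CT (T n a).
  by split => //; have [h _ _ _] := msh n; have [] := h a.
have st : setting mu lam rho k CT Omega GammaD GammaN (T n) ev w (wh n).
  split => //; last by have [] := hwh n.
  by split => //; exact: Hw.1.
have [sE oE bE EO HwE] := setting_elem st i.
have [x0 star0] := regular_star (rg i).
have [_ Vh] := hwh n.
have th := theta_bound pd sE star0 rho0 c10 d10 (Vh i) HwE
  (fun v Vv p0 => proj2 (andP (hSe n i v Vv p0))) (fun v Vv => proj2 (andP (hS0 n i v Vv))).
pose err a := error_size mu lam k (T n) ev (evh n) w (wh n) i a.
have th2 := le_trans th (theta_alg A0 B0 (norm0_ge0 _ _) (semi1_ge0 _ _) (norm0_ge0 _ _) (semi1_ge0 _ _)
   (mulr_ge0 (sqr_ge0 (diam (T n i))) (norm0_ge0 (T n i) (fun x => ev *: w x - evh n *: wh n x)))).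
have dH a : diam (T n a) <= H.
  by apply: le_trans (diam_le_mesh (T n) a) _; exact: le_trans (ler_norm _) (hH n).
have hd a : share_edge (T n i) (T n a) -> data_size mu lam rho k (T n) ev (evh n) w (wh n) a <= Cd * err a.
  by move=> sh; exact: (data_bound pd CT0 st (dH a) (hLa n) sh).
have si : share_edge (T n i) (T n i) := share_edge_refl (rg i).
have e0 a : 0 <= err a by exact: error_size_ge0.
have ed : \sum_(l <- edges (T n i)) diam (T n i) * seg_int l (fun x =>
    frob (residual_J Omega GammaN mu lam k (T n) (wh n) l x) (residual_J Omega GammaN mu lam k (T n) (wh n) l x)) <=
    M * (C2 * \sum_(a | share_edge (T n i) (T n a)) data_size mu lam rho k (T n) ev (evh n) w (wh n) a).
  set X := C2 * _; have X0 : 0 <= X.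
    by apply: mulr_ge0; [exact: ltW|apply: sumr_ge0 => a _; exact: data_size_ge0].
  apply: (@le_trans _ _ (\sum_(l <- edges (T n i)) X)).
    by rewrite big_seq [leRHS]big_seq; apply: ler_sum => l lE; exact: (hC2 _ _ _ _ _ _ _ _ _ st).
  rewrite big_const_seq count_predT iter_addr addr0 -mulr_natl; apply: ler_wpM2r => //; exact: hM.
have es : err i <= \sum_(a | share_edge (T n i) (T n a)) err a.
  by rewrite (bigD1 i)//= lerDl; apply: sumr_ge0.
have ds : \sum_(a | share_edge (T n i) (T n a)) data_size mu lam rho k (T n) ev (evh n) w (wh n) a <=
    Cd * \sum_(a | share_edge (T n i) (T n a)) err a.
  by rewrite mulr_sumr; apply: ler_sum.
have hr := hC1 _ _ _ _ _ _ (evh n) _ _ st i.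
exact: (eta_alg th2 hr (hd i si) ed ds es (addr_ge0 A0 B0) (ltW C10) (ltW Cd0) (ltW M0) (ltW C20)).
Qed.
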